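(* Let $E$ be a Banach space, and let $T\in\mathscr L(L^2(\mathbb R^d;E))$ be a Dini–Calderón–Zygmund operator with $\mathscr L(E)$-valued kernel. For any matrix weight $W\in A_2(\mathbb R^d;\mathbb R^n)$, the operator $T$ extends boundedly to $L^2(W;E^n)$ and satisfies $$\|T\|_{\mathscr L(L^2(W;E^n))}\le c_{n,T}\big([W]_{A_2}[W]_{A_\infty}[W^{-1}]_{A_\infty}\big)^{1/2}\le c_{n,T}[W]_{A_2}^{3/2},$$ where the constants $c_{n,T}$ depend only on $n$ and $T$ (not on $W$) and need not be the same at each occurrence.
   Context: $\mathscr L(X)$ denotes the bounded linear operators on $X$; Banach spaces are real. $T\in\mathscr L(L^2(\mathbb R^d;E))$ is a Dini–Calderón–Zygmund operator with $\mathscr L(E)$-valued kernel if $Tf(x)=\int_{\mathbb R^d}K(x,y)f(y)\,dy$ for $x\notin\operatorname{supp} f$, where $K(x,y)\in\mathscr L(E)$ satisfies $\|K(x,y)\|_{\mathscr L(E)}\le c|x-y|^{-d}$ and, for $|x-x'|\le\frac12|x-y|$, $$\|K(x,y)-K(x',y)\|_{\mathscr L(E)}+\|K(y,x)-K(y,x')\|_{\mathscr L(E)}\le\omega\Big(\frac{|x-x'|}{|x-y|}\Big)\frac1{|x-y|^d},$$ where $\omega:[0,\frac12]\to[0,\infty)$ is increasing, subadditive, and satisfies the Dini condition $\int_0^{1/2}\omega(t)\frac{dt}t<\infty$. A matrix weight is a locally integrable $W:\mathbb R^d\to\mathbb R^{n\times n}$ that is a.e. positive definite-valued. Matrices act on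 $E^n$ by $(A\vec x)_i=\sum_j A_{ij}x_j$. $E^n$ carries the norm $\|\vec x\|_{E^n}=(\sum_i\|x_i\|_E^2)^{1/2}$. The space $L^2(W;E^n)$ consists of measurable $\vec f:\mathbb R^d\to E^n$ with $W^{1/2}\vec f\in L^2(\mathbb R^d;E^n)$, with norm $\|\vec f\|_{L^2(W;E^n)}:=\|W^{1/2}\vec f\|_{L^2(\mathbb R^d;E^n)}$. The operator $T$ acts componentwise on $E^n$-valued functions, $(T\vec f)_i=T(f_i)$, initially for $\vec f\in L^2(\mathbb R^d;E^n)\cap L^2(W;E^n)$; ''extends boundedly'' refers to the extension of this action. For matrix weights $W,V$: $[W,V]_{A_2}:=\sup_Q|\langle W\rangle_Q^{1/2}\langle V\rangle_Q^{1/2}|^2$, the supremum being over all cubes $Q\subset\mathbb R^d$, where $\langle W\rangle_Q=\frac1{|Q|}\int_QW$ and $|\cdot|$ is the operator norm on $\mathbb R^{n\times n}$; $[W]_{A_2}:=[W,W^{-1}]_{A_2}$; $A_2(\mathbb R^d;\mathbb R^n)$ is the class of $\mathbb R^{n\times n}$-valued matrix weights with $[W]_{A_2}<\infty$. Also $[W]_{A_\infty}:=\sup_{0\ne\vec e\in\mathbb R^n}[x\mapsto\vec e\cdot W(x)\vec e]_{A_\infty}$, where for a scalar weight $w$, $[w]_{A_\infty}:=\sup_Q\frac1{w(Q)}\int_QM(1_Qw)$, $M$ being the Hardy–Littlewood maximal operator and $w(Q)=\int_Q w$. *)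

(* Defs.v *)
From HB Require Import structures.
From mathcomp Require Import all_boot all_order all_algebra.
From mathcomp Require Import all_classical all_reals all_analysis.
Import Order.TTheory GRing.Theory Num.Theory.
Import numFieldNormedType.Exports.

Set Implicit Arguments.
Unset Strict Implicit.
Unset Printing Implicit Defensive.

Local Open Scope classical_set_scope.
Local Open Scope ring_scope.

(* R^d is d.-tuple R with its product sigma-algebra. Its Lebesgue measure is
   the iterated product measure, transported along (x, t) |-> x :: t;
   lebesgue_box below computes the volume of boxes. *)
Section lebesgue_product.
Context {R : realType} (d : nat).

Definition cons_pair (p : measurableTypeR R * d.-tuple R) : d.+1.-tuple R :=
  [tuple of p.1 :: p.2].

Definition uncons_pair (t : d.+1.-tuple R) : measurableTypeR R * d.-tuple R :=
  (thead t, [tuple of behead t]).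

Lemma cons_pairK : cancel cons_pair uncons_pair.
Proof. by case=> x t; congr pair; exact/val_inj. Qed.

Lemma uncons_pairK : cancel uncons_pair cons_pair.
Proof. by move=> t; rewrite /cons_pair /= -tuple_eta. Qed.

Lemma measurable_cons_pair : measurable_fun setT cons_pair.
Proof.
apply: (@measurable_cons _ _ _ _ (fun p => p.1 : R) d (fun p => p.2)).
  exact: measurable_fst.
exact: measurable_snd.
Qed.

Lemma measurable_uncons_pair : measurable_fun setT uncons_pair.
Proof.
apply/measurable_fun_pair.
  exact: (@measurable_tnth _ R d.+1 ord0).
exact: measurable_behead.
Qed.

Variable mu : {sigma_finite_measure set (d.-tuple R) -> \bar R}.

Definition lebesgue_cons : set (d.+1.-tuple R) -> \bar R :=
  pushforward (@lebesgue_measure R \x mu)%E cons_pair.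

HB.instance Definition _ := Measure.copy lebesgue_cons
  (measure_function_pushforward__canonical__measure_function_Measure
    (@lebesgue_measure R \x mu)%E measurable_cons_pair).

Let lebesgue_cons_sigma_finite : sigma_finite setT lebesgue_cons.
Proof.
have /sigma_finiteP[F [TF ndF Foo]] := sigma_finiteT (@lebesgue_measure R).
have /sigma_finiteP[G [TG ndG Goo]] := sigma_finiteT mu.
exists (fun k => uncons_pair @^-1` (F k `*` G k)).
  rewrite -preimage_bigcup -[LHS](preimage_setT uncons_pair).
  congr (_ @^-1` _); apply/esym/seteqP; split=> // -[x y] _.
  have [n _ Fnx] : (\bigcup_i F i) x by rewrite -TF.
  have [k _ Gky] : (\bigcup_i G i) y by rewrite -TG.
  exists (maxn n k) => //; split.
    by move: x Fnx; exact/subsetPset/ndF/leq_maxl.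
  by move: y Gky; exact/subsetPset/ndG/leq_maxr.
move=> k; have [mF Fk] := Foo k; have [mG Gk] := Goo k; split.
  rewrite -[X in measurable X]setTI; apply: measurable_uncons_pair => //.
  exact: measurableX.
rewrite /lebesgue_cons /pushforward -comp_preimage.
rewrite (_ : uncons_pair \o cons_pair = id); last first.
  by apply/funext => p; exact: cons_pairK.
by rewrite preimage_id product_measure1E// lte_mul_pinfty// ge0_fin_numE.
Qed.

HB.instance Definition _ := Measure_isSigmaFinite.Build _ _ _ lebesgue_cons
  lebesgue_cons_sigma_finite.

End lebesgue_product.

Fixpoint lebesgue {R : realType} (d : nat) :
    {sigma_finite_measure set (d.-tuple R) -> \bar R} :=
  match d with
  | 0 => \d_([tuple] : 0.-tuple R)
  | d.+1 => lebesgue_cons (lebesgue d)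
  end.

Lemma lebesgue_box {R : realType} (d : nat) (a b : d.-tuple R) :
  (forall i, tnth a i <= tnth b i) ->
  lebesgue d [set x | forall i, tnth a i <= tnth x i <= tnth b i] =
    (\prod_(i < d) (tnth b i - tnth a i))%:E.
Proof.
elim: d a b => [|d IH] a b ab.
  by rewrite big_ord0 /= diracE mem_set// => -[].
case/tupleP: a ab => a0 a; case/tupleP: b => b0 b ab.
have ab0 : a0 <= b0 by have := ab ord0; rewrite !tnth0.
have ab' i : tnth a i <= tnth b i by have := ab (lift ord0 i); rewrite !tnthS.
rewrite big_ord_recl !tnth0 EFinM.
under eq_bigr do rewrite !tnthS.
rewrite -IH// /= /lebesgue_cons /pushforward.
rewrite (_ : _ @^-1` _ =
    `[a0, b0]%classic `*`
    [set x | forall i, tnth a i <= tnth x i <= tnth b i]); last first.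
  apply/seteqP; split=> -[x t] /=.
    move=> H; split=> [|i]; first by have := H ord0; rewrite !tnth0 in_itv.
    by have := H (lift ord0 i); rewrite !tnthS.
  move=> []; rewrite in_itv /= => Hx Ht i.
  by case: (unliftP ord0 i) => [j|] ->; rewrite ?tnthS// !tnth0.
have mbox : measurable [set x : d.-tuple R |
    forall i, tnth a i <= tnth x i <= tnth b i].
  rewrite (_ : mkset _ = \bigcap_(i in [set: 'I_d])
      ((fun x : d.-tuple R => tnth x i) @^-1` `[tnth a i, tnth b i]%classic)).
    apply: fin_bigcap_measurable => // i _.
    by rewrite -[X in measurable X]setTI; exact: measurable_tnth.
  apply/seteqP; split=> x /= H i; have := H i; rewrite /= in_itv/=; auto.
rewrite product_measure1E//; congr (_ * _)%E.
rewrite [LHS](lebesgue_measure_itv `[a0, b0]) /= lte_fin.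
by case: ltgtP ab0 => // ->; rewrite subrr.
Qed.

Section vector_valued.
Context {disp : measure_display} {X : measurableType disp} {R : realType}.
Variable mu : {measure set X -> \bar R}.

(* A mu-simple function \sum_(i < m) 1_{A_i} e_i, with mu(A_i) < +oo. *)
Record simple_fun (F : lmodType R) := SimpleFun {
  simple_size : nat;
  simple_set : nat -> set X;
  simple_val : nat -> F;
  measurable_simple_set : forall i, measurable (simple_set i);
  finite_simple_set : forall i, (mu (simple_set i) < +oo)%E }.

Definition simple_eval (F : lmodType R) (s : simple_fun F) (x : X) : F :=
  \sum_(i < simple_size s) (\1_(simple_set s i) x : R) *: simple_val s i.

Definition simple_integral (F : lmodType R) (s : simple_fun F) : F :=
  \sum_(i < simple_size s) fine (mu (simple_set s i)) *: simple_val s i.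

(* In this section the norm N of F is an explicit argument, because functions
   with values in E^n are measured with the l^2 norm of E^n. *)

Definition strongly_measurable (F : lmodType R) (N : F -> R) (f : X -> F) :=
  exists s : nat -> simple_fun F,
    \forall x \ae mu, N (f x - simple_eval (s k) x) @[k --> \oo] --> 0.

Definition bochner_integral_is (E : normedModType R) (f : X -> E) (v : E) :=
  strongly_measurable (fun x : E => `|x|) f /\
  exists s : nat -> simple_fun E,
    (\int[mu]_x (`|f x - simple_eval (s k) x|)%:E)%E @[k --> \oo] --> 0%E /\
    simple_integral (s k) @[k --> \oo] --> v.

Definition L2norm (F : lmodType R) (N : F -> R) (f : X -> F) : \bar R :=
  Lnorm mu 2%:E (fun x => (N (f x))%:E).

Definition L2fun (F : lmodType R) (N : F -> R) : set (X -> F) :=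
  [set f | strongly_measurable N f /\ (L2norm N f < +oo)%E].

(* Operators on spaces of classes of functions are maps on representatives.
   A bounded operator in the sense below respects equality almost everywhere,
   by linearity and boundedness, for all the (semi)norms nrm used here. *)

Definition operator_norm (V : Type) (D : set V) (nrm : V -> \bar R)
    (T : V -> V) : \bar R :=
  ereal_sup [set nrm (T f) | f in [set f | D f /\ (nrm f <= 1)%E]].

Definition bounded_operator (F : lmodType R) (D : set (X -> F))
    (nrm : (X -> F) -> \bar R) (T : (X -> F) -> X -> F) : Prop :=
  [/\ forall f, D f -> D (T f),
      forall (a : R) f g, D f -> D g ->
        \forall x \ae mu, T (a *: f + g) x = a *: T f x + T g x &
      (operator_norm D nrm T < +oo)%E].

End vector_valued.

(* E^n is 'I_n -> E. *)
Section tuples_of_vectors.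
Context {R : realType} {n : nat} {E : normedModType R}.

Definition l2norm (x : 'I_n -> E) : R := Num.sqrt (\sum_i `|x i| ^+ 2).

Definition mxact (A : 'M[R]_n) (x : 'I_n -> E) : 'I_n -> E :=
  fun i => \sum_j A i j *: x j.

End tuples_of_vectors.

Section matrices.
Context {R : realType} {n : nat}.
Implicit Types A B : 'M[R]_n.

Definition mxquad A (e : 'cV[R]_n) : R := (e^T *m A *m e) 0 0.

Definition posdefmx A := A^T = A /\ forall e, e != 0 -> 0 < mxquad A e.

Definition possemidefmx A := A^T = A /\ forall e, 0 <= mxquad A e.

(* The positive semidefinite square root; the default value 0 is only taken
   when A is not positive semidefinite. *)
Definition sqrtmx A : 'M[R]_n :=
  xget 0 [set B | possemidefmx B /\ B *m B = A].

Definition mxopnorm A : \bar R :=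
  operator_norm setT (fun v : 'I_n -> R^o => (l2norm v)%:E) (mxact A).

End matrices.

Section euclidean_space.
Context {R : realType} {d : nat}.
Local Notation X := (d.-tuple R).

Definition eucl_dist (x y : X) : R :=
  Num.sqrt (\sum_(i < d) (tnth x i - tnth y i) ^+ 2).

Definition cube (a : X) (l : R) : set X :=
  [set x | forall i, tnth a i <= tnth x i <= tnth a i + l].

Definition cubes : set (set X) :=
  [set Q | exists a l, 0 < l /\ Q = cube a l].

Definition essential_support (V : zmodType) (f : X -> V) : set X :=
  [set x | forall r : R, 0 < r ->
     ~ (lebesgue d).-negligible [set y | eucl_dist x y < r /\ f y <> 0]].

Definition locally_integrable_Rd (g : X -> R) :=
  strongly_measurable (lebesgue d) (fun x : R^o => `|x|) (g : X -> R^o) /\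
  forall Q, cubes Q -> (\int[lebesgue d]_(x in Q) `|g x|%:E < +oo)%E.

(* The (uncentered) Hardy-Littlewood maximal function over cubes. *)
Definition maximal_function (g : X -> R) (x : X) : \bar R :=
  ereal_sup [set ((fine (lebesgue d Q))^-1%:E *
                  \int[lebesgue d]_(y in Q) `|g y|%:E)%E |
             Q in [set Q | cubes Q /\ Q x]].

Definition Ainfty_scalar (w : X -> R) : \bar R :=
  ereal_sup [set ((\int[lebesgue d]_(x in Q) w x)^-1%R%:E *
                  \int[lebesgue d]_(x in Q)
                    maximal_function (fun y => \1_Q y * w y)%R x)%E |
             Q in cubes].

End euclidean_space.

Section dini_calderon_zygmund.
Context {R : realType} {d : nat} {E : completeNormedModType R}.
Local Notation X := (d.-tuple R).
Local Notation normE := (fun x : E => `|x|).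

Definition norm_LE (A : E -> E) : \bar R :=
  operator_norm setT (fun x : E => `|x|%:E) A.

Definition dini_modulus (omega : R -> R) :=
  [/\ forall t, 0 <= t <= 2^-1 -> 0 <= omega t,
      forall s t, 0 <= s -> s <= t -> t <= 2^-1 -> omega s <= omega t,
      forall s t, 0 <= s -> 0 <= t -> s + t <= 2^-1 ->
        omega (s + t) <= omega s + omega t &
      (\int[lebesgue_measure]_(t in `]0%R, 2^-1%R]) (omega t / t)%:E < +oo)%E].

(* Only the values K x y with x <> y matter; for these, the size bound makes
   the linear map K x y bounded. *)
Definition dini_cz_operator (T : (X -> E) -> X -> E) :=
  bounded_operator (lebesgue d) (L2fun (lebesgue d) normE)
    (L2norm (lebesgue d) normE) T /\
  exists (K : X -> X -> {linear E -> E}) (c : R) (omega : R -> R),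
  [/\ dini_modulus omega,
      forall x y, x <> y -> (norm_LE (K x y) <= (c / eucl_dist x y ^+ d)%:E)%E,
      forall x x' y, x <> y -> eucl_dist x x' <= 2^-1 * eucl_dist x y ->
        (norm_LE (K x y \- K x' y)%R + norm_LE (K y x \- K y x')%R
         <= (omega (eucl_dist x x' / eucl_dist x y) / eucl_dist x y ^+ d)%:E)%E &
      forall f, L2fun (lebesgue d) normE f ->
        \forall x \ae lebesgue d, ~ essential_support f x ->
          bochner_integral_is (lebesgue d) (fun y => K x y (f y)) (T f x)].

End dini_calderon_zygmund.

Section matrix_weights.
Context {R : realType} {d n : nat}.
Local Notation X := (d.-tuple R).
Implicit Types W V : X -> 'M[R]_n.

Definition matrix_weight W :=
  (forall i j, locally_integrable_Rd (fun x => W x i j)) /\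
  \forall x \ae lebesgue d, posdefmx (W x).

Definition inv_weight W : X -> 'M[R]_n := fun x => invmx (W x).

Definition average W (Q : set X) : 'M[R]_n :=
  \matrix_(i, j) ((fine (lebesgue d Q))^-1 *
                  \int[lebesgue d]_(x in Q) W x i j).

Definition A2_const2 W V : \bar R :=
  ereal_sup [set (mxopnorm (sqrtmx (average W Q) *m sqrtmx (average V Q))
                  ^+ 2)%E | Q in cubes].

Definition A2_const W : \bar R := A2_const2 W (inv_weight W).

(* A2_const W is only meaningful when W^-1 is a matrix weight as well, that
   is, when it is also locally integrable. *)
Definition A2_weight W :=
  [/\ matrix_weight W, matrix_weight (inv_weight W) & (A2_const W < +oo)%E].

Definition Ainfty_const W : \bar R :=
  ereal_sup [set Ainfty_scalar (fun x => mxquad (W x) e) |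
             e in [set e : 'cV[R]_n | e != 0]].

Context {E : completeNormedModType R}.

Definition weightedL2norm W (f : X -> 'I_n -> E) : \bar R :=
  L2norm (lebesgue d) l2norm (fun x => mxact (sqrtmx (W x)) (f x)).

Definition weightedL2 W : set (X -> 'I_n -> E) :=
  [set f | strongly_measurable (lebesgue d) l2norm f /\
           L2fun (lebesgue d) l2norm (fun x => mxact (sqrtmx (W x)) (f x))].

Definition componentwise (T : (X -> E) -> X -> E) (f : X -> 'I_n -> E) :
    X -> 'I_n -> E :=
  fun x i => T (fun y => f y i) x.

Definition bounded_extension (T : (X -> E) -> X -> E) W
    (S : (X -> 'I_n -> E) -> X -> 'I_n -> E) :=
  bounded_operator (lebesgue d) (weightedL2 W) (weightedL2norm W) S /\
  forall f, L2fun (lebesgue d) l2norm f -> weightedL2 W f ->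
    \forall x \ae lebesgue d, S f x = componentwise T f x.

End matrix_weights.

(* Main.v *)
(* Convex body domination. On a large cell c the vector (T f_i) is read in the
   coordinates given by the square root of the average of W^-1 on a dilate of c; the
   set where it, or its difference with T applied to f cut to a smaller dilate, is
   large compared with the average of f fills at most half of c. Iterating on the
   maximal bad subcells, the norm of W^(1/2) T f is bounded by a sparse sum of averages
   weighted by normalized entries of W and W^-1, at the cost of a factor
   [W]_(A_2)^(1/2). The scalar weights occurring in W and W^-1 satisfy a reverse Hoelder
   inequality with exponent 1 + c/[.]_(A_infty), hence a Carleson embedding with constant
   of order [.]_(A_infty); pairing the sparse sum with itself yields the factors
   [W]_(A_infty)^(1/2) and [W^-1]_(A_infty)^(1/2). Step functions are dense in L^2(W)
   and in L^2 simultaneously, which gives the extension, and [W]_(A_infty) is at most a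
   multiple of [W]_(A_2), which gives the second inequality. *)
Require Import Defs.
From HB Require Import structures.
From mathcomp Require Import all_boot all_order all_algebra.
From mathcomp Require Import finmap.
From mathcomp Require Import all_classical all_reals all_analysis.
From mathcomp Require Import measurable_realfun.
From mathcomp Require Import ring lra zify.
Import Order.TTheory GRing.Theory Num.Theory.
Import numFieldNormedType.Exports.

Set Implicit Arguments.
Unset Strict Implicit.
Unset Printing Implicit Defensive.

Local Open Scope classical_set_scope.
Local Open Scope ring_scope.

(** * Strong measurability and square integrals *)

(** Averages are taken over the dilates [nbr] of cells of one dyadic grid: dilates of nested cells
    are nested, which does the work of shifted grids, and the factor [2 * d] makes the diameter of a
    cell at most half its distance to the outside of the dilate, as the kernel regularity requires.
    The kernel represents the operator only off the support of the function; hence the estimates are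
    made for functions constant on small cells, whose Bochner integrals are finite sums. For a
    Banach space [E], a real matrix acting on [E^n] need not be bounded by its operator norm, so
    matrices are measured by the Frobenius norm; this costs powers of [n] only. Pairing the sparse
    sum with itself puts that sum on both sides, and it can be absorbed only when its square
    integral is finite; so this is done for finite subfamilies, followed by monotone convergence.
    The sigma-algebra carrying Lebesgue measure is not complete: norms of strongly measurable
    functions are measurable up to null sets only, and weights are first corrected on a null set. *)

Section nonmeasurable_integrands.
Context {disp : measure_display} {X : measurableType disp} {R : realType}.
Variable mu : {measure set X -> \bar R}.
Local Open Scope ereal_scope.
Import HBNNSimple.

(** The integral of a nonnegative function is a supremum over the simple functions below it, so
    integrands that are only almost everywhere equal to measurable ones can be compared directly:
    each simple function is multiplied by the indicator of the complement of the null set, which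
    keeps its integral. *)
Lemma ae_le_integral (D : set X) (f g : X -> \bar R) :
  (forall x, D x -> 0 <= f x) -> (forall x, D x -> 0 <= g x) ->
  (\forall x \ae mu, D x -> f x <= g x) ->
  \int[mu]_(x in D) f x <= \int[mu]_(x in D) g x.
Proof.
move=> f0 g0 [N [mN muN fgN]].
rewrite !ge0_integralE//; apply: ge_ereal_sup => _ [h hf <-].
have mC : measurable (~` N) by exact: measurableC.
pose h' := mul_nnsfun h (indic_nnsfun R mC).
have -> : sintegral mu h = sintegral mu h'.
  have := @ge0_ae_eq_integral _ _ _ mu setT (EFin \o h) (EFin \o h').
  rewrite !integral_nnsfun//= !patch_setT; apply => //.
  - by apply/measurable_EFinP.
  - by apply/measurable_EFinP.
  - by move=> x _ /=; rewrite lee_fin fun_ge0.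
  - by move=> x _ /=; rewrite lee_fin mulr_ge0 ?fun_ge0//= /mindic indicE.
  exists N; split=> // x /= nP; apply: contrapT => Nx; apply: nP => _.
  by rewrite /mindic indicE mem_set// mulr1.
apply: ereal_sup_ubound; exists h' => //= x.
rewrite /mindic indicE; case: (pselect (N x)) => Nx.
  rewrite memNset ?mulr0; last by apply.
  by apply: erestrict_ge0.
rewrite mem_set// mulr1; apply: (le_trans (hf x)).
rewrite !patchE; case: ifPn => // /set_mem Dx.
by apply: contrapT => nfg; apply: Nx; apply: fgN => /=; exact/not_implyP.
Qed.

Lemma ae_eq_ge0_integral (D : set X) (f g : X -> \bar R) :
  (forall x, D x -> 0 <= f x) -> (forall x, D x -> 0 <= g x) ->
  (\forall x \ae mu, D x -> f x = g x) ->
  \int[mu]_(x in D) f x = \int[mu]_(x in D) g x.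
Proof.
move=> f0 g0 fg; apply/eqP; rewrite eq_le; apply/andP; split;
  apply: ae_le_integral => //; apply: filterS fg => x /= + Dx => ->//.
Qed.

End nonmeasurable_integrands.

Section countable_factor.
Context {d1 d2 : measure_display} {X : measurableType d1} {Y : measurableType d2}.

Lemma measurable_countable_comp (I : countType) (j : X -> I) (phi : I -> Y) :
  (forall i, measurable (j @^-1` [set i])) ->
  measurable_fun setT (phi \o j).
Proof.
move=> mj _ B mB; rewrite setTI.
rewrite (_ : _ @^-1` _ = \bigcup_(i in [set i | B (phi i)]) (j @^-1` [set i])).
  rewrite bigcup_mkcond; apply: countable_bigcupT_measurable.
    exact: countableP.
  by move=> i; case: ifP => // _; exact: mj.
apply/seteqP; split=> [x /= Bx|x [i /= Bi /= ->]//].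
by exists (j x).
Qed.

End countable_factor.

(** The notions take the norm as an argument, which is [|x|] on [E] and [l2norm] on [E^n]; these two
    laws let one theory serve both. *)
Record seminorm {R : realType} {F : lmodType R} (N : F -> R) : Prop := Seminorm {
  seminormD : forall x y, N (x + y) <= N x + N y;
  seminormZ : forall a x, N (a *: x) = `|a| * N x }.

Section seminorm_theory.
Context {R : realType} {F : lmodType R} (N : F -> R) (snN : seminorm N).

Lemma seminorm0 : N 0 = 0.
Proof. by rewrite -(scale0r 0) seminormZ// normr0 mul0r. Qed.

Lemma seminormN x : N (- x) = N x.
Proof. by rewrite -scaleN1r seminormZ// normrN1 mul1r. Qed.

Lemma seminormB x y : N (x - y) = N (y - x).
Proof. by rewrite -opprB seminormN. Qed.

Lemma seminorm_ge0 x : 0 <= N x.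
Proof.
have := seminormD snN x (- x); rewrite subrr seminorm0 seminormN -mulr2n.
by rewrite pmulrn_lge0.
Qed.

Lemma seminorm_dist x y : `|N x - N y| <= N (x - y).
Proof.
have H a b : N a - N b <= N (a - b).
  by rewrite lerBlDr -{1}(subrK b a) seminormD.
by rewrite ler_norml H andbT lerNl opprB seminormB H.
Qed.

Lemma seminorm_triangle z x y : N (x - y) <= N (x - z) + N (z - y).
Proof. by rewrite -{1}(subrK z x) -addrA seminormD. Qed.

End seminorm_theory.

Lemma seminorm_normr {R : realType} {E : normedModType R} :
  seminorm (fun x : E => `|x|).
Proof. by split=> [x y|a x]; [exact: ler_normD|exact: normrZ]. Qed.

Section finite_valued.
Context {disp : measure_display} {X : measurableType disp} {R : realType}.
Variable mu : {measure set X -> \bar R}.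

Lemma le_mu (A B : set X) : measurable A -> measurable B -> A `<=` B ->
  (mu A <= mu B)%E.
Proof. by move=> mA mB AB; apply: le_measure; rewrite ?inE. Qed.

(* Simple functions presented as factorizations X -> I -> F with I finite:
   products and compositions of simple functions need no index bookkeeping. *)
Definition finite_valued (F : lmodType R) (f : X -> F) :=
  exists (I : finType) (j : X -> I) (v : I -> F),
    [/\ forall i, measurable (j @^-1` [set i]),
        forall i, v i <> 0 -> (mu (j @^-1` [set i]) < +oo)%E &
        f = v \o j].

Lemma finite_valued_simple (F : lmodType R) (s : simple_fun mu F) :
  finite_valued (simple_eval s).
Proof.
pose m := simple_size s; pose A := simple_set s.
exists {ffun 'I_m -> bool}, (fun x => [ffun i : 'I_m => x \in A i]).
exists (fun b : {ffun 'I_m -> bool} =>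
  \sum_(i < m) (b i)%:R *: simple_val s i).
have mj b : measurable ((fun x => [ffun i : 'I_m => x \in A i]) @^-1` [set b]).
  rewrite (_ : _ @^-1` _ = \bigcap_(i in [set: 'I_m])
      (if b i then A i else ~` A i)).
    apply: fin_bigcap_measurable => // i _.
    have mA : measurable (A i) by exact: measurable_simple_set.
    by case: ifP => // _; exact: measurableC.
  apply/seteqP; split=> [x /= xb i _|x xb /=].
    move/ffunP/(_ i): xb; rewrite ffunE => <-.
    by case: ifPn => [/set_mem//|/negP + Ax]; apply; rewrite inE.
  apply/ffunP => i; rewrite ffunE; have := xb i Logic.I.
  by case: (b i) => Aix; [apply/mem_set|apply/memNset].
split=> //.
- move=> b vb0; have [i bi] : exists i, b i.
    apply: contra_notP vb0 => nb; rewrite big1// => i _.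
    by case: (boolP (b i)) => [bi|_]; [case: nb; exists i|rewrite scale0r].
  apply: le_lt_trans (finite_simple_set s i); apply: le_mu => //.
    exact: measurable_simple_set.
  by move=> x xb; move: bi; rewrite -xb ffunE => /set_mem.
apply/funext => x /=; rewrite /simple_eval; apply: eq_bigr => i _.
by rewrite ffunE indicE.
Qed.

Lemma finite_valuedP (F : lmodType R) (f : X -> F) :
  finite_valued f <-> exists s : simple_fun mu F, f = simple_eval s.
Proof.
split=> [[I [j [v [mj foo ->]]]]|[s ->]]; last exact: finite_valued_simple.
pose A k : set X := if insub k is Some i then
  (if `[< v (@enum_val I predT i) = 0 >] then set0
   else j @^-1` [set @enum_val I predT i]) else set0.
pose w k : F := if insub k is Some i then v (@enum_val I predT i) else 0.
have mA k : measurable (A k).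
  by rewrite /A; case: insub => // i; case: ifPn.
have fA k : (mu (A k) < +oo)%E.
  rewrite /A; case: insub => [i|]; last by rewrite measure0.
  by case: ifPn => [_|/asboolPn/foo//]; rewrite measure0.
exists (@SimpleFun _ _ _ mu F #|I| A w mA fA); apply/funext => x.
rewrite /simple_eval /= (bigD1 (enum_rank (j x)))//= big1 ?addr0; last first.
  move=> i ij; rewrite /A /w !insubT// => ltiI; set k := Sub _ _.
  have -> : k = i by exact/val_inj.
  rewrite indicE; case: ifPn => [/asboolP->|_]; first by rewrite scaler0.
  rewrite memNset ?scale0r//= => jx; move/negP: ij; apply; apply/eqP.
  by rewrite jx enum_valK.
rewrite /A /w !insubT//= => lt; set k := Sub _ _.
have -> : k = enum_rank (j x) by exact/val_inj.
rewrite enum_rankK indicE; case: ifPn => [/asboolP->|_].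
  by rewrite scaler0.
by rewrite mem_set//= scale1r.
Qed.

(** [Phi k 0 = 0] keeps the value 0 on the fibres of infinite measure. *)
Lemma finite_valued_op (F F' : lmodType R) (K : finType) (h : X -> K)
    (Phi : K -> F -> F') (f : X -> F) :
  (forall k, measurable (h @^-1` [set k])) -> (forall k, Phi k 0 = 0) ->
  finite_valued f -> finite_valued (fun x => Phi (h x) (f x)).
Proof.
move=> mh Phi0 [I [j [v [mj foo ->]]]].
exists (K * I)%type, (fun x => (h x, j x)), (fun p => Phi p.1 (v p.2)).
have E k i : (fun x => (h x, j x)) @^-1` [set (k, i)] =
    h @^-1` [set k] `&` j @^-1` [set i].
  by apply/seteqP; split=> x /= => [[-> ->]|[-> ->]].
split=> //; first by move=> [k i]; rewrite E; exact: measurableI.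
move=> [k i] /= P0; rewrite E; apply: (@le_lt_trans _ _ (mu (j @^-1` [set i]))).
  by apply: le_mu; [exact: measurableI| |exact: subIsetr].
by apply: foo => vi0; apply: P0; rewrite vi0.
Qed.

Lemma finite_valued_op2 (F F' G : lmodType R)
    (Phi : F -> F' -> G) (f : X -> F) (f' : X -> F') :
  Phi 0 0 = 0 -> finite_valued f -> finite_valued f' ->
  finite_valued (fun x => Phi (f x) (f' x)).
Proof.
move=> Phi0 [I [j [v [mj foo ->]]]] [I' [j' [v' [mj' foo' ->]]]].
exists (I * I')%type, (fun x => (j x, j' x)), (fun p => Phi (v p.1) (v' p.2)).
have E k i : (fun x => (j x, j' x)) @^-1` [set (k, i)] =
    j @^-1` [set k] `&` j' @^-1` [set i].
  by apply/seteqP; split=> x /= => [[-> ->]|[-> ->]].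
split=> //; first by move=> [k i]; rewrite E; exact: measurableI.
move=> [k i] /= P0; rewrite E; case: (pselect (v k = 0)) => vk.
  apply: (@le_lt_trans _ _ (mu (j' @^-1` [set i]))).
    by apply: le_mu; [exact: measurableI| |exact: subIsetr].
  by apply: foo' => vi0; apply: P0; rewrite vi0 vk.
apply: (@le_lt_trans _ _ (mu (j @^-1` [set k]))).
  by apply: le_mu; [exact: measurableI| |exact: subIsetl].
exact: foo.
Qed.

Lemma finite_valued_comp_measurable (F : lmodType R) (phi : F -> R) (f : X -> F) :
  finite_valued f -> measurable_fun setT (phi \o f).
Proof.
move=> [I [j [v [mj _ ->]]]]; rewrite compA.
exact: measurable_countable_comp.
Qed.

End finite_valued.

Lemma nneseries_geometric_half {R : realType} (c : R) : 0 <= c ->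
  (\sum_(n <oo) (c * 2^-1 ^+ n)%:E <= (2 * c)%:E)%E.
Proof.
move=> c0; have c20 : 0 <= 2 * c by rewrite mulr_ge0.
apply: le_trans (epsilon_trick0 xpredT c20).
apply: lee_nneseries => n _; rewrite lee_fin; first by rewrite mulr_ge0// exprn_ge0.
by rewrite natrX exprS invfM mulrACA divff// mul1r exprVn.
Qed.

Section strong_measurability.
Import HBNNSimple.
Context {disp : measure_display} {X : measurableType disp} {R : realType}.
Variable mu : {measure set X -> \bar R}.
Implicit Types F G : lmodType R.

Lemma strongly_measurableP F (N : F -> R) (f : X -> F) :
  strongly_measurable mu N f <-> exists s : nat -> X -> F,
    (forall k, finite_valued mu (s k)) /\
    \forall x \ae mu, N (f x - s k x) @[k --> \oo] --> 0.
Proof.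
split=> [[s sf]|[s [ss sf]]].
  by exists (fun k => simple_eval (s k)); split => // k; exact: finite_valued_simple.
have /choice[t st] k : exists t : simple_fun mu F, s k = simple_eval t.
  exact/finite_valuedP.
by exists t; move: sf; rewrite (_ : s = fun k => simple_eval (t k))//; exact/funext.
Qed.

Section fixed_seminorm.
Context {F : lmodType R} (N : F -> R) (snN : seminorm N).

Lemma finite_valued_strongly_measurable f :
  finite_valued mu f -> strongly_measurable mu N f.
Proof.
move=> sf; apply/strongly_measurableP; exists (fun=> f); split=> //.
by apply: aeW => x /=; rewrite subrr seminorm0//; exact: cvg_cst.
Qed.

Lemma ae_eq_strongly_measurable f g : (\forall x \ae mu, f x = g x) ->
  strongly_measurable mu N f -> strongly_measurable mu N g.
Proof. by move=> fg [s sf]; exists s; apply: filterS2 fg sf => x <-. Qed.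

Lemma seminorm_cvg (s : nat -> F) (l : F) :
  N (l - s k) @[k --> \oo] --> 0 -> N (s k) @[k --> \oo] --> N l.
Proof.
move=> sl; apply/cvgrPdist_le => e e0.
have /cvgrPdist_le /(_ _ e0) := sl; apply: filterS => k.
rewrite sub0r normrN ger0_norm ?seminorm_ge0// => h.
exact: le_trans (seminorm_dist snN _ _) h.
Qed.

Lemma measurable_seminorm_lim (A : set X) (s : nat -> X -> F) f :
  measurable A -> (forall k, measurable_fun setT (N \o s k)) ->
  (forall x, A x -> N (f x - s k x) @[k --> \oo] --> 0) ->
  measurable_fun setT (\1_A \* (N \o f)).
Proof.
move=> mA ms sf.
apply: (@measurable_fun_cvg _ _ _ _ (fun k => \1_A \* (N \o s k))).
  by move=> k; apply: measurable_funM => //; exact: measurable_indic.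
move=> x _ /=; rewrite indicE; case: (pselect (A x)) => Ax.
  rewrite mem_set//= mul1r; under eq_fun do rewrite mul1r.
  exact/seminorm_cvg/sf.
by rewrite memNset//= mul0r; under eq_fun do rewrite mul0r; exact: cvg_cst.
Qed.

(** Replacing the norm by 0 on the null set where the simple approximations fail to converge makes
    it a pointwise limit of measurable functions. *)
Lemma strongly_measurable_near_norm f : strongly_measurable mu N f ->
  exists2 g : X -> R, measurable_fun setT g &
    (forall x, 0 <= g x) /\ \forall x \ae mu, N (f x) = g x.
Proof.
move=> /strongly_measurableP[s [ss [A [mA A0 fA]]]].
have mC : measurable (~` A) by exact: measurableC.
exists (\1_(~` A) \* (N \o f)).
  apply: (@measurable_seminorm_lim _ s) => // [k|x Ax].
    exact: finite_valued_comp_measurable (ss k).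
  by apply: contrapT => nx; apply: Ax; exact: fA.
split; first by move=> x /=; rewrite mulr_ge0 ?indicE//; exact: seminorm_ge0.
exists A; split=> // x /= nx; apply: contrapT => Ax; apply: nx.
by rewrite indicE mem_set//= mul1r.
Qed.

Lemma strongly_measurableD f g : strongly_measurable mu N f ->
  strongly_measurable mu N g -> strongly_measurable mu N (f + g).
Proof.
move=> /strongly_measurableP[s [ss sf]] /strongly_measurableP[t [ts tg]].
apply/strongly_measurableP; exists (fun k => s k + t k); split.
  move=> k; exact: (finite_valued_op2 (Phi := +%R)) (addr0 0) (ss k) (ts k).
apply: filterS2 sf tg => x sf tg; rewrite -[X in _ --> X](addr0 0).
have : N (f x - s k x) + N (g x - t k x) @[k --> \oo] --> (0 + 0 : R).
  exact: cvgD.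
apply: squeeze_cvgr; last exact: cvg_cst.
  apply: nearW => k; rewrite addr0 (seminorm_ge0 snN)/=.
  rewrite (_ : _ - _ = (f x - s k x) + (g x - t k x)) ?seminormD//.
  by rewrite opprD addrACA.
Qed.

Lemma strongly_measurableZ a f : strongly_measurable mu N f ->
  strongly_measurable mu N (a *: f).
Proof.
move=> /strongly_measurableP[s [ss sf]].
apply/strongly_measurableP; exists (fun k => a *: s k); split.
  move=> k; apply: (finite_valued_op2 (Phi := fun x _ => a *: x)) (ss k) (ss k).
  by rewrite scaler0.
apply: filterS sf => x sf; rewrite -[X in _ --> X](mulr0 `|a|).
rewrite (_ : (fun _ => _) = fun k => `|a| * N (f x - s k x)).
  by apply: cvgMr.
by apply/funext => k; rewrite -seminormZ// scalerBr.
Qed.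

Lemma strongly_measurableB f g : strongly_measurable mu N f ->
  strongly_measurable mu N g -> strongly_measurable mu N (f - g).
Proof.
move=> mf mg; rewrite -(scaleN1r g).
by apply: strongly_measurableD => //; exact: strongly_measurableZ.
Qed.

Lemma strongly_measurable0 : strongly_measurable mu N 0.
Proof.
apply: finite_valued_strongly_measurable.
exists unit, (fun=> tt), (fun=> 0); split => // -[].
by rewrite (_ : _ @^-1` _ = setT) //; apply/seteqP.
Qed.

Lemma strongly_measurable_sum (I : Type) (r : seq I) (P : pred I) (f : I -> X -> F) :
  (forall i, P i -> strongly_measurable mu N (f i)) ->
  strongly_measurable mu N (\sum_(i <- r | P i) f i).
Proof.
move=> mf; apply: big_ind => //; first exact: strongly_measurable0.
exact: strongly_measurableD.
Qed.

End fixed_seminorm.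

Lemma strongly_measurable_lin F G (N : F -> R) (N' : G -> R) (L : {linear F -> G})
    (C : R) f : seminorm N -> seminorm N' -> (forall x, N' (L x) <= C * N x) ->
  strongly_measurable mu N f -> strongly_measurable mu N' (fun x => L (f x)).
Proof.
move=> snN snN' LC /strongly_measurableP[s [ss sf]].
apply/strongly_measurableP; exists (fun k x => L (s k x)); split.
  move=> k; apply: (finite_valued_op2 (Phi := fun x _ => L x)) (ss k) (ss k).
  by rewrite linear0.
apply: filterS sf => x sf.
have : C * N (f x - s k x) @[k --> \oo] --> C * 0 by apply: cvgMr.
rewrite mulr0; apply: squeeze_cvgr; last exact: cvg_cst.
by apply: nearW => k; rewrite seminorm_ge0//= -linearB LC.
Qed.

(** The level sets of a simple approximation of [phi] may have infinite measure, but its product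
    with an approximation of [f] vanishes wherever the latter does, hence is again simple. *)
Lemma strongly_measurable_scale F (N : F -> R) (phi : X -> R) f : seminorm N ->
  measurable_fun setT phi ->
  strongly_measurable mu N f -> strongly_measurable mu N (fun x => phi x *: f x).
Proof.
move=> snN mphi mf.
have pos (psi : X -> R) : measurable_fun setT psi -> (forall x, 0 <= psi x) ->
    strongly_measurable mu N (fun x => psi x *: f x).
  move=> mpsi psi0; move: mf => /strongly_measurableP[s [ss sf]].
  have mE : measurable_fun setT (EFin \o psi) by exact/measurable_EFinP.
  have [//|h [_ hpsi]] := approximation measurableT mE.
    by move=> x _ /=; rewrite lee_fin.
  apply/strongly_measurableP; exists (fun k x => h k x *: s k x); split.
    move=> k.
    have hx x : h k x \in fset_set (range (h k)).
      by rewrite in_fset_set// inE; exists x.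
    apply: (finite_valued_op (h := fun x => [` hx x]%fset)
      (Phi := fun i y => fsval i *: y)) (ss k).
      move=> i; rewrite (_ : _ @^-1` _ = h k @^-1` [set fsval i]).
        exact: measurable_funPTI.
      by apply/seteqP; split => x /= => [<-//|?]; exact/val_inj.
    by move=> i; rewrite scaler0.
  apply: filterS sf => x sf.
  have {}hpsi : h k x @[k --> \oo] --> psi x.
    by have /fine_cvgP[] := hpsi x Logic.I.
  have : `|psi x - h k x| * N (f x) + `|h k x| * N (f x - s k x)
      @[k --> \oo] --> `|psi x - psi x| * N (f x) + `|psi x| * 0.
    apply: cvgD; first by apply: cvgMl; apply: cvg_norm; apply: cvgB => //; exact: cvg_cst.
    by apply: cvgM => //; exact: cvg_norm.
  rewrite subrr normr0 mul0r mulr0 addr0.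
  apply: squeeze_cvgr; last exact: cvg_cst.
  apply: nearW => k; rewrite (seminorm_ge0 snN)/=.
  rewrite -!(seminormZ snN) (le_trans _ (seminormD snN _ _))//.
  by rewrite scalerBl scalerBr addrA subrK.
rewrite (_ : (fun _ => _) = (fun x => phi^\+ x *: f x) - (fun x => phi^\- x *: f x)).
  apply: strongly_measurableB => //; apply: pos.
  - exact: measurable_funrpos.
  - exact: funrpos_ge0.
  - exact: measurable_funrneg.
  - exact: funrneg_ge0.
apply/funext => x; rewrite -[RHS]scalerBl; congr (_ *: _).
by rewrite -[in LHS](funrposBneg phi).
Qed.

End strong_measurability.

Section strongly_measurable_limit.
Context {disp : measure_display} {X : measurableType disp} {R : realType}.
Variable mu : {sigma_finite_measure set X -> \bar R}.
Context {F : lmodType R} (N : F -> R) (snN : seminorm N).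

Lemma measure_tail_cvg0 (G : set X) (h : nat -> X -> R) (e : R) :
  measurable G -> (mu G < +oo)%E -> 0 < e ->
  (forall k, measurable_fun setT (h k)) ->
  (forall x, h k x @[k --> \oo] --> 0) ->
  mu (\bigcup_(k >= n) (G `&` [set x | e <= h k x])) @[n --> \oo] --> 0%E.
Proof.
move=> mG Goo e0 mh hcvg.
have mS k : measurable (G `&` [set x | e <= h k x]).
  apply: measurableI => //; rewrite -[X in measurable X]setTI.
  by apply: measurable_fun_ler.
have mU n : measurable (\bigcup_(k >= n) (G `&` [set x | e <= h k x])).
  exact: bigcup_measurable.
rewrite -(measure0 mu).
rewrite (_ : set0 = \bigcap_n (\bigcup_(k >= n) (G `&` [set x | e <= h k x]))).
  apply: nonincreasing_cvg_mu => //.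
  - apply: le_lt_trans Goo; apply: le_mu => //.
    by apply: bigcup_sub => k _; exact: subIsetl.
  - exact: bigcapT_measurable.
  - move=> m n mn; apply/subsetPset; apply: bigcup_sub => k /= nk.
    by move=> x ?; exists k => //=; exact: leq_trans nk.
apply/esym/seteqP; split=> // x /= H.
have /cvgrPdist_lt /(_ _ e0) [n _ hn] := hcvg x.
have [k /= nk [_ ek]] := H n Logic.I.
have := hn k nk; rewrite sub0r normrN => /(le_lt_trans (ler_norm _)).
by rewrite ltNge ek.
Qed.

(** Egorov's argument: on a set of finite measure the tails of the sets of bad approximation shrink
    to a null set. *)
Lemma strongly_measurable_approx (G : set X) f (e : R) : 0 < e ->
  measurable G -> (mu G < +oo)%E -> strongly_measurable mu N f ->
  exists s B, [/\ finite_valued mu s, measurable B, (mu B <= e%:E)%E &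
    forall x, G x -> ~ B x -> N (f x - s x) <= e].
Proof.
move=> e0 mG Goo /strongly_measurableP[s [ss [A [mA A0 sf]]]].
have mC : measurable (~` A) by exact: measurableC.
pose h k := \1_(~` A) \* (N \o (fun x => f x - s k x)).
have hcvg x : h k x @[k --> \oo] --> 0.
  rewrite /h /= indicE; case: (pselect (A x)) => Ax.
    by rewrite memNset//=; under eq_fun do rewrite mul0r; exact: cvg_cst.
  rewrite mem_set//=; under eq_fun do rewrite mul1r.
  by apply: contrapT => nx; apply: Ax; exact: sf.
have mh k : measurable_fun setT (h k).
  apply: (@measurable_seminorm_lim _ _ _ _ _ snN _ (fun l x => s l x - s k x)) => //.
    move=> l; apply: (@finite_valued_comp_measurable _ _ _ mu).
    apply: (finite_valued_op2 (Phi := fun a b => a - b)) (ss l) (ss k).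
    by rewrite subr0.
  move=> x Ax; under eq_fun do rewrite opprB addrA subrK.
  by apply: contrapT => nx; apply: Ax; exact: sf.
have /fine_cvgP[fin /cvgrPdist_le /(_ _ e0) small] :=
  measure_tail_cvg0 mG Goo e0 mh hcvg.
have [n _ /(_ n (leqnn n)) [/= finn]] := filterI fin small.
rewrite sub0r normrN ger0_norm ?fine_ge0// => smalln.
set U := \bigcup_(k >= n) _ in finn smalln.
exists (s n), (U `|` A); split => //.
- apply: measurableU => //; apply: bigcup_measurable => k _.
  apply: measurableI => //; rewrite -[X in measurable X]setTI.
  exact: measurable_fun_ler.
- apply: le_trans (measureU2 _ _ _) _ => //.
    apply: bigcup_measurable => k _; apply: measurableI => //.
    by rewrite -[X in measurable X]setTI; exact: measurable_fun_ler.
  by rewrite [X in (_ + X)%E]A0 adde0 -[leLHS]fineK.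
move=> x Gx /not_orP[Ux Ax]; rewrite leNgt; apply/negP => ex; apply: Ux.
exists n => //=; split=> //=; rewrite /h /= indicE mem_set//= mul1r ltW//.
Qed.

(** Diagonal argument: [f_ m] is approximated within [2^-m] on the [m]-th set of an exhaustion, off
    a set [B m] of measure at most [2^-m]. By Borel-Cantelli almost every point lies in finitely
    many of the [B m]. *)
Lemma strongly_measurable_lim (f_ : nat -> X -> F) f :
  (forall m, strongly_measurable mu N (f_ m)) ->
  (\forall x \ae mu, N (f x - f_ k x) @[k --> \oo] --> 0) ->
  strongly_measurable mu N f.
Proof.
move=> mf cf; have /sigma_finiteP[G [GT ndG Goo]] := sigma_finiteT mu.
have /choice[s /choice[B sB]] m : exists s B, [/\ finite_valued mu s, measurable B,
    (mu B <= (2^-1 ^+ m)%:E)%E &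
    forall x, G m x -> ~ B x -> N (f_ m x - s x) <= 2^-1 ^+ m].
  have [mG Gm] := Goo m; apply: strongly_measurable_approx => //.
have mB m : measurable (B m) by case: (sB m).
have B0 : mu (lim_sup_set B) = 0%E.
  apply: lim_sup_set_cvg0 => //.
  apply: (@le_lt_trans _ _ (\sum_(n <oo) (1 * 2^-1 ^+ n)%:E)%E).
    by apply: lee_nneseries => // n _; rewrite mul1r; case: (sB n).
  by apply: le_lt_trans (nneseries_geometric_half ler01) (ltry _).
apply/strongly_measurableP; exists s; split; first by move=> k; case: (sB k).
apply: filterS2 cf (_ : \forall x \ae mu, ~ lim_sup_set B x); last first.
  exists (lim_sup_set B); split => //; last by move=> x /= /contrapT.
  apply: bigcap_measurable => // k _; exact: bigcup_measurable.
move=> x cx nx.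
have [n1 h1] : exists n, forall k, (n <= k)%N -> ~ B k x.
  apply: contra_notP nx => nx n _; apply: contra_notP nx => nx; exists n => k nk Bk.
  by apply: nx; exists k.
have [n2 _ h2] : (\bigcup_i G i) x by rewrite -GT.
apply/cvgrPdist_lt => e e0; have e20 : 0 < e / 2 by rewrite divr_gt0.
have /cvgrPdist_lt /(_ _ e20) H1 := cx.
have H2 : \forall k \near \oo, 2^-1 ^+ k < e / 2 :> R.
  have /cvgrPdist_lt /(_ _ e20) : 2^-1 ^+ k @[k --> \oo] --> (0 : R).
    by apply: cvg_expr; rewrite gtr0_norm ?invf_lt1 ?ltr1n.
  apply: filterS => k.
  by rewrite sub0r normrN ger0_norm ?exprn_ge0.
near=> k.
rewrite sub0r normrN ger0_norm ?(seminorm_ge0 snN)//.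
apply: le_lt_trans (seminorm_triangle snN (f_ k x) _ _) _.
rewrite (splitr e) ltrD//.
  have : `|0 - N (f x - f_ k x)| < e / 2 by near: k.
  by rewrite sub0r normrN ger0_norm ?(seminorm_ge0 snN).
case: (sB k) => _ _ _ /(_ x) H; apply: le_lt_trans (H _ _) _.
- have : (n2 <= k)%N by near: k; exists n2.
  by move=> /ndG/subsetPset; apply.
- by apply: h1; near: k; exists n1.
by near: k.
Unshelve. all: by end_near. Qed.

End strongly_measurable_limit.

Section square_integrals.
Context {disp : measure_display} {X : measurableType disp} {R : realType}.
Variable mu : {measure set X -> \bar R}.
Context {F : lmodType R} (N : F -> R) (snN : seminorm N).

(** The square of [L2norm]. Working with it avoids real powers and the Minkowski inequality, at the
    price of the factors 2 in [sqintD]. *)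
Definition sqint (f : X -> F) : \bar R := (\int[mu]_x (N (f x) ^+ 2)%:E)%E.

Lemma sqint_ge0 f : (0 <= sqint f)%E.
Proof. by apply: integral_ge0 => x _; rewrite lee_fin sqr_ge0. Qed.

Lemma L2normE f : L2norm mu N f = (sqint f `^ 2^-1)%E.
Proof.
rewrite /L2norm unlock; congr (_ `^ _)%E; apply: eq_integral => x _ /=.
by rewrite ger0_norm ?(seminorm_ge0 snN)// -powR_mulrn// (seminorm_ge0 snN).
Qed.

Lemma sqrt_le_fin (a : \bar R) (c : R) : (0 <= a)%E -> 0 <= c ->
  (a `^ 2^-1 <= c%:E)%E = (a <= (c ^+ 2)%:E)%E.
Proof.
move=> a0 c0; case: a a0 => [a| |]//=; rewrite ?lee_fin => a0.
  rewrite powR12_sqrt// -(@ler_pXn2r _ 2)// ?nnegrE ?sqrtr_ge0//.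
  by rewrite sqr_sqrtr.
by rewrite invr_eq0 pnatr_eq0/= !leNgt !ltry.
Qed.

Lemma L2norm_le f c : 0 <= c ->
  (L2norm mu N f <= c%:E)%E = (sqint f <= (c ^+ 2)%:E)%E.
Proof. by move=> c0; rewrite L2normE sqrt_le_fin// sqint_ge0. Qed.

Lemma L2norm_lty f : (L2norm mu N f < +oo)%E = (sqint f < +oo)%E.
Proof.
rewrite L2normE; have := sqint_ge0 f; case: (sqint f) => [a| |]//= a0.
  by rewrite !ltry.
by rewrite invr_eq0 pnatr_eq0.
Qed.

Lemma ae_eq_sqint f g : (\forall x \ae mu, f x = g x) -> sqint f = sqint g.
Proof.
move=> fg; apply: ae_eq_ge0_integral => [x _|x _|]; rewrite ?lee_fin ?sqr_ge0//.
by apply: filterS fg => x ->.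
Qed.

Lemma integral_seminormD f g :
  strongly_measurable mu N f -> strongly_measurable mu N g ->
  (\int[mu]_x (N ((f + g) x))%:E <= \int[mu]_x (N (f x))%:E + \int[mu]_x (N (g x))%:E)%E.
Proof.
move=> /(strongly_measurable_near_norm snN)[a ma [a0 fa]].
move=> /(strongly_measurable_near_norm snN)[b mb [b0 gb]].
rewrite (ae_eq_ge0_integral (g := EFin \o a) (f := EFin \o N \o f))//; last first.
- by apply: filterS fa => x /= ->.
- by move=> x _; rewrite lee_fin.
- by move=> x _; rewrite lee_fin (seminorm_ge0 snN).
rewrite (ae_eq_ge0_integral (g := EFin \o b) (f := EFin \o N \o g))//; last first.
- by apply: filterS gb => x /= ->.
- by move=> x _; rewrite lee_fin.
- by move=> x _; rewrite lee_fin (seminorm_ge0 snN).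
rewrite -ge0_integralD//; first last.
- by apply/measurable_EFinP.
- by move=> x _; rewrite lee_fin.
- by apply/measurable_EFinP.
- by move=> x _; rewrite lee_fin.
apply: ae_le_integral => [x _|x _|].
- by rewrite lee_fin (seminorm_ge0 snN).
- by rewrite adde_ge0// lee_fin.
apply: filterS2 fa gb => x /= <- <- _.
by rewrite -EFinD lee_fin seminormD.
Qed.

Lemma sqintD (f g : X -> F) :
  strongly_measurable mu N f -> strongly_measurable mu N g ->
  (sqint (f + g)%R <= 2%:E * sqint f + 2%:E * sqint g)%E.
Proof.
move=> /(strongly_measurable_near_norm snN)[a ma [a0 fa]].
move=> /(strongly_measurable_near_norm snN)[b mb [b0 gb]].
have -> : sqint f = (\int[mu]_x (a x ^+ 2)%:E)%E.
  apply: ae_eq_ge0_integral => [x _|x _|]; rewrite ?lee_fin ?sqr_ge0//.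
  by apply: filterS fa => x ->.
have -> : sqint g = (\int[mu]_x (b x ^+ 2)%:E)%E.
  apply: ae_eq_ge0_integral => [x _|x _|]; rewrite ?lee_fin ?sqr_ge0//.
  by apply: filterS gb => x ->.
have ma2 : measurable_fun setT (fun x => (a x ^+ 2)%:E).
  by apply/measurable_EFinP; exact: measurable_funX.
have mb2 : measurable_fun setT (fun x => (b x ^+ 2)%:E).
  by apply/measurable_EFinP; exact: measurable_funX.
have a20 x : (0 <= (a x ^+ 2)%:E)%E by rewrite lee_fin sqr_ge0.
have b20 x : (0 <= (b x ^+ 2)%:E)%E by rewrite lee_fin sqr_ge0.
rewrite -!ge0_integralZl_EFin// -ge0_integralD//; first last.
- by apply: emeasurable_funM => //; exact: measurable_cst.
- by move=> x _; rewrite mule_ge0.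
- by apply: emeasurable_funM => //; exact: measurable_cst.
- by move=> x _; rewrite mule_ge0.
apply: ae_le_integral => [x _|x _|].
- by rewrite lee_fin sqr_ge0.
- by rewrite adde_ge0// mule_ge0.
apply: filterS2 fa gb => x fa gb _; rewrite -!EFinM -EFinD lee_fin -fa -gb.
have := seminormD snN (f x) (g x); have := seminorm_ge0 snN (f x + g x).
set u := N (f x); set v := N (g x); rewrite /= -[(f + g) x]/(f x + g x).
set w := N (f x + g x) => w0 wuv.
apply: (@le_trans _ _ ((u + v) ^+ 2)); first by rewrite ler_pXn2r ?nnegrE// (le_trans w0).
by have := sqr_ge0 (u - v); nra.
Qed.

Lemma sqintZ a f : strongly_measurable mu N f ->
  sqint (a *: f) = ((a ^+ 2)%:E * sqint f)%E.
Proof.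
move=> /(strongly_measurable_near_norm snN)[b mb [b0 fb]].
have -> : sqint f = (\int[mu]_x (b x ^+ 2)%:E)%E.
  apply: ae_eq_ge0_integral => [x _|x _|]; rewrite ?lee_fin ?sqr_ge0//.
  by apply: filterS fb => x ->.
rewrite -ge0_integralZl_EFin ?sqr_ge0//; first last.
- by apply/measurable_EFinP; exact: measurable_funX.
- by move=> x _; rewrite lee_fin sqr_ge0.
apply: ae_eq_ge0_integral => [x _|x _|].
- by rewrite lee_fin sqr_ge0.
- by rewrite -EFinM lee_fin mulr_ge0 ?sqr_ge0.
by apply: filterS fb => x <- _; rewrite seminormZ// exprMn real_normK ?num_real.
Qed.

Lemma chebyshev_sqint f (K l : R) : strongly_measurable mu N f -> 0 < l ->
  (sqint f <= K%:E)%E ->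
  exists A, [/\ measurable A, (mu A <= (K / l ^+ 2)%:E)%E &
    \forall x \ae mu, ~ A x -> N (f x) <= l].
Proof.
move=> /(strongly_measurable_near_norm snN)[a ma [a0 fa]] l0.
have -> : sqint f = (\int[mu]_x (a x ^+ 2)%:E)%E.
  apply: ae_eq_ge0_integral => [x _|x _|]; rewrite ?lee_fin ?sqr_ge0//.
  by apply: filterS fa => x ->.
move=> aK; have ma2 : measurable_fun setT (fun x => (a x ^+ 2)%:E).
  by apply/measurable_EFinP; exact: measurable_funX.
pose A := [set x | l <= a x].
have mA : measurable A.
  by rewrite -[X in measurable X]setTI; exact: measurable_fun_ler.
exists A; split => //; last first.
  by apply: filterS fa => x -> /negP; rewrite -ltNge => /ltW.
rewrite EFinM lee_pdivlMr ?exprn_gt0// muleC.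
apply: le_trans aK; rewrite -integral_cst//.
apply: (@le_trans _ _ (\int[mu]_(x in A) (a x ^+ 2)%:E)%E).
  apply: ge0_le_integral => //.
  - by move=> x _; rewrite lee_fin sqr_ge0.
  - exact: measurable_funTS.
  - by move=> x Ax; rewrite lee_fin ler_pXn2r// ?nnegrE// ltW.
by apply: ge0_subset_integral => // x _; rewrite lee_fin sqr_ge0.
Qed.

End square_integrals.

(** * Bochner integrals of simple functions and their comparison *)

Section bochner.
Context {disp : measure_display} {X : measurableType disp} {R : realType}.
Variable mu : {measure set X -> \bar R}.
Context {E : normedModType R}.
Local Notation normE := (fun x : E => `|x|).

Lemma integral_finite_factor (I : finType) (J : X -> I) (phi : I -> R) :
  (forall i, measurable (J @^-1` [set i])) -> (forall i, 0 <= phi i) ->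
  (\int[mu]_x (phi (J x))%:E = \sum_(b : I) (phi b)%:E * mu (J @^-1` [set b]))%E.
Proof.
move=> mJ phi0.
transitivity (\int[mu]_x (\sum_(b <- index_enum I)
    (phi b)%:E * (\1_(J @^-1` [set b]) x)%:E))%E.
  apply: eq_integral => x _; rewrite (bigD1 (J x))//= indicE mem_set//= mule1.
  rewrite big1 ?adde0// => b bJ; rewrite indicE memNset ?mule0//= => Jb.
  by rewrite Jb eqxx in bJ.
rewrite ge0_integral_sum//; first last.
- by move=> b x _; rewrite mule_ge0 ?lee_fin.
- move=> b; apply: emeasurable_funM; first exact: measurable_cst.
  by apply/measurable_EFinP; exact: measurable_indic.
apply: eq_bigr => b _; rewrite ge0_integralZl_EFin//; first last.
- by apply/measurable_EFinP; exact: measurable_indic.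
by rewrite integral_indic// setIT.
Qed.

Lemma measure_finite_factor (I : finType) (J : X -> I) (P : pred I) :
  (forall i, measurable (J @^-1` [set i])) ->
  (mu [set x | P (J x)] = \sum_(b | P b) mu (J @^-1` [set b]))%E.
Proof.
move=> mJ; have mP : measurable [set x | P (J x)].
  rewrite -[X in measurable X]setTI.
  have := @measurable_countable_comp _ _ _ bool I J P mJ measurableT [set true].
  exact.
rewrite -[X in mu X](setIT _) -integral_indic//.
transitivity (\int[mu]_x ((P (J x))%:R : R)%:E)%E.
  apply: eq_integral => x _; rewrite indicE; case: (boolP (P (J x))) => Px.
    by rewrite mem_set.
  by rewrite memNset//=; apply/negP.
rewrite (integral_finite_factor (phi := fun b => (P b)%:R))//.
rewrite [RHS]big_mkcond; apply: eq_bigr => b _.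
by case: ifP => _; rewrite ?mul1e ?mul0e.
Qed.

Lemma simple_integral_factor (I : finType) (J : X -> I) (s : simple_fun mu E)
    (P : nat -> pred I) :
  (forall i, measurable (J @^-1` [set i])) ->
  (forall k, (k < simple_size s)%N -> simple_set s k = [set x | P k (J x)]) ->
  simple_integral s = \sum_(b : I) fine (mu (J @^-1` [set b])) *:
    \sum_(k < simple_size s | P k b) simple_val s k.
Proof.
move=> mJ sP; rewrite /simple_integral.
under [RHS]eq_bigr do rewrite scaler_sumr.
rewrite [RHS](exchange_big_dep xpredT)//=; apply: eq_bigr => k _.
rewrite -scaler_suml; congr (_ *: _).
rewrite sP// measure_finite_factor// sum_fine// => b Pb.
rewrite ge0_fin_numE//; apply: le_lt_trans (finite_simple_set s k).
apply: le_mu => //; first exact: measurable_simple_set.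
by rewrite sP// => x /= ->.
Qed.

(** Both functions factor through [J], the pattern of membership in all their sets, so both
    integrals become sums over one finite partition. *)
Lemma simple_integral_dist (s t : simple_fun mu E) :
  (`|simple_integral s - simple_integral t|%:E <=
   \int[mu]_x `|simple_eval s x - simple_eval t x|%:E)%E.
Proof.
pose J x := ([ffun i : 'I_(simple_size s) => x \in simple_set s i],
             [ffun i : 'I_(simple_size t) => x \in simple_set t i]).
have mb (u : simple_fun mu E) (b : {ffun 'I_(simple_size u) -> bool}) :
    measurable [set x | [ffun i : 'I_(simple_size u) => x \in simple_set u i] = b].
  rewrite (_ : mkset _ = \bigcap_(i in [set: 'I_(simple_size u)])
      (if b i then simple_set u i else ~` simple_set u i)).
    apply: fin_bigcap_measurable => // i _.
    have mA : measurable (simple_set u i) by exact: measurable_simple_set.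
    by case: ifP => // _; exact: measurableC.
  apply/seteqP; split=> [x /= xb i _|x xb /=].
    move/ffunP/(_ i): xb; rewrite ffunE => <-.
    by case: ifPn => [/set_mem//|/negP + Ax]; apply; rewrite inE.
  apply/ffunP => i; rewrite ffunE; have := xb i Logic.I.
  by case: (b i) => Aix; [apply/mem_set|apply/memNset].
have mJ b : measurable (J @^-1` [set b]).
  rewrite (_ : _ @^-1` _ = [set x | [ffun i : 'I_(simple_size s) => x \in simple_set s i] = b.1]
    `&` [set x | [ffun i : 'I_(simple_size t) => x \in simple_set t i] = b.2]).
    by apply: measurableI; exact: mb.
  by case: b => b1 b2; apply/seteqP; split=> x /= => [[-> ->]|[<- <-]].
pose Ps (k : nat) (b : {ffun 'I_(simple_size s) -> bool} * {ffun 'I_(simple_size t) -> bool}) :=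
  if insub k is Some i then b.1 i else false.
pose Pt (k : nat) (b : {ffun 'I_(simple_size s) -> bool} * {ffun 'I_(simple_size t) -> bool}) :=
  if insub k is Some i then b.2 i else false.
have HPs k : (k < simple_size s)%N -> simple_set s k = [set x | Ps k (J x)].
  move=> ks; apply/seteqP; split => x /=; rewrite /Ps insubT /J/= ffunE/=.
    exact: mem_set.
  exact: set_mem.
have HPt k : (k < simple_size t)%N -> simple_set t k = [set x | Pt k (J x)].
  move=> ks; apply/seteqP; split => x /=; rewrite /Pt insubT /J/= ffunE/=.
    exact: mem_set.
  exact: set_mem.
rewrite (simple_integral_factor mJ HPs) (simple_integral_factor mJ HPt).
pose S b := \sum_(k < simple_size s | Ps k b) simple_val s k.
pose T b := \sum_(k < simple_size t | Pt k b) simple_val t k.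
have sE x : simple_eval s x = S (J x).
  rewrite /simple_eval /S [RHS]big_mkcond; apply: eq_bigr => k _.
  rewrite (HPs k)// indicE; case: ifPn => Px.
    by rewrite mem_set// scale1r.
  by rewrite memNset ?scale0r//=; apply/negP.
have tE x : simple_eval t x = T (J x).
  rewrite /simple_eval /T [RHS]big_mkcond; apply: eq_bigr => k _.
  rewrite (HPt k)// indicE; case: ifPn => Px.
    by rewrite mem_set// scale1r.
  by rewrite memNset ?scale0r//=; apply/negP.
under eq_integral do rewrite sE tE.
rewrite (integral_finite_factor (phi := fun b => `|S b - T b|))//.
rewrite -sumrB.
apply: (@le_trans _ _ (\sum_b (`|S b - T b| * fine (mu (J @^-1` [set b])))%:E)%E).
  rewrite sumEFin lee_fin; apply: le_trans (ler_norm_sum _ _ _) _.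
  apply: ler_sum => b _; rewrite -scalerBr normrZ mulrC ler_wpM2l//.
  by rewrite ger0_norm ?fine_ge0.
apply: lee_sum => b _; rewrite EFinM.
case: (eqVneq (S b - T b) 0) => [->|ST0]; first by rewrite normr0 !mul0e.
rewrite fineK// ge0_fin_numE//.
case: (eqVneq (S b) 0) => [Sb0|Sb0].
  have [k Pk] : exists k : 'I_(simple_size t), Pt k b.
    apply: contraNP ST0 => nP; rewrite Sb0 sub0r oppr_eq0 /T big_pred0// => k.
    by apply/negP => Pk; apply: nP; exists k.
  apply: le_lt_trans (finite_simple_set t k); apply: le_mu => //.
    exact: measurable_simple_set.
  by rewrite (HPt k)// => x /= ->.
have [k Pk] : exists k : 'I_(simple_size s), Ps k b.
  apply: contraNP Sb0 => nP; rewrite /S big_pred0// => k.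
  by apply/negP => Pk; apply: nP; exists k.
apply: le_lt_trans (finite_simple_set s k); apply: le_mu => //.
  exact: measurable_simple_set.
by rewrite (HPs k)// => x /= ->.
Qed.

(** [bochner_integral_is] is a relation between a function and a value. This inequality yields at
    once the uniqueness of the value, its bound by the integral of the norm, and the comparison of
    two kernels; it is the limit of the one for simple functions. *)
Lemma bochner_dist (f g : X -> E) (v w : E) :
  bochner_integral_is mu f v -> bochner_integral_is mu g w ->
  (`|v - w|%:E <= \int[mu]_x `|f x - g x|%:E)%E.
Proof.
move=> [mf [s [fs sv]]] [mg [t [gt tw]]].
have snE := @seminorm_normr R E.
have ms (u : simple_fun mu E) : strongly_measurable mu normE (simple_eval u).
  exact/finite_valued_strongly_measurable/finite_valued_simple.
have key k : (`|simple_integral (s k) - simple_integral (t k)|%:E <=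
    \int[mu]_x `|f x - simple_eval (s k) x|%:E + \int[mu]_x `|f x - g x|%:E
    + \int[mu]_x `|g x - simple_eval (t k) x|%:E)%E.
  apply: le_trans (simple_integral_dist _ _) _.
  rewrite (_ : (\int[mu]_x `|f x - simple_eval (s k) x|%:E =
                \int[mu]_x `|simple_eval (s k) x - f x|%:E)%E); last first.
    by apply: eq_integral => x _; rewrite distrC.
  have H1 := integral_seminormD snE (strongly_measurableB snE (ms (s k)) mf)
    (strongly_measurableB snE mf mg).
  have H2 := integral_seminormD snE
    (strongly_measurableD snE (strongly_measurableB snE (ms (s k)) mf)
    (strongly_measurableB snE mf mg)) (strongly_measurableB snE mg (ms (t k))).
  apply: le_trans (leeD2r _ H1); apply: le_trans H2; rewrite le_eqVlt; apply/orP; left.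
  apply/eqP; apply: eq_integral => x _; congr (`|_|%:E).
  rewrite -[RHS]/((simple_eval (s k) x - f x) + (f x - g x) +
    (g x - simple_eval (t k) x)).
  by rewrite (addrA (_ - f x)) subrK (addrA (_ - g x)) subrK.
have lhs : `|simple_integral (s k) - simple_integral (t k)|%:E @[k --> \oo] -->
    `|v - w|%:E.
  by apply: cvg_EFin; [exact: nearW|apply: cvg_norm; exact: cvgB].
set c := (\int[mu]_x `|f x - g x|%:E)%E in key *.
have [->|cy] := eqVneq c +oo%E; first exact: leey.
have c0 : (0 <= c)%E by apply: integral_ge0 => x _; rewrite lee_fin.
have cfin : c \is a fin_num by rewrite ge0_fin_numE// ltey.
have rhs : (\int[mu]_x `|f x - simple_eval (s k) x|%:E + c
    + \int[mu]_x `|g x - simple_eval (t k) x|%:E)%E @[k --> \oo] --> (0 + c + 0)%E.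
  apply: cvgeD => //; first by rewrite add0e fin_num_adde_defr.
  by apply: cvgeD => //; exact: cvg_cst.
rewrite -(cvg_lim _ lhs)//; rewrite add0e adde0 in rhs; rewrite -(cvg_lim _ rhs)//.
by apply: lee_lim; [exact: cvgP lhs|exact: cvgP rhs|exact: nearW].
Qed.

End bochner.

(** * Dyadic grids *)

Section half_open_cubes.
Context {R : realType}.

Definition hcube {d} (b : 'I_d -> R) (l : R) : set (d.-tuple R) :=
  [set x | forall i, b i <= tnth x i < b i + l].

Lemma measurable_hcube d (b : 'I_d -> R) l : measurable (hcube b l).
Proof.
rewrite (_ : hcube b l = \bigcap_(i in [set: 'I_d])
    ((fun x : d.-tuple R => tnth x i) @^-1` `[b i, b i + l[%classic)).
  apply: fin_bigcap_measurable => // i _.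
  by rewrite -[X in measurable X]setTI; exact: measurable_tnth.
by apply/seteqP; split=> x /= H i; have := H i; rewrite /= in_itv/=; auto.
Qed.

Lemma lebesgue_hcube d (b : 'I_d -> R) l : 0 <= l ->
  lebesgue d (hcube b l) = (l ^+ d)%:E.
Proof.
move=> l0; elim: d b => [|d IH] b.
  by rewrite expr0 /= diracE mem_set// => -[].
rewrite /= /lebesgue_cons /pushforward.
rewrite (_ : _ @^-1` _ = `[b ord0, b ord0 + l[%classic `*`
    hcube (b \o lift ord0) l); last first.
  apply/seteqP; split=> -[x t] /=.
    move=> H; split=> [|i]; first by have := H ord0; rewrite !tnth0 in_itv.
    by have := H (lift ord0 i); rewrite !tnthS.
  move=> []; rewrite in_itv /= => Hx Ht i.
  by case: (unliftP ord0 i) => [j|] ->; rewrite ?tnthS ?tnth0//; exact: Ht.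
rewrite product_measure1E//; last exact: measurable_hcube.
rewrite IH exprS EFinM; congr (_ * _)%E.
rewrite [LHS](lebesgue_measure_itv `[b ord0, b ord0 + l[) /= lte_fin ltrDl.
by case: ltgtP l0 => [_ _||<-]//; rewrite -EFinB addrAC subrr add0r.
Qed.

Lemma lebesgue_cube d (a : d.-tuple R) l : 0 <= l ->
  lebesgue d (cube a l) = (l ^+ d)%:E.
Proof.
move=> l0; have := @lebesgue_box R d a [tuple tnth a i + l | i < d].
rewrite (_ : mkset _ = cube a l); last first.
  by apply/seteqP; split=> x H i; have := H i; rewrite tnth_mktuple.
move=> ->; last by move=> i; rewrite tnth_mktuple lerDl.
congr _%:E; under eq_bigr do rewrite tnth_mktuple addrAC subrr add0r.
by rewrite prodr_const card_ord.
Qed.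

Lemma measurable_cube d (a : d.-tuple R) l : measurable (cube a l).
Proof.
rewrite (_ : cube a l = \bigcap_(i in [set: 'I_d])
    ((fun x : d.-tuple R => tnth x i) @^-1` `[tnth a i, tnth a i + l]%classic)).
  apply: fin_bigcap_measurable => // i _.
  by rewrite -[X in measurable X]setTI; exact: measurable_tnth.
by apply/seteqP; split=> x /= H i; have := H i; rewrite /= in_itv/=; auto.
Qed.

Lemma hcube_sub_cube d (a : d.-tuple R) l : hcube (tnth a) l `<=` cube a l.
Proof. by move=> x H i; have /andP[-> /ltW] := H i. Qed.

Lemma cubeDhcube d (a : d.-tuple R) l : 0 <= l ->
  lebesgue d (cube a l `\` hcube (tnth a) l) = 0%E.
Proof.
move=> l0; rewrite measureD//; first last.
- by rewrite -[ltLHS]/(lebesgue d (cube a l)) lebesgue_cube// ltry.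
- exact: measurable_hcube.
- exact: measurable_cube.
rewrite (_ : cube a l `&` hcube (tnth a) l = hcube (tnth a) l); last first.
  by apply/setIidr; exact: hcube_sub_cube.
rewrite -[X in (X - _)%E]/(lebesgue d (cube a l)) -[X in (_ - X)%E]/(lebesgue d (hcube _ l)).
by rewrite lebesgue_cube// lebesgue_hcube// subee.
Qed.

End half_open_cubes.

(* Locked so that unification never unfolds a side length into a product. *)
HB.lock Definition side {R : realType} (L : R) (k : nat) : R := L / 2 ^+ k.

Section grid.
Context {R : realType} {d : nat} (a : 'I_d -> R) (L : R).
Hypothesis L0 : 0 < L.
Local Notation X := (d.-tuple R).

Definition gridix := {ffun 'I_d -> int}.

Local Notation side := (side L).

Definition corner (k : nat) (m : gridix) (i : 'I_d) : R := a i + side k * (m i)%:~R.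

(** Generations start at 0, at side [L], and have cells at all integer positions. There are no
    coarser cells, so chains of ancestors are finite. *)
Definition cell (c : nat * gridix) : set X := hcube (corner c.1 c.2) (side c.1).

Definition loc (k : nat) (x : X) : gridix :=
  [ffun i => Num.floor ((tnth x i - a i) / side k)].

Definition pt (c : nat * gridix) : X := [tuple corner c.1 c.2 i | i < d].

Lemma side_gt0 k : 0 < side k.
Proof. by rewrite side.unlock divr_gt0// exprn_gt0. Qed.
Local Hint Resolve side_gt0 : core.

Lemma side_ge0 k : 0 <= side k. Proof. exact: ltW. Qed.

Lemma side_half k j : side (k + j) * 2 ^+ j = side k.
Proof. by rewrite side.unlock exprD invfM mulrA divfK// lt0r_neq0// exprn_gt0. Qed.

Lemma side_anti k j : (k <= j)%N -> side j <= side k.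
Proof.
move=> kj; rewrite -(subnKC kj) -[leRHS](@side_half _ (j - k)).
by rewrite ler_peMr ?side_ge0// exprn_ege1// ler1n.
Qed.

Lemma cellP c x : cell c x <-> loc c.1 x = c.2.
Proof.
case: c => k m /=; rewrite /cell /hcube /=; split=> [H|<- i].
  apply/ffunP => i; rewrite ffunE; apply: floor_def; have /andP[H1 H2] := H i.
  rewrite ler_pdivlMr// ltr_pdivrMr// intrD; rewrite /corner in H1 H2.
  apply/andP; split; lra.
have := floor_itv ((tnth x i - a i) / side k).
rewrite ler_pdivlMr// ltr_pdivrMr// intrD /corner ffunE => /andP[H1 H2].
apply/andP; split; lra.
Qed.

Lemma cell_loc k x : cell (k, loc k x) x.
Proof. exact/cellP. Qed.

Lemma cell_pt c : cell c (pt c).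
Proof.
move=> i; rewrite tnth_mktuple lexx/= ltrDl//.
Qed.

Lemma loc_pt c : loc c.1 (pt c) = c.2.
Proof. exact/cellP/cell_pt. Qed.

Lemma measurable_cell c : measurable (cell c).
Proof. exact: measurable_hcube. Qed.

Lemma lebesgue_cell c : lebesgue d (cell c) = (side c.1 ^+ d)%:E.
Proof. by rewrite lebesgue_hcube// side_ge0. Qed.

Lemma loc_nested k j x y : (k <= j)%N -> loc j x = loc j y -> loc k x = loc k y.
Proof.
move=> kj /ffunP jxy; apply/ffunP => i; have := jxy i; rewrite !ffunE.
rewrite -{1 2}(subnKC kj) => H.
have e z : z / side (k + (j - k)) = z / side k * 2 ^+ (j - k).
  rewrite -(side_half k (j - k)); move: (side _) (side_gt0 (k + (j - k))) => s s0.
  by field; rewrite (gt_eqF s0) expf_neq0.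
rewrite !e in H; move: H; set u := _ / side k; set v := _ / side k => H.
clear -H; set p : int := 2 ^+ (j - k).
have p0 : (0 : R) < p%:~R by rewrite ltr0z exprn_gt0.
have pE : (2 ^+ (j - k) : R) = p%:~R by rewrite /p rmorphXn.
rewrite pE in H.
suff le (s t : R) : Num.floor (s * p%:~R) = Num.floor (t * p%:~R) ->
    Num.floor s <= Num.floor t.
  by apply/eqP; rewrite eq_le !le// H.
move=> st; rewrite floor_ge_int -(ler_pM2r p0) -intrM -floor_ge_int -st floor_ge_int.
by rewrite intrM ler_pM2r// floor_le.
Qed.

Lemma cell_nested c c' x : (c.1 <= c'.1)%N -> cell c x -> cell c' x ->
  cell c' `<=` cell c.
Proof.
move=> cc' /cellP cx /cellP c'x y /cellP c'y; apply/cellP.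
by rewrite -cx; apply: loc_nested cc' _; rewrite c'x.
Qed.

Definition nbr (t : R) (c : nat * gridix) : set X :=
  hcube (fun i => corner c.1 c.2 i - t * side c.1) ((1 + 2 * t) * side c.1).

Lemma measurable_nbr t c : measurable (nbr t c).
Proof. exact: measurable_hcube. Qed.

Lemma lebesgue_nbr t c : 0 <= t ->
  lebesgue d (nbr t c) = ((1 + 2 * t) ^+ d * side c.1 ^+ d)%:E.
Proof. by move=> t0; rewrite lebesgue_hcube ?exprMn// mulr_ge0// ?side_ge0//; lra. Qed.

Lemma sub_nbr t s c : t <= s -> nbr t c `<=` nbr s c.
Proof.
move=> ts x H i; have /andP[H1 H2] := H i; have := side_gt0 c.1.
by move: H1 H2; set e := side _; set z := corner _ _ _; set w := tnth _ _; nra.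
Qed.

Lemma nbr0 c : nbr 0 c = cell c.
Proof.
rewrite /nbr /cell mulr0 addr0 mul1r; congr (hcube _ _).
by apply/funext => i; rewrite mul0r subr0.
Qed.

Lemma cell_sub_nbr t c : 0 <= t -> cell c `<=` nbr t c.
Proof. by move=> t0; rewrite -nbr0; exact: sub_nbr. Qed.

(** It suffices to know where the lower corner of the smaller cell lies, because both corners are on
    the lattice of the smaller side. *)
Lemma cell_corner c c' : cell c' `<=` cell c -> (c.1 <= c'.1)%N -> forall i,
  corner c.1 c.2 i <= corner c'.1 c'.2 i /\
  corner c'.1 c'.2 i + side c'.1 <= corner c.1 c.2 i + side c.1.
Proof.
move=> sub cc' i; have := sub _ (cell_pt c') => /(_ i).
rewrite tnth_mktuple => /andP[H1 H2]; split=> //.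
set j := (c'.1 - c.1)%N; have E := side_half c.1 j.
rewrite subnKC// in E; move: H1 H2; rewrite /corner -E.
move: (side c'.1) (side_gt0 c'.1) => s s0.
have -> : (2 ^+ j : R) = (2 ^+ j : int)%:~R by rewrite rmorphXn.
set p := (2 ^+ j); rewrite -!mulrA -!intrM => H1 H2.
have : (c'.2 i)%:~R < (p * c.2 i + p)%:~R :> R.
  rewrite intrD -(ltr_pM2l s0) mulrDr; lra.
rewrite ltr_int -lezD1 -(ler_int R) -(ler_pM2l s0) !intrD !mulrDr; lra.
Qed.

Lemma nbr_sub t c c' : 0 <= t -> cell c' `<=` cell c -> (c.1 <= c'.1)%N ->
  nbr t c' `<=` nbr t c.
Proof.
move=> t0 sub cc' x H i; have /andP[H1 H2] := H i.
have [K1 K2] := cell_corner sub cc' i; have := side_anti cc'.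
move: H1 H2 K1 K2; set z := corner _ _ _; set z' := corner _ _ _.
set s := side _; set s' := side _; set w := tnth _ _; nra.
Qed.
End grid.

Lemma bigcup_countType_measurable {disp : measure_display} {X : measurableType disp}
    (I : countType) (S : set I) (A : I -> set X) :
  (forall i, measurable (A i)) -> measurable (\bigcup_(i in S) A i).
Proof.
move=> mA; rewrite bigcup_mkcond; apply: countable_bigcupT_measurable.
  exact: countableP.
by move=> i; case: ifP.
Qed.

Section countable_sums.
Context {disp : measure_display} {X : measurableType disp} {R : realType}.
Variable mu : {measure set X -> \bar R}.
Local Open Scope ereal_scope.

Let nat_family (I : countType) (S : set I) (A : I -> set X) (n : nat) : set X :=
  if @pickle_inv I n is Some i then (if i \in S then A i else set0) else set0.

Let nat_familyE I S A : \bigcup_(i in S) A i = \bigcup_n @nat_family I S A n.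
Proof.
apply/seteqP; split=> x.
  move=> [i Si Ax]; exists (choice.pickle i) => //.
  by rewrite /nat_family pickleK_inv mem_set.
move=> [n _]; rewrite /nat_family; case: pickle_inv => // i.
by case: ifPn => // /set_mem Si Ax; exists i.
Qed.

(** Only the [A i] are disjoint. The [B i] may overlap; [seqDU] makes them disjoint and only shrinks
    their integrals. *)
Lemma le_integral_bigcup (I : countType) (S : set I) (A B : I -> set X)
    (phi psi : X -> \bar R) :
  (forall i, measurable (A i)) -> (forall i, measurable (B i)) ->
  measurable_fun setT phi -> measurable_fun setT psi ->
  (forall x, 0 <= phi x) -> (forall x, 0 <= psi x) ->
  trivIset S A ->
  (forall i, S i -> \int[mu]_(x in B i) psi x <= \int[mu]_(x in A i) phi x) ->
  \int[mu]_(x in \bigcup_(i in S) B i) psi x <=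
  \int[mu]_(x in \bigcup_(i in S) A i) phi x.
Proof.
move=> mA mB mphi mpsi phi0 psi0 tA BA.
have mfam C : (forall i, measurable (C i)) -> forall n, measurable (@nat_family I S C n).
  by move=> mC n; rewrite /nat_family; case: pickle_inv => // i; case: ifPn.
rewrite (nat_familyE S A) (nat_familyE S B) [leRHS]ge0_integral_bigcup//; first last.
- apply/trivIsetP => m n _ _ mn; rewrite /nat_family.
  case Em: (@pickle_inv I m) => [i|]; last by rewrite set0I.
  case En: (@pickle_inv I n) => [j|]; last by rewrite setI0.
  case: ifPn => [/set_mem Si|_]; last by rewrite set0I.
  case: ifPn => [/set_mem Sj|_]; last by rewrite setI0.
  apply: contrapT => /eqP/set0P AA.
  have ij := tA _ _ Si Sj AA; move/eqP: mn; apply.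
  have := @pickle_invK I m; have := @pickle_invK I n.
  by rewrite Em En /= => <- <-; rewrite ij.
- exact: measurable_funTS.
- exact: mfam.
rewrite seqDU_bigcup_eq ge0_integral_bigcup//; first last.
- exact: measurable_funTS.
- by move=> n; apply: seqDU_measurable => *; exact: mfam.
apply: lee_nneseries => n _ ; first by move=> _; exact: integral_ge0.
apply: (@le_trans _ _ (\int[mu]_(x in nat_family S B n) psi x)).
  apply: ge0_subset_integral => //.
  - by apply: seqDU_measurable => *; exact: mfam.
  - exact: mfam.
  - exact: measurable_funTS.
  - exact: subset_seqDU.
rewrite /nat_family; case: pickle_inv => [i|]; last by rewrite !integral_set0.
by case: ifPn => [/set_mem/BA//|_]; rewrite !integral_set0.
Qed.

Lemma le_measure_bigcup (I : countType) (S : set I) (A B : I -> set X)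
    (phi : X -> \bar R) :
  (forall i, measurable (A i)) -> (forall i, measurable (B i)) ->
  measurable_fun setT phi -> (forall x, 0 <= phi x) ->
  trivIset S A ->
  (forall i, S i -> mu (B i) <= \int[mu]_(x in A i) phi x) ->
  mu (\bigcup_(i in S) B i) <= \int[mu]_(x in \bigcup_(i in S) A i) phi x.
Proof.
move=> mA mB mphi phi0 tA BA.
have mUB : measurable (\bigcup_(i in S) B i) by exact: bigcup_countType_measurable.
rewrite -[leLHS]mul1e -integral_cst//.
apply: le_integral_bigcup => //.
by move=> i Si; rewrite integral_cst// mul1e BA.
Qed.

Lemma integral_fin_cover (I : finType) (A : set X) (B : I -> set X) (phi : X -> \bar R) :
  measurable A -> (forall i, measurable (B i)) ->
  measurable_fun setT phi -> (forall x, 0 <= phi x) ->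
  (forall x, A x -> exists i, B i x) ->
  \int[mu]_(x in A) phi x <= \sum_(i : I) \int[mu]_(x in B i) phi x.
Proof.
move=> mA mB mphi phi0 AB; rewrite integral_mkcond.
under eq_bigr do rewrite integral_mkcond.
have m0 C : measurable C -> measurable_fun setT (phi \_ C).
  by move=> mC; apply/(measurable_restrictT _ mC); exact: measurable_funTS.
have p0 C x : 0 <= (phi \_ C) x by apply: erestrict_ge0.
rewrite -ge0_integral_sum//; last by move=> i; exact: m0.
apply: ge0_le_integral => //.
- exact: m0.
- by apply: emeasurable_sum => i; exact: m0.
move=> x _; rewrite {1}patchE; case: ifPn => [/set_mem/AB[i Bix]|_].
  rewrite (bigD1 i)//= patchE mem_set// leeDl// sume_ge0//.
by rewrite sume_ge0.
Qed.

End countable_sums.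

(** * Maximal cells and the weak type bound for averages over dilates *)

Section maximal_cells.
Context {R : realType} {d : nat} (a : 'I_d -> R) (L : R).
Hypothesis L0 : 0 < L.
Local Notation X := (d.-tuple R).
Local Notation mu := (lebesgue d).
Local Notation cell := (cell a L).
Local Notation loc := (loc a L).
Local Notation nbr := (nbr a L).
Local Notation cellix := (nat * @gridix d)%type.
Implicit Types c : cellix.

(** The ancestor of generation [k], located through the lower corner of [c]; meaningful for
    [k <= c.1]. *)
Definition anc (k : nat) (c : cellix) : cellix := (k, loc k (pt a L c)).

Lemma cellE c x : cell c x -> c = (c.1, loc c.1 x).
Proof. by move/(cellP _ L0) => ->; case: c. Qed.

Lemma ancE k c x : (k <= c.1)%N -> cell c x -> anc k c = (k, loc k x).
Proof.
move=> kc /(cellP _ L0) cx; congr (_, _); apply: (loc_nested L0 kc).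
by rewrite cx loc_pt.
Qed.

Lemma anc_cell k c x : (k <= c.1)%N -> cell c x -> cell (anc k c) x.
Proof. by move=> kc cx; rewrite (ancE kc cx); exact: cell_loc. Qed.

Lemma cell_anc_sub k c : (k <= c.1)%N -> cell c `<=` cell (anc k c).
Proof. by move=> kc x; exact: anc_cell. Qed.

Lemma cell_sub c c' x : (c.1 <= c'.1)%N -> cell c x -> cell c' x -> cell c' `<=` cell c.
Proof. exact: cell_nested. Qed.

Definition maxcells (q : set cellix) : set cellix :=
  [set c | q c /\ forall k, (k < c.1)%N -> ~ q (anc k c)].

Lemma maxcells_eq q c c' x :
  maxcells q c -> maxcells q c' -> cell c x -> cell c' x -> c = c'.
Proof.
wlog cc' : c c' / (c.1 <= c'.1)%N.
  move=> H; case: (leqP c.1 c'.1) => [|/ltnW] cc' qc qc' cx c'x; first exact: H.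
  by apply/esym; apply: H.
move=> [qc _] [_ qc'] cx c'x.
have E : anc c.1 c' = c by rewrite (ancE cc' c'x) [RHS](cellE cx).
move: cc'; rewrite leq_eqVlt => /predU1P[cc'|cc'].
  by rewrite (cellE cx) (cellE c'x) cc'.
by have := qc' _ cc'; rewrite E.
Qed.

Lemma trivIset_maxcells q : trivIset (maxcells q) cell.
Proof. by move=> c c' qc qc' [x [cx c'x]]; exact: maxcells_eq qc qc' cx c'x. Qed.

(** Among the finitely many generations up to that of [c], the smallest whose ancestor is in [q]
    gives the maximal cell. *)
Lemma maxcells_cover q c : q c -> exists c', [/\ maxcells q c', (c'.1 <= c.1)%N &
  cell c `<=` cell c'].
Proof.
move=> qc; pose P k := `[< (k <= c.1)%N /\ q (anc k c) >].
have ancc : anc c.1 c = c.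
  by rewrite (ancE (leqnn _) (cell_pt a L0 c)) -(cellE (cell_pt a L0 c)).
have exP : exists k, P k by exists c.1; apply/asboolP; split => //; rewrite ancc.
pose k := ex_minn exP.
have : P k /\ forall j, P j -> (k <= j)%N by rewrite /k; case: ex_minnP.
move=> [/asboolP[kc qk] kmin].
exists (anc k c); split => //; last exact: cell_anc_sub.
split=> // j /= jk; rewrite [in X in _ X]/anc -/(anc _ _) => qj.
suff : (k <= j)%N by rewrite leqNgt jk.
apply: kmin; apply/asboolP; split; first exact: leq_trans (ltnW jk) kc.
have := @ancE j (anc k c) _ (ltnW jk) (anc_cell kc (cell_pt a L0 c)).
rewrite {1}/anc /= -/(anc j _) => E; move: qj; rewrite E.
by rewrite (ancE (leq_trans (ltnW jk) kc) (cell_pt a L0 c)).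
Qed.

Lemma bigcup_maxcells q : \bigcup_(c in maxcells q) cell c = \bigcup_(c in q) cell c.
Proof.
apply/seteqP; split=> x [c qc cx]; first by exists c => //; case: qc.
by have [c' [qc' _ /(_ _ cx) c'x]] := maxcells_cover qc; exists c'.
Qed.

Lemma measurable_cells (q : set cellix) : measurable (\bigcup_(c in q) cell c).
Proof. by apply: bigcup_countType_measurable => c; exact: measurable_cell. Qed.

(** The entry [e i], between 0 and [2 * t], stands for the shift [e i - t]: the translates of a cell
    that fill its [t]-dilate are indexed by a finite type. *)
Definition shiftix (t : nat) (e : {ffun 'I_d -> 'I_(t + t).+1}) (m : @gridix d) : @gridix d :=
  [ffun i => m i + (e i)%:Z - t%:Z].

Lemma nbr_cover t c x : nbr t%:R c x ->
  exists e : {ffun 'I_d -> 'I_(t + t).+1}, cell (c.1, shiftix e c.2) x.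
Proof.
move=> cx; pose k (i : 'I_d) := loc c.1 x i - c.2 i + t%:Z.
have kP i : 0 <= k i < ((t + t).+1)%:Z.
  have /andP[H1 H2] := cx i; have s0 := side_gt0 L0 c.1.
  rewrite /k ffunE; set z := (tnth x i - a i) / side L c.1.
  have E : tnth x i = a i + z * side L c.1 by rewrite /z divfK ?gt_eqF//; ring.
  move: H1 H2; rewrite /corner E => {E}; move: z => z H1 H2.
  have z1 : (c.2 i)%:~R - t%:R <= z :> R.
    by rewrite -(ler_pM2r s0); nra.
  have z2 : z < (c.2 i)%:~R + t%:R + 1 :> R.
    by rewrite -(ltr_pM2r s0); nra.
  have f1 : c.2 i - t%:Z <= Num.floor z by rewrite floor_ge_int intrB.
  have f2 : Num.floor z < c.2 i + t%:Z + 1 by rewrite floor_lt_int !intrD.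
  lia.
have kabs i : (`|k i|%N < (t + t).+1)%N by have := kP i; lia.
exists [ffun i => Ordinal (kabs i)]; apply/(cellP _ L0) => /=.
apply/ffunP => i; rewrite [RHS]ffunE [X in nat_of_ord X]ffunE /= gez0_abs; last first.
  by case/andP: (kP i).
by rewrite /k; lia.
Qed.

Lemma sub_nbr_shift t c (e : {ffun 'I_d -> 'I_(t + t).+1}) :
  cell c `<=` nbr t%:R (c.1, shiftix e c.2).
Proof.
move=> x cx i; have /andP[H1 H2] := cx i; rewrite /= /corner ffunE.
have s0 := side_gt0 L0 c.1; have := ltn_ord (e i); rewrite ltnS => eit.
have e1 : 0 <= (e i)%:R :> R by [].
have e2 : (e i)%:R <= t%:R + t%:R :> R by rewrite -natrD ler_nat.
move: H1 H2; rewrite /corner !intrD mulrNz -!pmulrn.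
move: (side L c.1) s0 (tnth x i) => s s0 w H1 H2; nra.
Qed.

(** If the mass of a dilate is large, then by pigeonhole one of its [(1 + 2t)^d] translated cells
    has average above [l]. Maximal cells with this property are disjoint, so their measures add up
    to at most the integral over [l], and the original cell lies in the dilate of one of them. *)
Lemma weak_type_maximal (t : nat) (phi : X -> \bar R) (l : R) :
  0 < l -> measurable_fun setT phi -> (forall x, 0 <= phi x)%E ->
  (mu (\bigcup_(c in [set c | ((1 + 2 * t%:R) ^+ d * l)%:E * mu (cell c) <
        \int[mu]_(x in nbr t%:R c) phi x]) cell c)
  <= ((1 + 2 * t%:R) ^+ d / l)%:E * \int[mu]_x phi x)%E.
Proof.
move=> l0 mphi phi0; set K := (1 + 2 * t%:R) ^+ d.
have K0 : 0 < K by rewrite exprn_gt0// ltr_pwDl// mulr_ge0.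
pose q : set cellix := [set c | (l%:E * mu (cell c) < \int[mu]_(x in cell c) phi x)%E].
have mphi' : measurable_fun setT (fun x => (K / l)%:E * phi x)%E.
  by apply: emeasurable_funM => //; exact: measurable_cst.
have Kl0 : 0 <= K / l by rewrite divr_ge0 ?ltW.
apply: (@le_trans _ _ (mu (\bigcup_(c in maxcells q) nbr t%:R c))).
  apply: le_mu.
  - exact: measurable_cells.
  - by apply: bigcup_countType_measurable => c; exact: measurable_nbr.
  move=> x [c /= Hc cx].
  have [e He] : exists e : {ffun 'I_d -> 'I_(t + t).+1}, q (c.1, shiftix e c.2).
    apply: contrapT => nq; move: Hc; rewrite ltNge => /negP; apply.
    apply: le_trans (@integral_fin_cover _ _ _ mu {ffun 'I_d -> 'I_(t + t).+1} _
      (fun e => cell (c.1, shiftix e c.2)) _ _ _ mphi phi0 _) _.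
    - exact: measurable_nbr.
    - by move=> e; exact: measurable_cell.
    - by move=> y; exact: nbr_cover.
    apply: (@le_trans _ _ (\sum_(e : {ffun 'I_d -> 'I_(t + t).+1}) l%:E * mu (cell c))%E).
      apply: lee_sum => e _; rewrite leNgt; apply/negP => qe; apply: nq; exists e.
      by move: qe; rewrite /q /= !lebesgue_cell.
    rewrite lebesgue_cell// -EFinM sumEFin sumr_const lee_fin card_ffun !card_ord.
    rewrite -[_ *+ _]mulr_natl mulrA ler_wpM2r ?exprn_ge0 ?side_ge0// (ler_wpM2r (ltW l0))//.
    rewrite natrX /K lerXn2r ?nnegrE ?addr_ge0 ?mulr_ge0//.
    by rewrite -addn1 !natrD; lra.
  have [c' [qc' cc' sub]] := maxcells_cover He.
  exists c' => //; apply: (nbr_sub L0 (ler0n _ t) sub cc').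
  exact: (sub_nbr_shift e cx).
apply: (@le_trans _ _ (\int[mu]_(x in \bigcup_(c in maxcells q) cell c) ((K / l)%:E * phi x))%E).
  apply: le_measure_bigcup => //.
  - by move=> c; exact: measurable_cell.
  - by move=> c; exact: measurable_nbr.
  - by move=> x; rewrite mule_ge0.
  - exact: trivIset_maxcells.
  move=> c [qc _]; rewrite ge0_integralZl//; first last.
  - exact: measurable_funTS.
  - exact: measurable_cell.
  rewrite [leLHS](lebesgue_nbr a L0)// EFinM -/K -(lebesgue_cell a L0).
  apply: (@le_trans _ _ ((K / l)%:E * (l%:E * mu (cell c)))%E).
    by rewrite muleA -EFinM divfK// gt_eqF.
  by apply: lee_wpmul2l; [rewrite lee_fin|exact: ltW].
apply: (@le_trans _ _ (\int[mu]_x ((K / l)%:E * phi x))%E).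
  apply: ge0_subset_integral => //; first exact: measurable_cells.
  by move=> x _; rewrite mule_ge0.
by rewrite ge0_integralZl.
Qed.

End maximal_cells.

(** * Density of measurable sets in cells *)

Section cell_density.
Context {R : realType} {d : nat} (a : 'I_d -> R) (L : R).
Hypothesis L0 : 0 < L.
Local Notation X := (d.-tuple R).
Local Notation mu := (lebesgue d).
Local Notation cell := (cell a L).
Local Notation loc := (loc a L).
Local Notation cellix := (nat * @gridix d)%type.
Variable q0 : cellix.

Definition saturated (N : nat) (P : set (@gridix d)) : set X := [set x | P (loc N x)].

Lemma saturatedE N P : saturated N P = \bigcup_(c in [set c | c.1 = N /\ P c.2]) cell c.
Proof.
apply/seteqP; split=> x /=; first by move=> Px; exists (N, loc N x) => //; exact: cell_loc.
by move=> [[k m]/= [-> Pm]] /(cellP _ L0)/= E; rewrite /saturated /= E.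
Qed.

Lemma measurable_saturated N P : measurable (saturated N P).
Proof. by rewrite saturatedE; exact: measurable_cells. Qed.

Lemma saturated_refine N N' P : (N <= N')%N -> exists P', saturated N P = saturated N' P'.
Proof.
move=> NN'; exists [set m | P (loc N (pt a L (N', m)))].
apply/seteqP; split=> x /=; rewrite /saturated /= => H.
  suff -> : loc N (pt a L (N', loc N' x)) = loc N x by [].
  by apply: (loc_nested L0 NN'); rewrite (loc_pt a L0 (N', loc N' x)).
suff <- : loc N (pt a L (N', loc N' x)) = loc N x by [].
by apply: (loc_nested L0 NN'); rewrite (loc_pt a L0 (N', loc N' x)).
Qed.

Definition sdiff (A B : set X) : set X := (A `\` B) `|` (B `\` A).

Lemma measurable_sdiff A B : measurable A -> measurable B -> measurable (sdiff A B).
Proof. by move=> mA mB; apply: measurableU; exact: measurableD. Qed.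

(** Within [q0], the set is a union of cells of one generation up to small measure. Such sets form a
    sigma-algebra containing the coordinate rays, hence all measurable sets. *)
Definition cell_approximable (A : set X) := measurable A /\
  forall e : R, 0 < e -> exists N P, (q0.1 <= N)%N /\
    (mu (cell q0 `&` sdiff A (saturated N P)) <= e%:E)%E.

Let mq0 : measurable (cell q0). Proof. exact: measurable_cell. Qed.

Lemma approximable_saturated N P : cell_approximable (saturated N P).
Proof.
split=> [|e e0]; first exact: measurable_saturated.
have [P' ->] := saturated_refine P (leq_maxl N q0.1).
exists (maxn N q0.1), P'; split; first exact: leq_maxr.
by rewrite /sdiff setDv setU0 setI0 measure0 lee_fin ltW.
Qed.

Lemma approximableC A : cell_approximable A -> cell_approximable (~` A).
Proof.
move=> [mA HA]; split; first exact: measurableC.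
move=> e /HA[N [P [q0N H]]]; exists N, (~` P); split=> //.
suff -> : sdiff (~` A) (saturated N (~` P)) = sdiff A (saturated N P) by [].
apply/seteqP; split=> x; rewrite /sdiff/saturated/=;
  case: (pselect (A x)); case: (pselect (P (loc N x))); tauto.
Qed.

Lemma approximableU A B : cell_approximable A -> cell_approximable B ->
  cell_approximable (A `|` B).
Proof.
move=> [mA HA] [mB HB]; split; first exact: measurableU.
move=> e e0; have e20 : 0 < e / 2 by rewrite divr_gt0.
have [N [P [q0N H]]] := HA _ e20; have [N' [P' [_ H']]] := HB _ e20.
have [Q HQ] := saturated_refine P (leq_maxl N N').
have [Q' HQ'] := saturated_refine P' (leq_maxr N N').
exists (maxn N N'), (Q `|` Q'); split; first exact: leq_trans q0N (leq_maxl _ _).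
apply: (@le_trans _ _ (mu ((cell q0 `&` sdiff A (saturated N P)) `|`
   (cell q0 `&` sdiff B (saturated N' P'))))).
  apply: le_mu.
  - apply: measurableI => //; apply: measurable_sdiff; first exact: measurableU.
    exact: measurable_saturated.
  - by apply: measurableU; apply: measurableI => //; apply: measurable_sdiff => //;
      exact: measurable_saturated.
  rewrite HQ HQ' => x; rewrite /sdiff /saturated /=; tauto.
apply: le_trans (measureU2 _ _ _) _.
- by apply: measurableI => //; apply: measurable_sdiff => //; exact: measurable_saturated.
- by apply: measurableI => //; apply: measurable_sdiff => //; exact: measurable_saturated.
by rewrite (splitr e) EFinD leeD.
Qed.

Lemma approximable_bigcup (F : nat -> set X) :
  (forall n, cell_approximable (F n)) -> cell_approximable (\bigcup_n F n).
Proof.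
move=> aF.
have mF n : measurable (F n) by case: (aF n).
have mUF : measurable (\bigcup_n F n) by exact: bigcupT_measurable.
have aU n : cell_approximable (\big[setU/set0]_(i < n) F i).
  elim: n => [|n IH]; last by rewrite big_ord_recr; exact: approximableU.
  by rewrite big_ord0; have := approximable_saturated 0 set0.
split=> // e e0; have e20 : 0 < e / 2 by rewrite divr_gt0.
pose G n := cell q0 `&` (\bigcup_n F n `\` \big[setU/set0]_(i < n) F i).
have mG n : measurable (G n).
  by apply: measurableI => //; apply: measurableD => //; case: (aU n).
have G0 : mu (G n) @[n --> \oo] --> 0%E.
  rewrite -(measure0 mu) (_ : set0 = \bigcap_n G n).
    apply: nonincreasing_cvg_mu => //.
    - apply: (@le_lt_trans _ _ (mu (cell q0))).
        by apply: le_mu => //; exact: subIsetl.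
      by rewrite [ltLHS](lebesgue_cell a L0) ltry.
    - exact: bigcapT_measurable.
    - move=> m n mn; apply/subsetPset => x [q0x [Fx nx]]; split=> //; split=> //.
      by move=> H; apply: nx; exact: subset_bigsetU H.
  apply/esym/seteqP; split=> // x H; have [q0x [[n _ Fnx] _]] := H 0%N Logic.I.
  have [_ [_]] := H n.+1 Logic.I; apply.
  by rewrite -bigcup_mkord; exists n => /=.
have /fine_cvgP[fin /cvgrPdist_le /(_ _ e20) small] := G0.
have [n _ /(_ n (leqnn n)) [/= finn]] := filterI fin small.
rewrite sub0r normrN ger0_norm ?fine_ge0// -lee_fin fineK// => smalln.
have [_ /(_ _ e20)[N [P [q0N H]]]] := aU n.
exists N, P; split=> //.
apply: (@le_trans _ _ (mu (G n `|`
   (cell q0 `&` sdiff (\big[setU/set0]_(i < n) F i) (saturated N P))))).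
  apply: le_mu.
  - by apply: measurableI => //; apply: measurable_sdiff => //; exact: measurable_saturated.
  - apply: measurableU => //; apply: measurableI => //; apply: measurable_sdiff.
      by case: (aU n).
    exact: measurable_saturated.
  have sub : \big[setU/set0]_(i < n) F i `<=` \bigcup_n F n.
    by rewrite -bigcup_mkord => x [i _ Fx]; exists i.
  move=> x; have := sub x; rewrite /sdiff /G /=.
  by case: (pselect ((\big[setU/set0]_(i < n) F i) x)); tauto.
apply: le_trans (measureU2 _ _ _) _ => //.
- apply: measurableI => //; apply: measurable_sdiff; first by case: (aU n).
  exact: measurable_saturated.
by rewrite (splitr e) EFinD leeD.
Qed.

Lemma side_small (e : R) : 0 < e -> exists N, side L N < e.
Proof.
rewrite side.unlock => e0; have : L / 2 ^+ n @[n --> \oo] --> L * 0.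
  apply: cvgMr; rewrite (_ : (fun _ => _) = (fun n => 2^-1 ^+ n)).
    by apply: cvg_expr; rewrite gtr0_norm ?invf_lt1 ?ltr1n.
  by apply/funext => n; rewrite exprVn.
rewrite mulr0 => /cvgrPdist_lt /(_ _ e0) [N _ /(_ N (leqnn N))].
rewrite sub0r normrN => /(le_lt_trans (ler_norm _)) ?; by exists N.
Qed.

Lemma approximable_ray (i : 'I_d) (t : R) :
  cell_approximable [set x | tnth x i < t].
Proof.
pose P N : set (@gridix d) := [set m | corner a L N m i + side L N <= t].
rewrite (_ : mkset _ = \bigcup_N saturated N (P N)).
  by apply: approximable_bigcup => N; exact: approximable_saturated.
apply/seteqP; split=> x /=.
  rewrite -subr_gt0 => xt; have [N HN] := side_small xt.
  exists N => //; rewrite /saturated /P /=.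
  by have /andP[H1 _] := cell_loc a L0 N x i; rewrite /= in H1; lra.
move=> [N _]; rewrite /saturated /P /=; apply: lt_le_trans.
by have /andP[_] := cell_loc a L0 N x i.
Qed.

Lemma measurable_approximable (A : set X) : measurable A -> cell_approximable A.
Proof.
have D0 : cell_approximable set0 by have := approximable_saturated 0 set0.
have sD : sigma_algebra setT cell_approximable.
  split => //; last exact: approximable_bigcup.
  by move=> B; rewrite setTD; exact: approximableC.
apply: smallest_sub => //.
elim/big_ind : _ => [//|F G sF sG B [/sF|/sG]//|i _ B [C mC <-]]; rewrite setTI.
move: mC; rewrite -[measurable C]/((@ocitv R).-sigma.-measurable C) RGenInftyO.measurableE.
apply: (@smallest_sub _ _ _ [set C | cell_approximable ((fun x : X => tnth x i) @^-1` C)]).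
  split => /=; first by rewrite preimage_set0.
    by move=> D; rewrite setTD preimage_setC; exact: approximableC.
  by move=> F aF; rewrite preimage_bigcup; exact: approximable_bigcup.
move=> _ [t ->] /=; have := approximable_ray i t; congr (cell_approximable _).
Qed.

(** This does the work of the Lebesgue density theorem: a set that never fills more than the
    proportion [th] of a cell is approximated by unions of cells and so has measure at most [th]
    times its own. *)
Lemma cell_density (G : set X) (th : R) : measurable G -> 0 <= th < 1 ->
  (forall c, (q0.1 <= c.1)%N -> cell c `<=` cell q0 ->
    (mu (G `&` cell c) <= th%:E * mu (cell c))%E) ->
  mu (G `&` cell q0) = 0%E.
Proof.
move=> mG /andP[th0 th1] H.
have mGq : measurable (G `&` cell q0) by exact: measurableI.
have fin A : measurable A -> mu (A `&` cell q0) \is a fin_num.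
  move=> mA; rewrite ge0_fin_numE//; apply: (@le_lt_trans _ _ (mu (cell q0))).
    by apply: le_mu => //; exact: measurableI.
  by rewrite [ltLHS](lebesgue_cell a L0) ltry.
set m := mu (G `&` cell q0).
have mfin : m \is a fin_num by exact: fin.
(* The error [e] comes from approximating [G] by cells of one generation. Letting it tend to 0 gives
   [m <= th * m], so [m] vanishes. *)
suff key (e : R) : 0 < e -> (m <= th%:E * (m + e%:E) + e%:E)%E.
  have m0 : (0 <= m)%E by exact: measure_ge0.
  move: m0 key; case: m mfin => [m| |]// _ m0 key.
  rewrite lee_fin in m0.
  have : m <= th * m.
    apply/ler_addgt0Pr => e e0.
    have e20 : 0 < e / 2 by rewrite divr_gt0.
    have : (m%:E <= (th * (m + e / 2) + e / 2)%:E)%E by exact: key.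
    by rewrite lee_fin => /le_trans; apply; nra.
  by move=> mth; congr _%:E; nra.
move=> e0; have [_ /(_ _ e0)[N [P [q0N HP]]]] := measurable_approximable mG.
pose S := [set c : cellix | [/\ c.1 = N, P c.2 & cell c `<=` cell q0]].
have US : \bigcup_(c in S) cell c = saturated N P `&` cell q0.
  apply/seteqP; split=> x.
    move=> [[k n] [/= -> Pn sub] cx]; split; last exact: sub.
    by rewrite /saturated /=; have /(cellP _ L0)/= -> := cx.
  move=> [Px q0x]; exists (N, loc N x); last exact: cell_loc.
  split => //; apply: (cell_sub (c' := (N, loc N x)) L0 q0N q0x); exact: cell_loc.
have tS : trivIset S cell.
  by move=> [k n] [k' n'] [/= -> _ _] [/= -> _ _] [x [/(cellP _ L0)/= <- /(cellP _ L0)/= <-]].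
have H1 : (mu (G `&` (saturated N P `&` cell q0)) <= th%:E * mu (saturated N P `&` cell q0))%E.
  rewrite -US setI_bigcupr.
  apply: le_trans (le_measure_bigcup (A := cell) (B := fun c => G `&` cell c) (phi := cst th%:E) _ _ _ _ tS _) _.
  - by move=> c; exact: measurable_cell.
  - by move=> c; apply: measurableI => //; exact: measurable_cell.
  - exact: measurable_cst.
  - by move=> x; rewrite lee_fin.
  - move=> c [/= cN _ sub]; rewrite integral_cst; last exact: measurable_cell.
    by apply: H => //; rewrite cN.
  by rewrite integral_cst//; exact: measurable_cells.
have ms := measurable_saturated N P.
have H2 : (m <= mu (G `&` (saturated N P `&` cell q0)) + e%:E)%E.
  apply: le_trans (leeD2l _ HP).
  apply: le_trans (measureU2 _ _ _).
  - apply: le_mu => //.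
      apply: measurableU; apply: measurableI => //; first exact: measurableI.
      exact: measurable_sdiff.
    by move=> x; rewrite /sdiff /=; case: (pselect (saturated N P x)); tauto.
  - by apply: measurableI => //; exact: measurableI.
  - by apply: measurableI => //; exact: measurable_sdiff.
apply: le_trans H2 _; apply: leeD2r; apply: le_trans H1 _.
apply: lee_wpmul2l; first by rewrite lee_fin.
apply: le_trans (leeD2l _ HP).
apply: le_trans (measureU2 _ _ _).
- apply: le_mu => //; first exact: measurableI.
    apply: measurableU => //; apply: measurableI => //.
    exact: measurable_sdiff.
  by move=> x; rewrite /sdiff /=; case: (pselect (G x)); tauto.
- exact: mGq.
- by apply: measurableI => //; exact: measurable_sdiff.
Qed.

End cell_density.

(** * Bochner integrals of step functions *)

Section bochner_finite_valued.
Context {disp : measure_display} {X : measurableType disp} {R : realType}.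
Variable mu : {measure set X -> \bar R}.

Lemma finite_valued_bochner (E : normedModType R) (I : finType) (j : X -> I) (v : I -> E) :
  (forall i, measurable (j @^-1` [set i])) ->
  (forall i, v i <> 0 -> (mu (j @^-1` [set i]) < +oo)%E) ->
  bochner_integral_is mu (v \o j) (\sum_i fine (mu (j @^-1` [set i])) *: v i).
Proof.
move=> mj foo; have fv : finite_valued mu (v \o j) by exists I, j, v.
split; first exact/finite_valued_strongly_measurable/fv/seminorm_normr.
pose A k : set X := if insub k is Some i then
  (if `[< v (@enum_val I predT i) = 0 >] then set0
   else j @^-1` [set @enum_val I predT i]) else set0.
pose w k : E := if insub k is Some i then v (@enum_val I predT i) else 0.
have mA k : measurable (A k).
  by rewrite /A; case: insub => // i; case: ifPn.
have fA k : (mu (A k) < +oo)%E.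
  rewrite /A; case: insub => [i|]; last by rewrite measure0.
  by case: ifPn => [_|/asboolPn/foo//]; rewrite measure0.
pose s := @SimpleFun _ _ _ mu E #|I| A w mA fA.
have sE : v \o j = simple_eval s.
  apply/funext => x.
  rewrite /simple_eval /= (bigD1 (enum_rank (j x)))//= big1 ?addr0; last first.
    move=> i ij; rewrite /A /w !insubT// => ltiI; set k := Sub _ _.
    have -> : k = i by exact/val_inj.
    rewrite indicE; case: ifPn => [/asboolP->|_]; first by rewrite scaler0.
    rewrite memNset ?scale0r//= => jx; move/negP: ij; apply; apply/eqP.
    by rewrite jx enum_valK.
  rewrite /A /w !insubT//= => lt; set k := Sub _ _.
  have -> : k = enum_rank (j x) by exact/val_inj.
  rewrite enum_rankK indicE; case: ifPn => [/asboolP->|_].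
    by rewrite scaler0.
  by rewrite mem_set//= scale1r.
exists (fun=> s); split.
  rewrite (_ : (fun _ => _) = fun=> 0%E); first exact: cvg_cst.
  apply/funext => _; apply: integral0_eq => x _.
  by rewrite sE subrr normr0.
suff -> : \sum_i fine (mu (j @^-1` [set i])) *: v i = simple_integral s by exact: cvg_cst.
rewrite /simple_integral /= (reindex_onto (@enum_rank I) (@enum_val I predT))/=; last first.
  by move=> i _; rewrite enum_valK.
under [RHS]eq_bigl do rewrite enum_rankK eqxx.
apply: eq_bigr => i _; rewrite /A /w !insubT//= => lt; set k := Sub _ _.
have -> : k = enum_rank i by exact/val_inj.
by rewrite enum_rankK; case: ifPn => // /asboolP ->; rewrite !scaler0.
Qed.

Lemma bochner0 (E : normedModType R) : bochner_integral_is mu (fun=> 0 : E) 0.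
Proof.
have := @finite_valued_bochner E unit (fun=> tt) (fun=> 0) _ _.
rewrite big1; last by move=> i _; rewrite scaler0.
apply=> // -[]; rewrite (_ : _ @^-1` _ = setT) //; exact/seteqP.
Qed.

Lemma bochner_norm (E : normedModType R) (f : X -> E) v :
  bochner_integral_is mu f v -> (`|v|%:E <= \int[mu]_x `|f x|%:E)%E.
Proof.
move=> /bochner_dist/(_ (bochner0 E)); rewrite subr0 => /le_trans; apply.
by apply: ae_le_integral => [x _|x _|]; rewrite ?lee_fin//; apply: aeW => x /=; rewrite subr0.
Qed.

End bochner_finite_valued.

Section grid_step_functions.
Context {R : realType} {d : nat} (a : 'I_d -> R) (L : R).
Hypothesis L0 : 0 < L.
Local Notation X := (d.-tuple R).
Local Notation mu := (lebesgue d).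
Local Notation cell := (cell a L).
Local Notation loc := (loc a L).
Local Notation pt := (pt a L).
Local Notation nbr := (nbr a L).
Local Notation cellix := (nat * @gridix d)%type.

(** Constancy on the cells of generation [N] and the bound [B] on the indices leave finitely many
    values. The class is stable under combinations and under cutting to integer dilates, and its
    integrals are the finite sums [vint]. *)
Definition gstepB (N B : nat) (F : zmodType) (f : X -> F) :=
  (forall x y, loc N x = loc N y -> f x = f y) /\
  (forall x, f x <> 0 -> forall i, (`|loc N x i| <= B)%N).

Definition gstep (N : nat) (F : zmodType) (f : X -> F) := exists B, gstepB N B f.

Definition decodeix (B : nat) (e : {ffun 'I_d -> 'I_(B + B).+1}) : @gridix d :=
  [ffun i => (e i)%:Z - B%:Z].

Lemma decodeix_surj B (m : @gridix d) : (forall i, (`|m i| <= B)%N) ->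
  exists e : {ffun 'I_d -> 'I_(B + B).+1}, decodeix e = m.
Proof.
move=> mB; have lt i : (`|(m i + B%:Z)%R|%N < (B + B).+1)%N by have := mB i; lia.
exists [ffun i => Ordinal (lt i)]; apply/ffunP => i.
rewrite ffunE [X in nat_of_ord X]ffunE /= gez0_abs; first by rewrite addrK.
by have := mB i; lia.
Qed.

Lemma decodeix_inj B : injective (@decodeix B).
Proof.
move=> e e' /ffunP ee'; apply/ffunP => i; have := ee' i; rewrite !ffunE.
by move=> /addIr [] /val_inj.
Qed.

Definition boxix (B : nat) (m : @gridix d) : option {ffun 'I_d -> 'I_(B + B).+1} :=
  [pick e | decodeix e == m].

Lemma boxixP B m e : boxix B m = Some e <-> decodeix e = m.
Proof.
rewrite /boxix; case: pickP => [e' /eqP e'm|none]; split=> //.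
- by move=> [<-].
- by rewrite -e'm => /decodeix_inj ->.
- by move=> em; have := none e; rewrite em eqxx.
Qed.

Definition stepval (N B : nat) (F : zmodType) (f : X -> F)
    (e : option {ffun 'I_d -> 'I_(B + B).+1}) : F :=
  if e is Some e then f (pt (N, decodeix e)) else 0.

Lemma gstepE N B (F : zmodType) (f : X -> F) : gstepB N B f ->
  f = stepval N f \o (boxix B \o loc N).
Proof.
move=> [fN fB]; apply/funext => x /=; rewrite /stepval.
case E : (boxix B (loc N x)) => [e|].
  by move/boxixP : E => E; apply: fN; rewrite E (loc_pt a L0 (N, _)).
apply/eqP/negPn/negP => /eqP /fB /decodeix_surj[e /boxixP]; by rewrite E.
Qed.

Lemma measurable_box_fibre N B i : measurable ((boxix B \o loc N) @^-1` [set i]).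
Proof. exact: (measurable_saturated a L0 N [set m | boxix B m = i]). Qed.

Lemma box_fibreE N B e : (boxix B \o loc N) @^-1` [set Some e] = cell (N, decodeix e).
Proof.
apply/seteqP; split=> x /=; first by move/boxixP => E; apply/(cellP _ L0).
by move/(cellP _ L0) => /= E; apply/boxixP.
Qed.

Lemma lebesgue_box_fibre N B e :
  mu ((boxix B \o loc N) @^-1` [set Some e]) = (side L N ^+ d)%:E.
Proof. by rewrite box_fibreE; exact: lebesgue_cell. Qed.

Lemma stepval_finite N B (F : zmodType) (f : X -> F) i :
  @stepval N B F f i <> 0 -> (mu ((boxix B \o loc N) @^-1` [set i]) < +oo)%E.
Proof. by case: i => [e|//] _; rewrite [ltLHS](lebesgue_box_fibre N e) ltry. Qed.

Lemma gstep_finite_valued N (F : lmodType R) (f : X -> F) :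
  gstep N f -> finite_valued mu f.
Proof.
move=> [B fB]; exists (option {ffun 'I_d -> 'I_(B + B).+1}), (boxix B \o loc N), (stepval N f).
split; [exact: measurable_box_fibre|exact: stepval_finite|exact: gstepE].
Qed.

Definition vint (N B : nat) (F : lmodType R) (f : X -> F) : F :=
  \sum_(e : {ffun 'I_d -> 'I_(B + B).+1}) side L N ^+ d *: f (pt (N, decodeix e)).

Lemma big_option (V : nmodType) (I : finType) (u : option I -> V) :
  \sum_i u i = u None + \sum_i u (Some i).
Proof.
rewrite (bigD1 None)//=; congr (_ + _).
rewrite (reindex_omap Some id)/=; last by case.
by apply: eq_bigl => i; rewrite eqxx.
Qed.

Lemma gstep_bochner N B (E : normedModType R) (f : X -> E) : gstepB N B f ->
  bochner_integral_is mu f (vint N B f).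
Proof.
move=> fB; rewrite [X in bochner_integral_is _ X](gstepE fB).
have := @finite_valued_bochner _ _ _ mu E _ (boxix B \o loc N) (stepval N f)
  (@measurable_box_fibre N B) (@stepval_finite N B _ f).
rewrite big_option /= scaler0 add0r /vint.
under eq_bigr do rewrite [X in fine X](lebesgue_box_fibre N).
exact.
Qed.

Lemma gstep_integral N B (f : X -> R) : (forall x, 0 <= f x) -> gstepB N B f ->
  (\int[mu]_x (f x)%:E = (vint N B (f : X -> R^o))%:E)%E.
Proof.
move=> f0 fB; rewrite [in LHS](gstepE fB).
rewrite [LHS](@integral_finite_factor _ _ _ mu _ (boxix B \o loc N) (stepval N f))//.
- rewrite big_option /= mul0e add0e /vint -sumEFin; apply: eq_bigr => e _.
  by rewrite [X in (_ * X)%E](lebesgue_box_fibre N) -EFinM mulrC.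
- exact: measurable_box_fibre.
- by case=> [e|] /=.
Qed.

Lemma gstepB_le N B B' (F : zmodType) (f : X -> F) : (B <= B')%N ->
  gstepB N B f -> gstepB N B' f.
Proof. by move=> BB' [fN fB]; split=> // x /fB fx i; exact: leq_trans (fx i) BB'. Qed.

Lemma gstep_refine N N' (F : zmodType) (f : X -> F) : (N <= N')%N ->
  gstep N f -> gstep N' f.
Proof.
move=> NN' [B [fN fB]].
(* Passing to generation [N'] multiplies an index by [2 ^ (N' - N)] up to the offset inside the old
   cell; the last 1 is slack. *)
exists (2 ^ (N' - N) * (B + 1) + 1)%N; split.
  by move=> x y xy; apply: fN; exact: loc_nested xy.
move=> x /fB fx i; have := fx i; rewrite !ffunE.
have -> : (tnth x i - a i) / side L N' = (tnth x i - a i) / side L N * 2 ^+ (N' - N).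
  have := side_half L N (N' - N); rewrite subnKC// => <-.
  have := side_gt0 L0 N'; move: (side L N') => s s0.
  by field; rewrite (gt_eqF s0) expf_neq0.
move: (_ / side L N) => t tB.
have /andP[t1 t2] := floor_itv t; have /andP[u1 u2] := floor_itv (t * 2 ^+ (N' - N)).
set p : int := (2 ^ (N' - N))%N; have pE : (2 ^+ (N' - N) : R) = p%:~R.
  by rewrite /p -pmulrn natrX.
have p0 : 0 < p by rewrite /p ltz_nat expn_gt0.
rewrite pE in u1 u2 *; set n := Num.floor t in t1 t2 tB; set n' := Num.floor _ in u1 u2 *.
have pR : (0 : R) < p%:~R by rewrite ltr0z.
have n'1 : n' < (n + 1) * p.
  rewrite -(ltr_int R) intrM; apply: le_lt_trans u1 _; by rewrite ltr_pM2r.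
have n'2 : n * p < n' + 1.
  by rewrite -(ltr_int R) intrM; apply: le_lt_trans u2; rewrite ler_pM2r.
have -> : (2 ^ (N' - N))%N = `|p|%N by [].
move: p0 n'1 n'2 tB; clear; nia.
Qed.

Lemma gstep_comp2 N (F F' G : zmodType) (Phi : F -> F' -> G) (f : X -> F) (f' : X -> F') :
  Phi 0 0 = 0 -> gstep N f -> gstep N f' -> gstep N (fun x => Phi (f x) (f' x)).
Proof.
move=> Phi0 [B fB] [B' fB'].
have [fN {}fB] := gstepB_le (leq_maxl B B') fB.
have [fN' {}fB'] := gstepB_le (leq_maxr B B') fB'.
exists (maxn B B'); split=> [x y xy|x P0 i].
  by rewrite (fN _ _ xy) (fN' _ _ xy).
case: (pselect (f x = 0)) => fx; last exact: fB.
by apply: fB' => fx'; apply: P0; rewrite fx fx'.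
Qed.

Lemma gstep_comp N (F G : zmodType) (Phi : F -> G) (f : X -> F) :
  Phi 0 = 0 -> gstep N f -> gstep N (fun x => Phi (f x)).
Proof. by move=> P0 fs; exact: (gstep_comp2 (Phi := fun u _ => Phi u) P0 fs fs). Qed.

Lemma gstepD N (F : zmodType) (f g : X -> F) : gstep N f -> gstep N g -> gstep N (f + g).
Proof. exact: (gstep_comp2 (Phi := +%R) (addr0 0)). Qed.

Lemma gstepN N (F : zmodType) (f : X -> F) : gstep N f -> gstep N (- f).
Proof. exact: (gstep_comp (Phi := -%R) (oppr0 _)). Qed.

Lemma gstepB0 N (F : zmodType) (f g : X -> F) : gstep N f -> gstep N g -> gstep N (f - g).
Proof. by move=> fs gs; apply: gstepD => //; exact: gstepN. Qed.

Definition cut (F : zmodType) (A : set X) (f : X -> F) (x : X) : F :=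
  if x \in A then f x else 0.

Lemma cutT (F : zmodType) (A : set X) (f : X -> F) x : A x -> cut A f x = f x.
Proof. by move=> Ax; rewrite /cut mem_set. Qed.

Lemma cutF (F : zmodType) (A : set X) (f : X -> F) x : ~ A x -> cut A f x = 0.
Proof. by move=> Ax; rewrite /cut memNset. Qed.

Lemma gstep_restrict N (F : zmodType) (f : X -> F) (A : set X) :
  (forall x y, loc N x = loc N y -> A x -> A y) -> gstep N f ->
  gstep N (cut A f).
Proof.
move=> AN [B [fN fB]]; exists B; split=> [x y xy|x].
  rewrite /cut; case: ifPn => [/set_mem/(AN _ _ xy) Ay|nAx].
    by rewrite mem_set//; exact: fN.
  by rewrite memNset// => /(AN _ _ (esym xy)) Ax; move/negP: nAx; apply; exact: mem_set.
by rewrite /cut; case: ifPn => // _; exact: fB.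
Qed.

(** For a natural number [t] the dilate is a union of cells of the generation of [c]; this is why
    dilation factors are natural numbers. *)
Lemma nbr_saturated N t c x y : (c.1 <= N)%N -> loc N x = loc N y ->
  nbr t%:R c x -> nbr t%:R c y.
Proof.
move=> cN /(loc_nested L0 cN) xy /(nbr_cover L0)[e /(cellP _ L0)/= ex].
have : cell (c.1, shiftix e c.2) y by apply/(cellP _ L0); rewrite /= -xy.
move=> /(_ _) H i; have /andP[H1 H2] := H i; rewrite /= /corner ffunE in H1 H2.
have s0 := side_gt0 L0 c.1; have := ltn_ord (e i); rewrite ltnS => eit.
have e1 : 0 <= (e i)%:R :> R by [].
have e2 : (e i)%:R <= t%:R + t%:R :> R by rewrite -natrD ler_nat.
move: H1 H2; rewrite /corner !intrD mulrNz -!pmulrn.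
move: (side L c.1) s0 (tnth y i) => s s0 w H1 H2; nra.
Qed.

Lemma gstep_nbr N (F : zmodType) (f : X -> F) t c : (c.1 <= N)%N -> gstep N f ->
  gstep N (cut (nbr t%:R c) f).
Proof. by move=> cN; apply: gstep_restrict => x y; exact: nbr_saturated. Qed.

Lemma gstep_measurable N (F : zmodType) (phi : F -> R) (f : X -> F) : gstep N f ->
  measurable_fun setT (phi \o f).
Proof.
move=> [B fB]; rewrite (gstepE fB) compA.
apply: measurable_countable_comp => i; exact: measurable_box_fibre.
Qed.

End grid_step_functions.

(** * Kernel estimates *)

Lemma gstep_L2fun {R : realType} {d : nat} (a : 'I_d -> R) (L : R) (L0 : 0 < L)
    (F : lmodType R) (nrm : F -> R) (N : nat) (f : d.-tuple R -> F) :
  seminorm nrm -> gstep a L N f -> L2fun (lebesgue d) nrm f.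
Proof.
move=> sn fs; split.
  by apply: finite_valued_strongly_measurable => //; exact: gstep_finite_valued fs.
rewrite L2norm_lty// /sqint.
have [B sB] : gstep a L N (fun x => nrm (f x) ^+ 2).
  by apply: (gstep_comp (Phi := fun u => nrm u ^+ 2)) fs; rewrite seminorm0// expr0n.
rewrite [ltLHS](gstep_integral L0 _ sB) ?ltry// => x.
by rewrite sqr_ge0.
Qed.

Lemma norm_LE_le {R : realType} {E : completeNormedModType R} (A : E -> E) (c : R) :
  (forall r e, A (r *: e) = r *: A e) ->
  (norm_LE A <= c%:E)%E -> forall e, `|A e| <= c * `|e|.
Proof.
move=> AZ Ac e; have [->|e0] := eqVneq e 0.
  by rewrite -(scale0r 0) AZ !scale0r normr0 mulr0.
have e1 : `|e| != 0 by rewrite normr_eq0.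
have : (`|A (`|e|^-1 *: e)|%:E <= norm_LE A)%E.
  apply: ereal_sup_ubound; exists (`|e|^-1 *: e) => //; split=> //=.
  by rewrite lee_fin normrZ normfV normr_id mulVf.
move=> /le_trans /(_ Ac); rewrite lee_fin AZ normrZ normfV normr_id.
by rewrite ler_pdivrMl ?normr_gt0// mulrC.
Qed.

Lemma norm_LE_ge0 {R : realType} {E : completeNormedModType R} (A : E -> E) :
  (0 <= norm_LE A)%E.
Proof.
apply: (@le_trans _ _ `|A 0|%:E); first by rewrite lee_fin.
by apply: ereal_sup_ubound; exists 0 => //; split=> //=; rewrite normr0 lee_fin.
Qed.

(** On the interval from [2^-(k+2)] to [2^-(k+1)] the integrand is at least
    [omega (2^-(k+2)) * 2^(k+1)], and the interval has length [2^-(k+2)]: it contributes at least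
    half of [omega (2^-(k+2))] to the Dini integral. *)
Lemma dini_modulus_sum {R : realType} (omega : R -> R) : dini_modulus omega ->
  exists2 D : R, 0 <= D & forall n, \sum_(k < n) omega (2^-1 ^+ k.+1) <= D.
Proof.
move=> [om0 omn _ om_dini].
set I := (\int[lebesgue_measure]_(t in _) _)%E in om_dini.
have half01 (k : nat) : (0 : R) < 2^-1 ^+ k by rewrite exprn_gt0// invr_gt0.
have half2 (k : nat) : 2^-1 ^+ k.+1 <= 2^-1 :> R.
  by rewrite exprS ler_piMr ?invr_ge0// exprn_ile1 ?invr_ge0// invf_le1// ler1n.
have I0 : (0 <= I)%E.
  apply: integral_ge0 => t /=; rewrite in_itv/= => /andP[t0 t2].
  by rewrite lee_fin divr_ge0 ?(ltW t0)// om0// (ltW t0).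
have Ifin : I \is a fin_num by rewrite ge0_fin_numE.
pose A (k : nat) : set R := `]2^-1 ^+ k.+2, 2^-1 ^+ k.+1]%classic.
have anti (j k : nat) : (j <= k)%N -> 2^-1 ^+ k <= 2^-1 ^+ j :> R.
  move=> jk; rewrite -(subnKC jk) exprD ler_piMr ?(ltW (half01 _))//.
  by rewrite exprn_ile1 ?invr_ge0// invf_le1// ler1n.
have key n : (\sum_(k < n) (2^-1 * omega (2^-1 ^+ k.+2))%:E <= I)%E.
  pose c (k : nat) := omega (2^-1 ^+ k.+2) * 2 ^+ k.+1.
  have c0 k : 0 <= c k.
    by rewrite mulr_ge0 ?exprn_ge0// om0// (ltW (half01 _)) half2.
  have mA k : measurable (A k) by exact: measurable_itv.
  have mcA k : measurable_fun setT (fun t : R => (c k)%:E * (\1_(A k) t)%:E)%E.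
    apply: emeasurable_funM; first exact: measurable_cst.
    by apply/measurable_EFinP; exact: measurable_indic.
  have mI k : measurable_fun setT (fun t : R => (\1_(A k) t : R)%:E).
    by apply/measurable_EFinP; exact: measurable_indic.
  have cA0 k t : (0 <= (c k)%:E * (\1_(A k) t)%:E)%E by rewrite mule_ge0 ?lee_fin.
  apply: (@le_trans _ _ (\int[lebesgue_measure]_(t in `]0%R, 2^-1%R])
      (\sum_(k <- index_enum 'I_n) (c k)%:E * (\1_(A k) t)%:E))%E).
    rewrite ge0_integral_sum//; last by move=> k; exact: measurable_funTS (mcA k).
    apply: lee_sum => k _; rewrite ge0_integralZl//; first last.
    - by rewrite lee_fin.
    - exact: measurable_funTS (mI k).
    rewrite [X in (_ <= _ * X)%E](_ : _ = lebesgue_measure (A k)); last first.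
      rewrite integral_indic; [|exact: measurable_itv|exact: mA].
      congr (lebesgue_measure _); apply/setIidl => t; rewrite /A /= !in_itv/= => /andP[t1 t2].
      by rewrite (lt_trans (half01 _) t1) (le_trans t2 (half2 _)).
    rewrite [X in (_ <= _ * X)%E](lebesgue_measure_itv `]2^-1 ^+ k.+2, 2^-1 ^+ k.+1]) /=.
    rewrite lte_fin ifT; last first.
      by rewrite [ltLHS]exprS gtr_pMl ?half01// invf_lt1// ltr1n.
    rewrite -EFinB -EFinM lee_fin /c le_eqVlt; apply/orP; left; apply/eqP.
    have : (2 : R) ^+ k.+1 != 0 by rewrite expf_neq0.
    by rewrite !exprVn (exprS 2 k.+1); set p := 2 ^+ k.+1 => p0; field.
  apply: ae_le_integral.
  - by move=> t _; apply: sume_ge0.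
  - move=> t /=; rewrite in_itv/= => /andP[t0 t2].
    by rewrite lee_fin divr_ge0 ?(ltW t0)// om0// (ltW t0).
  apply: aeW => t /=; rewrite in_itv/= => /andP[t0 t2].
  have ft0 : (0 <= (omega t / t)%:E)%E.
    by rewrite lee_fin divr_ge0 ?(ltW t0)// om0// (ltW t0).
  case: (pselect (exists k : 'I_n, A k t)) => [[k Akt]|none]; last first.
    rewrite big1// => k _; rewrite indicE memNset ?mule0// => Ak.
    by apply: none; exists k.
  rewrite (bigD1 k)//= big1 ?adde0; last first.
    move=> j jk; rewrite indicE memNset ?mule0//.
    move: Akt; rewrite /A /= !in_itv/= => /andP[k1 k2] /andP[j1 j2].
    have := jk; rewrite -(inj_eq val_inj)/= neq_ltn => /orP[] lt.
    + by have := lt_le_trans j1 (le_trans k2 (anti j.+2 k.+1 lt)); rewrite ltxx.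
    + by have := lt_le_trans k1 (le_trans j2 (anti k.+2 j.+1 lt)); rewrite ltxx.
  rewrite indicE mem_set// mule1 lee_fin /c.
  move: Akt; rewrite /A /= in_itv/= => /andP[k1 k2].
  apply: ler_pM; [|exact: exprn_ge0| |].
  - by rewrite om0// (ltW (half01 _)) half2.
  - by apply: omn => //; exact: ltW.
  - by rewrite -[leLHS]invrK -exprVn lef_pV2// posrE ?invr_gt0// exprn_gt0// invr_gt0.
(* The first term, at the endpoint 1/2, has no interval above it and is counted separately. *)
exists (omega 2^-1 + 2 * fine I).
  by rewrite addr_ge0 ?mulr_ge0 ?fine_ge0// om0// invr_ge0 lexx/= ler0n.
case=> [|n].
  by rewrite big_ord0 addr_ge0 ?mulr_ge0 ?fine_ge0// om0// invr_ge0 lexx/= ler0n.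
rewrite big_ord_recl expr1 lerD2l.
have := key n; rewrite sumEFin -(fineK Ifin) lee_fin -mulr_sumr.
by rewrite ler_pdivrMl.
Qed.

(** A point outside the dilate of this radius is at distance at least [2^k * 2d] sides from the
    cell, whose diameter is at most [d] sides: the ratio in the regularity condition is then at most
    [2^-(k+1)]. *)
HB.lock Definition radius {R : realType} (d k : nat) : R := (2 ^ k * (2 * d))%:R.

Section cz_operator.
Context {R : realType} {d : nat} {E : completeNormedModType R}.
Local Notation X := (d.-tuple R).
Local Notation mu := (lebesgue d).
Local Notation normE := (fun x : E => `|x|).
Hypothesis d_gt0 : (0 < d)%N.

(* The Dini integral only enters through the bound D of its dyadic sums. *)
Record cz_bounds (T : (X -> E) -> X -> E) (K : X -> X -> {linear E -> E})
    (omega : R -> R) (CT D : R) : Prop := CzBounds {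
  cz_CT0 : 0 <= CT;
  cz_D0 : 0 <= D;
  cz_L2 : forall f, L2fun mu normE f -> L2fun mu normE (T f);
  cz_lin : forall (r : R) f g, L2fun mu normE f -> L2fun mu normE g ->
    \forall x \ae mu, T (r *: f + g) x = r *: T f x + T g x;
  cz_bound : forall f, L2fun mu normE f ->
    (sqint mu normE (T f) <= (CT ^+ 2)%:E * sqint mu normE f)%E;
  cz_om0 : forall t, 0 <= t <= 2^-1 -> 0 <= omega t;
  cz_omn : forall s t, 0 <= s -> s <= t -> t <= 2^-1 -> omega s <= omega t;
  cz_dini : forall n, \sum_(k < n) omega (2^-1 ^+ k.+1) <= D;
  cz_Kx : forall x x' y e, x <> y -> eucl_dist x x' <= 2^-1 * eucl_dist x y ->
    `|K x y e - K x' y e| <=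
      omega (eucl_dist x x' / eucl_dist x y) / eucl_dist x y ^+ d * `|e|;
  cz_Ky : forall x x' y e, x <> y -> eucl_dist x x' <= 2^-1 * eucl_dist x y ->
    `|K y x e - K y x' e| <=
      omega (eucl_dist x x' / eucl_dist x y) / eucl_dist x y ^+ d * `|e|;
  cz_rep : forall f, L2fun mu normE f ->
    \forall x \ae mu, ~ essential_support f x ->
      bochner_integral_is mu (fun y => K x y (f y)) (T f x) }.

Lemma L2funZ (r : R) f : L2fun mu normE f -> L2fun mu normE (r *: f).
Proof.
move=> [mf foo]; have sn := @seminorm_normr R E; split.
  exact: strongly_measurableZ.
rewrite L2norm_lty// sqintZ//; rewrite L2norm_lty// in foo.
by rewrite lte_mul_pinfty// lee_fin sqr_ge0.
Qed.

Lemma L2funD f g : L2fun mu normE f -> L2fun mu normE g -> L2fun mu normE (f + g).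
Proof.
move=> [mf foo] [mg goo]; have sn := @seminorm_normr R E; split.
  exact: strongly_measurableD.
rewrite !L2norm_lty// in foo goo *; apply: le_lt_trans (sqintD sn mf mg) _.
by rewrite lte_add_pinfty// lte_mul_pinfty.
Qed.

Lemma L2fun0 : L2fun mu normE 0.
Proof.
have sn := @seminorm_normr R E; split; first exact: strongly_measurable0.
by rewrite L2norm_lty// /sqint integral0_eq// => x _; rewrite normr0 expr0n.
Qed.

(** [operator_norm] only sees the unit ball; homogeneity, which holds almost everywhere, carries its
    bound to all functions. The two regularity estimates come from the two summands of the kernel
    condition. *)
Lemma dini_cz_operator_bounds T : dini_cz_operator T ->
  exists K omega CT D, cz_bounds T K omega CT D.
Proof.
move=> [[TL2 Tlin Tfin] [K [c [omega [om_dini Ksize Kreg Krep]]]]].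
have sn := @seminorm_normr R E.
have [D D0 HD] := dini_modulus_sum om_dini.
have [om0 omn _ _] := om_dini.
set nT := operator_norm _ _ _ in Tfin.
have nT0 : (0 <= nT)%E.
  apply: (@le_trans _ _ (L2norm mu normE (T 0))); first by rewrite Lnorm_ge0.
  apply: ereal_sup_ubound; exists 0 => //; split; first exact: L2fun0.
  by rewrite L2norm_le// /sqint integral0_eq// ?lee_fin// => x _; rewrite normr0 expr0n.
have nTfin : nT \is a fin_num by rewrite ge0_fin_numE.
pose CT := fine nT.
have TZ (r : R) f : L2fun mu normE f -> \forall x \ae mu, T (r *: f) x = r *: T f x.
  move=> Lf; have := Tlin r f 0 Lf L2fun0; have := Tlin 1 0 0 L2fun0 L2fun0.
  rewrite scaler0 !addr0; apply: filterS2 => x; rewrite scale1r => T0 ->.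
  have -> : T 0 x = 0 by apply: (addrI (T 0 x)); rewrite addr0 -T0.
  by rewrite addr0.
have unit_bound f : L2fun mu normE f -> (sqint mu normE f <= 1)%E ->
    (sqint mu normE (T f) <= (CT ^+ 2)%:E)%E.
  move=> Lf f1; rewrite -L2norm_le// ?fine_ge0// fineK//.
  apply: ereal_sup_ubound; exists f => //; split=> //=.
  by rewrite L2norm_le// expr1n.
have scaled_bound (r : R) f : L2fun mu normE f -> 0 < r ->
    (sqint mu normE f <= (r ^+ 2)%:E)%E -> (sqint mu normE (T f) <= (CT ^+ 2 * r ^+ 2)%:E)%E.
  move=> Lf r0 fr; have r20 : 0 < r ^+ 2 by rewrite exprn_gt0.
  have := unit_bound (r^-1 *: f) (L2funZ _ Lf).
  rewrite (sqintZ sn _ (proj1 Lf)) exprVn.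
  rewrite (ae_eq_sqint _ (TZ r^-1 f Lf)) (sqintZ sn _ (proj1 (TL2 _ Lf))) exprVn.
  rewrite -!lee_pdivlMl ?invr_gt0// invrK mule1 => /(_ fr).
  by rewrite (mulrC (CT ^+ 2)) EFinM.
exists K, omega, CT, D; split => //.
- exact: fine_ge0.
- move=> f Lf.
  have foo : (sqint mu normE f < +oo)%E by case: Lf => _; rewrite L2norm_lty.
  have q0 := sqint_ge0 mu normE f.
  have qfin : sqint mu normE f \is a fin_num by rewrite ge0_fin_numE.
  rewrite -(fineK qfin) -EFinM; apply/lee_addgt0Pr => e e0.
  (* The square integral of [f] may vanish, so it is enlarged by [e'] before [f] is scaled into the
     unit ball; [CT^2 * e'] is at most [e]. *)
  pose e' := e / (CT ^+ 2 + 1).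
  have e'0 : 0 < e' by rewrite divr_gt0// ltr_wpDl// sqr_ge0.
  have q0' := fine_ge0 q0.
  have r0 : 0 < Num.sqrt (fine (sqint mu normE f) + e') by rewrite sqrtr_gt0 ltr_wpDl.
  have rE : Num.sqrt (fine (sqint mu normE f) + e') ^+ 2 = fine (sqint mu normE f) + e'.
    by rewrite sqr_sqrtr// addr_ge0// ltW.
  apply: le_trans (scaled_bound _ _ Lf r0 _) _; rewrite rE.
    by rewrite EFinD fineK// leeDl// lee_fin ltW.
  rewrite -EFinD lee_fin mulrDr lerD2l /e' mulrCA ger_pMr//.
  by rewrite ler_pdivrMr ?ltr_wpDl ?sqr_ge0// mul1r lerDl.
- move=> x x' y e xy xx'; apply: (norm_LE_le (A := fun e => K x y e - K x' y e)).
    by move=> r u; rewrite [RHS]scalerBr; congr (_ - _); exact: linearZ.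
  apply: le_trans (Kreg x x' y xy xx'); rewrite leeDl//; exact: norm_LE_ge0.
- move=> x x' y e xy xx'; apply: (norm_LE_le (A := fun e => K y x e - K y x' e)).
    by move=> r u; rewrite [RHS]scalerBr; congr (_ - _); exact: linearZ.
  apply: le_trans (Kreg x x' y xy xx'); rewrite leeDr//; exact: norm_LE_ge0.
Qed.

Lemma eucl_dist_sym (x y : X) : eucl_dist x y = eucl_dist y x.
Proof.
by rewrite /eucl_dist; congr Num.sqrt; apply: eq_bigr => i _; rewrite -sqrrN opprB.
Qed.

Lemma eucl_dist_ge (x y : X) i (r : R) : 0 <= r ->
  r <= `|tnth x i - tnth y i| -> r <= eucl_dist x y.
Proof.
move=> r0 rxy; rewrite /eucl_dist -[leLHS]ger0_norm// -sqrtr_sqr ler_wsqrtr//.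
rewrite (bigD1 i)//=.
rewrite -[leLHS]addr0 lerD//; last by apply: sumr_ge0 => j _; exact: sqr_ge0.
by rewrite -[leRHS]real_normK ?num_real// ler_pXn2r// nnegrE.
Qed.

Section shells.
Local Notation radius := (@radius R d).
Context (a : 'I_d -> R) (L : R) (L0 : 0 < L).
Local Notation cell := (cell a L).
Local Notation nbr := (nbr a L).
Local Notation side := (side L).
Implicit Types c : (nat * @gridix d)%type.

Lemma radius_gt0 k : 0 < radius k.
Proof. by rewrite radius.unlock ltr0n muln_gt0 expn_gt0 muln_gt0/=. Qed.

Lemma radiusS k : radius k.+1 = 2 * radius k.
Proof. by rewrite radius.unlock expnS -mulnA natrM. Qed.

Lemma eucl_dist_cell c x x' : cell c x -> cell c x' -> eucl_dist x x' <= d%:R * side c.1.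
Proof.
move=> cx cx'; have s0 := side_gt0 L0 c.1.
have ds0 : 0 <= d%:R * side c.1 by rewrite mulr_ge0// ltW.
rewrite /eucl_dist -[leRHS]ger0_norm// -sqrtr_sqr ler_wsqrtr//.
apply: (@le_trans _ _ (\sum_(i < d) side c.1 ^+ 2)).
  apply: ler_sum => i _; rewrite -[leLHS]real_normK ?num_real//.
  rewrite ler_pXn2r ?nnegrE ?(ltW s0)//.
  have /andP[H1 H2] := cx i; have /andP[H3 H4] := cx' i.
  by rewrite ler_norml; apply/andP; split; lra.
rewrite sumr_const card_ord -[leLHS]mulr_natl exprMn.
rewrite ler_wpM2r ?sqr_ge0//.
by rewrite -natrX ler_nat; case: (d) d_gt0 => // n _; rewrite -mulnn leq_pmulr.
Qed.

Lemma eucl_dist_nbr t c x y : 0 <= t -> cell c x -> ~ nbr t c y ->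
  t * side c.1 <= eucl_dist x y.
Proof.
move=> t0 cx ny; have s0 := side_gt0 L0 c.1.
have [i Hi] : exists i, ~ (corner a L c.1 c.2 i - t * side c.1 <= tnth y i
    < corner a L c.1 c.2 i - t * side c.1 + (1 + 2 * t) * side c.1).
  by apply: contrapT => H; apply: ny => i; apply: contrapT => Hi; apply: H; exists i.
apply: (eucl_dist_ge (i := i)); first by rewrite mulr_ge0// ltW.
have /andP[H1 H2] := cx i; move: Hi => /negP; rewrite negb_and -ltNge -leNgt.
move=> /orP[H|H]; rewrite ler_normr; apply/orP; [left|right]; lra.
Qed.

Lemma nbr_exhaust c y : exists k, nbr (radius k) c y.
Proof.
have s0 := side_gt0 L0 c.1.
pose M := \sum_(i < d) `|tnth y i - corner a L c.1 c.2 i|.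
have M0 : 0 <= M by apply: sumr_ge0.
have [k Hk] : exists k : nat, M / side c.1 < radius k.
  exists (Num.trunc (M / side c.1)).+1; rewrite radius.unlock.
  apply: lt_le_trans (_ : (Num.trunc (M / side c.1)).+1%:R <= _).
    by rewrite truncnS_gt.
  rewrite ler_nat; apply: leq_trans (ltnW (ltn_expl _ (ltnSn 1))) _.
  by rewrite leq_pmulr// muln_gt0.
exists k => i; rewrite ltr_pdivrMr// in Hk.
have : `|tnth y i - corner a L c.1 c.2 i| <= M.
  by rewrite /M (bigD1 i)//= lerDl; apply: sumr_ge0.
move=> /le_lt_trans/(_ Hk); rewrite ltr_norml => /andP[H1 H2].
by apply/andP; split; nra.
Qed.

Lemma nbr_radius_sub k j c : (k <= j)%N -> nbr (radius k) c `<=` nbr (radius j) c.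
Proof.
move=> kj; apply: (sub_nbr L0); rewrite radius.unlock ler_nat leq_mul2r leq_exp2l//.
by rewrite kj orbT.
Qed.

(** A step function meets finitely many shells around [c], so the sums over shells below are
    finite. *)
Lemma bounded_support_nbr c N (F : zmodType) (u : X -> F) : gstep a L N u ->
  exists k, forall y, u y <> 0 -> nbr (radius k) c y.
Proof.
move=> /(gstep_refine L0 (leq_maxl N c.1))[B [uN uB]]; set N' := maxn N c.1 in uN uB.
have /choice[k Hk] (e : {ffun 'I_d -> 'I_(B + B).+1}) :
    exists k, nbr (radius k) c (pt a L (N', decodeix e)).
  exact: nbr_exhaust.
exists (\max_e k e)%N => y /uB uy; have [e He] := decodeix_surj L0 uy.
have : nbr (radius (\max_e k e)) c (pt a L (N', decodeix e)).
  by apply: nbr_radius_sub (Hk e); exact: leq_bigmax.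
rewrite radius.unlock; apply: (nbr_saturated L0 (leq_maxr N c.1)).
by rewrite (loc_pt a L0 (N', decodeix e)).
Qed.

Lemma shell_exists K c y : nbr (radius K) c y -> ~ nbr (radius 0) c y ->
  exists k, [/\ (k < K)%N, nbr (radius k.+1) c y & ~ nbr (radius k) c y].
Proof.
elim: K => [//|K IH] yK y0; case: (pselect (nbr (radius K) c y)) => yK'.
  by have [k [kK H1 H2]] := IH yK' y0; exists k; split => //; exact: ltnW.
by exists K.
Qed.

(** The 5 comes from [1 + 2 * (2r) <= 5r], valid since the radius [r] is at least 1. *)
Lemma lebesgue_nbr_radius k c :
  (mu (nbr (radius k.+1) c) <= (5 ^+ d * (radius k * side c.1) ^+ d)%:E)%E.
Proof.
rewrite (lebesgue_nbr a L0 c (ltW (radius_gt0 k.+1))).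
rewrite lee_fin -!exprMn lerXn2r ?nnegrE ?mulr_ge0 ?addr_ge0 ?mulr_ge0//;
  rewrite ?(ltW (radius_gt0 _)) ?(side_ge0 L0) ?(ltW L0)//.
rewrite mulrA ler_wpM2r ?(side_ge0 L0)// radiusS.
suff : 1 <= radius k by lra.
by rewrite radius.unlock ler1n muln_gt0 expn_gt0 muln_gt0/=.
Qed.

Section kernel.
Context {T : (X -> E) -> X -> E} {K : X -> X -> {linear E -> E}}
  {omega : R -> R} {CT D : R} (HT : cz_bounds T K omega CT D).

(** The bound for the difference of two kernels with arguments in [c], seen from a point outside the
    dilate of radius [radius k]. *)
Definition shell_weight k c : R := omega (2^-1 ^+ k.+1) / (radius k * side c.1) ^+ d.

Lemma half_pow_le k : 0 <= (2^-1 ^+ k.+1 : R) <= 2^-1.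
Proof.
rewrite exprn_ge0 ?invr_ge0//= exprS ler_piMr ?invr_ge0// exprn_ile1 ?invr_ge0//.
by rewrite invf_le1// ler1n.
Qed.

Lemma shell_weight_ge0 k c : 0 <= shell_weight k c.
Proof.
rewrite divr_ge0 ?(cz_om0 HT) ?half_pow_le// exprn_ge0//.
by rewrite mulr_ge0 ?(ltW (radius_gt0 _)) ?(ltW (side_gt0 L0 _)).
Qed.

Lemma shell_kernel_bound k c x x' y : cell c x -> cell c x' -> ~ nbr (radius k) c y ->
  [/\ x <> y, eucl_dist x x' <= 2^-1 * eucl_dist x y &
   omega (eucl_dist x x' / eucl_dist x y) / eucl_dist x y ^+ d <= shell_weight k c].
Proof.
move=> cx cx' ny; have s0 := side_gt0 L0 c.1; have r0 := radius_gt0 k.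
have d1 := eucl_dist_cell cx cx'; have d2 := eucl_dist_nbr (ltW r0) cx ny.
have rs0 : 0 < radius k * side c.1 by rewrite mulr_gt0.
have dxy0 : 0 < eucl_dist x y := lt_le_trans rs0 d2.
have rk : radius k = 2 ^+ k.+1 * d%:R.
  by rewrite radius.unlock mulnA -(mulnC 2) -expnS natrM natrX.
have k2 : (0 : R) < 2 ^+ k.+1 by rewrite exprn_gt0.
have ratio : eucl_dist x x' / eucl_dist x y <= 2^-1 ^+ k.+1.
  rewrite ler_pdivrMr// exprVn ler_pdivlMl//.
  apply: le_trans (_ : radius k * side c.1 <= _) => //.
  by rewrite rk -mulrA ler_wpM2l// ltW.
have /andP[h0 h2] := half_pow_le k.
split.
- move=> xy; move: dxy0; rewrite xy /eucl_dist.
  by rewrite big1 ?sqrtr0 ?ltxx// => i _; rewrite subrr expr0n.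
- by rewrite -ler_pdivrMr//; exact: le_trans ratio h2.
have q0 : 0 <= eucl_dist x x' / eucl_dist x y by rewrite divr_ge0 ?sqrtr_ge0.
apply: ler_pM.
- by rewrite (cz_om0 HT)// q0 (le_trans ratio h2).
- by rewrite invr_ge0 exprn_ge0// ltW.
- exact: (cz_omn HT).
- by rewrite lef_pV2 ?posrE ?exprn_gt0// lerXn2r ?nnegrE// ltW.
Qed.

Lemma shell_kernel_x k c x x' y e : cell c x -> cell c x' -> ~ nbr (radius k) c y ->
  `|K x y e - K x' y e| <= shell_weight k c * `|e|.
Proof.
move=> cx cx' ny; have [xy xx' le] := shell_kernel_bound cx cx' ny.
by apply: le_trans (cz_Kx HT e xy xx') _; rewrite ler_wpM2r.
Qed.

Lemma shell_kernel_y k c x x' y e : cell c x -> cell c x' -> ~ nbr (radius k) c y ->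
  `|K y x e - K y x' e| <= shell_weight k c * `|e|.
Proof.
move=> cx cx' ny; have [xy xx' le] := shell_kernel_bound cx cx' ny.
by apply: le_trans (cz_Ky HT e xy xx') _; rewrite ler_wpM2r.
Qed.

Lemma measurable_fun_restrict_EFin (A : set X) (phi : X -> R) : measurable A ->
  measurable_fun setT phi -> measurable_fun setT ((EFin \o phi) \_ A).
Proof.
move=> mA mphi; apply/(measurable_restrictT _ mA); apply: measurable_funTS.
exact/measurable_EFinP.
Qed.

(* Off the dilated cell, T of a function vanishing there varies on the cell by at
   most the Dini sum times the averages over the dyadic dilates. *)
Lemma far_oscillation N c u (M : R) : gstep a L N u -> (forall y, nbr (radius 0) c y -> u y = 0) ->
  (forall k, \int[mu]_(y in nbr (radius k.+1) c) `|u y|%:E <=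
     (M * (radius k * side c.1) ^+ d)%:E)%E ->
  exists2 P : X -> Prop, (\forall x \ae mu, P x) &
    forall x x', cell c x -> cell c x' -> P x -> P x' -> `|T u x - T u x'| <= D * M.
Proof.
move=> us u0 uM; have Lu : L2fun mu normE u := gstep_L2fun L0 seminorm_normr us.
(* The good points form one set of full measure, so the estimate holds for every pair of good points
   of the cell. *)
exists (fun x => cell c x -> bochner_integral_is mu (fun y => K x y (u y)) (T u x)).
  have := cz_rep HT Lu; apply: filterS => x H cx; apply: H => ess.
  have s0 := side_gt0 L0 c.1; have r0 := radius_gt0 0.
  apply: (ess (radius 0 * side c.1)); first by rewrite mulr_gt0.
  rewrite (_ : mkset _ = set0); first exact: negligible_set0.
  apply/seteqP; split=> // y /= [xy uy]; apply: uy; apply: u0.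
  apply: contrapT => ny; have := eucl_dist_nbr (ltW r0) cx ny.
  by rewrite leNgt xy.
move=> x x' cx cx' /(_ cx) bx /(_ cx') bx'.
have [K0 HK0] := bounded_support_nbr c us.
pose nu y : R := `|u y|.
have r0 k y : (0 <= ((EFin \o nu) \_ (nbr (radius k.+1) c)) y)%E.
  by apply: erestrict_ge0 => z; rewrite lee_fin /nu.
have mu' : measurable_fun setT nu := gstep_measurable L0 (Num.norm) us.
suff : (`|T u x - T u x'|%:E <= (D * M)%:E)%E by rewrite lee_fin.
apply: le_trans (bochner_dist bx bx') _.
apply: (@le_trans _ _ (\int[mu]_y (\sum_(k <- index_enum 'I_K0)
   (shell_weight k c)%:E * ((EFin \o nu) \_ (nbr (radius k.+1) c)) y))%E).
  apply: ae_le_integral => [y _|y _|]; first by rewrite lee_fin.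
    apply: sume_ge0 => k _; apply: mule_ge0; first by rewrite lee_fin shell_weight_ge0.
    exact: r0.
  apply: aeW => y /= _; case: (pselect (u y = 0)) => uy.
    rewrite (_ : _ - _ = 0) ?normr0; last by rewrite uy !linear0 ?subr0 ?addr0.
    apply: sume_ge0 => k _.
    apply: mule_ge0; first by rewrite lee_fin shell_weight_ge0.
    exact: r0.
  have [k [kK yk1 yk]] := shell_exists (HK0 _ uy) (fun H => uy (u0 _ H)).
  rewrite (bigD1 (Ordinal kK))//= patchE mem_set// -EFinM.
  apply: le_trans (_ : (shell_weight k c * `|u y|)%:E <= _)%E.
    by rewrite lee_fin shell_kernel_x.
  rewrite leeDl// sume_ge0// => j _; apply: mule_ge0; first by rewrite lee_fin shell_weight_ge0.
  exact: r0.
have mr k : measurable_fun setT ((EFin \o nu) \_ (nbr (radius k.+1) c)).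
  by apply: measurable_fun_restrict_EFin => //; exact: measurable_nbr.
rewrite ge0_integral_sum//; first last.
- by move=> k y _; apply: mule_ge0 => //; rewrite lee_fin shell_weight_ge0.
- by move=> k; apply: emeasurable_funM => //; exact: measurable_cst.
apply: (@le_trans _ _ (\sum_(k < K0) (omega (2^-1 ^+ k.+1) * M)%:E)%E).
  apply: lee_sum => k _; rewrite ge0_integralZl//; last by rewrite lee_fin shell_weight_ge0.
  rewrite -integral_mkcond.
  apply: (@le_trans _ _ ((shell_weight k c)%:E * (M * (radius k * side c.1) ^+ d)%:E)%E).
    by apply: lee_wpmul2l; rewrite ?lee_fin ?shell_weight_ge0//; exact: uM.
  rewrite -EFinM lee_fin /shell_weight le_eqVlt; apply/orP; left; apply/eqP.
  have : (radius k * side c.1) ^+ d != 0.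
    by rewrite expf_neq0// mulf_neq0// gt_eqF ?radius_gt0// side_gt0.
  by set z := _ ^+ d => z0; field.
have M0 : 0 <= M.
  have := uM 0%N; set z := (_ * _) ^+ d.
  have z0 : 0 < z by rewrite exprn_gt0// mulr_gt0 ?radius_gt0// side_gt0.
  move=> /(le_trans (integral_ge0 _ _)) H.
  have : (0 <= (M * z)%:E)%E by apply: H => y _; rewrite lee_fin.
  by rewrite lee_fin pmulr_lge0.
by rewrite sumEFin lee_fin -mulr_suml ler_wpM2r// (cz_dini HT).
Qed.

Lemma eucl_dist_nbr0 c x y : cell c y -> ~ nbr (radius 0) c x ->
  side c.1 <= eucl_dist x y.
Proof.
move=> cy nx; rewrite eucl_dist_sym; apply: le_trans (eucl_dist_nbr (ltW (radius_gt0 0)) cy nx).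
rewrite ler_peMl ?(side_ge0 L0)// radius.unlock ler1n muln_gt0 expn_gt0.
by rewrite muln_gt0/=.
Qed.

(* Off the dilated cell, the integral of b vanishing allows to subtract the value of
   the kernel at a point of the cell. *)
Lemma atom_bound N B c b : gstepB a L N B b -> (forall y, ~ cell c y -> b y = 0) ->
  vint a L N B b = 0 ->
  exists H : X -> \bar R, [/\ measurable_fun setT H, forall x, (0 <= H x)%E,
    (\int[mu]_x H x <= (5 ^+ d * D)%:E * \int[mu]_y `|b y|%:E)%E &
    \forall x \ae mu, ~ nbr (radius 0) c x -> (`|T b x|%:E <= H x)%E].
Proof.
move=> bB b0 bint; have bs : gstep a L N b by exists B.
have Lb : L2fun mu normE b := gstep_L2fun L0 seminorm_normr bs.
pose nb y : R := `|b y|.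
have [Bn nbB] : gstep a L N nb := gstep_comp (Phi := Num.norm) (normr0 _) bs.
pose I : R := vint a L N Bn (nb : X -> R^o).
have IE : (\int[mu]_y (nb y)%:E = I%:E)%E by apply: (gstep_integral L0 _ nbB) => y; exact: normr_ge0.
have I0 : 0 <= I.
  suff : (0 <= I%:E)%E by rewrite lee_fin.
  by rewrite -IE; apply: integral_ge0 => y _; rewrite lee_fin; exact: normr_ge0.
have mnb : measurable_fun setT nb := gstep_measurable L0 (Num.norm) bs.
pose w k := shell_weight k c * I.
have w0 k : 0 <= w k by rewrite mulr_ge0// shell_weight_ge0.
(* The shell of index [k] carries the weight [w k]; integrating over the larger dilate gives
   [5^d * omega (2^-(k+1))] times the integral of [|b|], and the Dini bound sums these. *)
pose H x := (\sum_(k <oo) (w k)%:E * (\1_(nbr (radius k.+1) c) x : R)%:E)%E.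
have mI k : measurable_fun setT (fun x => (\1_(nbr (radius k.+1) c) x : R)%:E).
  by apply/measurable_EFinP; apply: measurable_indic; exact: measurable_nbr.
have mt k : measurable_fun setT (fun x => (w k)%:E * (\1_(nbr (radius k.+1) c) x : R)%:E)%E.
  by apply: emeasurable_funM => //; exact: measurable_cst.
have t0 k x : (0 <= (w k)%:E * (\1_(nbr (radius k.+1) c) x : R)%:E)%E.
  by rewrite mule_ge0 ?lee_fin// indicE.
exists H; split.
- exact: ge0_emeasurable_sum.
- by move=> x; apply: nneseries_ge0.
- rewrite /H integral_nneseries//.
  rewrite [X in (_ <= _ * X)%E]IE -EFinM.
  apply: lime_le; first by apply: is_cvg_nneseries => n _ _; exact: integral_ge0.
  apply: nearW => n.
  apply: (@le_trans _ _ (\sum_(0 <= k < n) (5 ^+ d * omega (2^-1 ^+ k.+1) * I)%:E)%E).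
    apply: lee_sum => k _; rewrite ge0_integralZl//; last by rewrite lee_fin.
    rewrite integral_indic//; last exact: measurable_nbr.
    rewrite setIT.
    apply: (@le_trans _ _ ((w k)%:E * (5 ^+ d * (radius k * side c.1) ^+ d)%:E)%E).
      by apply: lee_wpmul2l; rewrite ?lee_fin//; exact: lebesgue_nbr_radius.
    rewrite -EFinM lee_fin /w /shell_weight le_eqVlt; apply/orP; left; apply/eqP.
    have : (radius k * side c.1) ^+ d != 0.
      by rewrite expf_neq0// mulf_neq0// gt_eqF ?radius_gt0// side_gt0.
    by move: (_ ^+ d) => z z0; field.
  rewrite sumEFin lee_fin -mulr_suml -mulr_sumr ler_wpM2r// ler_wpM2l ?exprn_ge0//.
  by rewrite big_mkord (cz_dini HT).
have := cz_rep HT Lb; apply: filterS => x Hx nx.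
have s0 := side_gt0 L0 c.1.
have {}Hx : bochner_integral_is mu (fun y => K x y (b y)) (T b x).
  apply: Hx => ess; apply: (ess (side c.1)); first exact: s0.
  rewrite (_ : mkset _ = set0); first exact: negligible_set0.
  apply/seteqP; split=> // y /= [xy uy]; apply: uy; apply: b0 => cy.
  by have := eucl_dist_nbr0 cy nx; rewrite leNgt xy.
(* With the kernel frozen at a point of the cell, linearity turns the vanishing of the integral of
   [b] into the value 0. *)
have Hc : bochner_integral_is mu (fun y => K x (pt a L c) (b y)) 0.
  have KB : gstepB a L N B (fun y => K x (pt a L c) (b y)).
    case: bB => [bN bB]; split=> [y z yz|y Kb]; first by rewrite (bN _ _ yz).
    by apply: bB => by0; apply: Kb; rewrite by0 linear0.
  have := gstep_bochner L0 KB; congr (bochner_integral_is _ _ _).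
  transitivity (K x (pt a L c) (vint a L N B b)); last by rewrite bint linear0.
  by rewrite /vint linear_sum; apply: eq_bigr => e _; rewrite linearZ.
have [J xJ] := nbr_exhaust c x.
have [k [_ xk1 xk]] := shell_exists xJ nx.
have := bochner_dist Hx Hc; rewrite subr0 => /le_trans; apply.
apply: (@le_trans _ _ (w k)%:E).
  apply: (@le_trans _ _ (\int[mu]_y ((shell_weight k c)%:E * (nb y)%:E))%E).
    apply: ae_le_integral => [y _|y _|].
    - by rewrite lee_fin.
    - by apply: mule_ge0; rewrite lee_fin; [exact: shell_weight_ge0|exact: normr_ge0].
    apply: aeW => y /= _; rewrite -EFinM lee_fin /nb.
    case: (pselect (cell c y)) => cy; last by rewrite b0// !linear0 ?addr0 ?subr0 !normr0 mulr0.
    by apply: shell_kernel_y => //; exact: cell_pt.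
  rewrite ge0_integralZl//; first last.
  - by rewrite lee_fin shell_weight_ge0.
  - by move=> z _; rewrite lee_fin; exact: normr_ge0.
  - by apply/measurable_EFinP; exact: mnb.
  by rewrite IE.
apply: le_trans (nneseries_lim_ge k.+1 (fun j _ _ => t0 j x)).
rewrite big_nat_recr//= indicE mem_set// mule1 leeDr//.
by apply: sume_ge0 => j _; exact: t0.
Qed.

End kernel.
End shells.
End cz_operator.

(** * The weak type estimate *)

Section nonnegative_real_integrals.
Context {disp : measure_display} {X : measurableType disp} {R : realType}.
Variable mu : {measure set X -> \bar R}.

Lemma integral_sumE (I : Type) (s : seq I) (phi : I -> X -> R) :
  (forall i x, 0 <= phi i x) -> (forall i, measurable_fun setT (phi i)) ->
  (\int[mu]_x (\sum_(i <- s) phi i x)%:E = \sum_(i <- s) \int[mu]_x (phi i x)%:E)%E.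
Proof.
move=> phi0 mphi; rewrite -ge0_integral_sum//; first last.
- by move=> i x _; rewrite lee_fin.
- by move=> i; exact/measurable_EFinP.
by apply: eq_integral => x _; rewrite sumEFin.
Qed.

Lemma integralDE (phi psi : X -> R) :
  (forall x, 0 <= phi x) -> (forall x, 0 <= psi x) ->
  measurable_fun setT phi -> measurable_fun setT psi ->
  (\int[mu]_x (phi x + psi x)%:E = \int[mu]_x (phi x)%:E + \int[mu]_x (psi x)%:E)%E.
Proof.
move=> phi0 psi0 mphi mpsi; rewrite -ge0_integralD//; try by move=> x _; rewrite lee_fin.
- exact/measurable_EFinP.
- exact/measurable_EFinP.
Qed.

Lemma integralZE (r : R) (phi : X -> R) : 0 <= r ->
  (forall x, 0 <= phi x) -> measurable_fun setT phi ->
  (\int[mu]_x (r * phi x)%:E = r%:E * \int[mu]_x (phi x)%:E)%E.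
Proof.
move=> r0 phi0 mphi; rewrite -ge0_integralZl//; first exact/measurable_EFinP.
by move=> x _; rewrite lee_fin.
Qed.

Lemma le_integralE (phi psi : X -> R) :
  (forall x, 0 <= phi x) -> (forall x, phi x <= psi x) ->
  (\int[mu]_x (phi x)%:E <= \int[mu]_x (psi x)%:E)%E.
Proof.
move=> phi0 pp; apply: ae_le_integral => [x _|x _|].
- by rewrite lee_fin.
- by rewrite lee_fin (le_trans _ (pp x)).
by apply: aeW => x _; rewrite lee_fin.
Qed.

Lemma ae_seq (I : eqType) (s : seq I) (P : I -> X -> Prop) :
  (forall i, i \in s -> \forall x \ae mu, P i x) ->
  \forall x \ae mu, forall i, i \in s -> P i x.
Proof.
elim: s => [|i s IH] H; first by apply: aeW.
have := IH (fun j js => H j (mem_behead (s := i :: s) js)).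
apply: filterS2 (H i (mem_head _ _)) => x Pi Ps j.
by rewrite inE => /orP[/eqP -> //|]; exact: Ps.
Qed.

End nonnegative_real_integrals.

Section weak_type.
Context {R : realType} {d : nat} {E : completeNormedModType R} (d_gt0 : (0 < d)%N).
Context (a : 'I_d -> R) (L : R) (L0 : 0 < L).
Context {T : (d.-tuple R -> E) -> d.-tuple R -> E}
  {K : d.-tuple R -> d.-tuple R -> {linear E -> E}}
  {omega : R -> R} {CT D : R} (HT : cz_bounds T K omega CT D).
Local Notation X := (d.-tuple R).
Local Notation mu := (lebesgue d).
Local Notation normE := (fun x : E => `|x|).
Local Notation cell := (cell a L).
Local Notation nbr := (nbr a L).
Local Notation side := (side L).
Local Notation radius := (@radius R d).
Local Notation cellix := (nat * @gridix d)%type.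
Implicit Types c : cellix.

Lemma cz_T0 : \forall x \ae mu, T 0 x = 0.
Proof.
have := cz_lin HT 1 (@L2fun0 R d E) (@L2fun0 R d E).
rewrite scaler0 addr0; apply: filterS => x; rewrite scale1r => T0.
by apply: (addrI (T 0 x)); rewrite addr0 -T0.
Qed.

(** [T] acts on representatives and is linear almost everywhere only, so each finite sum costs a
    null set. *)
Lemma cz_sum (I : eqType) (s : seq I) (f : I -> X -> E) :
  (forall i, L2fun mu normE (f i)) ->
  L2fun mu normE (\sum_(i <- s) f i) /\
  \forall x \ae mu, T (\sum_(i <- s) f i) x = \sum_(i <- s) T (f i) x.
Proof.
move=> Lf; elim: s => [|i s [IH1 IH2]].
  rewrite big_nil; split; first exact: L2fun0.
  by apply: filterS cz_T0 => x ->; rewrite big_nil.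
rewrite big_cons; split; first exact: L2funD.
have := cz_lin HT 1 (Lf i) IH1; rewrite scale1r.
by apply: filterS2 IH2 => x H ->; rewrite big_cons H scale1r.
Qed.

Lemma disjoint_sum (V : zmodType) (s : seq cellix) (v : cellix -> X -> V) x c :
  uniq s -> (forall c c', c \in s -> c' \in s -> cell c x -> cell c' x -> c = c') ->
  c \in s -> cell c x -> \sum_(c' <- s) cut (cell c') (v c') x = v c x.
Proof.
move=> us ds cs cx; rewrite (big_rem c)//= cutT// big1_seq ?addr0// => c' /andP[_].
rewrite mem_rem_uniq// !inE => /andP[/eqP c'c c's]; rewrite cutF// => c'x.
by apply: c'c; exact: ds c'x cx.
Qed.

Lemma disjoint_sum0 (V : zmodType) (s : seq cellix) (v : cellix -> X -> V) x :
  (forall c, c \in s -> ~ cell c x) -> \sum_(c' <- s) cut (cell c') (v c') x = 0.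
Proof.
move=> ns; rewrite big1_seq// => c /andP[_ cs]; rewrite cutF//; exact: ns.
Qed.

Lemma gstep_cell N (F : zmodType) (f : X -> F) c : (c.1 <= N)%N -> gstep a L N f ->
  gstep a L N (cut (cell c) f).
Proof. by move=> cN; rewrite -(nbr0 a L); exact: (gstep_nbr L0 0). Qed.

Lemma gstep_indic N c : (c.1 <= N)%N -> gstep a L N (\1_(cell c) : X -> R^o).
Proof.
move=> cN; apply: (gstep_refine L0 cN); exists (\sum_i `|c.2 i|)%N; split=> [x y xy|x].
  rewrite !indicE; congr ((_ : bool)%:R); apply/idP/idP => /set_mem /(cellP a L0) H;
    by apply/mem_set/(cellP a L0); rewrite -H xy.
rewrite indicE; case: (boolP (x \in cell c)) => // /set_mem /(cellP a L0) -> _ i.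
by rewrite (bigD1 i)//= leq_addr.
Qed.

Lemma cell_mean N f c : (c.1 <= N)%N -> gstep a L N (f : X -> E) -> exists (e : E) B,
  [/\ gstepB a L N B (cut (cell c) (f - cst e)), vint a L N B (cut (cell c) (f - cst e)) = 0 &
  (`|e|%:E * mu (cell c) <= \int[mu]_(x in cell c) `|f x|%:E)%E].
Proof.
move=> cN fs.
have [B1 fB1] := gstep_cell cN fs; have [B2 iB2] := gstep_indic cN.
pose B := maxn B1 B2.
have fB := gstepB_le (leq_maxl B1 B2) fB1.
have iB := gstepB_le (leq_maxr B1 B2) iB2.
have s0 : side c.1 ^+ d != 0 by rewrite expf_neq0// gt_eqF// side_gt0.
pose v := vint a L N B (cut (cell c) f); pose e := (side c.1 ^+ d)^-1 *: v.
have vi : vint a L N B (\1_(cell c) : X -> R^o) = side c.1 ^+ d.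
  apply: EFin_inj; rewrite -(gstep_integral L0 _ iB)//.
  rewrite integral_indic//; last exact: measurable_cell.
  by rewrite setIT [LHS](lebesgue_cell a L0).
have E1 : cut (cell c) (f - cst e) = (cut (cell c) f) - (fun x => (\1_(cell c) x : R) *: e).
  apply/funext => x; rewrite [RHS]/(_ - _) /= /cut indicE.
  by case: ifP => _; rewrite ?scale1r// scale0r; exact: (esym (subr0 _)).
have E2 z : (cut (cell c) (f - cst e)) z = (cut (cell c) f) z - (\1_(cell c) z : R) *: e.
  by rewrite E1.
exists e, B; split.
- split=> [x y xy|x]; rewrite !E2.
    have [fN _] := fB; have [iN _] := iB.
    by rewrite (fN _ _ xy) (iN _ _ xy).
  case: (pselect ((cut (cell c) f) x = 0)) => fx; last by move=> _; case: fB => _; exact.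
  case: (pselect (\1_(cell c) x = 0 :> R^o)) => ix; last by move=> _; case: iB => _; exact.
  by rewrite fx ix scale0r subr0.
- rewrite E1 /vint.
  transitivity (v - (vint a L N B (\1_(cell c) : X -> R^o)) *: e).
    rewrite /v /vint scaler_suml -sumrB; apply: eq_bigr => i _.
    by rewrite -[in RHS]scalerA -scalerBr.
  by rewrite vi scalerA divff// scale1r subrr.
rewrite [X in (_ * X)%E](lebesgue_cell a L0) -EFinM normrZ normfV.
rewrite (ger0_norm (_ : 0 <= side c.1 ^+ d)) ?exprn_ge0 ?side_ge0//.
rewrite mulrAC mulVf// mul1r.
apply: le_trans (bochner_norm (gstep_bochner L0 fB)) _.
rewrite [leRHS]integral_mkcond; apply: ae_le_integral => [x _|x _|].
- by rewrite lee_fin.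
- by apply: erestrict_ge0 => y _; rewrite lee_fin.
by apply: aeW => x _; rewrite patchE /cut; case: ifP => //; rewrite normr0.
Qed.

(** A cell of generation at most [N] that meets the support is an ancestor of one of the finitely
    many cells of generation [N] carrying it. *)
Lemma finite_cells N (F : zmodType) (f : X -> F) (q : set cellix) : gstep a L N f ->
  (forall c, q c -> (c.1 <= N)%N /\ exists2 y, cell c y & f y <> 0) ->
  exists2 s : seq cellix, uniq s & forall c, c \in s <-> q c.
Proof.
move=> [B [fN fB]] qN.
pose l := [seq (k, loc a L k (pt a L (N, decodeix e))) |
  k <- iota 0 N.+1, e <- enum {: {ffun 'I_d -> 'I_(B + B).+1}}].
exists (undup [seq c <- l | `[< q c >]]); first exact: undup_uniq.
move=> c; rewrite mem_undup mem_filter; split=> [/andP[/asboolP//]|qc].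
rewrite asboolT//=; have [cN [y cy fy]] := qN _ qc.
have [e He] := decodeix_surj L0 (fB _ fy).
apply/allpairsP; exists (c.1, e); split.
- by rewrite mem_iota.
- by rewrite mem_enum.
rewrite /=.
rewrite (cellE L0 cy) /=; congr (_, _); apply/esym; apply: (loc_nested L0 cN).
by rewrite (loc_pt a L0 (N, decodeix e)).
Qed.

Lemma markov_ereal (H : X -> \bar R) (l : R) : 0 < l ->
  measurable_fun setT H -> (forall x, 0 <= H x)%E ->
  measurable [set x | l%:E <= H x]%E /\
  (mu [set x | l%:E <= H x]%E <= l^-1%:E * \int[mu]_x H x)%E.
Proof.
move=> l0 mH H0; have mA : measurable [set x | l%:E <= H x]%E.
  rewrite -[X in measurable X]setTI.
  by apply: emeasurable_fun_c_infty => //.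
split=> //; rewrite -(lee_pdivrMl _ _ (_ : 0 < l^-1)) ?invr_gt0// invrK.
rewrite -integral_cst//.
apply: (@le_trans _ _ (\int[mu]_(x in [set x | l%:E <= H x]) H x)%E).
  apply: ge0_le_integral => //.
  - by move=> x _; rewrite lee_fin ltW.
  - exact: measurable_funTS.
by apply: ge0_subset_integral.
Qed.

Lemma integral_cut (A : set X) (phi : X -> R) :
  (\int[mu]_(x in A) (phi x)%:E = \int[mu]_x (cut A phi x)%:E)%E.
Proof.
by rewrite integral_mkcond; apply: eq_integral => x _; rewrite patchE /cut; case: ifP.
Qed.

Lemma integral_cut_cst (A : set X) (r : R) : measurable A ->
  (\int[mu]_x (cut A (cst r) x)%:E = r%:E * mu A)%E.
Proof. by move=> mA; rewrite -integral_cut; exact: (integral_cst mu mA r%:E). Qed.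

Lemma measurable_cut (A : set X) (phi : X -> R) : measurable A ->
  measurable_fun setT phi -> measurable_fun setT (cut A phi).
Proof.
move=> mA mphi; rewrite (_ : cut A phi = \1_A \* phi).
  by apply: measurable_funM => //; exact: measurable_indic.
by apply/funext => x; rewrite /cut /= indicE; case: ifP => _ /=; rewrite ?mul1r ?mul0r.
Qed.

(** The three terms bound three exceptional sets: Chebyshev for the good part at height [l / 2],
    Markov for the images of the bad parts off their dilates at height [l / 2], and the dilates of
    the selected cells. *)
Definition weak_const : R :=
  CT ^+ 2 * 2 ^+ (d + 3) + 4 * (5 ^+ d * D) + (1 + 2 * radius 0) ^+ d.

(* Calderon-Zygmund decomposition at height l, over a finite family of cells. *)
Lemma weak_type_cz N k0 (f : X -> E) (l : R) : 0 < l -> gstep a L N f ->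
  (forall c, c.1 = k0 -> \int[mu]_(x in cell c) `|f x|%:E <= l%:E * mu (cell c))%E ->
  exists A, [/\ measurable A, (mu A <= (weak_const / l)%:E * \int[mu]_x `|f x|%:E)%E &
    \forall x \ae mu, ~ A x -> `|T f x| <= l].
Proof.
move=> l0 /(gstep_refine L0 (leq_maxl N k0)); set N' := maxn N k0 => fs fk0.
have k0N : (k0 <= N')%N := leq_maxr N k0.
have sn := @seminorm_normr R E.
pose nf x : R := `|f x|.
have nf0 x : 0 <= nf x by exact: normr_ge0.
have [Bf nfB] : gstep a L N' nf := gstep_comp (Phi := Num.norm) (normr0 _) fs.
have mnf : measurable_fun setT nf := gstep_measurable L0 (Num.norm) fs.
have mcut c : measurable_fun setT (cut (cell c) nf).
  by apply: measurable_cut => //; exact: measurable_cell.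
set IE := (\int[mu]_x _)%E.
pose I : R := vint a L N' Bf (nf : X -> R^o).
have IEE : IE = I%:E by exact: (gstep_integral L0 nf0 nfB).
have I0 : 0 <= I.
  suff : (0 <= I%:E)%E by rewrite lee_fin.
  by rewrite -IEE; apply: integral_ge0 => y _; rewrite lee_fin.
have sd0 c : 0 < side c.1 ^+ d by rewrite exprn_gt0// side_gt0.
(* Generations finer than [N'] bring nothing new, as [f] is constant on cells of generation [N']. At
   generation [k0] the averages are at most [l], so every selected cell has a parent inside the
   range. *)
pose q := [set c | (k0 <= c.1 <= N')%N /\
  (l%:E * mu (cell c) < \int[mu]_(x in cell c) (nf x)%:E)%E].
have [s us sq] : exists2 s : seq cellix, uniq s & forall c, c \in s <-> maxcells a L q c.
  apply: (finite_cells fs) => c [[/andP[_ cN] qc] _]; split=> //.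
  apply: contrapT => nex; move: qc; rewrite ltNge => /negP; apply.
  rewrite integral0_eq => [|x cx]; first by apply: mule_ge0; rewrite ?lee_fin ?(ltW l0).
  by rewrite /nf; case: (pselect (f x = 0)) => [->|fx]; [rewrite normr0|case: nex; exists x].
have ds c c' x : c \in s -> c' \in s -> cell c x -> cell c' x -> c = c'.
  by move=> /sq cs /sq c's cx c'x; exact: (maxcells_eq L0 cs c's cx c'x).
have sN c : c \in s -> (c.1 <= N')%N by move=> /sq[[/andP[]]].
have slo c : c \in s -> ((side c.1 ^+ d)%:E <= l^-1%:E * \int[mu]_(x in cell c) (nf x)%:E)%E.
  move=> /sq[[_ /ltW H] _]; rewrite -(lee_pdivrMl _ _ (_ : 0 < l^-1)) ?invr_gt0// invrK.
  by move: H; rewrite [X in (_ * X)%E](lebesgue_cell a L0).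
have shi c : c \in s ->
    (\int[mu]_(x in cell c) (nf x)%:E <= (2 ^+ d * l * side c.1 ^+ d)%:E)%E.
  move=> /sq[[/andP[kc cN] qc] cmax].
  have {kc}kc : (k0 < c.1)%N.
    rewrite ltn_neqAle kc andbT; apply/eqP => /esym/fk0.
    by rewrite leNgt qc.
  have c1 : c.1 = c.1.-1.+1 by rewrite prednK// (leq_ltn_trans _ kc).
  have pc : (c.1.-1 <= c.1)%N by exact: leq_pred.
  have np := cmax c.1.-1; have pc1 : (c.1.-1 < c.1)%N by rewrite [X in (_ < X)%N]c1.
  have {}np := np pc1.
  have {}np : (\int[mu]_(x in cell (anc a L c.1.-1 c)) (nf x)%:E <=
      l%:E * mu (cell (anc a L c.1.-1 c)))%E.
    rewrite leNgt; apply/negP => H; apply: np => //; split=> //=.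
    by rewrite (leq_trans pc cN) andbT -ltnS -c1.
  apply: (@le_trans _ _ (\int[mu]_(x in cell (anc a L c.1.-1 c)) (nf x)%:E)%E).
    apply: ge0_subset_integral; rewrite ?lee_fin//.
    - exact: measurable_cell.
    - exact: measurable_cell.
    - by apply: measurable_funTS; exact/measurable_EFinP.
    - by move=> x _; rewrite lee_fin.
    - exact: cell_anc_sub.
  apply: le_trans np _; rewrite [X in (_ * X)%E](lebesgue_cell a L0) -EFinM lee_fin /=.
  rewrite -(side_half L c.1.-1 1) addn1 -c1 expr1 exprMn.
  by rewrite le_eqVlt; apply/orP; left; apply/eqP; ring.
have S1 : (\sum_(c <- s) \int[mu]_(x in cell c) (nf x)%:E <= I%:E)%E.
  rewrite -IEE; under eq_bigr do rewrite integral_cut.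
  rewrite -integral_sumE//; last by move=> c x; rewrite /cut; case: ifP.
  apply: le_integralE => x.
    by apply: sumr_ge0 => c _; rewrite /cut; case: ifP.
  case: (pselect (exists2 c, c \in s & cell c x)) => [[c cs cx]|none].
    by rewrite (disjoint_sum _ us (fun c c' => ds c c' x) cs cx).
  by rewrite disjoint_sum0// => c cs cx; apply: none; exists c.
have /choice[e /choice[B eB]] c : exists (e : E) B, c \in s ->
  [/\ gstepB a L N' B (cut (cell c) (f - cst e)), vint a L N' B (cut (cell c) (f - cst e)) = 0 &
  (`|e|%:E * mu (cell c) <= \int[mu]_(x in cell c) (nf x)%:E)%E].
  case: (boolP (c \in s)) => [cs|_]; last by exists 0, 0%N.
  by have [e [B H]] := cell_mean (sN _ cs) fs; exists e, B.
have e_le c : c \in s -> `|e c| <= 2 ^+ d * l.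
  move=> cs; have [_ _ H] := eB c cs; have := le_trans H (shi c cs).
  by rewrite [X in (_ * X)%E](lebesgue_cell a L0) -EFinM lee_fin ler_pM2r.
pose b c := cut (cell c) (f - cst (e c)).
have bs c : c \in s -> gstep a L N' (b c) by move=> cs; have [H _ _] := eB c cs; exists (B c).
(* [cz_sum] asks for square integrability at every index, hence the value 0 off the list. *)
pose bs' c := if c \in s then b c else 0.
have bsE : \sum_(c <- s) bs' c = \sum_(c <- s) b c.
  by apply: eq_big_seq => c cs; rewrite /bs' cs.
have Lbs c : L2fun mu normE (bs' c).
  rewrite /bs'; case: ifP => [cs|_]; last exact: L2fun0.
  exact: (gstep_L2fun L0 sn (bs c cs)).
have [Lb Tb] := cz_sum s Lbs; rewrite bsE in Lb Tb.
pose g := f - \sum_(c <- s) b c.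
have gE x : g x = f x - \sum_(c <- s) cut (cell c) (f - cst (e c)) x.
  by rewrite /g [LHS]/(_ - _) /= fct_sumE.
have g_in x c : c \in s -> cell c x -> g x = e c.
  move=> cs cx; rewrite gE (disjoint_sum _ us (fun c c' => ds c c' x) cs cx).
  by rewrite [(f - _) x]/(_ - _)/= opprB addrC subrK.
have g_out x : (forall c, c \in s -> ~ cell c x) -> g x = f x.
  by move=> ns; rewrite gE disjoint_sum0// subr0.
(* At generation [N'] the average of [|f|] over a cell is its value there; this stands in for
   Lebesgue differentiation. *)
have f_out x : (forall c, c \in s -> ~ cell c x) -> `|f x| <= l.
  move=> ns; pose c := (N', loc a L N' x).
  have nq : ~ q c.
    move=> qc; have [c' [qc' _ sub]] := maxcells_cover a L0 qc.
    by apply: (ns c'); [exact/sq|apply: sub; exact: cell_loc].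
  have : (\int[mu]_(x in cell c) (nf x)%:E <= l%:E * mu (cell c))%E.
    rewrite leNgt; apply/negP => H; apply: nq; split=> //=.
    by rewrite k0N leqnn.
  rewrite [X in (X <= _)%E](_ : _ = \int[mu]_(y in cell c) (cst (nf x)%:E) y)%E; last first.
    apply: eq_integral => y /set_mem /(cellP a L0)/= cy; congr EFin.
    by rewrite /nf; congr (`|_|); case: fs => B' [fN _]; exact: fN.
  rewrite integral_cst; last exact: measurable_cell.
  have mc := lebesgue_cell a L0 c; rewrite [X in (_ * X <= _)%E]mc [X in (_ <= _ * X)%E]mc.
  by rewrite -!EFinM lee_fin ler_pM2r.
have dich x : (exists2 c, c \in s & cell c x) \/ (forall c, c \in s -> ~ cell c x).
  case: (pselect (exists2 c, c \in s & cell c x)) => [|none]; first by left.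
  by right=> c cs cx; apply: none; exists c.
have two_d : 1 <= 2 ^+ d :> R by rewrite exprn_ege1// ler1n.
have g_le x : `|g x| <= 2 ^+ d * l.
  case: (dich x) => [[c cs cx]|ns]; first by rewrite (g_in _ _ cs cx) e_le.
  by rewrite g_out// (le_trans (f_out _ ns))// ler_peMl// ltW.
have gs : gstep a L N' g.
  rewrite /g; apply: gstepB0 => //.
  rewrite big_seq; apply: big_ind => [|u v us' vs|c cs]; last exact: bs.
    by exists 0%N; split=> // x; rewrite /=.
  exact: gstepD.
have Lg : L2fun mu normE g := gstep_L2fun L0 sn gs.
pose ec c : X -> R := cut (cell c) (cst `|e c|).
have ec0 c x : 0 <= ec c x by rewrite /ec /cut; case: ifP.
have mec c : measurable_fun setT (ec c).
  by apply: measurable_cut; [exact: measurable_cell|exact: measurable_cst].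
have iec c : c \in s -> (\int[mu]_x (ec c x)%:E <= \int[mu]_(x in cell c) (nf x)%:E)%E.
  move=> cs; have [_ _] := eB c cs; apply: le_trans.
  by rewrite [leLHS]integral_cut_cst//; exact: measurable_cell.
have g1 : (\int[mu]_x `|g x|%:E <= (2 * I)%:E)%E.
  apply: (@le_trans _ _ (\int[mu]_x (nf x + \sum_(c <- s) ec c x)%:E)%E).
    apply: le_integralE => [x|x]; first exact: normr_ge0.
    case: (dich x) => [[c cs cx]|ns]; last first.
      by rewrite g_out// lerDl sumr_ge0.
    rewrite (disjoint_sum (fun c => cst `|e c|) us (fun c c' => ds c c' x) cs cx).
    by rewrite (g_in _ _ cs cx) lerDr.
  rewrite integralDE//; last 2 first.
  - by move=> x; rewrite sumr_ge0.
  - exact: measurable_sum.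
  rewrite -/IE IEE mulr_natl mulr2n EFinD; apply: leeD => //; apply: le_trans S1.
  by rewrite integral_sumE// !big_seq; apply: lee_sum => c cs; exact: iec.
(* The good part is bounded by [2^d * l], so its square integral is at most this times its
   integral. *)
have g2 : (sqint mu normE g <= (2 ^+ d * l * (2 * I))%:E)%E.
  have [Bg gB] : gstep a L N' (fun x => `|g x| : R) := gstep_comp (Phi := Num.norm) (normr0 _) gs.
  have mg : measurable_fun setT (fun x => `|g x| : R) := gstep_measurable L0 (Num.norm) gs.
  have dl0 : 0 <= 2 ^+ d * l by rewrite mulr_ge0// ltW.
  apply: (@le_trans _ _ (\int[mu]_x (2 ^+ d * l * (`|g x| : R))%:E)%E).
    apply: le_integralE => x; first exact: sqr_ge0.
    by rewrite expr2 ler_wpM2r.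
  rewrite integralZE//; rewrite [in leRHS]EFinM; apply: lee_wpmul2l; [by rewrite lee_fin|exact: g1].
have l20 : 0 < l / 2 by rewrite divr_gt0.
have Tg2 : (sqint mu normE (T g) <= (CT ^+ 2 * (2 ^+ d * l * (2 * I)))%:E)%E.
  by apply: le_trans (cz_bound HT Lg) _; rewrite [leRHS]EFinM; apply: lee_wpmul2l; rewrite ?lee_fin ?sqr_ge0.
have [A1 [mA1 A1le A1P]] := chebyshev_sqint sn (proj1 (cz_L2 HT Lg)) l20 Tg2.
have /choice[H HP] c : exists H : X -> \bar R, [/\ measurable_fun setT H, forall x, (0 <= H x)%E &
    c \in s -> (\int[mu]_x H x <= (2 * (5 ^+ d * D))%:E * \int[mu]_(x in cell c) (nf x)%:E)%E /\
    \forall x \ae mu, ~ nbr (radius 0) c x -> (`|T (b c) x|%:E <= H x)%E].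
  case: (boolP (c \in s)) => [cs|_]; last first.
    by exists (cst 0%E); split=> //; exact: measurable_cst.
  have [bB bv _] := eB c cs.
  have bc y : ~ cell c y -> b c y = 0 by move=> cy; rewrite /b cutF.
  have [H [mH H0 H1 H2]] := atom_bound d_gt0 L0 HT bB bc bv.
  exists H; split=> // _; split=> //; apply: le_trans H1 _.
  rewrite (_ : (2 * (5 ^+ d * D))%:E = (5 ^+ d * D)%:E * 2%:E)%E; last by rewrite -EFinM mulrC.
  rewrite -muleA; apply: lee_wpmul2l.
    by rewrite lee_fin mulr_ge0 ?exprn_ge0// (cz_D0 HT).
  have cn0 x : 0 <= cut (cell c) nf x by rewrite /cut; case: ifP.
  apply: (@le_trans _ _ (\int[mu]_x (cut (cell c) nf x + ec c x)%:E)%E).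
    apply: le_integralE => x; first exact: normr_ge0.
    rewrite /ec /cut; case: ifP => _; last by rewrite normr0 addr0.
    by rewrite [(f - _) x]/(_ - _)/= -(normrN (e c)) ler_normD.
  rewrite integralDE// -(integral_cut (cell c) nf) (_ : 2%:E = 1 + 1)%E; last by rewrite -EFinD.
  rewrite ge0_muleDl// mul1e; apply: leeD => //; exact: iec.
pose Hs x : \bar R := (\sum_(c <- s) H c x)%E.
have Hs0 x : (0 <= Hs x)%E by apply: sume_ge0 => c _; case: (HP c).
have mHs : measurable_fun setT Hs by apply: emeasurable_sum => c; case: (HP c).
have HsI : (\int[mu]_x Hs x <= (2 * (5 ^+ d * D) * I)%:E)%E.
  rewrite /Hs ge0_integral_sum//; first last.
  - by move=> c x _; case: (HP c).
  - by move=> c; case: (HP c).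
  apply: (@le_trans _ _ (\sum_(c <- s) ((2 * (5 ^+ d * D))%:E *
      \int[mu]_(x in cell c) (nf x)%:E))%E).
    rewrite !big_seq; apply: lee_sum => c cs; have [_ _ /(_ cs)[]] := HP c; exact.
  have D0 : 0 <= 2 * (5 ^+ d * D) by rewrite !mulr_ge0 ?exprn_ge0// (cz_D0 HT).
  rewrite -ge0_sume_distrr; last by move=> c _; apply: integral_ge0 => x _; rewrite lee_fin.
  by rewrite [leRHS]EFinM; apply: lee_wpmul2l => //; rewrite lee_fin.
have [mA2 A2le] := markov_ereal l20 mHs Hs0; set A2 := mkset _ in mA2 A2le.
pose A3 := \bigcup_(c in [set c | c \in s]) nbr (radius 0) c.
have mA3 : measurable A3.
  by apply: bigcup_countType_measurable => c; exact: measurable_nbr.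
have A3le : (mu A3 <= ((1 + 2 * radius 0) ^+ d / l * I)%:E)%E.
  have K0 : 0 <= (1 + 2 * radius 0) ^+ d / l.
    by rewrite divr_ge0 ?(ltW l0)// exprn_ge0// addr_ge0// mulr_ge0// (ltW (radius_gt0 d_gt0 _)).
  have mphi : measurable_fun setT (fun x => ((1 + 2 * radius 0) ^+ d / l * nf x)%:E).
    by apply/measurable_EFinP; apply: measurable_funM => //; exact: measurable_cst.
  have phi0 x : (0 <= ((1 + 2 * radius 0) ^+ d / l * nf x)%:E)%E by rewrite lee_fin mulr_ge0.
  apply: (@le_trans _ _ (\int[mu]_x ((1 + 2 * radius 0) ^+ d / l * nf x)%:E)%E); last first.
    by rewrite integralZE// -/IE IEE.
  apply: (@le_trans _ _ (\int[mu]_(x in \bigcup_(c in [set c | c \in s]) cell c)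
      ((1 + 2 * radius 0) ^+ d / l * nf x)%:E)%E); last first.
    by apply: ge0_subset_integral => //; exact: measurable_cells.
  apply: le_measure_bigcup => //.
  - by move=> c; exact: measurable_cell.
  - by move=> c; exact: measurable_nbr.
  - by move=> c c' /= cs c's [x [cx c'x]]; exact: ds cx c'x.
  move=> c /= cs; rewrite [leLHS](lebesgue_nbr a L0 c (ltW (radius_gt0 d_gt0 0))).
  rewrite integral_cut (_ : (fun x => _) = (fun x => ((1 + 2 * radius 0) ^+ d / l * cut (cell c) nf x)%:E)); last first.
    by apply/funext => x; rewrite /cut; case: ifP; rewrite ?mulr0.
  rewrite integralZE//; last by move=> x; rewrite /cut; case: ifP.
  rewrite -integral_cut EFinM [in leRHS]EFinM -muleA; apply: lee_wpmul2l; last exact: slo.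
  by rewrite lee_fin exprn_ge0// addr_ge0// mulr_ge0// (ltW (radius_gt0 d_gt0 _)).
exists (A1 `|` A2 `|` A3); split.
- by apply: measurableU => //; exact: measurableU.
- apply: le_trans (measureU2 _ _ _) _ => //; first exact: measurableU.
  apply: (@le_trans _ _ ((mu A1 + mu A2) + mu A3)%E).
    by apply: leeD2r; apply: measureU2.
  rewrite [X in (_ <= _ * X)%E]IEE -EFinM.
  apply: le_trans (leeD (leeD A1le (le_trans A2le (lee_wpmul2l _ HsI))) A3le) _.
    by rewrite lee_fin invr_ge0 ltW.
  rewrite -EFinM -!EFinD lee_fin /weak_const exprD le_eqVlt; apply/orP; left; apply/eqP.
  by have := gt_eqF l0; move: (2 ^+ d : R) (5 ^+ d : R) ((1 + 2 * radius 0) ^+ d) => p5 p2 p3 /negbT ln0; field.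
have Tfg := cz_lin HT 1 Lb Lg.
rewrite scale1r (_ : \sum_(c <- s) b c + g = f) in Tfg; last by rewrite /g addrC subrK.
have Hall : \forall x \ae mu, forall c, c \in s -> ~ nbr (radius 0) c x -> (`|T (b c) x|%:E <= H c x)%E.
  by apply: ae_seq => c cs; have [_ _ /(_ cs)[]] := HP c.
apply: filterS2 Tfg (filterI Tb (filterI A1P Hall)) => x -> [-> [A1x Hx]] /not_orP[/not_orP[nA1 nA2] nA3].
rewrite scale1r; apply: le_trans (ler_normD _ _) _.
rewrite (splitr l); apply: lerD; last exact: A1x.
suff : (`|\sum_(c <- s) T (bs' c) x|%:E <= (l / 2)%:E)%E by rewrite lee_fin.
apply: le_trans (_ : Hs x <= _)%E; last first.
  by move/negP: nA2; rewrite -ltNge => /ltW.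
apply: (@le_trans _ _ (\sum_(c <- s) `|T (bs' c) x|%:E)%E).
  by rewrite sumEFin lee_fin ler_norm_sum.
rewrite /Hs !big_seq; apply: lee_sum => c cs; rewrite /bs' cs; apply: Hx => // cx.
by apply: nA3; exists c.
Qed.

End weak_type.

(** * Local oscillation *)

Section lerner_step.
Context {R : realType} {d : nat} {E : completeNormedModType R} (d_gt0 : (0 < d)%N).
Context (a : 'I_d -> R) (L : R) (L0 : 0 < L).
Context {T : (d.-tuple R -> E) -> d.-tuple R -> E}
  {K : d.-tuple R -> d.-tuple R -> {linear E -> E}}
  {omega : R -> R} {CT D : R} (HT : cz_bounds T K omega CT D).
Local Notation X := (d.-tuple R).
Local Notation mu := (lebesgue d).
Local Notation normE := (fun x : E => `|x|).
Local Notation cell := (cell a L).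
Local Notation nbr := (nbr a L).
Local Notation side := (side L).
Local Notation radius := (@radius R d).
Local Notation cellix := (nat * @gridix d)%type.
Implicit Types c : cellix.
Local Notation weak_const := (@weak_const R d CT D).

Lemma weak_const_ge0 : 0 <= weak_const.
Proof.
have r0 : 0 <= radius 0 := ltW (radius_gt0 d_gt0 0); have D0 := cz_D0 HT.
apply: addr_ge0; first apply: addr_ge0.
- by rewrite mulr_ge0 ?sqr_ge0 ?exprn_ge0.
- by rewrite !mulr_ge0 ?exprn_ge0.
- by rewrite exprn_ge0// addr_ge0// mulr_ge0.
Qed.

Lemma cz_sub f g : L2fun mu normE f -> L2fun mu normE g ->
  L2fun mu normE (f - g) /\ \forall x \ae mu, T (f - g) x = T f x - T g x.
Proof.
move=> Lf Lg; have LN : L2fun mu normE (- g) by rewrite -scaleN1r; exact: L2funZ.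
split; first by rewrite -scaleN1r addrC; exact: L2funD (L2funZ _ Lg) Lf.
have := cz_lin HT (-1) Lg Lf; rewrite scaleN1r addrC.
by apply: filterS => x ->; rewrite scaleN1r addrC.
Qed.

(** One half and one quarter do not fill the cell, even with a null set added. *)
Lemma cell_point c (A B : set X) (P : X -> Prop) : measurable A -> measurable B ->
  (mu (A `&` cell c) <= 2^-1%:E * mu (cell c))%E -> (mu B <= 4^-1%:E * mu (cell c))%E ->
  (\forall x \ae mu, P x) -> exists x, [/\ cell c x, ~ A x, ~ B x & P x].
Proof.
move=> mA mB Ac Bc [G [mG G0 PG]]; apply: contrapT => none.
have mc := measurable_cell a L c.
have sub : cell c `<=` (A `&` cell c) `|` (B `|` G).
  move=> x cx; apply: contrapT => nx; apply: none; exists x.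
  split; [exact: cx|by move=> Ax; apply: nx; left|by move=> Bx; apply: nx; right; left|].
  by apply: contrapT => nP; apply: nx; right; right; apply: PG.
have mBG : measurable (B `|` G) by exact: measurableU.
have mU : measurable ((A `&` cell c) `|` (B `|` G)).
  by apply: measurableU => //; exact: measurableI.
have G0' : (mu G <= 0)%E by rewrite le_eqVlt; apply/orP; left; apply/eqP; exact: G0.
have : (mu (cell c) <= 2^-1%:E * mu (cell c) + 4^-1%:E * mu (cell c))%E.
  apply: (@le_trans _ _ (mu ((A `&` cell c) `|` (B `|` G)))).
    exact: le_mu.
  apply: le_trans (measureU2 _ _ _) _ => //; first exact: measurableI.
  apply: leeD => //; apply: le_trans (measureU2 _ _ _) _ => //.
  by rewrite -[leRHS]adde0; apply: leeD.
rewrite [X in (X <= _)%E](lebesgue_cell a L0) [X in (_ <= _ * X + _)%E](lebesgue_cell a L0).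
rewrite [X in (_ <= _ + _ * X)%E](lebesgue_cell a L0) -!EFinM -EFinD lee_fin.
have : 0 < side c.1 ^+ d by rewrite exprn_gt0// side_gt0.
by move: (side c.1 ^+ d) => s s0; lra.
Qed.

(** The far part of [g] has an image of small oscillation on the cell. Its size is therefore
    controlled by its value at one point where both [T g] and the image of the near part are small;
    such a point exists because both exceptional sets are small. *)
Lemma cell_oscillation N c (g : X -> E) (M B : R) (A : set X) : 0 < M -> (c.1 <= N)%N ->
  gstep a L N g -> 0 <= B ->
  (forall k, \int[mu]_(y in nbr (radius k.+1) c) `|g y|%:E <=
     (M * (radius k * side c.1) ^+ d)%:E)%E ->
  measurable A -> (mu (A `&` cell c) <= 2^-1%:E * mu (cell c))%E ->
  (\forall x \ae mu, ~ A x -> `|T g x| <= B) ->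
  \forall x \ae mu, cell c x -> `|T g x - T (cut (nbr (radius 0) c) g) x| <=
     (D + 4 * (weak_const + 1) * (2 * d)%:R ^+ d) * M + B.
Proof.
move=> M0 cN gs B0 gM mA Ac TgB; set w := cut _ _.
have sn := @seminorm_normr R E.
have rE : radius 0 = (2 * d)%:R by rewrite radius.unlock mul1n.
have ws : gstep a L N w by rewrite /w rE; exact: (gstep_nbr L0).
have Lg : L2fun mu normE g := gstep_L2fun L0 sn gs.
have Lw : L2fun mu normE w := gstep_L2fun L0 sn ws.
have [Lv Tv] := cz_sub Lg Lw.
have r0 : 0 < radius 0 := radius_gt0 d_gt0 0.
have sd0 : 0 < side c.1 ^+ d by rewrite exprn_gt0// side_gt0.
pose J := M * (2 * d)%:R ^+ d.
have J0 : 0 < J by rewrite mulr_gt0// exprn_gt0// -rE.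
have wI : (\int[mu]_y `|w y|%:E <= (J * side c.1 ^+ d)%:E)%E.
  apply: (@le_trans _ _ (\int[mu]_(y in nbr (radius 1) c) `|g y|%:E)%E); last first.
    by apply: le_trans (gM 0%N) _; rewrite exprMn rE mulrA.
  rewrite (integral_cut (nbr (radius 1) c) (fun y => `|g y|)).
  apply: le_integralE => y; first exact: normr_ge0.
  rewrite /w /cut; case: ifPn => [/set_mem y0|_]; last by rewrite normr0; case: ifP.
  by have /mem_set -> := nbr_radius_sub L0 (leq0n 1) y0.
(* At this height the weak type bound leaves an exceptional set of at most a quarter of the cell;
   moreover [l >= J], so the averages over cells of the generation of [c] are below the height. *)
pose l := 4 * (weak_const + 1) * J.
have wc := weak_const_ge0.
have l0 : 0 < l by rewrite mulr_gt0// mulr_gt0// ltr_wpDl.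
have [A2 [mA2 A2le A2P]] : exists A2, [/\ measurable A2,
    (mu A2 <= (weak_const / l)%:E * \int[mu]_x `|w x|%:E)%E &
    \forall x \ae mu, ~ A2 x -> `|T w x| <= l].
  apply: (weak_type_cz d_gt0 L0 HT (k0 := c.1)) ws _ => // c' c'c.
  apply: (@le_trans _ _ (\int[mu]_y `|w y|%:E)%E).
    rewrite (integral_cut (cell c') (fun y => `|w y|)).
    apply: le_integralE => y; rewrite /cut; case: ifP => //; by rewrite normr_ge0.
  apply: le_trans wI _; rewrite [X in (_ <= _ * X)%E](lebesgue_cell a L0) c'c -EFinM lee_fin.
  by rewrite ler_wpM2r ?(ltW sd0)// /l ler_peMl ?(ltW J0)//; lra.
have A2c : (mu A2 <= 4^-1%:E * mu (cell c))%E.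
  apply: le_trans A2le _; rewrite [X in (_ <= _ * X)%E](lebesgue_cell a L0).
  apply: (@le_trans _ _ ((weak_const / l)%:E * (J * side c.1 ^+ d)%:E)%E).
    by apply: lee_wpmul2l => //; rewrite lee_fin divr_ge0// ltW.
  rewrite -!EFinM lee_fin mulrA ler_wpM2r ?(ltW sd0)//.
  have w1 : 0 < weak_const + 1 by rewrite ltr_wpDl.
  have -> : weak_const / l * J = weak_const / (4 * (weak_const + 1)).
    have aux (u j : R) : 0 < u + 1 -> 0 < j -> u / (4 * (u + 1) * j) * j = u / (4 * (u + 1)).
      by move=> u1 j0; field; rewrite !gt_eqF.
    exact: aux.
  by rewrite ler_pdivrMr ?mulr_gt0//; lra.
have vs : gstep a L N (g - w) by exact: gstepB0.
have gwE y : (g - w) y = g y - w y by [].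
have v0 y : nbr (radius 0) c y -> (g - w) y = 0.
  by move=> ny; rewrite gwE /w cutT// subrr.
have vM k : (\int[mu]_(y in nbr (radius k.+1) c) `|(g - w) y|%:E <=
     (M * (radius k * side c.1) ^+ d)%:E)%E.
  apply: le_trans (gM k); rewrite (integral_cut _ (fun y => `|(g - w) y|)).
  rewrite (integral_cut _ (fun y => `|g y|)).
  apply: le_integralE => y; rewrite /cut; case: ifP => // _.
  rewrite gwE /w /cut; case: ifP => _; last by rewrite subr0.
  by rewrite subrr normr0.
have [P PT Posc] := far_oscillation d_gt0 L0 HT vs v0 vM.
have [x' [cx' nA nA2 [[Px' Ex'] [/(_ nA) gx' /(_ nA2) wx']]]] :=
  cell_point mA mA2 Ac A2c (filterI (filterI PT Tv) (filterI TgB A2P)).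
apply: filterS2 PT Tv => x Px Ex cx; rewrite -Ex.
have vx' : `|T (g - w) x'| <= B + l.
  by rewrite Ex'; apply: le_trans (ler_normB _ _) _; exact: lerD.
have := Posc _ _ cx cx' Px Px'.
have : `|T (g - w) x| <= `|T (g - w) x - T (g - w) x'| + `|T (g - w) x'|.
  by rewrite -{1}(subrK (T (g - w) x') (T (g - w) x)) ler_normD.
move: vx'; rewrite /l /J; move: (_%:R ^+ d) weak_const => k v.
by move: (`|_ - _|) (`|_|) (`|_|) => p q r; nra.
Qed.

Lemma le_integral_on (A B : set X) (phi psi : X -> R) : A `<=` B ->
  (forall x, 0 <= phi x) -> (forall x, phi x <= psi x) ->
  (\int[mu]_(x in A) (phi x)%:E <= \int[mu]_(x in B) (psi x)%:E)%E.
Proof.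
move=> AB phi0 pp; rewrite (integral_cut A phi) (integral_cut B psi).
apply: le_integralE => x; first by rewrite /cut; case: ifP.
rewrite /cut; case: ifPn => [/set_mem/AB/mem_set -> //|_].
by case: ifP => // _; exact: le_trans (pp x).
Qed.

Lemma mu_bigsetU_le (I : Type) (s : seq I) (A : I -> set X) : (forall i, measurable (A i)) ->
  (mu (\big[setU/set0]_(i <- s) A i) <= \sum_(i <- s) mu (A i))%E.
Proof.
move=> mA; elim: s => [|i s IH]; first by rewrite !big_nil measure0.
rewrite !big_cons; apply: le_trans (measureU2 _ _ _) _ => //; last exact: leeD.
exact: bigsetU_measurable.
Qed.

(** Each generation upwards doubles the side, so [radius k.+1] sides of [c] are [2 * d] sides of the
    ancestor [k.+1] generations above. *)
Lemma nbr_radius_anc k c : (k < c.1)%N ->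
  nbr (radius k.+1) c `<=` nbr (2 * d)%:R (anc a L (c.1 - k.+1) c).
Proof.
move=> kc x cx i; have /andP[H1 H2] := cx i.
have le : (c.1 - k.+1 <= c.1)%N by exact: leq_subr.
have sub : cell c `<=` cell (anc a L (c.1 - k.+1) c) by exact: cell_anc_sub.
have [K1 K2] := cell_corner L0 sub le i.
have sE : radius k.+1 * side c.1 = (2 * d)%:R * side (anc a L (c.1 - k.+1) c).1.
  rewrite /= -(side_half L (c.1 - k.+1) k.+1) subnK// radius.unlock natrM natrX.
  by move: (2 ^+ k.+1 : R) ((2 * d)%:R : R) => p q; ring.
have e : (1 + 2 * radius k.+1) * side c.1 = side c.1 + 2 * (radius k.+1 * side c.1) by ring.
rewrite sE in H1; rewrite e sE in H2.
by apply/andP; split; lra.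
Qed.

Lemma integral_scaled_indic (A D' : set X) (r : R) : 0 <= r -> measurable A -> measurable D' ->
  (\int[mu]_(x in D') (r * \1_A x)%:E = r%:E * mu (A `&` D'))%E.
Proof.
move=> r0 mA mD; rewrite (integral_cut D' (fun x => r * \1_A x)).
rewrite (_ : (fun x => _) = (fun x => (r * \1_(A `&` D') x)%:E)); last first.
  apply/funext => x; rewrite /cut !indicE in_setI.
  by case: ifP => _; rewrite ?andbT// andbF mulr0.
rewrite integralZE//; last by apply: measurable_indic; exact: measurableI.
by rewrite integral_indic ?setIT//; exact: measurableI.
Qed.

(** Divided by this number, the [n] weak type constants and the constant of the dilated maximal
    function together make at most [2^-(d+2)]. *)
Definition stop_const n : R :=
  2 ^+ (d + 2) * (n%:R * weak_const + (1 + 2 * (2 * d)%:R) ^+ d) + 1.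

(** The constant of [cell_oscillation] with averages at most [(1 + 4d)^d * stop_const n * F] and
    [T u] bounded by [stop_const n * F]. *)
Definition lerner_const n : R :=
  (D + 4 * (weak_const + 1) * (2 * d)%:R ^+ d) *
    ((1 + 2 * (2 * d)%:R) ^+ d * stop_const n) + stop_const n.

Lemma stop_const_ge1 n : 1 <= stop_const n.
Proof.
rewrite /stop_const lerDr mulr_ge0 ?exprn_ge0// addr_ge0 ?mulr_ge0 ?weak_const_ge0//.
Qed.

(* The exceptional set E, where T u or the maximal function of u exceeds a large
   multiple of F, is small; the selected cells are the maximal ones in which E has
   density more than 2^-(d+1), so that their parents meet the complement of E. *)
Lemma lerner_step n N (u : X -> 'I_n -> E) q0 (F : R) : 0 < F ->
  (forall i, gstep a L N (u ^~ i)) ->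
  (\int[mu]_x (\sum_i `|u x i|)%:E <= F%:E * mu (cell q0))%E ->
  exists Sel : set cellix,
  [/\ forall c, Sel c -> cell c `<=` cell q0 /\ (q0.1 < c.1)%N,
      trivIset Sel cell,
      (mu (\bigcup_(c in Sel) cell c) <= 2^-1%:E * mu (cell q0))%E,
      \forall x \ae mu, cell q0 x -> ~ (\bigcup_(c in Sel) cell c) x ->
        forall i, `|T (u ^~ i) x| <= lerner_const n * F &
      forall c, Sel c -> \forall x \ae mu, cell c x -> forall i,
        `|T (u ^~ i) x - T (cut (nbr (radius 0) c) (u ^~ i)) x| <= lerner_const n * F].
Proof.
move=> F0 us uF; pose nu x : R := \sum_i `|u x i|.
have nu0 x : 0 <= nu x by exact: sumr_ge0.
have u_nu i x : `|u x i| <= nu x by rewrite /nu (bigD1 i)//= lerDl sumr_ge0.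
have mnu : measurable_fun setT nu.
  by apply: measurable_sum => i; exact: (gstep_measurable L0 (Num.norm) (us i)).
pose La := stop_const n; have La1 : 1 <= La := stop_const_ge1 n.
have La0 : 0 < La by lra.
pose tt : R := (1 + 2 * (2 * d)%:R) ^+ d.
have tt0 : 1 <= tt by rewrite exprn_ege1// lerDl mulr_ge0.
have sd0 c : 0 < side c.1 ^+ d by rewrite exprn_gt0// side_gt0.
have l0 : 0 < La * F by rewrite mulr_gt0.
have wc := weak_const_ge0.
have mcE c : mu (cell c) = (side c.1 ^+ d)%:E := lebesgue_cell a L0 c.
have uFE : (\int[mu]_x (nu x)%:E <= (F * side q0.1 ^+ d)%:E)%E.
  by apply: le_trans uF _; rewrite [X in (_ * X)%E]mcE.
have /choice[E1 E1P] i : exists A, [/\ measurable A,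
    (mu A <= (weak_const / La * side q0.1 ^+ d)%:E)%E &
    \forall x \ae mu, ~ A x -> `|T (u ^~ i) x| <= La * F].
  have [|A [mA Ale AP]] := weak_type_cz d_gt0 L0 HT (k0 := q0.1) l0 (us i) _.
    move=> c cq; apply: (@le_trans _ _ (\int[mu]_(x in setT) (nu x)%:E)%E).
      by apply: le_integral_on => // x; exact: normr_ge0.
    apply: le_trans uFE _; rewrite [X in (_ * X)%E]mcE cq -EFinM lee_fin.
    by rewrite ler_wpM2r ?(ltW (sd0 _))// ler_peMl// ltW.
  exists A; split=> //; apply: le_trans Ale _.
  apply: (@le_trans _ _ ((weak_const / (La * F))%:E * (F * side q0.1 ^+ d)%:E)%E).
    apply: lee_wpmul2l; first by rewrite lee_fin divr_ge0// ltW.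
    by apply: le_trans uFE; apply: le_integralE => x; [exact: normr_ge0|exact: u_nu].
  rewrite -EFinM lee_fin mulrA ler_wpM2r ?(ltW (sd0 _))// invfM mulrA mulfVK//.
  by rewrite gt_eqF.
(* The factor [tt] is the ratio of the measures of the dilate and the cell: the condition says that
   the average of [nu] over the dilate exceeds [La * F]. *)
pose E2 := \bigcup_(c in [set c | (tt * (La * F))%:E * mu (cell c) <
        \int[mu]_(x in nbr (2 * d)%:R c) (nu x)%:E]%E) cell c.
have mE2 : measurable E2 by exact: measurable_cells.
have E2le : (mu E2 <= (tt / La * side q0.1 ^+ d)%:E)%E.
  have mnuE : measurable_fun setT (EFin \o nu) by exact/measurable_EFinP.
  apply: le_trans (weak_type_maximal a L0 (2 * d) l0 mnuE _) _.
    by move=> x; rewrite lee_fin.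
  apply: (@le_trans _ _ ((tt / (La * F))%:E * (F * side q0.1 ^+ d)%:E)%E).
    by apply: lee_wpmul2l => //; rewrite lee_fin divr_ge0// ?(ltW l0)//; lra.
  rewrite -EFinM lee_fin mulrA ler_wpM2r ?(ltW (sd0 _))// invfM mulrA mulfVK//.
  by rewrite gt_eqF.
pose E1u := \big[setU/set0]_(i <- index_enum 'I_n) E1 i.
have mE1 i : measurable (E1 i) by case: (E1P i).
have mE1u : measurable E1u by exact: bigsetU_measurable.
have inE1 i x : E1 i x -> E1u x.
  by move=> E1x; rewrite /E1u -bigcup_seq; exists i => //=; rewrite mem_index_enum.
pose EE := E1u `|` E2.
have mEE : measurable EE by exact: measurableU.
have EEle : (mu EE <= (2^-1 ^+ (d + 2) * side q0.1 ^+ d)%:E)%E.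
  apply: le_trans (measureU2 _ _ _) _ => //.
  apply: (@le_trans _ _ (\sum_(i <- index_enum 'I_n) (weak_const / La * side q0.1 ^+ d)%:E
      + (tt / La * side q0.1 ^+ d)%:E)%E).
    apply: leeD => //; apply: le_trans (mu_bigsetU_le _ _) _ => //.
    by apply: lee_sum => i _; case: (E1P i).
  rewrite sumEFin sumr_const cardE enumT -enumT -cardE card_ord.
  rewrite -EFinD lee_fin -mulrnAl -mulrDl ler_wpM2r ?(ltW (sd0 _))//.
  rewrite -mulrnAl -mulrDl ler_pdivrMr// exprVn ler_pdivlMl ?exprn_gt0//.
  by rewrite /La /stop_const -/tt mulr_natl lerDl.
pose q := [set c | [/\ (q0.1 <= c.1)%N, cell c `<=` cell q0 &
  ((2^-1 ^+ d.+1)%:E * mu (cell c) < mu (EE `&` cell c))%E]].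
pose Sel := maxcells a L q.
(* The exceptional set has at most the proportion [2^-(d+2)] of [q0], below the threshold
   [2^-(d+1)], so [q0] is not selected and selected cells have a parent inside it. *)
have nq0 c : c.1 = q0.1 -> cell c `<=` cell q0 -> ~ q c.
  move=> cq _ [_ _]; apply/negP; rewrite -leNgt.
  apply: (@le_trans _ _ (mu EE)).
    by apply: le_mu => //; apply: measurableI => //; exact: measurable_cell.
  apply: le_trans EEle _; rewrite [X in (_ * X)%E]mcE cq -EFinM lee_fin.
  rewrite ler_wpM2r ?(ltW (sd0 _))// addn2 exprS ler_piMl ?exprn_ge0 ?invr_ge0//.
  by rewrite invf_le1// ler1n.
have mc c := measurable_cell a L c.
have Sq c : Sel c -> [/\ (q0.1 < c.1)%N, cell c `<=` cell q0 &
    ((2^-1 ^+ d.+1)%:E * mu (cell c) < mu (EE `&` cell c))%E].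
  move=> [[qc cq dc] _]; split=> //; rewrite ltn_neqAle qc andbT; apply/eqP => qcE.
  exact: (nq0 c (esym qcE) cq).
exists Sel; split.
- by move=> c /Sq[].
- exact: trivIset_maxcells.
- have p0 : 0 <= 2 ^+ d.+1 :> R by exact: exprn_ge0.
  apply: (@le_trans _ _ (\int[mu]_(x in \bigcup_(c in Sel) cell c) (2 ^+ d.+1 * \1_EE x)%:E)%E).
    apply: le_measure_bigcup => //.
    - apply/measurable_EFinP; apply: measurable_funM; first exact: measurable_cst.
      exact: measurable_indic.
    - exact: trivIset_maxcells.
    move=> c /Sq[_ _ /ltW]; rewrite integral_scaled_indic//.
    by rewrite exprVn lee_pdivrMl// exprn_gt0.
  apply: (@le_trans _ _ ((2 ^+ d.+1)%:E * mu EE)%E).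
    rewrite integral_scaled_indic//; last exact: measurable_cells.
    apply: lee_wpmul2l; first by rewrite lee_fin.
    by apply: le_mu => //; apply: measurableI => //; exact: measurable_cells.
  rewrite [X in (_ <= _ * X)%E]mcE.
  apply: le_trans (lee_wpmul2l _ EEle) _; first by rewrite lee_fin.
  rewrite -!EFinM lee_fin mulrA ler_wpM2r ?(ltW (sd0 _))// addn2 (exprS _ d.+1) mulrCA.
  by rewrite -exprMn divff// expr1n mulr1.
(* Outside the selected cells no cell reaches the threshold density, so by [cell_density] the rest
   of the exceptional set is null. *)
- pose G := EE `\` \bigcup_(c in Sel) cell c.
  have mG : measurable G by apply: measurableD => //; exact: measurable_cells.
  have th1 : 0 <= (2^-1 ^+ d.+1 : R) < 1.
    by rewrite exprn_ge0 ?invr_ge0//= exprn_ilt1 ?invr_ge0// invf_lt1// ltr1n.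
  have G0 : mu (G `&` cell q0) = 0%E.
    apply: (cell_density L0 mG th1) => c qc cq.
    case: (pselect (q c)) => [Qc|nQc].
      have -> : G `&` cell c = set0.
        apply/seteqP; split=> // x [[_ nS] cx]; apply: nS.
        by rewrite (bigcup_maxcells a L0 q); exists c.
      by rewrite measure0 mule_ge0// lee_fin; case/andP: th1.
    apply: (@le_trans _ _ (mu (EE `&` cell c))).
      by apply: le_mu; [exact: measurableI|exact: measurableI|move=> x [[]]].
    by rewrite leNgt; apply/negP => dc; apply: nQc.
  have Gn : \forall x \ae mu, ~ (G `&` cell q0) x.
    exists (G `&` cell q0); split=> //; first exact: measurableI.
    by move=> x /= nx; apply: contrapT.
  have E1all := ae_seq (s := index_enum 'I_n) (fun i _ => let: And3 _ _ H := E1P i in H).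
  apply: filterS2 Gn E1all => x nG H qx nS i.
  apply: (@le_trans _ _ (La * F)).
    apply: H; rewrite ?mem_index_enum// => E1x.
    by apply: nG; split=> //; split=> //; left; exact: inE1 E1x.
  rewrite ler_wpM2r ?(ltW F0)// /lerner_const -/La lerDr.
  by rewrite mulr_ge0 ?addr_ge0 ?mulr_ge0 ?(cz_D0 HT) ?exprn_ge0//; lra.
move=> c Sc; have [qc cq dc] := Sq _ Sc.
have c1 : c.1 = c.1.-1.+1 by rewrite prednK// (leq_ltn_trans _ qc).
have pc : (c.1.-1 <= c.1)%N by exact: leq_pred.
set p := anc a L c.1.-1 c.
have px : cell p (pt a L c) by apply: cell_anc_sub => //; exact: cell_pt.
have pq : cell p `<=` cell q0.
  apply: (cell_sub L0 _ (cq _ (cell_pt a L0 c)) px); by rewrite /p /= -ltnS -c1.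
have EEp : (mu (EE `&` cell p) <= (2^-1 ^+ d.+1)%:E * mu (cell p))%E.
  rewrite leNgt; apply/negP => dp; have [_ cmax] := Sc.
  by apply: (cmax c.1.-1); [rewrite [X in (_ < X)%N]c1|split=> //=; rewrite -ltnS -c1].
have pE : ((2^-1 ^+ d.+1)%:E * mu (cell p) = (2^-1 * side c.1 ^+ d)%:E)%E.
  rewrite [X in (_ * X)%E]mcE /p /= -(side_half L c.1.-1 1) addn1 -c1 expr1 -EFinM.
  congr EFin; rewrite exprMn exprS exprVn.
  have : (2 ^+ d : R) != 0 by rewrite expf_neq0.
  by move: (2 ^+ d : R) (side c.1 ^+ d) => v w v0; field.
(* The point is taken in the parent, not in [c]: the first dilate that has to be controlled fits
   into the dilate of the parent, and every ancestor needed contains [y]. *)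
have [y [py nEy _ _]] : exists y, [/\ cell p y, ~ EE y, ~ (@set0 X) y & True].
  apply: (cell_point (P := fun=> True) mEE measurable0) => //.
  - apply: le_trans EEp _; apply: lee_wpmul2r => //; rewrite lee_fin exprS ler_piMr ?invr_ge0//.
    by rewrite exprn_ile1 ?invr_ge0// invf_le1// ler1n.
  - by rewrite measure0 mule_ge0.
  - exact: aeW.
have EEc : (mu (EE `&` cell c) <= 2^-1%:E * mu (cell c))%E.
  apply: (@le_trans _ _ (mu (EE `&` cell p))).
    apply: le_mu; [exact: measurableI|exact: measurableI|].
    by move=> x [Ex cx]; split=> //; apply: cell_anc_sub cx.
  by apply: le_trans EEp _; rewrite pE [X in (_ * X)%E]mcE -EFinM.
have nuM k : (\int[mu]_(x in nbr (radius k.+1) c) (nu x)%:E <=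
    (tt * La * F * (radius k * side c.1) ^+ d)%:E)%E.
  have rk : 2 ^+ k.+1 <= radius k.
    by rewrite radius.unlock -natrX ler_nat expnSr leq_mul2l leq_pmulr// orbT.
  case: (ltnP k c.1) => kc.
    apply: (@le_trans _ _ (\int[mu]_(x in nbr (2 * d)%:R (anc a L (c.1 - k.+1) c)) (nu x)%:E)%E).
      by apply: le_integral_on => //; exact: nbr_radius_anc.
    have ay : cell (anc a L (c.1 - k.+1) c) y.
      have le1 : (c.1 - k.+1 <= c.1)%N by exact: leq_subr.
      have ax : cell (anc a L (c.1 - k.+1) c) (pt a L c).
        by apply: cell_anc_sub => //; exact: cell_pt.
      by apply: (cell_sub L0 _ ax px) => //=; rewrite -subn1 leq_sub2l.
    apply: (@le_trans _ _ ((tt * (La * F))%:E * mu (cell (anc a L (c.1 - k.+1) c)))%E).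
      rewrite leNgt; apply/negP => H; apply: nEy; right.
      by exists (anc a L (c.1 - k.+1) c).
    rewrite [X in (_ * X)%E]mcE -EFinM lee_fin mulrA ler_wpM2l//.
      by rewrite !mulr_ge0//; lra.
    rewrite lerXn2r ?nnegrE ?mulr_ge0 ?(side_ge0 L0) ?(ltW (radius_gt0 d_gt0 _))//=.
    rewrite -(side_half L (c.1 - k.+1) k.+1) subnK// mulrC ler_wpM2r//.
    exact: side_ge0.
  (* Here the ancestor would be coarser than generation 0; but [radius k] sides of [c] are then at
     least a side of generation 0, and the total mass suffices. *)
  apply: (@le_trans _ _ (\int[mu]_(x in setT) (nu x)%:E)%E).
    exact: le_integral_on.
  apply: le_trans uFE _; rewrite lee_fin.
  apply: ler_pM; [exact: ltW|exact: ltW| |].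
    by rewrite ler_peMl ?(ltW F0)// mulr_ege1.
  rewrite lerXn2r ?nnegrE ?mulr_ge0 ?(side_ge0 L0) ?(ltW (radius_gt0 d_gt0 _))//=.
  apply: (@le_trans _ _ (side 0)); first exact: side_anti.
  rewrite -(side_half L 0 c.1) add0n mulrC ler_wpM2r ?side_ge0//.
  apply: le_trans rk; apply: (@le_trans _ _ (2 ^+ k)); last by rewrite exprS ler_peMl ?exprn_ge0// ler1n.
  by apply: ler_weXn2l => //; rewrite ler1n.
have Call : \forall x \ae mu, forall i, i \in index_enum 'I_n -> cell c x ->
    `|T (u ^~ i) x - T (cut (nbr (radius 0) c) (u ^~ i)) x| <= lerner_const n * F.
  apply: ae_seq => i _.
  have M0 : 0 < tt * La * F by rewrite mulr_gt0// mulr_gt0//; lra.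
  have gs := gstep_refine L0 (leq_maxl N c.1) (us i).
  have [_ _ Ti] := E1P i.
  have Ti' : \forall x \ae mu, ~ EE x -> `|T (u ^~ i) x| <= La * F.
    by apply: filterS Ti => x H nE; apply: H => /inE1 ?; apply: nE; left.
  have uM k : (\int[mu]_(x in nbr (radius k.+1) c) `|u x i|%:E <=
      (tt * La * F * (radius k * side c.1) ^+ d)%:E)%E.
    apply: le_trans (nuM k).
    apply: le_integral_on => // x; exact: normr_ge0.
  have := cell_oscillation M0 (leq_maxr N c.1) gs (ltW l0) uM mEE EEc Ti'.
  apply: filterS => x H cx; apply: le_trans (H cx) _.
  rewrite /lerner_const -/La -/tt le_eqVlt; apply/orP; left; apply/eqP.
  by move: (_%:R ^+ d) => v; ring.
apply: filterS Call => x H cx i; exact: H (mem_index_enum i) cx.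
Qed.

End lerner_step.

(** * Dyadic maximal functions *)

Section maximal_power.
Context {R : realType} {d : nat} (a : 'I_d -> R) (L : R) (L0 : 0 < L).
Local Notation X := (d.-tuple R).
Local Notation mu := (lebesgue d).
Local Notation cell := (cell a L).
Local Notation nbr := (nbr a L).
Local Notation side := (side L).
Local Notation cellix := (nat * @gridix d)%type.
Implicit Types c : cellix.

(** The convexity bound for [2^-x] on the unit interval, obtained from Young's inequality with
    exponents [1/x] and [1/(1-x)]. It makes the geometric series below sum with the factor
    [2 / x]. *)
Lemma half_powR_le (x : R) : 0 < x -> x <= 1 -> 2^-1 `^ x <= 1 - x / 2.
Proof.
move=> x0; rewrite le_eqVlt => /orP[/eqP ->|x1]; first by rewrite powRr1 ?invr_ge0//; lra.
have p0 : 0 < x^-1 by rewrite invr_gt0.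
have q0 : 0 < (1 - x)^-1 by rewrite invr_gt0 subr_gt0.
have := @conjugate_powR R (2^-1 `^ x) 1 x^-1 (1 - x)^-1 (powR_ge0 _ _) ler01 p0 q0.
rewrite !invrK => /(_ (subrKC _ _)); rewrite mulr1 powR1 -powRrM divff ?gt_eqF//.
by rewrite powRr1 ?invr_ge0// mul1r; lra.
Qed.

Lemma dyadic_sum (x e : R) (K : nat) : 0 < x -> x <= 1 -> 0 < e ->
  \sum_(k < K.+1) (2 ^+ k * e) `^ x <= 2 / x * (2 ^+ K * e) `^ x.
Proof.
move=> x0 x1 e0; have x20 : 0 < 2 / x by rewrite divr_gt0.
have h : 1 <= 2 / x * (1 - 2^-1 `^ x).
  by rewrite mulrAC ler_pdivlMr// mul1r; have := half_powR_le x0 x1; lra.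
elim: K => [|K IH].
  rewrite big_ord1 ler_peMl ?powR_ge0// ler_pdivlMr// mul1r; lra.
rewrite big_ord_recr /=; apply: le_trans (lerD IH (lexx _)) _.
have -> : 2 ^+ K * e = 2^-1 * (2 ^+ K.+1 * e) by rewrite exprS !mulrA mulVf// mul1r.
rewrite [X in _ / _ * X + _]powRM ?invr_ge0 ?mulr_ge0 ?exprn_ge0 ?(ltW e0)//.
by have := powR_ge0 (2 ^+ K.+1 * e) x; move: (_ `^ x) (_ `^ x) h => p q h q0; nra.
Qed.

Lemma dyadic_level_sum (x e y : R) (K : nat) : 0 < x -> x <= 1 -> 0 < e -> 0 <= y ->
  \sum_(k < K) (if 2 ^+ k * e < y then (2 ^+ k * e) `^ x else 0) <= 2 / x * y `^ x.
Proof.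
move=> x0 x1 e0 y0; have x20 : 0 <= 2 / x by rewrite divr_ge0 ?ltW.
elim: K => [|K IH]; first by rewrite big_ord0 mulr_ge0 ?powR_ge0.
case: (ltrP (2 ^+ K * e) y) => Ky; last first.
  by rewrite big_ord_recr /= ltNge Ky addr0.
apply: (@le_trans _ _ (\sum_(k < K.+1) (2 ^+ k * e) `^ x)).
  by apply: ler_sum => k _; case: ifP => // _; exact: powR_ge0.
apply: le_trans (dyadic_sum K x0 x1 e0) _; rewrite ler_wpM2l//.
by rewrite ge0_ler_powR ?nnegrE ?mulr_ge0 ?exprn_ge0 ?(ltW e0) ?(ltW x0) ?(ltW Ky).
Qed.

Lemma seq_lower_bound (I : eqType) (s : seq I) (y : I -> R) :
  exists2 e, 0 < e & forall i, i \in s -> 0 < y i -> e < y i.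
Proof.
elim: s => [|i s [e e0 He]]; first by exists 1.
case: (ltrP 0 (y i)) => yi; last first.
  exists e => // j; rewrite inE => /orP[/eqP ->|]; last exact: He.
  by rewrite ltNge yi.
exists (Num.min e (y i / 2)); first by rewrite lt_min e0 divr_gt0.
move=> j; rewrite inE => /orP[/eqP -> _|js yj].
  by rewrite gt_min; apply/orP; right; lra.
by rewrite gt_min He.
Qed.

Lemma seq_upper_bound (I : eqType) (s : seq I) (y : I -> R) :
  exists M, forall i, i \in s -> y i <= M.
Proof.
elim: s => [|i s [M HM]]; first by exists 0.
exists (Num.max M (y i)) => j; rewrite inE => /orP[/eqP ->|js].
  by rewrite le_max lexx orbT.
by rewrite le_max HM.
Qed.

Lemma disjoint_measure_le (I : eqType) (s : seq I) (P : pred I) (A : I -> set X) (B : set X) :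
  uniq s -> (forall i, measurable (A i)) -> measurable B ->
  (forall i j x, i \in s -> j \in s -> A i x -> A j x -> i = j) ->
  (forall i, i \in s -> P i -> A i `<=` B) ->
  (\sum_(i <- s | P i) mu (A i) <= mu B)%E.
Proof.
move=> us mA mB dA AB; pose ch (C : set X) x : R := \1_C x.
have E C : measurable C -> (\int[mu]_x (ch C x)%:E = mu C)%E.
  by move=> mC; rewrite integral_indic// setIT.
rewrite -big_filter; set s' := seq.filter P s.
under eq_bigr do rewrite -E//.
rewrite -E// -integral_sumE; first last.
- by move=> i; exact: measurable_indic.
- by move=> i x; rewrite /ch indicE.
apply: le_integralE => x; first by apply: sumr_ge0 => i _; rewrite /ch indicE.
case: (pselect (exists2 i, i \in s' & A i x)) => [[i is' Aix]|none]; last first.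
  rewrite big1_seq; first by rewrite /ch indicE.
  move=> i /andP[_ is']; rewrite /ch indicE memNset// => Aix.
  by apply: none; exists i.
have [Pi si] : P i /\ i \in s by move: is'; rewrite mem_filter => /andP[].
rewrite (big_rem i)//= big1_seq ?addr0.
  by rewrite /ch !indicE !mem_set//; exact: AB si Pi _ Aix.
move=> j /andP[_]; rewrite mem_rem_uniq ?filter_uniq// !inE => /andP[/eqP ji].
rewrite mem_filter => /andP[_ js]; rewrite /ch indicE memNset// => Ajx.
by apply: ji; exact: dA js si Ajx Aix.
Qed.

(* Marcinkiewicz interpolation, with dyadic levels, between the weak type estimate
   for the averages and their trivial bound by the supremum. *)
Lemma maximal_power (t : nat) (phi : X -> R) (s : seq cellix) (A : cellix -> set X)
    (y : cellix -> R) (x : R) : 0 < x -> x <= 1 ->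
  measurable_fun setT phi -> (forall z, 0 <= phi z) -> uniq s ->
  (forall c, measurable (A c)) -> (forall c, A c `<=` cell c) ->
  (forall c c' z, c \in s -> c' \in s -> A c z -> A c' z -> c = c') ->
  (forall c, c \in s -> 0 <= y c /\
    ((y c)%:E * mu (cell c) <= \int[mu]_(z in nbr t%:R c) (phi z)%:E)%E) ->
  (\sum_(c <- s) (y c `^ (1 + x))%:E * mu (A c) <=
   (32 * (1 + 2 * t%:R) ^+ d ^+ 3 / x)%:E * \int[mu]_z (phi z `^ (1 + x))%:E)%E.
Proof.
move=> x0 x1 mphi phi0 us mA Ac dA yP.
have [tt ttE] : exists tt : R, tt = (1 + 2 * t%:R) ^+ d by exists ((1 + 2 * t%:R) ^+ d).
rewrite -ttE; have tt1 : 1 <= tt by rewrite ttE exprn_ege1// lerDl mulr_ge0.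
have tt0 : 0 < tt by lra.
(* Finiteness of the family gives a positive number below all positive [y c] and a bound above all
   of them, so finitely many dyadic levels suffice. *)
have [e e0 He] := seq_lower_bound s y; have [M HM] := seq_upper_bound s y.
have [e1 e1E] : exists e1, e1 = e / (2 * tt) by exists (e / (2 * tt)).
have e10 : 0 < e1 by rewrite e1E divr_gt0// mulr_gt0.
have [la laE] : exists la : nat -> R, forall k, la k = 2 ^+ k * e1.
  by exists (fun k => 2 ^+ k * e1).
have la0 k : 0 < la k by rewrite laE mulr_gt0// exprn_gt0.
have laS k : la k.+1 = 2 * la k by rewrite !laE exprS mulrA.
have [K HK] : exists K : nat, M <= 2 * tt * la K.
  exists (Num.trunc (M / (2 * tt * e1))).+1.
  have tte : 0 < 2 * tt * e1 by rewrite mulr_gt0// mulr_gt0.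
  rewrite laE mulrCA -ler_pdivrMr//.
  apply: (@le_trans _ _ (Num.trunc (M / (2 * tt * e1))).+1%:R).
    by apply: ltW; rewrite truncnS_gt.
  by rewrite -natrX ler_nat ltnW// ltn_expl.
have mcE c : mu (cell c) = (side c.1 ^+ d)%:E := lebesgue_cell a L0 c.
(* A value between [2 * tt * la J] and twice this contributes its power through the single term [J];
   since [1 + x <= 2], the constant is at most [(4 * tt)^2]. *)
have y_le c : c \in s -> y c `^ (1 + x) <=
    \sum_(k < K) (if 2 * tt * la k < y c then (4 * tt) ^+ 2 * la k `^ (1 + x) else 0).
  move=> cs; have [yc0 _] := yP _ cs.
  have sum0 (J : nat) : 0 <= \sum_(k < J) (if 2 * tt * la k < y c then (4 * tt) ^+ 2 * la k `^ (1 + x) else 0).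
    by apply: sumr_ge0 => k _; case: ifP => // _; rewrite mulr_ge0 ?sqr_ge0 ?powR_ge0.
  have x10 : 0 <= 1 + x by lra.
  move: yc0; rewrite le_eqVlt => /orP[/eqP <-|yc0].
    rewrite powR0; last by rewrite gt_eqF//; lra.
    by apply: sumr_ge0 => k _; case: ifP => // _; rewrite mulr_ge0 ?sqr_ge0 ?powR_ge0.
  have yK : y c <= 2 * tt * la K by exact: le_trans (HM _ cs) HK.
  elim: (K) yK => [|J IH] yK.
    have := He _ cs yc0; rewrite ltNge; move: yK; rewrite laE expr0 mul1r e1E.
    by rewrite mulrC divfK ?gt_eqF ?mulr_gt0// => ->.
  case: (ltrP (2 * tt * la J) (y c)) => yJ; last first.
    by apply: le_trans (IH yJ) _; rewrite big_ord_recr /= lerDl ltNge yJ.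
  rewrite big_ord_recr /= yJ; apply: (@le_trans _ _ ((4 * tt) ^+ 2 * la J `^ (1 + x))); last first.
    rewrite lerDr; exact: sum0.
  apply: (@le_trans _ _ ((4 * tt * la J) `^ (1 + x))).
    rewrite ge0_ler_powR ?nnegrE ?(ltW yc0) ?mulr_ge0 ?(ltW tt0) ?(ltW (la0 _))//.
    by apply: le_trans yK _; rewrite laS; lra.
  rewrite powRM ?mulr_ge0 ?(ltW tt0) ?(ltW (la0 _))// ler_wpM2r ?powR_ge0//.
  rewrite -powR_mulrn ?mulr_ge0 ?(ltW tt0)// ler_powR; lra.
pose hi k z : R := if la k < phi z then phi z else 0.
have mhi k : measurable_fun setT (hi k).
  by apply: measurable_fun_ifT => //; apply: measurable_fun_ltr => //; exact: measurable_cst.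
have hi0 k z : 0 <= hi k z by rewrite /hi; case: ifP.
(* The part of [phi] below [la k] contributes at most [tt * la k], half of the lower bound for
   [y c]; the other half must come from [hi k], to which the weak type bound applies. *)
have wk k : (\sum_(c <- s | (2 * tt * la k < y c)%R) mu (A c) <=
    (tt / la k)%:E * \int[mu]_z (hi k z)%:E)%E.
  have mhiE : measurable_fun setT (EFin \o hi k) by exact/measurable_EFinP.
  rewrite ttE.
  apply: le_trans (weak_type_maximal a L0 t (la0 k) mhiE _); last by move=> z; rewrite lee_fin.
  apply: disjoint_measure_le => //; first exact: measurable_cells.
  move=> c cs; rewrite -ttE => yk z Az; exists c; last exact: Ac.
  rewrite /= [X in (_ * X < _)%E]mcE -EFinM.
  have [yc0 yc] := yP _ cs; rewrite [X in (_ * X <= _)%E]mcE -EFinM in yc.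
  have sd0 : 0 < side c.1 ^+ d by rewrite exprn_gt0// side_gt0.
  have le : (\int[mu]_(w in nbr t%:R c) (phi w)%:E <=
      (la k * (tt * side c.1 ^+ d))%:E + \int[mu]_(w in nbr t%:R c) (hi k w)%:E)%E.
    rewrite (integral_cut (nbr t%:R c) phi) (integral_cut (nbr t%:R c) (hi k)).
    have mn := measurable_nbr a L t%:R c.
    apply: (@le_trans _ _ (\int[mu]_w (cut (nbr t%:R c) (cst (la k)) w + cut (nbr t%:R c) (hi k) w)%:E)%E).
      apply: le_integralE => w; rewrite /cut; case: ifP => //; rewrite ?addr0// => _.
      rewrite /hi /=; case: ltrP => lp; last by rewrite addr0.
      by rewrite lerDr; exact: (ltW (la0 k)).
    rewrite integralDE//; first last.
    - exact: measurable_cut.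
    - by apply: measurable_cut => //; exact: measurable_cst.
    - by move=> w; rewrite /cut; case: ifP.
    - by move=> w; rewrite /cut; case: ifP => // _; exact: (ltW (la0 k)).
    apply: leeD => //; rewrite integral_cut_cst// [X in (_ * X)%E](lebesgue_nbr a L0 c (ler0n _ t)).
    by rewrite -EFinM ttE.
  have {}le := le_trans yc le.
  case: (\int[mu]_(w in nbr t%:R c) (hi k w)%:E)%E le => [v| |]; last by [].
    by rewrite -EFinD !lee_fin !lte_fin; move: (side c.1 ^+ d) sd0 yk => sd sd0 yk; nra.
  by rewrite ltry.
have la1 k : 0 <= la k `^ (1 + x) by exact: powR_ge0.
apply: (@le_trans _ _ (\sum_(k < K) ((4 * tt) ^+ 2 * la k `^ (1 + x))%:E *
    \sum_(c <- s | (2 * tt * la k < y c)%R) mu (A c))%E).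
  apply: (@le_trans _ _ (\sum_(c <- s) \sum_(k < K)
      (if 2 * tt * la k < y c then (4 * tt) ^+ 2 * la k `^ (1 + x) else 0)%:E * mu (A c))%E).
    rewrite !big_seq; apply: lee_sum => c cs; rewrite -ge0_sume_distrl; last first.
      by move=> k _; case: ifP => // _; rewrite lee_fin mulr_ge0 ?sqr_ge0.
    by rewrite sumEFin; apply: lee_wpmul2r => //; rewrite lee_fin y_le.
  rewrite exchange_big /=; apply: lee_sum => k _; rewrite ge0_sume_distrr//.
  rewrite [leRHS]big_mkcond /=; apply: lee_sum => c _.
  by case: ifP => // _; rewrite mul0e.
apply: (@le_trans _ _ (\sum_(k < K) (16 * tt ^+ 3)%:E * \int[mu]_z (la k `^ x * hi k z)%:E)%E).
  apply: lee_sum => k _; rewrite integralZE ?powR_ge0//.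
  apply: le_trans (lee_wpmul2l _ (wk k)) _; first by rewrite lee_fin mulr_ge0 ?sqr_ge0.
  rewrite !muleA -!EFinM le_eqVlt; apply/orP; left; apply/eqP; congr (_%:E * _)%E.
  have -> : la k `^ (1 + x) = la k * la k `^ x.
    by rewrite powRD ?(gt_eqF (la0 k)) ?implybT// powRr1// ltW.
  have := gt_eqF (la0 k); move: (la k) (_ `^ x) => l lx /negbT l0.
  by rewrite /GRing.exp /=; field.
rewrite -ge0_sume_distrr; last by move=> k _; apply: integral_ge0 => z _; rewrite lee_fin mulr_ge0 ?powR_ge0.
rewrite -integral_sumE; first last.
- by move=> k; apply: measurable_funM => //; exact: measurable_cst.
- by move=> k z; rewrite mulr_ge0 ?powR_ge0.
have -> : 32 * tt ^+ 3 / x = 16 * tt ^+ 3 * (2 / x) by field; rewrite gt_eqF.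
rewrite [in leRHS]EFinM -muleA; apply: lee_wpmul2l; first by rewrite lee_fin mulr_ge0 ?exprn_ge0// ltW.
rewrite -integralZE ?divr_ge0 ?(ltW x0)//; first last.
- by apply: (measurableT_comp (measurable_powR _)).
- by move=> z; exact: powR_ge0.
apply: le_integralE => z; first by apply: sumr_ge0 => k _; rewrite mulr_ge0 ?powR_ge0.
have -> : \sum_(k < K) la k `^ x * hi k z =
    phi z * \sum_(k < K) (if la k < phi z then la k `^ x else 0).
  by rewrite mulr_sumr; apply: eq_bigr => k _; rewrite /hi; case: ifP; rewrite ?mulr0// mulrC.
have := phi0 z; rewrite le_eqVlt => /orP[/eqP <-|p0].
  by rewrite mul0r mulr_ge0 ?powR_ge0// divr_ge0// ltW.
have -> : phi z `^ (1 + x) = phi z * phi z `^ x.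
  by rewrite powRD ?(gt_eqF p0) ?implybT// powRr1// ltW.
rewrite mulrCA ler_wpM2l//; under eq_bigr do rewrite laE.
exact: dyadic_level_sum.
Qed.

End maximal_power.

(** * The reverse Hoelder inequality *)

Section stopping_sets.
Context {R : realType} {d : nat} (a : 'I_d -> R) (L : R) (L0 : 0 < L).
Local Notation X := (d.-tuple R).
Local Notation mu := (lebesgue d).
Local Notation cell := (cell a L).
Local Notation nbr := (nbr a L).
Local Notation side := (side L).
Local Notation cellix := (nat * @gridix d)%type.
Implicit Types c : cellix.

(** This ratio of consecutive levels makes the next stopping set fill at most half of each maximal
    cell, the two factors [(1 + 2t)^d] being lost in the weak type bound. The undilated case [t = 0]
    serves the reverse Hoelder inequality, [t = 1] the derivation of A_infinity from A_2. *)
Definition stop_ratio (t : nat) : R := 4 * ((1 + 2 * t%:R) ^+ d) ^+ 2 * 2 ^+ d.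

Definition stop_level (t : nat) (wb : R) (j : nat) : R := stop_ratio t ^+ j * wb.

Definition stop_cells (t : nat) (w : X -> R) (q0 : cellix) (wb : R) (j : nat) : set cellix :=
  [set c | [/\ (q0.1 <= c.1)%N, cell c `<=` cell q0 &
    ((stop_level t wb j)%:E * mu (cell c) <= \int[mu]_(x in nbr t%:R c) (w x)%:E)%E]].

Definition stop_set t w q0 wb j : set X := \bigcup_(c in stop_cells t w q0 wb j) cell c.

Lemma cell_eq_gen c c' : c.1 = c'.1 -> cell c `<=` cell c' -> c = c'.
Proof.
case: c c' => [k m] [k' m'] /= <- sub; have := sub _ (cell_pt a L0 (k, m)).
by move=> /(cellP a L0)/= <-; rewrite (loc_pt a L0 (k, m)).
Qed.

Context (t : nat) (w : X -> R) (q0 : cellix) (wb : R).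
Hypothesis mw : measurable_fun setT w.
Hypothesis w0 : forall x, 0 <= w x.
Hypothesis wsup : forall x, ~ cell q0 x -> w x = 0.
Hypothesis wb0 : 0 < wb.
Hypothesis wq0 : (\int[mu]_x (w x)%:E = wb%:E * mu (cell q0))%E.

Local Notation tt := ((1 + 2 * t%:R) ^+ d : R).
Local Notation ratio := (stop_ratio t).
Local Notation level := (stop_level t wb).
Local Notation q := (stop_cells t w q0 wb).
Local Notation Om := (stop_set t w q0 wb).

Lemma tt_ge1 : 1 <= tt. Proof. by rewrite exprn_ege1// lerDl mulr_ge0. Qed.

Lemma stop_ratio_ge2 : 2 <= ratio.
Proof.
have := tt_ge1; have : 1 <= 2 ^+ d :> R by rewrite exprn_ege1// ler1n.
rewrite /stop_ratio; move: (2 ^+ d : R) tt => u v u1 v1.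
have : 1 <= v ^+ 2 by rewrite exprn_ege1.
by move: (v ^+ 2) => z z1; nra.
Qed.

Lemma stop_level_gt0 j : 0 < level j.
Proof. by rewrite mulr_gt0// exprn_gt0//; have := stop_ratio_ge2; lra. Qed.

Lemma stop_levelS j : level j.+1 = ratio * level j.
Proof. by rewrite /stop_level exprS -mulrA. Qed.

Lemma stop_level0 : level 0 = wb. Proof. by rewrite /stop_level expr0 mul1r. Qed.

Lemma measurable_stop_set j : measurable (Om j). Proof. exact: measurable_cells. Qed.

Lemma stop_setE j : Om j = \bigcup_(c in maxcells a L (q j)) cell c.
Proof. by rewrite bigcup_maxcells. Qed.

Lemma stop_set_sub j : Om j `<=` cell q0.
Proof. by move=> x [c [_ sub _] cx]; exact: sub. Qed.

Lemma stop_cells_le i j : (i <= j)%N -> q j `<=` q i.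
Proof.
move=> ij; rewrite -(subnKC ij); elim: (j - i)%N => [|k IH]; rewrite ?addn0// addnS => c [qc cq Hc].
apply: IH; split=> //; apply: le_trans Hc; apply: lee_wpmul2r => //; rewrite lee_fin stop_levelS.
by rewrite ler_peMl ?(ltW (stop_level_gt0 _))//; have := stop_ratio_ge2; lra.
Qed.

Lemma stop_set_le i j : (i <= j)%N -> Om j `<=` Om i.
Proof. by move=> ij x [c /(stop_cells_le ij) qc cx]; exists c. Qed.

Lemma integral_nbr_q0 : (\int[mu]_(x in nbr t%:R q0) (w x)%:E = wb%:E * mu (cell q0))%E.
Proof.
rewrite -wq0 (integral_cut (nbr t%:R q0) w); congr (integral _ _ _); apply/funext => x.
rewrite /cut; case: ifPn => // /negP nx; rewrite wsup// => qx; apply: nx.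
by apply/mem_set/(cell_sub_nbr L0 _ qx).
Qed.

Lemma stop_set0 : Om 0 = cell q0.
Proof.
apply/seteqP; split; first exact: stop_set_sub.
move=> x qx; exists q0 => //; split=> //; rewrite stop_level0 integral_nbr_q0//.
Qed.

Lemma le_integral_w (A B : set X) : measurable A -> measurable B -> A `<=` B ->
  (\int[mu]_(x in A) (w x)%:E <= \int[mu]_(x in B) (w x)%:E)%E.
Proof. by move=> mA mB AB; exact: le_integral_on. Qed.

(** The parent of a maximal cell misses the level, has measure [2^d] times larger, and its dilate
    contains that of the cell. The root has no parent in the range, but its mean is exactly [wb]. *)
Lemma stop_cells_upper j c : maxcells a L (q j) c ->
  (\int[mu]_(x in nbr t%:R c) (w x)%:E <= (2 ^+ d * level j)%:E * mu (cell c))%E.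
Proof.
move=> [[qc cq Hc] cmax].
have two_d : 1 <= 2 ^+ d :> R by rewrite exprn_ege1// ler1n.
move: (qc); rewrite leq_eqVlt => /orP[/eqP qcE|{}qc].
  rewrite (cell_eq_gen (esym qcE) cq) integral_nbr_q0; apply: lee_wpmul2r => //.
  rewrite lee_fin /stop_level mulrA ler_peMl ?(ltW wb0)// mulr_ege1// exprn_ege1//.
  by have := stop_ratio_ge2; lra.
have c1 : c.1 = c.1.-1.+1 by rewrite prednK// (leq_ltn_trans _ qc).
have pc : (c.1.-1 <= c.1)%N by exact: leq_pred.
set p := anc a L c.1.-1 c.
have px : cell p (pt a L c) by apply: cell_anc_sub => //; exact: cell_pt.
have qp : (q0.1 <= p.1)%N by rewrite /p /= -ltnS -c1.
have pq : cell p `<=` cell q0 := cell_sub L0 qp (cq _ (cell_pt a L0 c)) px.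
have pE : mu (cell p) = ((2 ^+ d)%:E * mu (cell c))%E.
  rewrite [LHS](lebesgue_cell a L0) [X in (_ * X)%E](lebesgue_cell a L0).
  by rewrite /p /= -(side_half L c.1.-1 1) addn1 -c1 expr1 -EFinM exprMn mulrC.
have : (\int[mu]_(x in nbr t%:R p) (w x)%:E <= (level j)%:E * mu (cell p))%E.
  rewrite leNgt; apply/negP => /ltW H; apply: (cmax c.1.-1); first by rewrite [X in (_ < X)%N]c1.
  by split.
rewrite [X in (_ <= _ * X)%E]pE muleA -EFinM (mulrC (level j)); apply: le_trans.
apply: le_integral_w; [exact: measurable_nbr|exact: measurable_nbr|].
by apply: nbr_sub => //; exact: cell_anc_sub.
Qed.

Lemma stop_cells_nested i j c c' x : (i <= j)%N -> maxcells a L (q i) c -> q j c' ->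
  cell c x -> cell c' x -> (c.1 <= c'.1)%N /\ cell c' `<=` cell c.
Proof.
move=> ij mc /(stop_cells_le ij) qc' cx c'x.
have [c'' [mc'' c''c' sub]] := maxcells_cover a L0 qc'.
have -> : c = c'' by exact: maxcells_eq mc mc'' cx (sub _ c'x).
by [].
Qed.

(** Only the restriction of [w] to the dilate of [c] matters inside [c]; the weak type bound at the
    next level then compares with the upper bound at this level. *)
Lemma stop_set_half j c : maxcells a L (q j) c ->
  (mu (Om j.+1 `&` cell c) <= 2^-1%:E * mu (cell c))%E.
Proof.
move=> mc; have t0 := tt_ge1.
pose phi x := (cut (nbr t%:R c) w x)%:E.
have mphi : measurable_fun setT phi.
  by apply/measurable_EFinP; apply: measurable_cut => //; exact: measurable_nbr.
have phi0 x : (0 <= phi x)%E by rewrite lee_fin /cut; case: ifP.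
pose l := level j.+1 / (2 * tt).
have l0 : 0 < l by rewrite divr_gt0 ?stop_level_gt0// mulr_gt0//; lra.
apply: (@le_trans _ _ ((tt / l)%:E * \int[mu]_x phi x)%E).
  apply: le_trans (weak_type_maximal a L0 t l0 mphi phi0).
  apply: le_mu; first by apply: measurableI; [exact: measurable_stop_set|exact: measurable_cell].
    exact: measurable_cells.
  move=> x [[c' qc' c'x] cx]; exists c' => //=.
  have [cc' sub] := stop_cells_nested (leqnSn j) mc qc' cx c'x.
  have [_ _ Hc'] := qc'.
  have -> : (\int[mu]_(x in nbr t%:R c') phi x = \int[mu]_(x in nbr t%:R c') (w x)%:E)%E.
    apply: eq_integral => z /set_mem c'z; rewrite /phi cutT//.
    by apply: nbr_sub sub cc' _ c'z.
  apply: lt_le_trans Hc'; rewrite [X in (_ * X < _)%E](lebesgue_cell a L0).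
  rewrite [X in (_ < _ * X)%E](lebesgue_cell a L0) -!EFinM lte_fin.
  rewrite ltr_pM2r ?exprn_gt0 ?side_gt0// /l.
  have -> : tt * (level j.+1 / (2 * tt)) = level j.+1 / 2.
    by field; rewrite gt_eqF//; lra.
  by have := stop_level_gt0 j.+1; lra.
rewrite /phi -integral_cut; apply: le_trans (lee_wpmul2l _ (stop_cells_upper mc)) _.
  by rewrite lee_fin divr_ge0 ?(ltW l0)//; lra.
rewrite muleA -EFinM; apply: lee_wpmul2r => //; rewrite lee_fin /l stop_levelS /stop_ratio.
rewrite le_eqVlt; apply/orP; left; apply/eqP.
have : (2 ^+ d : R) != 0 by rewrite expf_neq0.
have := gt_eqF (stop_level_gt0 j); move: (2 ^+ d : R) (level j) tt t0 => u v z z1 /negbT v0 u0.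
have z0 : z != 0 by rewrite gt_eqF//; lra.
by field; rewrite v0 u0 z0.
Qed.

Lemma stop_set_diff_ge j c : maxcells a L (q j) c ->
  (mu (cell c) <= 2%:E * mu (cell c `\` Om j.+1))%E.
Proof.
move=> mc; have := stop_set_half mc.
have mcc := measurable_cell a L c; have mO := measurable_stop_set j.+1.
have cE := lebesgue_cell a L0 c.
have fin B : measurable B -> B `<=` cell c -> (mu B \is a fin_num)%E.
  move=> mB Bc; have H : (mu B <= mu (cell c))%E by exact: le_mu.
  by rewrite ge0_fin_numE//; apply: (le_lt_trans H); rewrite [ltLHS]cE ltry.
have E : (mu (cell c) = mu (Om j.+1 `&` cell c) + mu (cell c `\` Om j.+1))%E.
  rewrite setIC -measureU//; first by rewrite setUIDK.
  - exact: measurableI.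
  - exact: measurableD.
  - by apply/seteqP; split=> // x [[_ H] [_]].
move: E; rewrite [X in (X = _ -> _)]cE [X in (_ -> X <= _)%E]cE [X in (_ -> _ <= _ * X -> _)%E]cE.
have f1 := fin _ (measurableI _ _ mO mcc) (@subIsetr _ _ _).
have f2 := fin _ (measurableD mcc mO) (@subDsetl _ _ _).
rewrite -(fineK f1) -(fineK f2) -EFinD => -[E].
by rewrite -!EFinM !lee_fin; lra.
Qed.

Lemma stop_set_small j : (mu (Om j) <= ((tt * 2 * tt) * (side q0.1 ^+ d) / ratio ^+ j)%:E)%E.
Proof.
have t0 := tt_ge1.
have mphi : measurable_fun setT (EFin \o w) by exact/measurable_EFinP.
pose l := level j / (2 * tt).
have l0 : 0 < l by rewrite divr_gt0 ?stop_level_gt0// mulr_gt0//; lra.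
apply: (@le_trans _ _ ((tt / l)%:E * \int[mu]_x (w x)%:E)%E).
  apply: le_trans (weak_type_maximal a L0 t l0 mphi _); last by move=> x; rewrite lee_fin.
  apply: le_mu; [exact: measurable_stop_set|exact: measurable_cells|].
  move=> x [c qc cx]; exists c => //=; have [_ _ Hc] := qc; apply: lt_le_trans Hc.
  rewrite [X in (_ * X < _)%E](lebesgue_cell a L0).
  rewrite [X in (_ < _ * X)%E](lebesgue_cell a L0) -!EFinM lte_fin.
  rewrite ltr_pM2r ?exprn_gt0 ?side_gt0// /l.
  have -> : tt * (level j / (2 * tt)) = level j / 2.
    by field; rewrite gt_eqF//; lra.
  by have := stop_level_gt0 j; lra.
rewrite wq0 [X in (_ * (_ * X) <= _)%E](lebesgue_cell a L0) -!EFinM lee_fin.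
rewrite le_eqVlt; apply/orP; left; apply/eqP; rewrite /l /stop_level.
have r0 : 0 < ratio ^+ j by rewrite exprn_gt0//; have := stop_ratio_ge2; lra.
move: (gt_eqF r0) (gt_eqF wb0) => /negbT; move: (ratio ^+ j) tt t0 (side _ ^+ d) => r z z1 s rn /negbT wn.
by field; rewrite rn wn gt_eqF//; lra.
Qed.

(** The measures decay like [ratio^-j] with [ratio >= 2], so the intersection of the stopping sets
    is null. *)
Lemma stop_set_null : \forall x \ae mu, exists j, ~ Om j x.
Proof.
pose N := \bigcap_j Om j.
have mN : measurable N by apply: bigcapT_measurable => j; exact: measurable_stop_set.
exists N; split=> //; last by move=> x /= H j _; apply: contrapT => nj; apply: H; exists j.
apply/eqP; rewrite eq_le measure_ge0 andbT; apply/lee_addgt0Pr => e e0; rewrite add0e.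
have t0 := tt_ge1; set C := (tt * 2 * tt) * (side q0.1 ^+ d).
have C0 : 0 <= C by rewrite !mulr_ge0 ?exprn_ge0 ?side_ge0//; lra.
pose J := (Num.trunc (C / e)).+1.
apply: (@le_trans _ _ (mu (Om J))).
  by apply: le_mu => //; [exact: measurable_stop_set|move=> x; exact].
apply: le_trans (stop_set_small J) _; rewrite lee_fin -/C.
have r2 := stop_ratio_ge2.
rewrite ler_pdivrMr ?exprn_gt0//; last by lra.
rewrite mulrC -ler_pdivrMr//; apply: (@le_trans _ _ J%:R).
  by apply: ltW; rewrite /J truncnS_gt.
apply: (@le_trans _ _ (2 ^+ J)); first by rewrite -natrX ler_nat ltnW// ltn_expl.
by rewrite lerXn2r ?nnegrE//; lra.
Qed.

End stopping_sets.

(** * Geometric sums and the self-improvement of packing conditions *)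

Section geometric_packing.
Context {R : realType}.

Fixpoint geo (th : R) (v : nat -> R) (n i : nat) : R :=
  if n is n'.+1 then v i + th * geo th v n' i.+1 else 0.

(** The sum of all later geometric sums: it is the coefficient of [th - 1] when the factor [th] is
    split as [1 + (th - 1)]. *)
Fixpoint geo_tails (th : R) (v : nat -> R) (n i : nat) : R :=
  if n is n'.+1 then geo th v n' i.+1 + geo_tails th v n' i.+1 else 0.

Lemma geoE th v n i : geo th v n i = \sum_(k < n) th ^+ k * v (i + k)%N.
Proof.
elim: n i => [|n IH] i; first by rewrite big_ord0.
rewrite big_ord_recl expr0 mul1r addn0 /= IH mulr_sumr; congr (_ + _).
by apply: eq_bigr => k _; rewrite mulrA -exprS /= -addSnnS.
Qed.

Lemma geo_split th v n i : geo th v n i = geo 1 v n i + (th - 1) * geo_tails th v n i.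
Proof. by elim: n i => [|n IH] i /=; [ring|have := IH i.+1; move=> e; rewrite [in LHS]e; ring: e]. Qed.

(** A packing condition survives geometric weights of ratio slightly above 1: the surplus
    [(th - 1) * geo_tails] is a small multiple of the plain sum. Both invariants are needed
    together, the second bounding the tails by [2K] times the plain sum with [2K * v i] to spare. *)
Lemma geo_packing (v : nat -> R) (K th : R) : (forall i, 0 <= v i) -> 0 <= K -> 1 <= th ->
  (th - 1) * (2 * K) <= 1 -> (forall n i, geo 1 v n i <= K * v i) ->
  forall n i, geo th v n i <= 2 * K * v i.
Proof.
move=> v0 K0 th1 thK H.
suff C n : (forall i, geo th v n i <= 2 * K * v i) /\
    (forall i, geo_tails th v n.+1 i + 2 * K * v i <= 2 * K * geo 1 v n.+1 i).
  by move=> n; case: (C n).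
elim: n => [|n [IH1 IH2]].
  by split=> i /=; [rewrite !mulr_ge0|rewrite !addr0 add0r mulr0 addr0].
have C1 i : geo th v n.+1 i <= 2 * K * v i.
  rewrite geo_split; have := IH2 i; have := H n.+1 i; have := v0 i.
  move: (geo_tails _ _ _ _) (geo _ _ _ _) (v i) => u s z z0 sK us.
  have u1 : u <= 2 * K * s by have := mulr_ge0 (mulr_ge0 (ler0n R 2) K0) z0; lra.
  have s1 : (th - 1) * u <= (th - 1) * (2 * K * s) by rewrite ler_wpM2l// subr_ge0.
  have [s0|s0] := lerP 0 s; last first.
    have : (th - 1) * (2 * K * s) <= 0.
      by rewrite mulr_ge0_le0 ?subr_ge0// mulr_ge0_le0 ?mulr_ge0// ltW.
    have := mulr_ge0 K0 z0; lra.
  have : (th - 1) * (2 * K * s) <= s by rewrite mulrA ler_piMl.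
  lra.
split=> // i; rewrite [geo_tails _ _ _ _]/= [geo 1 _ _ _]/=.
have := IH2 i.+1; have := C1 i.+1; rewrite /= => h1 h2; lra.
Qed.

(** Summation by parts; the discarded last term has a favourable sign. *)
Lemma geo_telescope (v : nat -> R) (th : R) n i : (forall i, 0 <= v i) -> 0 <= th ->
  geo th (fun k => v k - v k.+1) n.+1 i <= v i + (th - 1) * geo th v n i.+1.
Proof.
move=> v0 th0; suff -> : geo th (fun k => v k - v k.+1) n.+1 i =
    v i - th ^+ n * v (i + n).+1 + (th - 1) * geo th v n i.+1.
  by rewrite lerD2r lerBlDr lerDl mulr_ge0 ?exprn_ge0.
elim: n i => [|n IH] i; first by rewrite /= addn0; ring.
transitivity (v i - v i.+1 + th * geo th (fun k => v k - v k.+1) n.+1 i.+1) => //.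
by rewrite IH exprS -addSnnS [in RHS]/=; ring.
Qed.

End geometric_packing.

(** * From packing to higher integrability *)

Section reverse_hoelder.
Context {R : realType} {d : nat} (a : 'I_d -> R) (L : R) (L0 : 0 < L).
Local Notation X := (d.-tuple R).
Local Notation mu := (lebesgue d).
Local Notation cell := (cell a L).
Local Notation side := (side L).
Local Notation cellix := (nat * @gridix d)%type.
Implicit Types c : cellix.

(* A form of the A_infty condition that only involves averages over cells. *)
Definition cell_Ainfty (w : X -> R) (q0 : cellix) (A : R) :=
  forall c (phi : X -> R), (q0.1 <= c.1)%N -> cell c `<=` cell q0 ->
  measurable_fun setT phi -> (forall x, 0 <= phi x) ->
  (forall x, cell c x -> phi x = 0 \/ exists c', [/\ cell c' x, cell c' `<=` cell c &
    ((phi x)%:E * mu (cell c') <= \int[mu]_(z in cell c') (w z)%:E)%E]) ->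
  (\int[mu]_(x in cell c) (phi x)%:E <= A%:E * \int[mu]_(x in cell c) (w x)%:E)%E.

Context (w : X -> R) (q0 : cellix) (wb A : R).
Hypothesis mw : measurable_fun setT w.
Hypothesis w0 : forall x, 0 <= w x.
Hypothesis wsup : forall x, ~ cell q0 x -> w x = 0.
Hypothesis wb0 : 0 < wb.
Hypothesis wq0 : (\int[mu]_x (w x)%:E = wb%:E * mu (cell q0))%E.
Hypothesis A0 : 0 <= A.
Hypothesis wA : cell_Ainfty w q0 A.

Local Notation ratio := (@stop_ratio R d 0).
Local Notation level := (@stop_level R d 0 wb).
Local Notation q := (stop_cells a L 0 w q0 wb).
Local Notation Om := (stop_set a L 0 w q0 wb).

Let mOm j : measurable (Om j) := measurable_stop_set a L 0 w q0 wb j.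
Let level_gt0 j : 0 < level j := stop_level_gt0 0 wb0 j.
Let mwE : measurable_fun setT (EFin \o w). Proof. exact/measurable_EFinP. Qed.

Lemma nbr0E c : nbr a L 0%:R c = cell c. Proof. exact: nbr0. Qed.

(** On a maximal cell the average is at most [2^d * level j], and at least half of the cell survives
    the next stopping set. *)
Lemma stop_weight_le j : (\int[mu]_(x in Om j) (w x)%:E <=
  (2 ^+ d.+1 * level j)%:E * mu (Om j `\` Om j.+1))%E.
Proof.
have r0 : 0 <= 2 ^+ d.+1 * level j by rewrite mulr_ge0 ?exprn_ge0// ltW.
have mC : measurable (~` Om j.+1) by exact: measurableC.
rewrite (stop_setE a L0 0 w q0 wb j) setDE setIC.
rewrite -integral_scaled_indic//; last exact: measurable_cells.
apply: (@le_integral_bigcup _ _ _ mu _ _ cell cell).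
- by move=> c; exact: measurable_cell.
- by move=> c; exact: measurable_cell.
- apply/measurable_EFinP; apply: measurable_funM; [exact: measurable_cst|exact: measurable_indic].
- exact: mwE.
- by move=> x; rewrite lee_fin mulr_ge0.
- by move=> x; rewrite lee_fin.
- exact: trivIset_maxcells.
move=> c mc; rewrite integral_scaled_indic//; last exact: measurable_cell.
have := stop_cells_upper L0 w0 wsup wb0 wq0 mc; rewrite nbr0E => /le_trans; apply.
have H := stop_set_diff_ge L0 mw w0 wsup wb0 wq0 mc.
apply: le_trans (lee_wpmul2l _ H) _; first by rewrite lee_fin mulr_ge0 ?exprn_ge0// ltW.
by rewrite muleA -EFinM exprS setDE setIC (mulrC 2) mulrAC.
Qed.

Let D k : set X := Om k `\` Om k.+1.

Let D_disj x j k : D j x -> D k x -> j = k.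
Proof.
wlog jk : j k / (j <= k)%N.
  by move=> H; case: (leqP j k) => [|/ltnW] jk Dj Dk; [exact: H|apply/esym; exact: H].
move=> [_ nj] [Ok _]; apply/eqP; rewrite eqn_leq jk leqNgt; apply/negP => kj; apply: nj.
by apply: (stop_set_le wb0 kj).
Qed.

Let mD k : measurable (D k). Proof. exact: measurableD. Qed.

(** The function equal to [level (i + k)] on the layer [D (i + k)] is pointwise at most an average
    over a cell, so the A_infinity condition bounds its integral, while [stop_weight_le] bounds the
    weighted measures of the stopping sets by it. *)
Lemma stop_packing n i :
  (\sum_(k < n) \int[mu]_(x in Om (i + k)) (w x)%:E <=
   (2 ^+ d.+1 * A)%:E * \int[mu]_(x in Om i) (w x)%:E)%E.
Proof.
pose phi x : R := \sum_(k < n) level (i + k) * \1_(D (i + k)) x.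
have phi0 x : 0 <= phi x by apply: sumr_ge0 => k _; rewrite mulr_ge0// ltW.
have mt k : measurable_fun setT (fun x => level k * \1_(D k) x).
  by apply: measurable_funM; [exact: measurable_cst|exact: measurable_indic].
have mphi : measurable_fun setT phi by apply: measurable_sum => k; exact: mt.
have phi_in x (k : 'I_n) : D (i + k) x -> phi x = level (i + k).
  move=> Dk; rewrite /phi (bigD1 k)//= indicE mem_set// mulr1 big1 ?addr0// => j jk.
  rewrite indicE memNset ?mulr0// => Dj; have := D_disj Dk Dj => /addnI/val_inj jk'.
  by rewrite jk' eqxx in jk.
have phi_out x : (forall k : 'I_n, ~ D (i + k) x) -> phi x = 0.
  by move=> nD; rewrite /phi big1// => k _; rewrite indicE memNset ?mulr0.
have main : (\int[mu]_(x in Om i) (phi x)%:E <= \int[mu]_(x in Om i) (A * w x)%:E)%E.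
  rewrite (stop_setE a L0 0 w q0 wb i).
  apply: (@le_integral_bigcup _ _ _ mu _ _ cell cell).
  - by move=> c; exact: measurable_cell.
  - by move=> c; exact: measurable_cell.
  - by apply/measurable_EFinP; apply: measurable_funM => //; exact: measurable_cst.
  - exact/measurable_EFinP.
  - by move=> x; rewrite lee_fin mulr_ge0.
  - by move=> x; rewrite lee_fin.
  - exact: trivIset_maxcells.
  move=> c mc; rewrite [leRHS](_ : _ = A%:E * \int[mu]_(x in cell c) (w x)%:E)%E; last first.
    under eq_integral do rewrite EFinM.
    rewrite ge0_integralZl//; [exact: measurable_cell|exact: measurable_funTS|].
    by move=> x _; rewrite lee_fin.
  have [[qc cq _] _] := mc.
  apply: wA => // x cx.
  case: (pselect (exists k : 'I_n, D (i + k) x)) => [[k Dk]|nD]; last first.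
    by left; apply: phi_out => k Dk; apply: nD; exists k.
  right; have [[c' qc' c'x] _] := Dk; exists c'.
  have [cc' sub] := stop_cells_nested L0 wb0 (leq_addr k i) mc qc' cx c'x.
  split=> //; have [_ _] := qc'; rewrite nbr0E (phi_in _ _ Dk); exact.
apply: (@le_trans _ _ (\sum_(k < n) (2 ^+ d.+1 * level (i + k))%:E * mu (D (i + k)))%E).
  by apply: lee_sum => k _; exact: stop_weight_le.
rewrite EFinM -muleA.
have -> : (A%:E * \int[mu]_(x in Om i) (w x)%:E = \int[mu]_(x in Om i) (A * w x)%:E)%E.
  under [in RHS]eq_integral do rewrite EFinM.
  rewrite ge0_integralZl//; first exact: measurable_funTS.
  by move=> x _; rewrite lee_fin.
apply: (@le_trans _ _ ((2 ^+ d.+1)%:E * \int[mu]_x (phi x)%:E)%E).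
  rewrite integral_sumE//; last by move=> k x; rewrite mulr_ge0// ltW.
  rewrite ge0_sume_distrr; last by move=> k _; apply: integral_ge0 => x _; rewrite lee_fin mulr_ge0// ltW.
  apply: lee_sum => k _; rewrite EFinM -muleA; apply: lee_wpmul2l => //.
  by rewrite -{1}(setIT (D (i + k))) -integral_scaled_indic ?(ltW (level_gt0 _)).
apply: lee_wpmul2l => //; apply: le_trans main.
rewrite (integral_cut (Om i) phi); apply: le_integralE => // x.
rewrite /cut; case: ifPn => // /negP nO; rewrite phi_out// => k [Ok _].
by apply: nO; apply/mem_set; exact: (stop_set_le wb0 (leq_addr k i) Ok).
Qed.

(** Off the stopping set all cell averages are below [level j], so the set where [w] exceeds twice
    this fills at most half of any cell; by [cell_density] it is null. The factor 2 is the price for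
    avoiding differentiation. *)
Lemma weight_le_level j : \forall x \ae mu, cell q0 x -> ~ Om j x -> w x <= 2 * level j.
Proof.
pose G : set X := [set x | 2 * level j < w x] `\` Om j.
have mG1 : measurable [set x | 2 * level j < w x].
  rewrite -[X in measurable X]setTI; apply: measurable_fun_ltr => //; exact: measurable_cst.
have mG : measurable G by exact: measurableD.
have G0 : mu (G `&` cell q0) = 0%E.
  apply: (cell_density L0 mG (_ : 0 <= 2^-1 < 1)); first by rewrite invr_ge0 ler0n invf_lt1// ltr1n.
  move=> c qc cq; have mGc : measurable (G `&` cell c) by apply: measurableI => //; exact: measurable_cell.
  case: (pselect (q j c)) => [Qc|nQc].
    have -> : G `&` cell c = set0.
      by apply/seteqP; split=> // x [[_ nO] cx]; apply: nO; exists c.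
    by rewrite measure0 mule_ge0// lee_fin invr_ge0.
  have lt : (\int[mu]_(x in cell c) (w x)%:E < (level j)%:E * mu (cell c))%E.
    by rewrite ltNge; apply/negP => H; apply: nQc; split=> //; rewrite nbr0E.
  have le : ((2 * level j)%:E * mu (G `&` cell c) <= \int[mu]_(x in cell c) (w x)%:E)%E.
    rewrite -integral_scaled_indic//; [|by rewrite mulr_ge0// ltW|exact: measurable_cell].
    apply: le_integral_on => // x; first by apply: mulr_ge0 => //; apply: mulr_ge0 => //; exact: (ltW (level_gt0 j)).
    rewrite indicE; case: (boolP (x \in G)) => [/set_mem[/ltW H _]|_]; first by rewrite mulr1.
    by rewrite mulr0.
  have := le_trans le (ltW lt).
  have l20 : 0 < 2 * level j by rewrite mulr_gt0.
  rewrite -(lee_pdivlMl _ _ l20) => /le_trans; apply.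
  rewrite muleA -EFinM; apply: lee_wpmul2r => //; rewrite lee_fin invfM -mulrA mulVf ?mulr1//.
  by rewrite gt_eqF.
exists (G `&` cell q0); split=> //; first by apply: measurableI => //; exact: measurable_cell.
move=> x /= H; apply: contrapT => nG; apply: H => qx nO; rewrite leNgt; apply/negP => lt.
by apply: nG.
Qed.

(** On the layer [D k] the power [w^e] is at most a constant times [th^k], so the integral is a
    geometric sum of the masses of the layers. Its summation by parts is controlled by the packing
    condition, provided [th] is close to 1. *)
Lemma reverse_hoelder (e : R) : 0 <= e ->
  (ratio `^ e - 1) * (2 * (2 ^+ d.+1 * A)) <= 1 ->
  (\int[mu]_x (w x `^ (1 + e))%:E <=
   ((2 * ratio * wb) `^ e * (2 * wb))%:E * mu (cell q0))%E.
Proof.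
move=> e0; set th := ratio `^ e => thK.
have r2 : 2 <= ratio := stop_ratio_ge2 0.
have th1 : 1 <= th by rewrite /th -(powRr0 ratio) ler_powR//; lra.
have [v vE] : exists v : nat -> R, forall j, (\int[mu]_(x in Om j) (w x)%:E = (v j)%:E)%E.
  exists (fun j => fine (\int[mu]_(x in Om j) (w x)%:E)%E) => j.
  rewrite fineK// ge0_fin_numE; last by apply: integral_ge0 => x _; rewrite lee_fin.
  apply: (@le_lt_trans _ _ (\int[mu]_(x in setT) (w x)%:E)%E); first exact: le_integral_on.
  by rewrite wq0 [X in (_ * X)%E](lebesgue_cell a L0) -EFinM ltry.
have v0 j : 0 <= v j.
  by rewrite -lee_fin -vE; apply: integral_ge0 => x _; rewrite lee_fin.
have pack n i : geo 1 v n i <= 2 ^+ d.+1 * A * v i.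
  have := stop_packing n i; rewrite vE -EFinM.
  rewrite (eq_bigr (fun k : 'I_n => (v (i + k)%N)%:E)) => [|k _]; last exact: vE.
  rewrite sumEFin lee_fin geoE; apply: le_trans; apply: ler_sum => k _.
  by rewrite expr1n mul1r.
have K0 : 0 <= 2 ^+ d.+1 * A by rewrite mulr_ge0 ?exprn_ge0.
have gp := geo_packing v0 K0 th1 thK pack.
have v_le : v 1 <= v 0%N.
  rewrite -lee_fin -!vE; apply: le_integral_on => //; exact: stop_set_le.
have tele n : geo th (fun k => v k - v k.+1) n 0 <= 2 * v 0%N.
  case: n => [|n]; first by rewrite /= mulr_ge0.
  apply: le_trans (geo_telescope n 0 v0 (le_trans ler01 th1)) _.
  have : (th - 1) * geo th v n 1 <= (th - 1) * (2 * (2 ^+ d.+1 * A) * v 1).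
    by rewrite ler_wpM2l ?subr_ge0//; apply: le_trans (gp n 1) _; rewrite mulrA.
  have h2 : (th - 1) * (2 * (2 ^+ d.+1 * A) * v 1) <= v 1.
    by rewrite mulrA; apply: ler_piMl; [exact: v0|exact: thK].
  move=> h1; rewrite mulr_natl mulr2n lerD2l; exact: le_trans (le_trans h1 h2) v_le.
have vD j : (\int[mu]_(x in D j) (w x)%:E = (v j - v j.+1)%:E)%E.
  have : (\int[mu]_(x in Om j) (w x)%:E =
      \int[mu]_(x in Om j.+1) (w x)%:E + \int[mu]_(x in D j) (w x)%:E)%E.
    rewrite -ge0_integral_setU//; last 2 first.
    - by move=> x _; rewrite lee_fin.
    - by rewrite disj_set2E; apply/eqP/seteqP; split=> // x [? [_]].
    - by rewrite setDUK//; exact: stop_set_le.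
    - exact: measurable_funTS.
  rewrite !vE; case: (\int[mu]_(x in D j) _)%E => [z| |]//= [->].
  by rewrite [v j.+1 + z]addrC addrK.
set C := (2 * ratio * wb) `^ e.
have C0 : 0 <= C by exact: powR_ge0.
have pointwise : \forall x \ae mu, ((w x `^ (1 + e))%:E <=
    \sum_(j <oo) (C * th ^+ j)%:E * ((cut (D j) w x)%:E))%E.
  have all : \forall x \ae mu, forall j, cell q0 x -> ~ Om j x -> w x <= 2 * level j.
    by apply: ae_foralln => j; exact: weight_le_level.
  have null : \forall x \ae mu, exists j, ~ Om j x by exact: stop_set_null.
  apply: filterS2 all null => x wl [j nj].
  have t0 k : (0 <= (C * th ^+ k)%:E * (cut (D k) w x)%:E)%E.
    rewrite -EFinM lee_fin; apply: mulr_ge0; last by rewrite /cut; case: ifP.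
    by apply: mulr_ge0; [exact: C0|rewrite exprn_ge0// (le_trans ler01)].
  case: (pselect (cell q0 x)) => qx; last first.
    by rewrite wsup// powR0 ?nneseries_ge0//; rewrite gt_eqF//; lra.
  have [k Dk] : exists k, D k x.
    elim: j nj => [|j IH] nj; first by case: nj; rewrite stop_set0.
    by case: (pselect (Om j x)) => Oj; [exists j|exact: IH].
  apply: le_trans (nneseries_lim_ge k.+1 (fun j _ _ => t0 j)).
  rewrite big_nat_recr//=; apply: (@le_trans _ _ ((C * th ^+ k)%:E * (cut (D k) w x)%:E)%E); last first.
    by rewrite leeDr//; apply: sume_ge0.
  rewrite cutT// -EFinM lee_fin.
  have [_ nk] := Dk; have := wl _ qx nk => wk.
  have := w0 x; rewrite le_eqVlt => /orP[/eqP <-|wx0].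
    by rewrite mulr0 powR0 ?gt_eqF//; lra.
  rewrite powRD ?(gt_eqF wx0) ?implybT// powRr1 ?(ltW wx0)// mulrC ler_wpM2r ?(ltW wx0)//.
  apply: (@le_trans _ _ ((2 * level k.+1) `^ e)).
    by rewrite ge0_ler_powR ?nnegrE ?(ltW wx0)// mulr_ge0// ltW.
  have -> : 2 * level k.+1 = 2 * ratio * wb * ratio ^+ k.
    by rewrite /stop_level exprS; ring.
  rewrite powRM ?exprn_ge0 ?mulr_ge0 ?(ltW wb0)//; try by lra.
  rewrite -/C ler_wpM2l// -powR_mulrn; last by lra.
  by rewrite powRAC powR_mulrn ?powR_ge0.
have mcut j : measurable_fun setT (fun x => (cut (D j) w x)%:E).
  by apply/measurable_EFinP; exact: measurable_cut.
have cut0 j x : 0 <= cut (D j) w x by rewrite /cut; case: ifP.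
have Cth0 k : 0 <= C * th ^+ k by rewrite mulr_ge0 ?exprn_ge0// (le_trans ler01).
apply: (@le_trans _ _ (\int[mu]_x \sum_(j <oo) (C * th ^+ j)%:E * ((cut (D j) w x)%:E))%E).
  apply: ae_le_integral => [x _|x _|]; first by rewrite lee_fin powR_ge0.
    by apply: nneseries_ge0 => j _ _; rewrite -EFinM lee_fin mulr_ge0.
  by apply: filterS pointwise.
rewrite integral_nneseries//; last 2 first.
- by move=> j; apply: emeasurable_funM => //; exact: measurable_cst.
- by move=> j x _; rewrite -EFinM lee_fin mulr_ge0.
apply: lime_le.
  apply: is_cvg_nneseries => j _ _; apply: integral_ge0 => x _.
  by rewrite -EFinM lee_fin mulr_ge0.
apply: nearW => n.
have -> : (\sum_(0 <= j < n) \int[mu]_x ((C * th ^+ j)%:E * (cut (D j) w x)%:E) =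
    (C * geo th (fun k => v k - v k.+1) n 0)%:E)%E.
  rewrite geoE big_mkord mulr_sumr -sumEFin; apply: eq_bigr => j _.
  rewrite ge0_integralZl_EFin//; last by move=> x _; rewrite lee_fin.
  by rewrite -integral_cut vD -EFinM mulrA add0n.
have v00 : (v 0%N)%:E = (wb%:E * mu (cell q0))%E.
  rewrite -vE stop_set0// -wq0 (integral_cut (cell q0) w).
  apply: eq_integral => x _; rewrite /cut; case: ifPn => // /negP nx.
  by rewrite wsup// => qx; apply: nx; apply/mem_set.
apply: (@le_trans _ _ (C * (2 * v 0%N))%:E); first by rewrite lee_fin ler_wpM2l.
by rewrite !EFinM v00 !muleA.
Qed.

End reverse_hoelder.

(** * Carleson embedding *)

Section carleson.
Context {R : realType} {d : nat} (a : 'I_d -> R) (L : R) (L0 : 0 < L).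
Local Notation X := (d.-tuple R).
Local Notation mu := (lebesgue d).
Local Notation cell := (cell a L).
Local Notation nbr := (nbr a L).
Local Notation side := (side L).
Local Notation cellix := (nat * @gridix d)%type.
Implicit Types c : cellix.

(* Young's inequality with exponents 2(1+e) and p = 2(1+e)/(1+2e) bounds the average of
   sqrt w h by that of h^p to the power 1/p, and the maximal function is bounded on
   L^(2/p). *)
Lemma sparse_square_sum (t : nat) (h : X -> R) (s : seq cellix) (A : cellix -> set X)
    (w : cellix -> X -> R) (y : cellix -> R) (e K : R) :
  0 < e -> e <= 1 -> 0 <= K ->
  measurable_fun setT h -> (forall z, 0 <= h z) -> (\int[mu]_x (h x ^+ 2)%:E < +oo)%E ->
  uniq s -> (forall c, measurable (A c)) -> (forall c, A c `<=` cell c) ->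
  (forall c c' z, c \in s -> c' \in s -> A c z -> A c' z -> c = c') ->
  (forall c, c \in s -> (mu (cell c) <= 2%:E * mu (A c))%E) ->
  (forall c, measurable_fun setT (w c)) -> (forall c z, 0 <= w c z) ->
  (forall c, c \in s ->
    (\int[mu]_(x in nbr t%:R c) (w c x `^ (1 + e))%:E <= K%:E * mu (cell c))%E) ->
  (forall c, c \in s -> 0 <= y c /\
    ((y c)%:E * mu (cell c) <= \int[mu]_(x in nbr t%:R c) (Num.sqrt (w c x) * h x)%:E)%E) ->
  (\sum_(c <- s) (y c ^+ 2)%:E * mu (cell c) <=
   ((K + 1) ^+ 2 * 128 * (1 + 2 * t%:R) ^+ d ^+ 3 / e)%:E * \int[mu]_x (h x ^+ 2)%:E)%E.
Proof.
move=> e0 e1 K0 mh h0 hoo us mA Ac dA cA mw w0 wK yP.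
(* [p] is the exponent conjugate to [2 * r], and [p * (1 + x) = 2]: the maximal bound for the power
   [1 + x] of averages of [h^p] returns the square integral of [h]. *)
pose r := 1 + e; pose p := 2 * r / (2 * r - 1); pose x := e / (1 + e).
have r1 : 1 < r by rewrite /r; lra.
have p0 : 0 < p by rewrite divr_gt0//; lra.
have x0 : 0 < x by rewrite divr_gt0//; lra.
have x1 : x <= 1 by rewrite ler_pdivrMr; lra.
have px : p * (1 + x) = 2.
  by rewrite /p /x /r; field; rewrite !gt_eqF//; lra.
have p1 : p^-1 = (1 + x) / 2.
  by apply: (mulfI (lt0r_neq0 p0)); rewrite mulfV ?gt_eqF// mulrA px divff.
have pp : (2 * r)^-1 + p^-1 = 1.
  by rewrite /p /r; field; rewrite !gt_eqF//; lra.
pose phi z := h z `^ p.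
have phi0 z : 0 <= phi z by exact: powR_ge0.
have mphi : measurable_fun setT phi by apply: (measurableT_comp (measurable_powR _)).
have phi2 z : phi z `^ (1 + x) = h z ^+ 2 by rewrite -powRrM px powR_mulrn.
have mcE c : mu (cell c) = (side c.1 ^+ d)%:E := lebesgue_cell a L0 c.
have sd0 c : 0 < side c.1 ^+ d by rewrite exprn_gt0// side_gt0.
have /choice[z zP] c : exists z : R, 0 <= z /\
    (\int[mu]_(x in nbr t%:R c) (phi x)%:E = z%:E * mu (cell c))%E.
  have I0 : (0 <= \int[mu]_(x in nbr t%:R c) (phi x)%:E)%E.
    by apply: integral_ge0 => z _; rewrite lee_fin.
  have fin : (\int[mu]_(x in nbr t%:R c) (phi x)%:E < +oo)%E.
    apply: (@le_lt_trans _ _ (\int[mu]_x (cut (nbr t%:R c) (cst 1) x + h x ^+ 2)%:E)%E).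
      rewrite (integral_cut (nbr t%:R c) phi); apply: le_integralE => z; rewrite /cut; case: ifP => // _.
        rewrite /phi; have [h1|h1] := lerP (h z) 1.
          apply: (@le_trans _ _ 1); last by rewrite lerDl sqr_ge0.
          by apply: le_trans (ge0_ler_powR (ltW p0) _ _ h1) _; rewrite ?nnegrE// powR1.
        apply: (@le_trans _ _ (h z ^+ 2)); last by rewrite lerDr.
        rewrite -powR_mulrn// ler_powR ?(ltW h1)//.
        by rewrite -px ler_peMr ?(ltW p0)//; lra.
      by rewrite add0r sqr_ge0.
    rewrite integralDE//.
    - rewrite integral_cut_cst; last exact: measurable_nbr.
      rewrite [X in (_ * X + _)%E](lebesgue_nbr a L0 c (ler0n _ t)) -EFinM.
      by rewrite lte_add_pinfty// ltry.
    - by move=> z; rewrite /cut; case: ifP.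
    - by move=> z; rewrite sqr_ge0.
    - by apply: measurable_cut; [exact: measurable_nbr|exact: measurable_cst].
    - exact: measurable_funX.
  exists (fine (\int[mu]_(x in nbr t%:R c) (phi x)%:E) / side c.1 ^+ d); split.
    by rewrite divr_ge0 ?fine_ge0// ltW.
  by rewrite [X in (_ * X)%E]mcE -EFinM divfK ?gt_eqF// fineK// ge0_fin_numE.
have y_le c : c \in s -> y c ^+ 2 <= (K + 1) ^+ 2 * z c `^ (1 + x).
  move=> cs; have [yc0 yc] := yP _ cs; have [zc0 zc] := zP c.
  have -> : z c `^ (1 + x) = (z c `^ p^-1) ^+ 2.
    by rewrite -powR_mulrn ?powR_ge0// -powRrM p1; congr (_ `^ _); field.
  rewrite -exprMn lerXn2r ?nnegrE ?mulr_ge0 ?powR_ge0 ?addr_ge0//.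
  (* Young's inequality is applied to [sqrt w] and [h / m]; the free scale [m] turns the sum of two
     terms into the product of Hoelder's inequality. *)
  have ym m : 0 < m -> y c <= m * (K + (m `^ p)^-1 * z c).
    move=> m0; have mp0 : 0 < m `^ p by exact: powR_gt0.
    have mpi0 : 0 <= (m `^ p)^-1 by rewrite invr_ge0 ltW.
    have young v : Num.sqrt (w c v) * h v <= m * (w c v `^ (1 + e) + (m `^ p)^-1 * phi v).
      have r20 : 0 < 2 * r by lra.
      have hm0 : 0 <= h v / m by rewrite divr_ge0// ltW.
      have H := @conjugate_powR R (Num.sqrt (w c v)) (h v / m) (2 * r) p (sqrtr_ge0 _) hm0 r20 p0 pp.
      have {}H : Num.sqrt (w c v) * (h v / m) <= w c v `^ (1 + e) + (m `^ p)^-1 * phi v.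
        apply: le_trans H _; apply: lerD.
          rewrite powRrM powR_mulrn ?sqrtr_ge0// sqr_sqrtr// ler_pdivrMr// ler_peMr ?powR_ge0//; lra.
        rewrite powRM ?invr_ge0 ?(ltW m0)//.
        have -> : m^-1 `^ p = (m `^ p)^-1.
          apply: (mulIf (lt0r_neq0 mp0)).
          by rewrite -powRM ?invr_ge0 ?(ltW m0)// !mulVf ?gt_eqF// powR1.
        rewrite -/(phi v) (mulrC (phi v)) ler_pdivrMr// ler_peMr ?mulr_ge0//.
        rewrite /p ler_pdivlMr; lra.
      by rewrite -ler_pdivrMl// mulrC -mulrA.
    have mn := measurable_nbr a L t%:R c.
    have mc1 : measurable_fun setT (cut (nbr t%:R c) (fun v => w c v `^ (1 + e))).
      by apply: measurable_cut => //; apply: (measurableT_comp (measurable_powR _)).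
    have mc2 : measurable_fun setT (cut (nbr t%:R c) phi) by exact: measurable_cut.
    have c10 v : 0 <= cut (nbr t%:R c) (fun v => w c v `^ (1 + e)) v.
      by rewrite /cut; case: ifP => // _; exact: powR_ge0.
    have c20 v : 0 <= cut (nbr t%:R c) phi v by rewrite /cut; case: ifP.
    have c30 v : 0 <= (m `^ p)^-1 * cut (nbr t%:R c) phi v by rewrite mulr_ge0.
    have mc3 : measurable_fun setT (fun v => (m `^ p)^-1 * cut (nbr t%:R c) phi v).
      by apply: measurable_funM => //; exact: measurable_cst.
    have : ((y c)%:E * mu (cell c) <= (m * (K + (m `^ p)^-1 * z c))%:E * mu (cell c))%E.
      apply: le_trans yc _.
      apply: (@le_trans _ _ (\int[mu]_v (m * (cut (nbr t%:R c) (fun v => w c v `^ (1 + e)) v +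
          (m `^ p)^-1 * cut (nbr t%:R c) phi v))%:E)%E).
        rewrite (integral_cut (nbr t%:R c) (fun v => Num.sqrt (w c v) * h v)).
        apply: le_integralE => v; rewrite /cut; case: ifP => // _.
          by rewrite mulr_ge0// sqrtr_ge0.
        by rewrite mulr0 addr0 mulr0.
      rewrite integralZE ?(ltW m0)//; first last.
      - exact: measurable_funD.
      - by move=> v; rewrite addr_ge0.
      rewrite integralDE// integralZE//.
      rewrite -(integral_cut _ (fun v => w c v `^ (1 + e))) -(integral_cut _ phi) zc.
      rewrite [in leRHS]EFinM -muleA; apply: lee_wpmul2l; first by rewrite lee_fin ltW.
      rewrite muleA -EFinM EFinD ge0_muleDl ?lee_fin ?mulr_ge0//.
      by apply: leeD => //; exact: wK.
    by rewrite [X in (_ * X <= _)%E]mcE [X in (_ <= _ * X)%E]mcE -!EFinM lee_fin ler_pM2r.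
  move: zc0; rewrite le_eqVlt => /orP[/eqP zc0|zc0].
    (* When the average of [h^p] vanishes no optimal scale exists; the scale [y c / (2 * (K + 1))]
       would give [y c <= y c / 2]. *)
    rewrite -zc0 powR0 ?invr_neq0 ?gt_eqF// mulr0 leNgt; apply/negP => y0.
    have K10 : 0 < 2 * (K + 1) by lra.
    have := ym (y c / (2 * (K + 1))); rewrite divr_gt0// -zc0 mulr0 addr0 => /(_ isT).
    rewrite mulrAC ler_pdivlMr// => H; nra.
  (* At the scale [m = z c ^ (1/p)] the second term is exactly 1. *)
  have m0 : 0 < z c `^ p^-1 by rewrite powR_gt0.
  apply: le_trans (ym _ m0) _; rewrite mulrC -powRrM mulVf ?gt_eqF// powRr1 ?(ltW zc0)//.
  by rewrite mulVf// gt_eqF.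
have zA c : c \in s -> 0 <= z c /\
    ((z c)%:E * mu (cell c) <= \int[mu]_(x in nbr t%:R c) (phi x)%:E)%E.
  by move=> cs; have [zc0 ->] := zP c.
have main := maximal_power L0 x0 x1 mphi phi0 us mA Ac dA zA.
have phiE : (\int[mu]_v (phi v `^ (1 + x))%:E = \int[mu]_v (h v ^+ 2)%:E)%E.
  by apply: eq_integral => v _; rewrite phi2.
rewrite phiE in main.
apply: (@le_trans _ _ (((K + 1) ^+ 2 * 2)%:E * \sum_(c <- s) (z c `^ (1 + x))%:E * mu (A c))%E).
  rewrite ge0_sume_distrr; last by move=> c _; rewrite mule_ge0// lee_fin powR_ge0.
  rewrite !big_seq; apply: lee_sum => c cs.
  apply: (@le_trans _ _ (((K + 1) ^+ 2 * z c `^ (1 + x))%:E * (2%:E * mu (A c)))%E).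
    apply: lee_pmul => //; [by rewrite lee_fin sqr_ge0|by rewrite lee_fin y_le|exact: cA].
  by rewrite !muleA -!EFinM mulrAC.
apply: le_trans (lee_wpmul2l _ main) _; first by rewrite lee_fin mulr_ge0 ?sqr_ge0.
rewrite muleA -EFinM; apply: lee_wpmul2r; first by apply: integral_ge0 => v _; rewrite lee_fin sqr_ge0.
rewrite lee_fin; set tt := _ ^+ d ^+ 3.
have tt0 : 0 <= tt by rewrite !exprn_ge0// addr_ge0// mulr_ge0.
have xe : x^-1 <= 2 / e.
  by rewrite /x invf_div ler_pM2r ?invr_gt0//; lra.
have -> : (K + 1) ^+ 2 * 2 * (32 * tt / x) = (K + 1) ^+ 2 * 64 * tt * x^-1 by ring.
have -> : (K + 1) ^+ 2 * 128 * tt / e = (K + 1) ^+ 2 * 64 * tt * (2 / e) by ring.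
rewrite ler_wpM2l//; apply: mulr_ge0 => //; apply: mulr_ge0 => //; exact: sqr_ge0.
Qed.

End carleson.

(** * A-infinity weights on cells *)

Section Ainfty_weights.
Context {R : realType} {d : nat}.
Local Notation X := (d.-tuple R).
Local Notation mu := (lebesgue d).
Implicit Types (w phi : X -> R) (Q : set X).

Lemma hcube_cube_ae (b : X) (l : R) : 0 <= l ->
  \forall x \ae mu, cube b l x <-> hcube (tnth b) l x.
Proof.
move=> l0; exists (cube b l `\` hcube (tnth b) l); split.
- by apply: measurableD; [exact: measurable_cube|exact: measurable_hcube].
- exact: cubeDhcube.
move=> x /= H; have sub := @hcube_sub_cube R d b l.
case: (pselect (cube b l x)) => cx; case: (pselect (hcube (tnth b) l x)) => hx.
- by case: H; split.
- by split.
- by case: cx; exact: sub.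
- by case: H; split.
Qed.

Lemma integral_cube (b : X) (l : R) phi : 0 <= l -> (forall x, 0 <= phi x) ->
  (\int[mu]_(x in cube b l) (phi x)%:E = \int[mu]_(x in hcube (tnth b) l) (phi x)%:E)%E.
Proof.
move=> l0 phi0; rewrite (integral_cut (cube b l) phi) (integral_cut (hcube _ l) phi).
apply: ae_eq_ge0_integral => [x _|x _|].
- by rewrite lee_fin /cut; case: ifP.
- by rewrite lee_fin /cut; case: ifP.
apply: filterS (hcube_cube_ae b l0) => x [H1 H2] _; congr EFin; rewrite /cut.
case: (boolP (x \in cube b l)) => [/set_mem/H1/mem_set -> //|/negP nx].
by case: (boolP (x \in hcube _ l)) => // /set_mem/H2/mem_set.
Qed.

Lemma maximal_function_ge w (b : X) (l r : R) x : 0 < l -> cube b l x ->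
  (r%:E * (l ^+ d)%:E <= \int[mu]_(y in cube b l) `|w y|%:E)%E ->
  (r%:E <= maximal_function w x)%E.
Proof.
move=> l0 cx H; have ld : 0 < l ^+ d by rewrite exprn_gt0.
apply: (@le_trans _ _ ((fine (mu (cube b l)))^-1%:E * \int[mu]_(y in cube b l) `|w y|%:E)%E).
  rewrite (_ : fine _ = l ^+ d); last by rewrite [X in fine X](lebesgue_cube b (ltW l0)).
  by rewrite lee_pdivlMl// muleC.
apply: ereal_sup_ubound; exists (cube b l) => //; split=> //.
by exists b, l.
Qed.

Lemma maximal_function_ge0 w x : (0 <= maximal_function w x)%E.
Proof.
have c : cube x 1 x by move=> i; rewrite lexx/= lerDl.
apply: (@maximal_function_ge w x 1 0 x ltr01 c).
by rewrite mul0e; apply: integral_ge0 => y _; rewrite lee_fin.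
Qed.

Section cells.
Context (a : 'I_d -> R) (L : R) (L0 : 0 < L).
Local Notation cell := (cell a L).
Local Notation side := (side L).
Local Notation cellix := (nat * @gridix d)%type.
Implicit Types c : cellix.

Lemma cell_hcube c : cell c = hcube (tnth (pt a L c)) (side c.1).
Proof.
by rewrite /cell; congr (hcube _ _); apply/funext => i; rewrite tnth_mktuple.
Qed.

Lemma integral_cell_cube c phi : (forall x, 0 <= phi x) ->
  (\int[mu]_(x in cell c) (phi x)%:E =
   \int[mu]_(x in cube (pt a L c) (side c.1)) (phi x)%:E)%E.
Proof. by move=> phi0; rewrite cell_hcube integral_cube// side_ge0. Qed.

(** At a point of [c], any average of [w] over a subcell containing it is at most the maximal
    function of [w] cut to the closed cube of [c]; boundaries of cubes are null. *)
Lemma Ainfty_cell w q0 (A : R) : measurable_fun setT w -> (forall x, 0 <= w x) ->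
  0 <= A -> (\int[mu]_(x in cell q0) (w x)%:E < +oo)%E ->
  (Ainfty_scalar w <= A%:E)%E -> cell_Ainfty a L (cut (cell q0) w) q0 A.
Proof.
move=> mw w0 A0 woo wA c phi qc cq mphi phi0 phiP.
have mc := measurable_cell a L c.
have s0 : 0 < side c.1 by exact: side_gt0.
have cutE c' : cell c' `<=` cell c ->
    (\int[mu]_(x in cell c') (cut (cell q0) w x)%:E = \int[mu]_(x in cell c') (w x)%:E)%E.
  by move=> sub; apply: eq_integral => x /set_mem c'x; rewrite cutT//; apply: cq; exact: sub.
rewrite (cutE c)//; set Q := cube (pt a L c) (side c.1).
have cQ : cell c `<=` Q by rewrite cell_hcube; exact: hcube_sub_cube.
have wQ := integral_cell_cube c w0; rewrite -/Q in wQ.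
have w_fin : (\int[mu]_(x in Q) (w x)%:E \is a fin_num)%E.
  rewrite -wQ ge0_fin_numE; last by apply: integral_ge0 => x _; rewrite lee_fin.
  by apply: le_lt_trans woo; exact: le_integral_on.
set W := (\int[mu]_(x in Q) (w x)%:E)%E in w_fin wQ.
have W0 : 0 <= fine W by apply: fine_ge0; apply: integral_ge0 => x _; rewrite lee_fin.
move: W0; rewrite le_eqVlt => /orP[/eqP W0|W0].
  (* The inverse of the mass in [Ainfty_scalar] has here the default value 0 and the hypothesis is
     void for this cube; but all averages over subcells vanish, and [phi] with them. *)
  have W0E : W = 0%E by rewrite -(fineK w_fin) -W0.
  rewrite integral0_eq ?wQ ?W0E ?mule0// => x cx.
  case: (phiP x cx) => [->//|[c' [c'x sub H]]].
  have : ((phi x)%:E * mu (cell c') <= 0)%E.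
    apply: le_trans H _; rewrite (cutE _ sub) -W0E -wQ.
    by apply: le_integral_on.
  rewrite [X in (_ * X <= _)%E](lebesgue_cell a L0) -EFinM lee_fin.
  rewrite pmulr_lle0 ?exprn_gt0 ?side_gt0// => px.
  by congr EFin; apply/eqP; rewrite eq_le px phi0.
have : ((fine W)^-1%:E * \int[mu]_(x in Q) maximal_function (fun y => \1_Q y * w y)%R x <= A%:E)%E.
  apply: le_trans wA; apply: ereal_sup_ubound; exists Q => //.
  by exists (pt a L c), (side c.1).
rewrite lee_pdivrMl// fineK// => H; rewrite wQ muleC; apply: le_trans _ H.
rewrite (integral_cut (cell c) phi) [leRHS]integral_mkcond.
apply: ae_le_integral => [x _|x _|].
- by rewrite lee_fin /cut; case: ifP.
- by apply: erestrict_ge0 => y _; exact: maximal_function_ge0.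
apply: aeW => x _; rewrite /cut; case: ifPn => [/set_mem cx|_]; last first.
  by apply: erestrict_ge0 => y _; exact: maximal_function_ge0.
rewrite patchE mem_set; last exact: cQ.
case: (phiP x cx) => [->|[c' [c'x sub pc']]]; first exact: maximal_function_ge0.
have s'0 : 0 < side c'.1 by exact: side_gt0.
apply: (@maximal_function_ge _ (pt a L c') (side c'.1)) => //.
  by apply: hcube_sub_cube; rewrite -cell_hcube.
move: pc'; rewrite [X in (_ * X <= _)%E -> _](lebesgue_cell a L0) => /le_trans; apply.
rewrite (cutE _ sub) -integral_cell_cube; last by move=> y; exact: normr_ge0.
rewrite (integral_cut (cell c') w) (integral_cut (cell c') (fun y => `|\1_Q y * w y|)).
apply: le_integralE => y; first by rewrite /cut; case: ifP.
rewrite /cut; case: ifPn => // /set_mem c'y.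
by rewrite indicE mem_set ?mul1r ?ler_norm//; apply: cQ; exact: sub.
Qed.

End cells.

(** The exponent is [e = 1 / (rh_const * A)]: the maximum bounds [ln ratio], and 8 times [2^(d+1)]
    leaves room for [exp y <= 1 + 2 * y] at [y = e * ln ratio <= 1/8]. *)
Definition rh_const : R := 8 * 2 ^+ d.+1 * Num.max 1 (ln (@stop_ratio R d 0)).

Lemma rh_exponent (A : R) : 1 <= A -> exists e : R, [/\ 0 < e, e <= 1,
  (@stop_ratio R d 0 `^ e - 1) * (2 * (2 ^+ d.+1 * A)) <= 1 & e^-1 = rh_const * A].
Proof.
move=> A1; set r := @stop_ratio R d 0; set l := Num.max 1 (ln r).
have l1 : 1 <= l by rewrite le_max lexx.
have p1 : 1 <= 2 ^+ d.+1 :> R by rewrite exprn_ege1// ler1n.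
pose e := (rh_const * A)^-1.
have rc : 8 <= rh_const.
  by rewrite /rh_const -/r -/l -mulrA ler_peMr// mulr_ege1.
have rA : 8 <= rh_const * A by nra.
have e0 : 0 < e by rewrite invr_gt0; lra.
exists e; split => //; last by rewrite invrK.
  by rewrite invf_le1; lra.
have r2 : 2 <= r by exact: stop_ratio_ge2.
have r0 : 0 < r by lra.
have ln0 : 0 < ln r by rewrite ln_gt0//; lra.
pose y := e * ln r.
have K0 : 0 < 2 ^+ d.+1 * A by rewrite mulr_gt0//; lra.
have y_le : y * (8 * (2 ^+ d.+1 * A)) <= 1.
  have -> : y * (8 * (2 ^+ d.+1 * A)) = ln r / l.
    rewrite /y /e /rh_const -/r -/l.
    by field; rewrite !gt_eqF//; lra.
  by rewrite ler_pdivrMr ?mul1r ?le_max ?lexx ?orbT//; lra.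
have y0 : 0 < y by rewrite mulr_gt0.
have K1 : 1 <= 2 ^+ d.+1 * A by rewrite mulr_ege1.
have y8 : y <= 8^-1 by rewrite -[leRHS]mul1r ler_pdivlMr//; nra.
have E : r `^ e = expR y by rewrite /powR gt_eqF.
have : expR y <= 1 + 2 * y.
  have h := expR_ge1Dx (- y); rewrite expRN in h.
  have e1 := expR_gt0 y.
  have : (1 - y) * expR y <= 1 by rewrite -ler_pdivlMr// mul1r.
  by move: (expR y) e1 => z z0; nra.
rewrite E; move: (expR y) => z; nra.
Qed.

(** An arbitrary half-open cube is made the root cell of a grid of its own. For mean at most 1 the
    constant is a number: [(2 * ratio * wb)^e] is at most 4, and [2 * wb] at most 2. *)
Lemma Ainfty_reverse_hoelder w (b : 'I_d -> R) (l A e wb : R) :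
  measurable_fun setT w -> (forall x, 0 <= w x) -> 0 < l -> 0 <= A ->
  (Ainfty_scalar w <= A%:E)%E -> 0 < wb -> wb <= 1 ->
  (\int[mu]_(x in hcube b l) (w x)%:E = (wb * l ^+ d)%:E)%E ->
  0 <= e -> (@stop_ratio R d 0 `^ e - 1) * (2 * (2 ^+ d.+1 * A)) <= 1 ->
  @stop_ratio R d 0 `^ e <= 2 ->
  (\int[mu]_(x in hcube b l) (w x `^ (1 + e))%:E <= (8 * l ^+ d)%:E)%E.
Proof.
move=> mw w0 l0 A0 wA wb0 wb1 wI e0 eA e2.
pose q0 : nat * @gridix d := (0%N, [ffun=> 0]).
have qE : cell b l q0 = hcube b l.
  rewrite /cell /= side.unlock expr0 divr1; congr (hcube _ _); apply/funext => i.
  by rewrite /corner ffunE mulr0 addr0.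
have mq : measurable (cell b l q0) by exact: measurable_cell.
pose w' := cut (cell b l q0) w.
have mw' : measurable_fun setT w' by exact: measurable_cut.
have w'0 x : 0 <= w' x by rewrite /w' /cut; case: ifP.
have w's x : ~ cell b l q0 x -> w' x = 0 by exact: cutF.
have muq : mu (cell b l q0) = (l ^+ d)%:E.
  by rewrite qE [LHS](lebesgue_hcube b (ltW l0)).
have w'I : (\int[mu]_x (w' x)%:E = wb%:E * mu (cell b l q0))%E.
  by rewrite -(integral_cut _ w) [in LHS]qE wI [X in (_ * X)%E]muq -EFinM.
have oo : (\int[mu]_(x in cell b l q0) (w x)%:E < +oo)%E by rewrite [in ltLHS]qE wI ltry.
have := reverse_hoelder l0 mw' w'0 w's wb0 w'I A0 (Ainfty_cell l0 mw w0 A0 oo wA) e0 eA.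
rewrite -qE (integral_cut (cell b l q0) (fun x => w x `^ (1 + e))).
have -> : (fun x => (cut (cell b l q0) (fun x => w x `^ (1 + e)) x)%:E) =
    (fun x => (w' x `^ (1 + e))%:E).
  apply/funext => x; rewrite /w' /cut; case: ifP => // _.
  by rewrite powR0// gt_eqF//; lra.
move=> /le_trans; apply; rewrite [X in (_ * X)%E]muq -EFinM lee_fin.
rewrite ler_wpM2r ?exprn_ge0 ?(ltW l0)//.
have r2 : 2 <= @stop_ratio R d 0 by exact: stop_ratio_ge2.
move: (stop_ratio 0) e2 r2 => r e2 r2 {eA}.
have H : (2 * r * wb) `^ e <= 4.
  apply: (@le_trans _ _ ((r * r) `^ e)).
    by rewrite ge0_ler_powR ?nnegrE//; nra.
  by rewrite powRM; [have := powR_ge0 r e; nra|lra|lra].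
have := powR_ge0 (2 * r * wb) e; move: (_ `^ e) H => z z4 z0; nra.
Qed.

End Ainfty_weights.

(** * A-infinity from A2 *)

Section Ainfty_of_A2.
Context {R : realType} {d : nat}.
Local Notation X := (d.-tuple R).
Local Notation mu := (lebesgue d).
Context (w : X -> R) (A : R).
Hypothesis mw : measurable_fun setT w.
Hypothesis w0 : forall x, 0 <= w x.
Hypothesis A0 : 0 <= A.
Hypothesis w_loc : forall b l, 0 < l -> (\int[mu]_(x in hcube b l) (w x)%:E < +oo)%E.
(* The scalar trace of the A_2 condition. *)
Hypothesis wA2 : forall b l (F : set X) (f : R), 0 < l -> measurable F -> F `<=` hcube b l ->
  0 <= f -> (f%:E <= mu F)%E ->
  ((f ^+ 2)%:E * \int[mu]_(x in hcube b l) (w x)%:E <=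
   (A * (l ^+ d) ^+ 2)%:E * \int[mu]_(x in F) (w x)%:E)%E.

Section one_cube.
Context (b : X) (l : R) (l0 : 0 < l).
Local Notation a := (tnth b).
Local Notation cell := (cell a l).
Local Notation nbr := (nbr a l).
Local Notation side := (side l).
Let q0 : nat * @gridix d := (0%N, [ffun=> 0]).
Let Q := cube b l.
Let w' := cut (cell q0) w.

Let qE : cell q0 = hcube a l.
Proof.
rewrite /cell /= side.unlock expr0 divr1; congr (hcube _ _); apply/funext => i.
by rewrite /corner ffunE mulr0 addr0.
Qed.

Let mq : measurable (cell q0). Proof. exact: measurable_cell. Qed.
Let mw' : measurable_fun setT w'. Proof. exact: measurable_cut. Qed.
Let w'0 x : 0 <= w' x. Proof. by rewrite /w' /cut; case: ifP. Qed.
Let w's x : ~ cell q0 x -> w' x = 0. Proof. exact: cutF. Qed.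
Let w'le x : w' x <= w x. Proof. by rewrite /w' /cut; case: ifP. Qed.

Variable wb : R.
Hypothesis wb0 : 0 < wb.
Hypothesis w'I : (\int[mu]_x (w' x)%:E = wb%:E * mu (cell q0))%E.

Local Notation level := (@stop_level R d 1 wb).
Local Notation q := (stop_cells a l 1 w' q0 wb).
Local Notation Om := (stop_set a l 1 w' q0 wb).

Let D j : set X := Om j `\` Om j.+1.
Let mOm j : measurable (Om j) := measurable_stop_set a l 1 w' q0 wb j.
Let mD j : measurable (D j). Proof. exact: measurableD. Qed.
Let level_gt0 j : 0 < level j := stop_level_gt0 1 wb0 j.

Let C9 : R := 4 * (3 ^+ d) ^+ 2 * A.
Let C90 : 0 <= C9. Proof. by rewrite /C9 !mulr_ge0 ?sqr_ge0. Qed.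

Let nbr_hcube c : nbr 1%:R c =
  hcube (fun i => corner a l c.1 c.2 i - 1 * side c.1) (3 * side c.1).
Proof. by rewrite /nbr; congr (hcube _ (_ * _)); lra. Qed.

(** For a maximal cell [c], the A_2 trace is applied to its dilate and to the part of [c] outside
    the next stopping set, which is at least half of [c]: the mass of the dilate is carried over to
    that part. Squaring the half gives the 4 in [C9], the dilate of three sides the [3^d]. *)
Lemma stop_layer j : ((level j)%:E * mu (Om j) <= C9%:E * \int[mu]_(x in D j) (w x)%:E)%E.
Proof.
have mC : measurable (~` Om j.+1) by exact: measurableC.
have mphi : measurable_fun setT (fun x => C9 * cut (~` Om j.+1) w x).
  by apply: measurable_funM; [exact: measurable_cst|exact: measurable_cut].
have cut0 (B : set X) x : 0 <= cut B w x by rewrite /cut; case: ifP.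
have E (B : set X) : measurable B -> (\int[mu]_(x in B) (C9 * cut (~` Om j.+1) w x)%:E =
    C9%:E * \int[mu]_(x in B `\` Om j.+1) (w x)%:E)%E.
  move=> mB; rewrite (integral_cut B (fun x => C9 * cut (~` Om j.+1) w x)).
  rewrite (integral_cut (B `\` Om j.+1) w) -integralZE//; last by apply: measurable_cut => //; exact: measurableD.
  apply: eq_integral => x _; congr EFin; rewrite /cut setDE in_setI.
  by case: (x \in B); case: (x \in ~` Om j.+1); rewrite ?mulr0.
have -> : ((level j)%:E * mu (Om j) = \int[mu]_(x in Om j) (level j)%:E)%E.
  by rewrite integral_cst.
rewrite -E//; rewrite (stop_setE a l0 1 w' q0 wb j).
apply: (@le_integral_bigcup _ _ _ mu _ _ cell cell).
- by move=> c; exact: measurable_cell.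
- by move=> c; exact: measurable_cell.
- exact/measurable_EFinP.
- exact: measurable_cst.
- by move=> x; rewrite lee_fin mulr_ge0.
- by move=> x; rewrite lee_fin ltW.
- exact: trivIset_maxcells.
move=> c mc; have mcc := measurable_cell a l c.
rewrite integral_cst// E//.
have [[_ _ H] _] := mc; apply: le_trans H _.
have cE := lebesgue_cell a l0 c.
have s0 : 0 < side c.1 by exact: side_gt0.
have sd0 : 0 < side c.1 ^+ d by rewrite exprn_gt0.
have half : ((side c.1 ^+ d / 2)%:E <= mu (cell c `\` Om j.+1))%E.
  have H := stop_set_diff_ge l0 mw' w'0 w's wb0 w'I mc.
  by move: H; rewrite [X in (X <= _)%E]cE mulrC EFinM -lee_pdivrMl// invrK.
have sub : cell c `\` Om j.+1 `<=` nbr 1%:R c.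
  by move=> x [cx _]; apply: (cell_sub_nbr l0 (ler0n _ 1) cx).
have s30 : 0 < 3 * side c.1 by rewrite mulr_gt0.
have := @wA2 (fun i => corner a l c.1 c.2 i - 1 * side c.1) (3 * side c.1) (cell c `\` Om j.+1)
  (side c.1 ^+ d / 2) s30 (measurableD mcc (mOm j.+1)).
rewrite -nbr_hcube => /(_ sub (divr_ge0 (ltW sd0) (ler0n _ 2)) half) H.
apply: (@le_trans _ _ (\int[mu]_(x in nbr 1%:R c) (w x)%:E)%E).
  exact: le_integral_on.
rewrite -(lee_pdivlMl _ _ (_ : 0 < (side c.1 ^+ d / 2) ^+ 2)) ?exprn_gt0 ?divr_gt0// in H.
apply: le_trans H _; rewrite muleA -EFinM le_eqVlt; apply/orP; left; apply/eqP.
congr (_%:E * _)%E; rewrite /C9 (exprMn d 3 (side c.1)); move: sd0; move: (side c.1 ^+ d) (3 ^+ d : R) => v u v0.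
by field; rewrite gt_eqF.
Qed.

Let ind_D j x : (\1_(D j) x : R) = \1_(Om j) x - \1_(Om j.+1) x.
Proof.
rewrite !indicE /D in_setD; case: (boolP (x \in Om j.+1)) => [/set_mem H|_] /=.
  by rewrite andbF mem_set ?subrr//; apply: (stop_set_le wb0 (leqnSn j) H).
by rewrite andbT subr0.
Qed.

(** The layers are disjoint parts of the root cell, so their masses add up to at most its mass. *)
Lemma stop_layers n :
  (\sum_(j < n) (level j)%:E * mu (Om j) <= (C9 * wb)%:E * mu (cell q0))%E.
Proof.
apply: (@le_trans _ _ (\sum_(j < n) C9%:E * \int[mu]_(x in D j) (w x)%:E)%E).
  by apply: lee_sum => j _; exact: stop_layer.
rewrite -ge0_sume_distrr; last by move=> j _; apply: integral_ge0 => x _; rewrite lee_fin.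
rewrite (EFinM C9 wb) -muleA -w'I; apply: lee_wpmul2l; first by rewrite lee_fin.
rewrite (eq_bigr (fun j : 'I_n => \int[mu]_x (cut (D j) w x)%:E)%E); last first.
  by move=> j _; rewrite integral_cut.
have cut0 (B : set X) x : 0 <= cut B w x by rewrite /cut; case: ifP.
rewrite -integral_sumE//; last by move=> j; exact: measurable_cut.
apply: le_integralE => x; first exact: sumr_ge0.
have -> : \sum_(j < n) cut (D j) w x = (\1_(Om 0) x - \1_(Om n) x) * w x.
  elim: (n) => [|m IH]; first by rewrite big_ord0 subrr mul0r.
  rewrite big_ord_recr IH /=.
  have -> : cut (D m) w x = \1_(D m) x * w x.
    by rewrite /cut indicE; case: ifP; rewrite ?mul1r ?mul0r.
  by rewrite ind_D -mulrDl addrA subrK.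
rewrite /w' /cut stop_set0// !indicE; case: (boolP (x \in cell q0)) => [_|/negP nx].
  by rewrite ler_piMl// gerBl.
rewrite memNset ?subr0 ?mul0r// => H; apply: nx; apply/mem_set.
exact: stop_set_sub H.
Qed.

Let IE (B : set X) : (\int[mu]_(x in B) `|\1_Q x * w x|%:E = \int[mu]_(x in B) (w' x)%:E)%E.
Proof.
rewrite (integral_cut B (fun x => `|\1_Q x * w x|)) (integral_cut B w').
apply: ae_eq_ge0_integral => [x _|x _|].
- by rewrite lee_fin /cut; case: ifP.
- by rewrite lee_fin /cut; case: ifP.
apply: filterS (hcube_cube_ae b (ltW l0)) => x [H1 H2] _; congr EFin.
rewrite /w' /cut qE; case: ifP => // _; rewrite indicE.
case: (boolP (x \in Q)) => [/set_mem/H1/mem_set -> |/negP nx]; first by rewrite mul1r ger0_norm.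
by rewrite mul0r normr0; case: ifPn => // /set_mem/H2/mem_set.
Qed.

Lemma scale_exists (s : R) : 0 < s -> s < l -> exists k, side k.+1 < s /\ s <= side k.
Proof.
move=> s0 sl; have [N HN] := side_small l s0.
elim: N HN => [|N IH] HN.
  by move: HN; rewrite side.unlock expr0 divr1 ltNge (ltW sl).
by case: (ltrP (side N) s) => [/IH//|sN]; exists N.
Qed.

(** A cube through [x] of side between those of generations [k.+1] and [k] lies in the 1-dilate of
    the cell of generation [k] at [x]; this is why [t = 1] here. Comparing the two sides costs
    [2^d], and cubes larger than [l] see at most the total mass. *)
Lemma maximal_function_le j x : cell q0 x -> ~ Om j x ->
  (maximal_function (fun y => \1_Q y * w y)%R x <= (2 ^+ d * level j)%:E)%E.
Proof.
move=> qx nO; apply: ge_ereal_sup => _ [P [[p [s [s0 ->]]] Px] <-].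
have sd0 : 0 < s ^+ d by rewrite exprn_gt0.
rewrite (_ : fine _ = s ^+ d); last by rewrite [X in fine X](lebesgue_cube p (ltW s0)).
rewrite lee_pdivrMl// IE.
have lev : wb <= level j.
  by rewrite /stop_level ler_peMl ?(ltW wb0)// exprn_ege1//; have := @stop_ratio_ge2 R d 1; lra.
have two_d : 1 <= 2 ^+ d :> R by rewrite exprn_ege1// ler1n.
case: (ltrP s l) => sl; last first.
  apply: (@le_trans _ _ (\int[mu]_x (w' x)%:E)%E).
    by apply: (@le_integral_on _ _ _ setT).
  rewrite w'I [X in (_ * X)%E](lebesgue_cell a l0) -!EFinM lee_fin side.unlock expr0 divr1.
  rewrite mulrC; apply: ler_pM; rewrite ?exprn_ge0 ?(ltW l0) ?(ltW wb0)//.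
    by rewrite lerXn2r// ?nnegrE ltW.
  by apply: le_trans lev _; rewrite ler_peMl// ltW.
have [k [sk1 sk]] := scale_exists s0 sl.
pose c := (k, loc a l k x).
have cx : cell c x by exact: cell_loc.
have cq : cell c `<=` cell q0 by apply: (cell_sub l0 _ qx cx).
have Pc : cube p s `<=` nbr 1%:R c.
  move=> y Py i; have /andP[h1 h2] := Px i; have /andP[h3 h4] := Py i; have /andP[h5 h6] := cx i.
  by apply/andP; split; rewrite /= in h5 h6 *; lra.
have lt : (\int[mu]_(y in nbr 1%:R c) (w' y)%:E <= (level j)%:E * mu (cell c))%E.
  rewrite leNgt; apply/negP => /ltW H; apply: nO; exists c => //; split=> //.
apply: (@le_trans _ _ (\int[mu]_(y in nbr 1%:R c) (w' y)%:E)%E); first exact: le_integral_on.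
apply: le_trans lt _; rewrite [X in (_ * X)%E](lebesgue_cell a l0) -!EFinM lee_fin /=.
rewrite mulrA [leRHS]mulrC; apply: ler_wpM2l; first exact: ltW.
rewrite -exprMn; apply: lerXn2r; rewrite ?nnegrE ?side_ge0 ?(ltW l0)//; first by rewrite mulr_ge0// ltW.
by have := side_half l k 1; rewrite addn1 expr1; lra.
Qed.

Lemma integral_maximal_le :
  (\int[mu]_(x in Q) maximal_function (fun y => \1_Q y * w y)%R x <=
   (2 ^+ d * @stop_ratio R d 1 * C9 * wb * l ^+ d)%:E)%E.
Proof.
pose rt := @stop_ratio R d 1; have r2 : 2 <= rt by exact: stop_ratio_ge2.
have C0 j : 0 <= 2 ^+ d * rt * level j.
  apply: mulr_ge0; last exact: ltW.
  by apply: mulr_ge0; [exact: exprn_ge0|lra].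
have t0 j x : (0 <= (2 ^+ d * rt * level j)%:E * (\1_(Om j) x : R)%:E)%E.
  by rewrite -EFinM lee_fin mulr_ge0// indicE.
have null : \forall x \ae mu, exists j, ~ Om j x by exact: stop_set_null.
have pointwise : \forall x \ae mu, Q x ->
   (maximal_function (fun y => \1_Q y * w y)%R x <=
    \sum_(j <oo) (2 ^+ d * rt * level j)%:E * (\1_(Om j) x : R)%:E)%E.
  apply: filterS2 (hcube_cube_ae b (ltW l0)) null => x [/[swap] _ H] [j nj] /H; rewrite -qE => qx.
  have [k [Ok nk]] : exists k, Om k x /\ ~ Om k.+1 x.
    elim: j nj => [|j IH] nj; first by case: nj; rewrite stop_set0.
    by case: (pselect (Om j x)) => Oj; [exists j|exact: IH].
  apply: le_trans (nneseries_lim_ge k.+1 (fun j _ _ => t0 j x)).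
  rewrite big_nat_recr//= indicE mem_set// mule1.
  apply: le_trans (maximal_function_le qx nk) _.
  rewrite stop_levelS mulrA -/rt leeDr//; apply: sume_ge0 => i _; exact: t0.
apply: (@le_trans _ _ (\int[mu]_x \sum_(j <oo) (2 ^+ d * rt * level j)%:E * (\1_(Om j) x : R)%:E)%E).
  rewrite [leLHS]integral_mkcond; apply: ae_le_integral => [x _|x _|].
  - by apply: erestrict_ge0 => y _; exact: maximal_function_ge0.
  - by apply: nneseries_ge0 => j _ _; exact: t0.
  apply: filterS pointwise => x H _; rewrite patchE; case: ifPn => [/set_mem/H//|_].
  by apply: nneseries_ge0 => j _ _; exact: t0.
have mI j : measurable_fun setT (fun x => (\1_(Om j) x : R)%:E).
  by apply/measurable_EFinP; exact: measurable_indic.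
rewrite integral_nneseries//; last first.
- by move=> j; apply: emeasurable_funM => //; exact: measurable_cst.
apply: lime_le.
  by apply: is_cvg_nneseries => j _ _; apply: integral_ge0 => x _; exact: t0.
apply: nearW => n; rewrite big_mkord.
rewrite (eq_bigr (fun j : 'I_n => (2 ^+ d * rt)%:E * ((level j)%:E * mu (Om j)))%E); last first.
  move=> j _; rewrite ge0_integralZl//; last by rewrite lee_fin.
  by rewrite integral_indic// setIT EFinM muleA.
have K0 : 0 <= 2 ^+ d * rt by apply: mulr_ge0; [exact: exprn_ge0|lra].
rewrite -ge0_sume_distrr; last by move=> j _; rewrite mule_ge0// lee_fin ltW.
apply: le_trans (lee_wpmul2l _ (stop_layers n)) _; first by rewrite lee_fin.
rewrite [X in (_ * (_ * X) <= _)%E](lebesgue_cell a l0) side.unlock expr0 divr1.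
by rewrite -!EFinM lee_fin !mulrA.
Qed.

End one_cube.

Definition Ainfty_A2_const : R := 2 ^+ d * @stop_ratio R d 1 * (4 * (3 ^+ d) ^+ 2).

Lemma Ainfty_scalar_le : (Ainfty_scalar w <= (Ainfty_A2_const * A)%:E)%E.
Proof.
have C0 : 0 <= Ainfty_A2_const * A.
  have := @stop_ratio_ge2 R d 1 => r2.
  by rewrite !mulr_ge0 ?exprn_ge0//; lra.
apply: ge_ereal_sup => _ [_ [b [l [l0 ->]]] <-].
set W := (\int[mu]_(x in cube b l) w x)%R.
have WE : (\int[mu]_(x in hcube (tnth b) l) (w x)%:E = W%:E)%E.
  rewrite -integral_cube ?ltW// /W /Rintegral fineK// ge0_fin_numE; last first.
    by apply: integral_ge0 => x _; rewrite lee_fin.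
  by rewrite integral_cube ?ltW//; exact: w_loc.
have W0 : 0 <= W by rewrite -lee_fin -WE; apply: integral_ge0 => x _; rewrite lee_fin.
have [W00|W0'] := eqVneq W 0; first by rewrite W00 invr0 mul0e lee_fin.
have {W0' W0}W0 : 0 < W by rewrite lt_def W0' W0.
have ld : 0 < l ^+ d by rewrite exprn_gt0.
have wb0 : 0 < W / l ^+ d by rewrite divr_gt0.
rewrite lee_pdivrMl//; apply: le_trans (integral_maximal_le l0 wb0 _) _.
  rewrite -(integral_cut _ w) [X in (_ = _ * X)%E](lebesgue_cell _ l0) side.unlock expr0 divr1.
  rewrite -EFinM divfK ?gt_eqF// -WE; congr (integral _ _ _).
  rewrite /cell /= side.unlock expr0 divr1; congr (hcube _ _); apply/funext => i.
  by rewrite /corner ffunE mulr0 addr0.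
rewrite -EFinM lee_fin le_eqVlt; apply/orP; left; apply/eqP; rewrite /Ainfty_A2_const.
move: (stop_ratio 1) (2 ^+ d : R) (3 ^+ d : R) (l ^+ d) ld => r u v z z0.
by field; rewrite gt_eqF.
Qed.

End Ainfty_of_A2.

(** * Square roots of matrices *)

Section quadratic_forms.
Context {R : realType} {n : nat}.
Implicit Types (A B M : 'M[R]_n) (e : 'cV[R]_n).

Definition sqnorm e : R := \sum_i e i 0 ^+ 2.

Lemma sqnorm_ge0 e : 0 <= sqnorm e.
Proof. by apply: sumr_ge0 => i _; exact: sqr_ge0. Qed.

Lemma sqnorm_eq0 e : sqnorm e = 0 -> e = 0.
Proof.
move/eqP; rewrite psumr_eq0; last by move=> i _; exact: sqr_ge0.
move=> /allP H; apply/matrixP => i j; rewrite ord1 mxE.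
by have := H i (mem_index_enum i); rewrite /= sqrf_eq0 => /eqP.
Qed.

Lemma mxquadE A e : mxquad A e = \sum_i \sum_j A i j * e i 0 * e j 0.
Proof.
rewrite /mxquad -mulmxA mxE; apply: eq_bigr => i _; rewrite !mxE mulr_sumr.
by apply: eq_bigr => j _; ring.
Qed.

Lemma mxquadD A B e : mxquad (A + B) e = mxquad A e + mxquad B e.
Proof. by rewrite /mxquad mulmxDr mulmxDl mxE. Qed.

Lemma mxquadZ r A e : mxquad (r *: A) e = r * mxquad A e.
Proof. by rewrite /mxquad -scalemxAr -scalemxAl mxE. Qed.

Lemma mxquadB A B e : mxquad (A - B) e = mxquad A e - mxquad B e.
Proof. by rewrite -scaleN1r mxquadD mxquadZ mulN1r. Qed.

Lemma mxquad1 e : mxquad 1%:M e = sqnorm e.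
Proof. by rewrite /mxquad mulmx1 mxE; apply: eq_bigr => i _; rewrite mxE. Qed.

Lemma mxquad_congr M A e : mxquad (M^T *m A *m M) e = mxquad A (M *m e).
Proof. by rewrite /mxquad trmx_mul !mulmxA. Qed.

Lemma mxquad_sqr A e : A^T = A -> mxquad (A *m A) e = sqnorm (A *m e).
Proof.
by move=> sA; rewrite -mxquad1 -mxquad_congr sA mulmx1.
Qed.

(** Entries are recovered from quadratic forms, so monotone convergence of forms yields convergence
    of matrices. *)
Lemma mxquad_polar A i j : A^T = A ->
  A i j = (mxquad A (delta_mx i 0 + delta_mx j 0) - mxquad A (delta_mx i 0)
           - mxquad A (delta_mx j 0)) / 2.
Proof.
move=> sA.
have E k l : ((delta_mx k (0 : 'I_1))^T *m A *m delta_mx l (0 : 'I_1)) 0 0 = A k l.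
  by rewrite trmx_delta -rowE -colE !mxE.
rewrite /mxquad mulmxDr linearD /= !mulmxDl.
have D2 (P Q : 'M[R]_1) : (P + Q) 0 0 = P 0 0 + Q 0 0 by rewrite mxE.
rewrite !D2 !E.
have -> : A j i = A i j by rewrite -{1}sA mxE.
by field.
Qed.

Lemma mxquad_inj A B : A^T = A -> B^T = B -> (forall e, mxquad A e = mxquad B e) -> A = B.
Proof. by move=> sA sB E; apply/matrixP => i j; rewrite !mxquad_polar// !E. Qed.

Lemma mulmx_eq0_sqr A : A^T = A -> A *m A = 0 -> A = 0.
Proof.
move=> sA AA; apply: mxquad_inj => //; first by rewrite trmx0.
have Ae e : A *m e = 0 by apply: sqnorm_eq0; rewrite -mxquad_sqr// AA /mxquad mulmx0 mul0mx mxE.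
by move=> e; rewrite /mxquad -mulmxA Ae !mulmx0 mul0mx !mxE.
Qed.

Lemma mxquad_le_sum A e : mxquad A e <= (1 + \sum_i \sum_j `|A i j|) * sqnorm e.
Proof.
rewrite mxquadE mulrDl mul1r; apply: ler_wpDl; first exact: sqnorm_ge0.
rewrite mulr_suml; apply: ler_sum => i _; rewrite mulr_suml; apply: ler_sum => j _.
apply: le_trans (ler_norm _) _; rewrite -mulrA normrM ler_wpM2l//.
have le1 k : e k 0 ^+ 2 <= sqnorm e.
  by rewrite /sqnorm (bigD1 k)//= lerDl sumr_ge0// => l _; exact: sqr_ge0.
have := le1 i; have := le1 j; rewrite normrM -(real_normK (num_real (e i 0))) -(real_normK (num_real (e j 0))).
have := sqr_ge0 (`|e i 0| - `|e j 0|); nra.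
Qed.

End quadratic_forms.

Section square_root.
Context {R : realType} {n : nat}.
Implicit Types A B M : 'M[R]_n.

(* With A = 1 - C the equation (1 - Y)^2 = A becomes Y = (C + Y^2) / 2, whose
   iterates from 0 increase to a solution when 0 <= C <= 1. *)
Fixpoint sqrt_iter (C : 'M[R]_n) (k : nat) : 'M[R]_n :=
  if k is k.+1 then 2^-1 *: (C + sqrt_iter C k *m sqrt_iter C k) else 0.

Section iteration.
Variable C : 'M[R]_n.
Hypothesis pC : possemidefmx C.
Hypothesis pD : possemidefmx (1%:M - C).
Local Notation D := (1%:M - C).
Local Notation Y := (sqrt_iter C).

(** Polynomials in [C] and [1 - C] with nonnegative coefficients. They commute and are positive
    semidefinite, which gives all order relations between the iterates without spectral theory. *)
Inductive cone : 'M[R]_n -> Prop :=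
| cone1 : cone 1%:M
| coneC M : cone M -> cone (C *m M)
| coneD M : cone M -> cone (D *m M)
| coneA M N : cone M -> cone N -> cone (M + N)
| coneZ (r : R) M : 0 <= r -> cone M -> cone (r *: M).

Let CD : C *m D = D *m C. Proof. by rewrite mulmxBr mulmxBl mulmx1 mul1mx. Qed.

Lemma cone_comm M N : cone M -> N *m C = C *m N -> M *m N = N *m M.
Proof.
move=> cM NC; have ND : N *m D = D *m N by rewrite mulmxBr mulmxBl mulmx1 mul1mx NC.
elim: cM => [|K _ IH|K _ IH|K K' _ IH _ IH'|r K _ _ IH].
- by rewrite mulmx1 mul1mx.
- by rewrite -mulmxA IH !mulmxA NC.
- by rewrite -mulmxA IH !mulmxA ND.
- by rewrite mulmxDl mulmxDr IH IH'.
- by rewrite -scalemxAl -scalemxAr IH.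
Qed.

Lemma cone_commC M : cone M -> M *m C = C *m M.
Proof. by move=> cM; exact: cone_comm. Qed.

Lemma coneM M N : cone M -> cone N -> cone (M *m N).
Proof.
move=> cM cN; elim: cM => [|K _ IH|K _ IH|K K' _ IH _ IH'|r K r0 _ IH].
- by rewrite mul1mx.
- by rewrite -mulmxA; exact: coneC.
- by rewrite -mulmxA; exact: coneD.
- by rewrite mulmxDl; exact: coneA.
- by rewrite -scalemxAl; exact: coneZ.
Qed.

Let mxquad_conj M N e : N^T = N -> mxquad (N *m M *m N) e = mxquad M (N *m e).
Proof. by move=> sN; rewrite -{1}sN mxquad_congr. Qed.

(** The induction carries the forms of [M], [C M], [D M] and [C D M]: a repeated factor moves to
    both sides as a congruence, so these cases are closed. For [M = 1] one uses
    [C D = C D C + D C D]. *)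
Lemma cone_possemidef M : cone M -> possemidefmx M.
Proof.
have [sC qC] := pC; have [sD qD] := pD.
suff H : cone M -> [/\ M^T = M, forall e, 0 <= mxquad M e, forall e, 0 <= mxquad (C *m M) e,
   forall e, 0 <= mxquad (D *m M) e & forall e, 0 <= mxquad (C *m (D *m M)) e].
  by move=> /H[? ? _ _ _].
elim=> [|K cK [h0 h1 h2 h3 h4]|K cK [h0 h1 h2 h3 h4]|K K' cK [h0 h1 h2 h3 h4] cK' [k0 k1 k2 k3 k4]|r K r0 cK [h0 h1 h2 h3 h4]].
- split; rewrite ?mulmx1 ?trmx1// => e; first by rewrite mxquad1 sqnorm_ge0.
  have -> : C *m D = C *m D *m C + D *m C *m D.
    by rewrite -CD -mulmxDr [C + _]addrC subrK mulmx1.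
  by rewrite mxquadD !mxquad_conj// addr_ge0.
- have KC := cone_commC cK; split => // [|e|e|e].
  + by rewrite trmx_mul h0 sC KC.
  + by rewrite -KC mulmxA mxquad_conj.
  + by rewrite !mulmxA -CD -mulmxA.
  + by rewrite -KC !mulmxA -(mulmxA C) mxquad_conj.
- have KC := cone_commC cK.
  have KD : K *m D = D *m K by rewrite mulmxBr mulmxBl mulmx1 mul1mx KC.
  split => // [|e|e].
  + by rewrite trmx_mul h0 sD KD.
  + by rewrite -KD mulmxA mxquad_conj.
  + by rewrite mulmxA CD -mulmxA -KD !mulmxA -(mulmxA D) mxquad_conj.
- split => [|e|e|e|e]; first by rewrite linearD /= h0 k0.
  + by rewrite mxquadD addr_ge0.
  + by rewrite mulmxDr mxquadD addr_ge0.
  + by rewrite mulmxDr mxquadD addr_ge0.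
  + by rewrite !mulmxDr mxquadD addr_ge0.
- split => [|e|e|e|e]; first by rewrite linearZ /= h0.
  + by rewrite mxquadZ mulr_ge0.
  + by rewrite -scalemxAr mxquadZ mulr_ge0.
  + by rewrite -scalemxAr mxquadZ mulr_ge0.
  + by rewrite -!scalemxAr mxquadZ mulr_ge0.
Qed.

Lemma cone0 : cone 0.
Proof. by rewrite -(scale0r 1%:M); apply: coneZ => //; exact: cone1. Qed.

Lemma cone_iter k : cone (Y k).
Proof.
elim: k => [|k IH] /=; first exact: cone0.
apply: coneZ; first by rewrite invr_ge0.
apply: coneA; last exact: coneM.
by rewrite -[X in cone X]mulmx1; apply: coneC; exact: cone1.
Qed.

Lemma cone_1_iter k : cone (1%:M - Y k).
Proof.
elim: k => [|k IH] /=; first by rewrite subr0; exact: cone1.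
have -> : 1%:M - 2^-1 *: (C + Y k *m Y k) = 2^-1 *: (D *m 1%:M + (1%:M - Y k) *m (1%:M + Y k)).
  rewrite mulmx1 mulmxDr mulmx1 mulmxBl mul1mx.
  apply/matrixP => i j; rewrite !mxE; move: (\sum_(_ < n) _) => S; by field.
apply: coneZ; first by rewrite invr_ge0.
apply: coneA; first by apply: coneD; exact: cone1.
by apply: coneM => //; apply: coneA; [exact: cone1|exact: cone_iter].
Qed.

(** By commutation, each increment is half the product of the preceding increment and the sum of the
    two preceding iterates. *)
Lemma cone_iterS k : cone (Y k.+1 - Y k).
Proof.
elim: k => [|k IH]; first by rewrite /= mulmx0 addr0 subr0 -[C]mulmx1; apply: coneZ; [rewrite invr_ge0|apply: coneC; exact: cone1].
have -> : Y k.+2 - Y k.+1 = 2^-1 *: ((Y k.+1 - Y k) *m (Y k.+1 + Y k)).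
  have comm : Y k.+1 *m Y k = Y k *m Y k.+1.
    by apply: cone_comm; [exact: cone_iter|apply: cone_commC; exact: cone_iter].
  have YE m : Y m.+1 = 2^-1 *: (C + Y m *m Y m) by [].
  rewrite (YE k.+1) {3}(YE k) -scalerBr; congr (_ *: _).
  rewrite mulmxDr !mulmxBl comm opprD addrACA subrr add0r.
  by rewrite addrA subrK.
apply: coneZ; first by rewrite invr_ge0.
by apply: coneM => //; apply: coneA; exact: cone_iter.
Qed.

Lemma mxquad_iter_cvg e : cvgn (fun k => mxquad (Y k) e).
Proof.
apply: nondecreasing_is_cvgn.
  apply/nondecreasing_seqP => k; rewrite -subr_ge0 -mxquadB.
  by have [_] := cone_possemidef (cone_iterS k).
exists (sqnorm e) => _ [k _ <-].
by rewrite -mxquad1 -subr_ge0 -mxquadB; have [_] := cone_possemidef (cone_1_iter k).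
Qed.

Lemma sqrt_iter_cvg : exists B, [/\ possemidefmx B, B *m B = 1%:M - C &
  forall i j, (1%:M - Y k) i j @[k --> \oo] --> B i j].
Proof.
have sY k : (Y k)^T = Y k by have [] := cone_possemidef (cone_iter k).
have cY i j : cvgn (fun k => Y k i j).
  rewrite (_ : (fun k => _) = (fun k => (mxquad (Y k) (delta_mx i 0 + delta_mx j 0)
     - mxquad (Y k) (delta_mx i 0) - mxquad (Y k) (delta_mx j 0)) / 2)); last first.
    by apply/funext => k; apply: mxquad_polar.
  by apply: is_cvgMl; apply: is_cvgB; [apply: is_cvgB|]; exact: mxquad_iter_cvg.
pose Z : 'M[R]_n := \matrix_(i, j) limn (fun k => Y k i j).
have cZ i j : Y k i j @[k --> \oo] --> Z i j by rewrite mxE; exact: cY.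
have cB i j : (1%:M - Y k) i j @[k --> \oo] --> (1%:M - Z) i j.
  rewrite [X in _ --> X]mxE [in X in _ --> _ + X]mxE.
  under eq_fun do rewrite mxE [X in _ + X]mxE.
  by apply: cvgB => //; exact: cvg_cst.
have ZE : Z = 2^-1 *: (C + Z *m Z).
  apply/matrixP => i j; rewrite !mxE -[LHS]/(limn _).
  have H : Y k.+1 i j @[k --> \oo] --> Z i j by rewrite (cvg_shiftS (fun k => Y k i j)); exact: cZ.
  rewrite -[LHS](_ : Z i j = _); last by rewrite mxE.
  apply: (cvg_unique _ H) => //=.
  under eq_fun do rewrite !mxE.
  apply: cvgMr; apply: cvgD; first exact: cvg_cst.
  by apply: cvg_big => [|l _]; [exact: add_continuous|exact: cvgM].
exists (1%:M - Z); split => //; last first.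
  rewrite mulmxBr mulmx1 mulmxBl mul1mx.
  apply/matrixP => i j; have /matrixP/(_ i j) := ZE.
  move: (Z *m Z) => ZZ; clearbody Z; rewrite !mxE; lra.
split.
  apply/matrixP => i j; rewrite mxE; apply: (cvg_unique _ (cB j i)) => //.
  rewrite (_ : (fun k => (1%:M - Y k) j i) = (fun k => (1%:M - Y k) i j)); first exact: cB.
  by apply/funext => k; have [+ _] := cone_possemidef (cone_1_iter k) => /matrixP/(_ i j); rewrite mxE.
move=> e; rewrite mxquadE.
have H : (\sum_i \sum_j (1%:M - Y k) i j * e i 0 * e j 0) @[k --> \oo] -->
    \sum_i \sum_j (1%:M - Z) i j * e i 0 * e j 0.
  apply: cvg_big => [|i _]; first exact: add_continuous.
  apply: cvg_big => [|j _]; first exact: add_continuous.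
  by apply: cvgMl; apply: cvgMl.
rewrite -(cvg_lim _ H)//; apply: limr_ge; first by apply/cvg_ex; eexists; exact: H.
by apply: nearW => k; rewrite -mxquadE; have [_] := cone_possemidef (cone_1_iter k).
Qed.

End iteration.

(** An upper bound for the quadratic form on unit vectors, used to normalize [A] between 0 and 1; it
    is a measurable function of the entries. *)
Definition mxscale A : R := 1 + \sum_i \sum_j `|A i j|.

Lemma mxscale_gt0 A : 0 < mxscale A.
Proof. by apply: ltr_pwDl => //; apply: sumr_ge0 => i _; exact: sumr_ge0. Qed.

(** The explicit limit is kept in the statement because measurability of the square root is read off
    from it. *)
Lemma sqrtmx_exists A : possemidefmx A -> exists B, [/\ possemidefmx B, B *m B = A &
  forall i j, Num.sqrt (mxscale A) *
    (1%:M - sqrt_iter (1%:M - (mxscale A)^-1 *: A) k) i j @[k --> \oo] --> B i j].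
Proof.
move=> [sA qA]; set s := mxscale A; have s0 : 0 < s := mxscale_gt0 A.
pose C := 1%:M - s^-1 *: A.
have DE : 1%:M - C = s^-1 *: A by rewrite opprB addrC subrK.
have pC : possemidefmx C.
  split; first by rewrite linearB /= linearZ /= sA trmx1.
  move=> e; rewrite mxquadB mxquadZ mxquad1 subr_ge0 mulrC ler_pdivrMr// mulrC.
  exact: mxquad_le_sum.
have pD : possemidefmx (1%:M - C).
  rewrite DE; split; first by rewrite linearZ /= sA.
  by move=> e; rewrite mxquadZ mulr_ge0// invr_ge0 ltW.
have [B [[sB qB] BB cB]] := sqrt_iter_cvg pC pD.
exists (Num.sqrt s *: B); split.
- split; first by rewrite linearZ /= sB.
  by move=> e; rewrite mxquadZ mulr_ge0// sqrtr_ge0.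
- by rewrite -scalemxAl -scalemxAr scalerA -expr2 sqr_sqrtr ?(ltW s0)// BB DE scalerA divff ?gt_eqF// scale1r.
- by move=> i j; rewrite mxE; apply: cvgMr; exact: cB.
Qed.

Lemma possemidef_ker A e : possemidefmx A -> mxquad A e = 0 -> A *m e = 0.
Proof.
move=> /sqrtmx_exists[B [[sB _] <- _]]; rewrite mxquad_sqr// => /sqnorm_eq0 E.
by rewrite -mulmxA E mulmx0.
Qed.

(** With [D = B - S] the traces of [D B D] and [D S D] are nonnegative and opposite, hence zero.
    Then [B D] and [S D] vanish, and so does the square of [D]. *)
Lemma sqrt_unique B S : possemidefmx B -> possemidefmx S -> B *m B = S *m S -> B = S.
Proof.
move=> pB pS E; have [sB qB] := pB; have [sS qS] := pS.
pose D := B - S; have sD : D^T = D by rewrite linearB /= sB sS.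
have DBS : D *m B = - (S *m D) by rewrite mulmxBl mulmxBr E opprB.
have tr0 : \tr (D *m B *m D) = - \tr (D *m S *m D).
  by rewrite DBS mulNmx linearN /= -mulmxA mxtrace_mulC mulmxA mxtrace_mulC mulmxA.
have trE M : \tr (D *m M *m D) = \sum_i mxquad M (D *m delta_mx i 0).
  rewrite /mxtrace; apply: eq_bigr => i _; rewrite -mxquad_congr sD /mxquad.
  by rewrite trmx_delta -rowE -colE !mxE.
have trge M : possemidefmx M -> 0 <= \tr (D *m M *m D).
  by move=> [_ qM]; rewrite trE; apply: sumr_ge0 => i _; exact: qM.
have kill M : possemidefmx M -> \tr (D *m M *m D) = 0 -> M *m D = 0.
  move=> pM; rewrite trE => /eqP; rewrite psumr_eq0; last by move=> i _; case: pM => _; apply.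
  move=> /allP H; apply/matrixP => i j.
  have /eqP/(possemidef_ker pM)/matrixP/(_ i 0) := H j (mem_index_enum j).
  by rewrite mulmxA -colE !mxE.
have trB := trge _ pB; have trS := trge _ pS.
have B0 : B *m D = 0 by apply: kill => //; lra.
have S0 : S *m D = 0 by apply: kill => //; lra.
apply/eqP; rewrite -subr_eq0; apply/eqP; apply: mulmx_eq0_sqr => //.
by rewrite -/D {1}/D mulmxBl B0 S0 subr0.
Qed.

Lemma sqrtmxP A : possemidefmx A -> possemidefmx (sqrtmx A) /\ sqrtmx A *m sqrtmx A = A.
Proof.
by move=> /sqrtmx_exists[B [pB BB _]]; rewrite /sqrtmx; case: xgetP => [S _ []//|/(_ B)[]].
Qed.

(** [sqrtmx] is a choice; uniqueness identifies it with the limit of the iteration, whose steps are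
    measurable. *)
Lemma measurable_sqrtmx {disp} {X : measurableType disp} (W : X -> 'M[R]_n) :
  (forall i j, measurable_fun setT (fun x => W x i j)) -> (forall x, possemidefmx (W x)) ->
  forall i j, measurable_fun setT (fun x => sqrtmx (W x) i j).
Proof.
move=> mW pW i j.
have ms : measurable_fun setT (fun x => mxscale (W x)).
  apply: measurable_funD; first exact: measurable_cst.
  apply: measurable_sum => k; apply: measurable_sum => l.
  by apply: measurableT_comp (mW k l).
have mC : forall k l, measurable_fun setT (fun x => (1%:M - (mxscale (W x))^-1 *: W x) k l).
  move=> k l; under eq_fun do rewrite mxE [X in _ + X]mxE [X in _ - X]mxE.
  apply: measurable_funB; first exact: measurable_cst.
  apply: measurable_funM; last exact: mW.
  under eq_fun do rewrite -(powR_inv1 (ltW (mxscale_gt0 _))).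
  exact: measurableT_comp (measurable_powR (-1)) ms.
have mY N : forall k l, measurable_fun setT (fun x => sqrt_iter (1%:M - (mxscale (W x))^-1 *: W x) N k l).
  elim: N => [|N IH] k l /=.
    by under eq_fun do rewrite mxE; exact: measurable_cst.
  under eq_fun do rewrite mxE [X in _ * X]mxE [X in _ * (_ + X)]mxE.
  apply: measurable_funM; first exact: measurable_cst.
  apply: measurable_funD; first exact: mC.
  by apply: measurable_sum => m; apply: measurable_funM; exact: IH.
apply: (@measurable_fun_cvg _ _ _ setT (fun N x => Num.sqrt (mxscale (W x)) *
    (1%:M - sqrt_iter (1%:M - (mxscale (W x))^-1 *: W x) N) i j)).
  move=> N; apply: measurable_funM.
    by apply: measurableT_comp ms; apply: continuous_measurable_fun; exact: sqrt_continuous.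
  under eq_fun do rewrite mxE [X in _ + X]mxE.
  by apply: measurable_funB; [exact: measurable_cst|exact: mY].
move=> x _; have [B [pB BB cB]] := sqrtmx_exists (pW x).
have [pS SS] := sqrtmxP (pW x).
by rewrite (sqrt_unique pS pB)// SS BB.
Qed.

End square_root.

(** * Sparse families *)

Lemma ae_countType {disp : measure_display} {X : measurableType disp} {R : realType}
    (mu : {measure set X -> \bar R}) (I : countType) (P : I -> X -> Prop) :
  (forall i, \forall x \ae mu, P i x) -> \forall x \ae mu, forall i, P i x.
Proof.
move=> H; have : \forall x \ae mu, forall k, forall i, choice.unpickle k = Some i :> option I -> P i x.
  apply: ae_foralln => k; case E : (choice.unpickle k : option I) => [i|].
    by apply: filterS (H i) => x Px _ [<-].
  by apply: aeW.
by apply: filterS => x Hx i; apply: (Hx (choice.pickle i)); exact: choice.pickleK.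
Qed.

Section sparse_tree.
Context {R : realType} {d : nat} (a : 'I_d -> R) (L : R) (L0 : 0 < L).
Local Notation X := (d.-tuple R).
Local Notation mu := (lebesgue d).
Local Notation cell := (cell a L).
Local Notation cellix := (nat * @gridix d)%type.
Variables (Sel : cellix -> set cellix) (q0 : cellix).
Hypothesis Sel_sub : forall c c', Sel c c' -> (c.1 < c'.1)%N /\ cell c' `<=` cell c.
Hypothesis Sel_triv : forall c, trivIset (Sel c) cell.
Hypothesis Sel_half : forall c,
  (mu (\bigcup_(c' in Sel c) cell c') <= 2^-1%:E * mu (cell c))%E.

Fixpoint generation (j : nat) : set cellix :=
  if j is j.+1 then \bigcup_(c in generation j) Sel c else [set q0].

Definition descendant : set cellix := \bigcup_j generation j.

Definition remainder (c : cellix) : set X := cell c `\` \bigcup_(c' in Sel c) cell c'.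

Lemma measurable_remainder c : measurable (remainder c).
Proof. by apply: measurableD; [exact: measurable_cell|exact: measurable_cells]. Qed.

Lemma generation_inj j c c' x : generation j c -> generation j c' -> cell c x -> cell c' x ->
  c = c'.
Proof.
elim: j c c' => [|j IH] c c' /=; first by move=> -> ->.
move=> [p gp pc] [p' gp' pc'] cx c'x.
have pE : p = p'.
  by apply: IH => //; [exact: (proj2 (Sel_sub pc))|exact: (proj2 (Sel_sub pc'))].
by rewrite -pE in pc'; apply: (@Sel_triv p) => //; exists x.
Qed.

Lemma generation_pred i j c x : (i < j)%N -> generation j c -> cell c x ->
  exists p, [/\ generation i p, cell p x & (\bigcup_(c' in Sel p) cell c') x].
Proof.
elim: j c => // j IH c; rewrite ltnS leq_eqVlt => /orP[/eqP ->|ij] [p gp pc] cx.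
  by exists p; split=> //; [exact: (proj2 (Sel_sub pc))|exists c].
by apply: (IH p ij gp); exact: (proj2 (Sel_sub pc)).
Qed.

Lemma remainder_inj c c' x : descendant c -> descendant c' ->
  remainder c x -> remainder c' x -> c = c'.
Proof.
move=> [i _ gi] [j _ gj] [cx nc] [c'x nc'].
case: (ltngtP i j) => ij; last by rewrite ij in gi; exact: generation_inj gi gj cx c'x.
- have [p [gp px Sp]] := generation_pred ij gj c'x.
  by case: nc; rewrite (generation_inj gi gp cx px).
- have [p [gp px Sp]] := generation_pred ij gi cx.
  by case: nc'; rewrite (generation_inj gj gp c'x px).
Qed.

Lemma remainder_half c : (mu (cell c) <= 2%:E * mu (remainder c))%E.
Proof.
have mS := measurable_cells a L (Sel c).
have sub : \bigcup_(c' in Sel c) cell c' `<=` cell c by move=> x [c' /Sel_sub[_]]; apply.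
have cE := lebesgue_cell a L0 c.
have H := Sel_half c.
have foo : mu (\bigcup_(c' in Sel c) cell c') \is a fin_num.
  rewrite ge0_fin_numE//; apply: le_lt_trans H _.
  by rewrite [X in (_ * X)%E]cE -EFinM ltry.
rewrite [X in (_ <= _ * X)%E]measureD//; first last.
- by rewrite [ltLHS]cE ltry.
- exact: measurable_cell.
have [v vE] : exists v, mu (\bigcup_(c' in Sel c) cell c') = v%:E.
  by exists (fine (mu (\bigcup_(c' in Sel c) cell c'))); rewrite fineK.
rewrite setIidr//; move: H.
rewrite [X in (X <= _)%E -> _]vE [X in (_ <= _ * X)%E -> _]cE.
rewrite [X in _ -> (_ <= _ * (_ - X))%E]vE [X in _ -> (_ <= _ * (X - _))%E]cE.
by rewrite [X in _ -> (X <= _)%E]cE -!EFinM !lee_fin => H; lra.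
Qed.

Let tail j : set X := \bigcup_(c in generation j) cell c.

Lemma generation_tail_measure j : (mu (tail j) <= (2^-1 ^+ j)%:E * mu (cell q0))%E.
Proof.
elim: j => [|j IH]; first by rewrite /tail /= bigcup_set1 mul1e.
rewrite exprS EFinM -muleA; apply: le_trans (lee_wpmul2l _ IH); last by rewrite lee_fin.
have -> : tail j.+1 = \bigcup_(c in generation j) \bigcup_(c' in Sel c) cell c'.
  apply/seteqP; split=> x.
    by move=> [c [p gp pc] cx]; exists p => //; exists c.
  by move=> [p gp [c pc cx]]; exists c => //; exists p.
have mt : measurable (tail j) by exact: measurable_cells.
rewrite -[leRHS](_ : (\int[mu]_(x in tail j) 2^-1%:E = _)%E); last by rewrite integral_cst.
apply: (le_measure_bigcup (A := cell) (phi := cst 2^-1%:E)).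
- by move=> c; exact: measurable_cell.
- by move=> c; exact: measurable_cells.
- exact: measurable_cst.
- by move=> x; rewrite lee_fin.
- by move=> c c' gc gc' [x [cx c'x]]; exact: generation_inj gc gc' cx c'x.
move=> c _; rewrite integral_cst; last exact: measurable_cell.
exact: Sel_half.
Qed.

Lemma generation_exit : \forall x \ae mu, exists j, ~ tail j x.
Proof.
have mt j : measurable (tail j) by exact: measurable_cells.
exists (\bigcap_j tail j); split.
- by apply: bigcapT_measurable.
- apply/eqP; rewrite -measure_le0; apply/lee_addgt0Pr => e e0; rewrite add0e.
  have sd : 0 <= side L q0.1 ^+ d by rewrite exprn_ge0// side_ge0.
  have [N HN] := side_small (side L q0.1 ^+ d) e0.
  apply: (@le_trans _ _ (mu (tail N))).
    by apply: le_mu => //; [exact: bigcapT_measurable|move=> x /(_ N); apply].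
  apply: le_trans (generation_tail_measure N) _.
  rewrite [X in (_ * X)%E](lebesgue_cell a L0) -EFinM lee_fin exprVn mulrC.
  by move: HN; rewrite side.unlock => /ltW.
- move=> x /= H j _; apply: contrapT => nj; apply: H; by exists j.
Qed.

(** Almost every point leaves the tree after finitely many generations. Along its chain of cells,
    [G c] is split as the difference to the next cell plus the value there, until the point lies in
    a remainder. *)
Lemma sparse_telescope (F : lmodType R) (N : F -> R) (snN : seminorm N)
    (G : cellix -> X -> F) (M : cellix -> X -> R) :
  (forall c, \forall x \ae mu, remainder c x -> N (G c x) <= M c x) ->
  (forall c c', Sel c c' -> \forall x \ae mu, cell c' x -> N (G c x - G c' x) <= M c x) ->
  \forall x \ae mu, cell q0 x -> exists s : seq cellix, [/\ uniq s,
    forall c, c \in s -> descendant c /\ cell c x & N (G q0 x) <= \sum_(c <- s) M c x].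
Proof.
move=> H1 H2.
have H1' : \forall x \ae mu, forall c, remainder c x -> N (G c x) <= M c x.
  by apply: ae_countType => c; exact: H1.
have H2' : \forall x \ae mu, forall c c', Sel c c' -> cell c' x -> N (G c x - G c' x) <= M c x.
  apply: ae_countType => c; apply: ae_countType => c'.
  case: (pselect (Sel c c')) => Sc; last by apply: aeW.
  by apply: filterS (H2 _ _ Sc) => x H _.
apply: filterS3 generation_exit H1' H2' => x [k nk] H1x H2x q0x.
(* The lower bound on generations in the induction keeps the list free of repetitions. *)
suff key : forall m j c, generation j c -> cell c x -> ~ tail (j + m) x ->
   exists s : seq cellix, [/\ uniq s, forall c', c' \in s -> [/\ descendant c', cell c' x & (c.1 <= c'.1)%N] &
     N (G c x) <= \sum_(c <- s) M c x].
  have [s [us ss Hs]] := key k 0%N q0 erefl q0x nk.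
  by exists s; split=> // c /ss[].
elim=> [|m IH] j c gc cx; first by rewrite addn0; case; exists c.
rewrite addnS -addSn => nt.
have Dc : descendant c by exists j.
case: (pselect ((\bigcup_(c' in Sel c) cell c') x)) => [[c' Sc c'x]|nS]; last first.
  exists [:: c]; split=> // [c'|]; last by rewrite big_seq1; exact: H1x.
  by rewrite inE => /eqP ->.
have gc' : generation j.+1 c' by exists c.
have [s [us ss Hs]] := IH _ _ gc' c'x nt.
have lt := proj1 (Sel_sub Sc).
exists (c :: s); split=> [|c''|].
- by rewrite /= us andbT; apply/negP => /ss[_ _]; rewrite leqNgt lt.
- rewrite inE => /predU1P[->//|/ss[D1 D2 D3]]; split=> //.
  exact: leq_trans (ltnW lt) D3.
rewrite big_cons -[G c x](subrK (G c' x)).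
by apply: le_trans (seminormD snN _ _) _; apply: lerD => //; exact: H2x.
Qed.

End sparse_tree.

(** * Vectors and matrix weights *)

Section cauchy_schwarz.
Context {R : realType} {I : finType}.
Implicit Types u v : I -> R.

Lemma cauchy_schwarz_sum u v :
  (\sum_i u i * v i) ^+ 2 <= (\sum_i u i ^+ 2) * (\sum_i v i ^+ 2).
Proof.
set A := \sum_i u i ^+ 2; set B := \sum_i v i ^+ 2; set C := \sum_i u i * v i.
have B0 : 0 <= B by apply: sumr_ge0 => i _; exact: sqr_ge0.
have H : 0 <= B * (B * A - C ^+ 2).
  have -> : B * (B * A - C ^+ 2) = \sum_i (B * u i - C * v i) ^+ 2.
    transitivity (B ^+ 2 * A - 2 * B * C * C + C ^+ 2 * B); first by ring.
    rewrite (eq_bigr (fun i => B ^+ 2 * u i ^+ 2 + (- 2 * B * C) * (u i * v i) + C ^+ 2 * v i ^+ 2)).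
      by rewrite !big_split /= -!mulr_sumr -/A -/B -/C; ring.
    by move=> i _; ring.
  by apply: sumr_ge0 => i _; exact: sqr_ge0.
have [BE|B1] := eqVneq B 0; last first.
  by rewrite mulrC -subr_ge0 -(pmulr_rge0 _ (_ : 0 < B))// lt_def B1.
have v0 i : v i = 0.
  move/eqP: BE; rewrite psumr_eq0; last by move=> j _; exact: sqr_ge0.
  by move=> /allP/(_ i (mem_index_enum i)); rewrite /= sqrf_eq0 => /eqP.
by rewrite /C big1 ?expr0n ?BE ?mulr0// => i _; rewrite v0 mulr0.
Qed.

Lemma cauchy_schwarz_sqrt u v :
  \sum_i u i * v i <= Num.sqrt (\sum_i u i ^+ 2) * Num.sqrt (\sum_i v i ^+ 2).
Proof.
rewrite -sqrtrM; last by apply: sumr_ge0 => i _; exact: sqr_ge0.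
apply: le_trans (ler_norm _) _; rewrite -sqrtr_sqr ler_wsqrtr//.
exact: cauchy_schwarz_sum.
Qed.

Lemma sqr_sum_le_card u : (\sum_i u i) ^+ 2 <= #|I|%:R * \sum_i u i ^+ 2.
Proof.
have := cauchy_schwarz_sum (fun=> 1) u.
under eq_bigr do rewrite mul1r.
by under [X in _ <= X * _ -> _]eq_bigr do rewrite expr1n; rewrite sumr_const.
Qed.

End cauchy_schwarz.

Section vector_tuples.
Context {R : realType} {n : nat} {E : normedModType R}.
Implicit Types (x y : 'I_n -> E) (A B : 'M[R]_n).

Lemma l2norm_sq x : l2norm x ^+ 2 = \sum_i `|x i| ^+ 2.
Proof. by rewrite sqr_sqrtr//; apply: sumr_ge0 => i _; exact: sqr_ge0. Qed.

Lemma l2norm_ge_coord x i : `|x i| <= l2norm x.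
Proof.
rewrite -(@ler_pXn2r _ 2) ?nnegrE ?sqrtr_ge0// l2norm_sq (bigD1 i)//= lerDl.
by apply: sumr_ge0 => j _; exact: sqr_ge0.
Qed.

Lemma l2norm_le_sum x : l2norm x <= \sum_i `|x i|.
Proof.
have s0 : 0 <= \sum_i `|x i| by exact: sumr_ge0.
rewrite -(@ler_pXn2r _ 2) ?nnegrE ?sqrtr_ge0// l2norm_sq expr2 mulr_suml.
apply: ler_sum => i _; rewrite expr2 ler_wpM2l// (bigD1 i)//= lerDl.
exact: sumr_ge0.
Qed.

Lemma l2norm_seminorm : seminorm (@l2norm R n E).
Proof.
split=> [x y|r x]; last first.
  rewrite /l2norm (eq_bigr (fun i => r ^+ 2 * `|x i| ^+ 2)); last first.
    by move=> i _; rewrite [(r *: x) i]/(r *: x i) normrZ exprMn real_normK ?num_real.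
  by rewrite -mulr_sumr sqrtrM ?sqr_ge0// sqrtr_sqr.
have nx0 : 0 <= l2norm x + l2norm y by rewrite addr_ge0// sqrtr_ge0.
rewrite -(@ler_pXn2r _ 2) ?nnegrE ?sqrtr_ge0// sqrrD !l2norm_sq.
apply: (@le_trans _ _ (\sum_i (`|x i| + `|y i|) ^+ 2)).
  apply: ler_sum => i _; rewrite lerXn2r ?nnegrE ?addr_ge0//; exact: ler_normD.
under eq_bigr do rewrite sqrrD -mulr_natl.
rewrite !big_split /= lerD2r lerD2l -mulr_sumr -[leRHS]mulr_natl; apply: ler_wpM2l => //.
exact: (cauchy_schwarz_sqrt (fun i => `|x i|) (fun i => `|y i|)).
Qed.

Lemma mxactM A B x : mxact (A *m B) x = mxact A (mxact B x).
Proof.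
apply/funext => i; rewrite /mxact.
under eq_bigr do rewrite mxE scaler_suml.
rewrite exchange_big /=; apply: eq_bigr => k _; rewrite scaler_sumr.
by apply: eq_bigr => j _; rewrite scalerA.
Qed.

Lemma mxact1 x : mxact 1%:M x = x.
Proof.
apply/funext => i; rewrite /mxact (bigD1 i)//= mxE eqxx scale1r big1 ?addr0// => j ji.
by rewrite mxE eq_sym (negbTE ji) scale0r.
Qed.

Lemma mxactD A x y : mxact A (x + y) = mxact A x + mxact A y.
Proof.
apply/funext => i; rewrite /mxact -[RHS]big_split; apply: eq_bigr => j _.
exact: scalerDr.
Qed.

Lemma mxactZ A r x : mxact A (r *: x) = r *: mxact A x.
Proof.
apply/funext => i; rewrite /mxact [RHS]scaler_sumr; apply: eq_bigr => j _.
by rewrite [(r *: x) j]/(r *: x j) !scalerA mulrC.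
Qed.

Lemma mxactB A x y : mxact A (x - y) = mxact A x - mxact A y.
Proof. by rewrite -scaleN1r mxactD mxactZ scaleN1r. Qed.

Lemma mxact_coord_le A x i :
  `|mxact A x i| <= Num.sqrt (\sum_j A i j ^+ 2) * l2norm x.
Proof.
apply: (@le_trans _ _ (\sum_j `|A i j| * `|x j|)).
  apply: le_trans (ler_norm_sum _ _ _) _; apply: ler_sum => j _; rewrite normrZ//.
apply: le_trans (cauchy_schwarz_sqrt _ _) _.
by under eq_bigr do rewrite real_normK ?num_real//.
Qed.

(** The squared Frobenius norm. By Cauchy-Schwarz on the rows its root bounds the action on [E^n]
    for every Banach space [E], which the operator norm on [R^n] does not. *)
Definition frob2 A : R := \sum_i \sum_j A i j ^+ 2.

Lemma frob2_ge0 A : 0 <= frob2 A.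
Proof. by apply: sumr_ge0 => i _; apply: sumr_ge0 => j _; exact: sqr_ge0. Qed.

Lemma mxact_le A x : l2norm (mxact A x) <= Num.sqrt (frob2 A) * l2norm x.
Proof.
rewrite -(@ler_pXn2r _ 2) ?nnegrE ?mulr_ge0 ?sqrtr_ge0// l2norm_sq exprMn (sqr_sqrtr (frob2_ge0 A)).
rewrite /frob2 mulr_suml; apply: ler_sum => i _.
have s0 : 0 <= \sum_j A i j ^+ 2 by apply: sumr_ge0 => j _; exact: sqr_ge0.
by rewrite -(sqr_sqrtr s0) -exprMn lerXn2r ?nnegrE ?mulr_ge0 ?sqrtr_ge0// mxact_coord_le.
Qed.

End vector_tuples.

Section positive_definite.
Context {R : realType} {n : nat}.
Implicit Types A B : 'M[R]_n.

Lemma posdef_semi A : posdefmx A -> possemidefmx A.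
Proof.
move=> [sA pA]; split=> // e; have [->|/pA/ltW//] := eqVneq e 0.
by rewrite /mxquad mulmx0 mxE.
Qed.

Lemma posdef_unit A : posdefmx A -> A \in unitmx.
Proof.
move=> [sA pA]; rewrite -row_free_unit; apply: inj_row_free => v vA.
apply/eqP; rewrite -[v]trmxK trmx_eq0; apply/negPn/negP => /pA.
by rewrite /mxquad trmxK vA mul0mx mxE ltxx.
Qed.

Lemma posdef_sqrt A : posdefmx A ->
  [/\ (sqrtmx A)^T = sqrtmx A, sqrtmx A *m sqrtmx A = A & sqrtmx A \in unitmx].
Proof.
move=> pA; have [[sS _] SS] := sqrtmxP (posdef_semi pA); split=> //.
by have := posdef_unit pA; rewrite -{1}SS unitmx_mul => /andP[].
Qed.

Lemma invmx_sym A : A^T = A -> (invmx A)^T = invmx A.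
Proof. by move=> sA; rewrite trmx_inv sA. Qed.

Lemma posdef_inv A : posdefmx A -> posdefmx (invmx A).
Proof.
move=> pA; have uA := posdef_unit pA; have [sA qA] := pA.
split; first exact: invmx_sym.
move=> e e0; have -> : mxquad (invmx A) e = mxquad A (invmx A *m e).
  by rewrite -mxquad_congr invmx_sym// mulVmx// mul1mx.
apply: qA; apply: contra_neq e0 => H.
by rewrite -[e](mulKVmx uA) H mulmx0.
Qed.

Lemma mxquad_sqrt A e : posdefmx A -> mxquad A e = sqnorm (sqrtmx A *m e).
Proof. by move=> /posdef_sqrt[sS SS _]; rewrite -{1}SS mxquad_sqr. Qed.

Lemma mxquad_sqrtV A e : posdefmx A -> mxquad A (invmx (sqrtmx A) *m e) = sqnorm e.
Proof. by move=> pA; have [_ _ uS] := posdef_sqrt pA; rewrite mxquad_sqrt// mulKVmx. Qed.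

Lemma invmx_sqrt A : posdefmx A -> invmx A = invmx (sqrtmx A) *m invmx (sqrtmx A).
Proof.
move=> pA; have [_ SS uS] := posdef_sqrt pA; have uA := posdef_unit pA.
apply: (can_inj (mulKmx uA)); rewrite mulmxV// -{1}SS.
by rewrite -mulmxA mulKVmx// mulmxV.
Qed.

Lemma sqnorm_delta (k : 'I_n) : sqnorm (delta_mx k 0 : 'cV[R]_n) = 1.
Proof.
rewrite /sqnorm (bigD1 k)//= mxE !eqxx expr1n big1 ?addr0// => i ik.
by rewrite mxE (negbTE ik) expr0n.
Qed.

Lemma sqnorm_colE A k : sqnorm (A *m delta_mx k 0) = \sum_i A i k ^+ 2.
Proof. by rewrite -colE; apply: eq_bigr => i _; rewrite mxE. Qed.

Lemma frob2E A : frob2 A = \sum_k sqnorm (A *m delta_mx k 0).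
Proof. by rewrite /frob2 exchange_big; apply: eq_bigr => k _; rewrite sqnorm_colE. Qed.

Lemma frob2M_le A B : frob2 (A *m B) <= frob2 A * frob2 B.
Proof.
rewrite /frob2 mulr_suml; apply: ler_sum => i _.
rewrite (exchange_big _ _ (index_enum 'I_n)) /= mulr_sumr; apply: ler_sum => j _.
rewrite mxE; exact: cauchy_schwarz_sum.
Qed.

End positive_definite.

Section regular_weights.
Context {R : realType} {d n : nat}.
Local Notation X := (d.-tuple R).
Local Notation mu := (lebesgue d).
Implicit Types (U : X -> 'M[R]_n) (b : X) (l : R).

(** A representative of a matrix weight that is measurable and positive definite everywhere, so that
    roots and inverses can be formed pointwise. *)
Definition regular_weight U := [/\ forall i j, measurable_fun setT (fun x => U x i j),
  forall x, posdefmx (U x) & forall b l i j, 0 < l ->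
  (\int[mu]_(x in cube b l) `|U x i j|%:E < +oo)%E].

Lemma measurable_mxquad U e : (forall i j, measurable_fun setT (fun x => U x i j)) ->
  measurable_fun setT (fun x => mxquad (U x) e).
Proof.
move=> mU; under eq_fun do rewrite mxquadE.
apply: measurable_sum => i; apply: measurable_sum => j.
by apply: measurable_funM => //; apply: measurable_funM.
Qed.

Lemma mxquad_ge0 U e : regular_weight U -> forall x, 0 <= mxquad (U x) e.
Proof. by move=> [_ pU _] x; have [_] := posdef_semi (pU x). Qed.

Section one_weight.
Variables (U : X -> 'M[R]_n) (b : X) (l : R).
Hypothesis rU : regular_weight U.
Hypothesis l0 : 0 < l.
Local Notation Q := (cube b l).

Lemma average_mxquad e :
  (\int[mu]_(x in Q) (mxquad (U x) e)%:E = (l ^+ d * mxquad (average U Q) e)%:E)%E.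
Proof.
have [mU _ iU] := rU; have mQ : measurable Q by exact: measurable_cube.
have ld : 0 < l ^+ d by rewrite exprn_gt0.
have int (p : 'I_n * 'I_n) : mu.-integrable Q (fun x => (U x p.1 p.2)%:E * (e p.1 0 * e p.2 0)%:E)%E.
  apply: integrableZr => //; apply/integrableP; split.
    by apply/measurable_EFinP; exact: measurable_funTS.
  exact: iU.
have int' i j : mu.-integrable Q (fun x => (U x i j)%:E).
  apply/integrableP; split; last exact: iU.
  by apply/measurable_EFinP; exact: measurable_funTS.
transitivity (\int[mu]_(x in Q) (\sum_p (U x p.1 p.2)%:E * (e p.1 0 * e p.2 0)%:E))%E.
  apply: eq_integral => x _; rewrite mxquadE pair_bigA /= -sumEFin; apply: eq_bigr => p _.
  by rewrite -mulrA -EFinM.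
rewrite integral_sum// mxquadE pair_bigA /= mulr_sumr -sumEFin; apply: eq_bigr => p _.
rewrite integralZr// -[X in (X * _)%E]fineK; last exact: integrable_fin_num.
rewrite -EFinM; congr EFin.
have fQ : fine (mu Q) = l ^+ d by rewrite [X in fine X](lebesgue_cube b (ltW l0)).
rewrite mxE fQ /Rintegral.
by move: (fine _) => I; field; rewrite gt_eqF.
Qed.

(** Were the averaged form zero at [e], the nonnegative function [e . U(x) e] would vanish almost
    everywhere on a cube of positive measure. *)
Lemma average_posdef : posdefmx (average U Q).
Proof.
have [mU pU iU] := rU; have ld : 0 < l ^+ d by rewrite exprn_gt0.
have mQ : measurable Q by exact: measurable_cube.
split.
  apply/matrixP => i j; rewrite !mxE; congr (_ * _); congr Rintegral.
  by apply/funext => x; have [+ _] := pU x => /matrixP/(_ i j); rewrite mxE.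
move=> e e0; have : (0 <= (l ^+ d * mxquad (average U Q) e)%:E)%E.
  by rewrite -average_mxquad; apply: integral_ge0 => x _; rewrite lee_fin mxquad_ge0.
rewrite lee_fin pmulr_rge0// le_eqVlt => /predU1P[H|//].
have : (\int[mu]_(x in Q) `|(mxquad (U x) e)%:E| = 0)%E.
  rewrite -[RHS](_ : (l ^+ d * mxquad (average U Q) e)%:E = 0%E); last by rewrite -H mulr0.
  by rewrite -average_mxquad; apply: eq_integral => x _; rewrite gee0_abs// lee_fin mxquad_ge0.
move/(ae_eq_integral_abs _ mQ) => /(_ _) [].
  by apply/measurable_EFinP; apply: measurable_funTS; exact: measurable_mxquad.
move=> N [mN N0 sub]; have : (mu Q <= mu N)%E.
  apply: le_mu => // x Qx; apply: sub => /= /(_ Qx) [] H0.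
  by have [_ /(_ _ e0)] := pU x; rewrite H0 ltxx.
by rewrite [X in (X <= _)%E](lebesgue_cube b (ltW l0)) N0 lee_fin leNgt ld.
Qed.

Lemma normalized_average e :
  (\int[mu]_(x in Q) (mxquad (U x) (invmx (sqrtmx (average U Q)) *m e))%:E =
   (l ^+ d * sqnorm e)%:E)%E.
Proof. by rewrite average_mxquad mxquad_sqrtV//; exact: average_posdef. Qed.

End one_weight.

End regular_weights.

(** * Sparse domination *)

Section sparse_domination.
Context {R : realType} {d : nat} {E : completeNormedModType R} (d_gt0 : (0 < d)%N).
Context (a : 'I_d -> R) (L : R) (L0 : 0 < L).
Context {T : (d.-tuple R -> E) -> d.-tuple R -> E}
  {K : d.-tuple R -> d.-tuple R -> {linear E -> E}}
  {omega : R -> R} {CT D : R} (HT : cz_bounds T K omega CT D).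
Local Notation X := (d.-tuple R).
Local Notation mu := (lebesgue d).
Local Notation normE := (fun x : E => `|x|).
Local Notation cell := (cell a L).
Local Notation nbr := (nbr a L).
Local Notation side := (side L).
Local Notation radius := (@radius R d).
Local Notation cellix := (nat * @gridix d)%type.
Implicit Types c : cellix.
Local Notation lerner_const n := (@lerner_const R d CT D n).

Lemma gstep_eq0 N (v : X -> R) : gstep a L N v -> (forall x, 0 <= v x) ->
  (\int[mu]_x (v x)%:E <= 0)%E -> forall x, v x = 0.
Proof.
move=> [B [vN _]] v0 I0 x; set c := (N, loc a L N x).
have cx : cell c x by exact: cell_loc.
have sd : 0 < side c.1 ^+ d by rewrite exprn_gt0// side_gt0.
have H : (\int[mu]_(y in cell c) (cst (v x)%:E y) <= 0)%E.
  apply: le_trans I0; rewrite (integral_cut (cell c) (cst (v x))).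
  apply: le_integralE => y; rewrite /cut; case: ifPn => //; first by rewrite /= v0.
  move=> /set_mem cy.
  rewrite /= (vN x y)//; apply: esym; exact/(cellP a L0 c).
move: H; rewrite integral_cst; last exact: measurable_cell.
rewrite [X in (_ * X)%E](lebesgue_cell a L0) -EFinM lee_fin pmulr_lle0// => H.
by apply/eqP; rewrite eq_le H v0.
Qed.

(** When [F = 0] the step function [u] vanishes everywhere and the empty selection serves. *)
Lemma lerner_step_ge0 n N (u : X -> 'I_n -> E) q0 (F : R) : 0 <= F ->
  (forall i, gstep a L N (u ^~ i)) ->
  (\int[mu]_x (\sum_i `|u x i|)%:E <= F%:E * mu (cell q0))%E ->
  exists Sel : set cellix,
  [/\ forall c, Sel c -> cell c `<=` cell q0 /\ (q0.1 < c.1)%N,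
      trivIset Sel cell,
      (mu (\bigcup_(c in Sel) cell c) <= 2^-1%:E * mu (cell q0))%E,
      \forall x \ae mu, cell q0 x -> ~ (\bigcup_(c in Sel) cell c) x ->
        forall i, `|T (u ^~ i) x| <= lerner_const n * F &
      forall c, Sel c -> \forall x \ae mu, cell c x -> forall i,
        `|T (u ^~ i) x - T (cut (nbr (radius 0) c) (u ^~ i)) x| <= lerner_const n * F].
Proof.
move=> F0 us uF; have [FE|F1] := eqVneq F 0; last first.
  by apply: (lerner_step d_gt0 L0 HT _ us uF); rewrite lt_def F1.
have u0 i : u ^~ i = 0.
  apply/funext => x; apply/eqP; rewrite -normr_eq0; apply/eqP.
  apply: (gstep_eq0 (gstep_comp (Phi := Num.norm) (normr0 _) (us i))) => //.
  apply: (@le_trans _ _ (\int[mu]_x (\sum_i `|u x i|)%:E)%E).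
    apply: le_integralE => // y; rewrite (bigD1 i)//= lerDl; exact: sumr_ge0.
  by apply: le_trans uF _; rewrite FE mul0e.
exists set0; split=> //.
- by rewrite bigcup_set0 measure0 mule_ge0// lee_fin.
- by apply: filterS (cz_T0 HT) => x H _ _ i; rewrite u0 H normr0 FE mulr0.
Qed.

Lemma cz_lincomb n (r : 'I_n -> R) (f : 'I_n -> X -> E) : (forall i, L2fun mu normE (f i)) ->
  \forall x \ae mu, T (fun x => \sum_i r i *: f i x) x = \sum_i r i *: T (f i) x.
Proof.
move=> Lf; have Lr i : L2fun mu normE (r i *: f i) by exact: L2funZ.
have [_ H] := cz_sum HT (index_enum 'I_n) Lr.
have H' : \forall x \ae mu, forall i, i \in index_enum 'I_n -> T (r i *: f i) x = r i *: T (f i) x.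
  apply: ae_seq => i _; have := cz_lin HT (r i) (Lf i) (@L2fun0 R d E).
  by apply: filterS2 (cz_T0 HT) => x T0; rewrite addr0 => ->; rewrite T0 addr0.
rewrite (_ : (fun x => \sum_i r i *: f i x) = \sum_i (r i *: f i)); last first.
  by apply/funext => x; rewrite fct_sumE.
by apply: filterS2 H H' => x -> Hx; apply: eq_bigr => i _; apply: Hx; rewrite mem_index_enum.
Qed.

Section one_function.
Context {n : nat} (N : nat) (f : X -> 'I_n -> E).
Hypothesis fs : forall i, gstep a L N (f ^~ i).
Variable B : cellix -> 'M[R]_n.
Hypothesis uB : forall c, B c \in unitmx.

Definition local_image c (x : X) : 'I_n -> E :=
  fun i => T (cut (nbr (radius 0) c) (f ^~ i)) x.

(** The mass of [f] over the dilate, in the coordinates [B c] and divided by the measure of [c]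
    itself. *)
Definition coef c : R := (side c.1 ^+ d)^-1 *
  fine (\int[mu]_(x in nbr (radius 0) c) (\sum_i `|mxact (invmx (B c)) (f x) i|)%:E).

Let u c (x : X) : 'I_n -> E := mxact (invmx (B c)) (fun i => cut (nbr (radius 0) c) (f ^~ i) x).

Let gstep_sum M (g : 'I_n -> X -> E) : (forall j, gstep a L M (g j)) ->
  gstep a L M (fun x => \sum_j g j x).
Proof.
move=> gs; elim: (index_enum 'I_n) => [|j s IH].
  by rewrite (_ : (fun x => _) = (0 : X -> E)); [exists 0%N; split=> // x /eqP|apply/funext => x; rewrite big_nil].
rewrite (_ : (fun x => _) = g j + (fun x => \sum_(i <- s) g i x)); first exact: gstepD.
by apply/funext => x; rewrite big_cons.
Qed.

Let gstep_cut c i : gstep a L (maxn N c.1) (cut (nbr (radius 0) c) (f ^~ i)).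
Proof.
rewrite radius.unlock; apply: gstep_nbr => //; first exact: leq_maxr.
exact: gstep_refine (leq_maxl _ _) (fs i).
Qed.

Let gstep_u c i : gstep a L (maxn N c.1) (u c ^~ i).
Proof.
apply: gstep_sum => j; apply: (gstep_comp (Phi := fun v => invmx (B c) i j *: v)) => //.
by rewrite scaler0.
Qed.

Let L2cut c i : L2fun mu normE (cut (nbr (radius 0) c) (f ^~ i)).
Proof. by apply: gstep_L2fun (gstep_cut c i) => //; exact: seminorm_normr. Qed.

Let coef_int c : (\int[mu]_x (\sum_i `|u c x i|)%:E = (coef c)%:E * mu (cell c))%E /\ 0 <= coef c.
Proof.
have sd : 0 < side c.1 ^+ d by rewrite exprn_gt0// side_gt0.
have uE : (\int[mu]_x (\sum_i `|u c x i|)%:E =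
    \int[mu]_(x in nbr (radius 0) c) (\sum_i `|mxact (invmx (B c)) (f x) i|)%:E)%E.
  rewrite (integral_cut (nbr (radius 0) c) (fun x => \sum_i `|mxact (invmx (B c)) (f x) i|)).
  apply: eq_integral => x _; congr EFin; rewrite /u /cut; case: ifP => // _.
  by rewrite big1// => i _; rewrite /mxact big1 ?normr0// => j _; rewrite scaler0.
have gu : gstep a L (maxn N c.1) (fun x => \sum_i `|u c x i|).
  have key (s : seq 'I_n) : gstep a L (maxn N c.1) (fun x => \sum_(i <- s) `|u c x i|).
    elim: s => [|i s IH].
      by rewrite (_ : (fun x => _) = (0 : X -> R)); [exists 0%N; split=> // x /eqP|apply/funext => x; rewrite big_nil].
    rewrite (_ : (fun x => _) = (fun x => `|u c x i|) + (fun x => \sum_(j <- s) `|u c x j|)).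
      by apply: gstepD => //; apply: (gstep_comp (Phi := Num.norm)); [exact: normr0|exact: gstep_u].
    by apply/funext => x; rewrite big_cons.
  exact: key.
have u0 x : 0 <= \sum_i `|u c x i| by exact: sumr_ge0.
have [B' gu'] := gu; have I := gstep_integral L0 u0 gu'.
have foo : (\int[mu]_x (\sum_i `|u c x i|)%:E)%E \is a fin_num by rewrite I.
split; last first.
  rewrite mulr_ge0 ?invr_ge0 ?(ltW sd)// fine_ge0//; apply: integral_ge0 => x _.
  by rewrite lee_fin sumr_ge0.
rewrite [X in (_ = _ * X)%E](lebesgue_cell a L0) -EFinM /coef -uE mulrAC mulVf ?gt_eqF// mul1r.
by rewrite fineK.
Qed.

Lemma coef_ge0 c : 0 <= coef c. Proof. by have [] := coef_int c. Qed.

Lemma coefE c : ((coef c)%:E * mu (cell c) =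
  \int[mu]_(x in nbr (radius 0) c) (\sum_i `|mxact (invmx (B c)) (f x) i|)%:E)%E.
Proof.
have [<- _] := coef_int c.
rewrite (integral_cut (nbr (radius 0) c) (fun x => \sum_i `|mxact (invmx (B c)) (f x) i|)).
apply: eq_integral => x _; congr EFin; rewrite /u /cut; case: ifP => // _.
by rewrite big1// => i _; rewrite /mxact big1 ?normr0// => j _; rewrite scaler0.
Qed.

Let image_u c : \forall x \ae mu, (fun i => T (u c ^~ i) x) = mxact (invmx (B c)) (local_image c x).
Proof.
have : \forall x \ae mu, forall i, i \in index_enum 'I_n ->
    T (u c ^~ i) x = mxact (invmx (B c)) (local_image c x) i.
  by apply: ae_seq => i _; exact: cz_lincomb.
by apply: filterS => x H; apply/funext => i; rewrite H// mem_index_enum.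
Qed.

Let image_cut_u c c' : cell c' `<=` cell c -> (c.1 <= c'.1)%N ->
  \forall x \ae mu, (fun i => T (cut (nbr (radius 0) c') (u c ^~ i)) x) =
    mxact (invmx (B c)) (local_image c' x).
Proof.
move=> c'c le.
have sub : nbr (radius 0) c' `<=` nbr (radius 0) c by apply: nbr_sub => //; exact/ltW/radius_gt0.
have : \forall x \ae mu, forall i, i \in index_enum 'I_n ->
    T (cut (nbr (radius 0) c') (u c ^~ i)) x = mxact (invmx (B c)) (local_image c' x) i.
  apply: ae_seq => i _.
  have -> : cut (nbr (radius 0) c') (u c ^~ i) =
      (fun x => \sum_j invmx (B c) i j *: cut (nbr (radius 0) c') (f ^~ j) x).
    apply/funext => x; case: (pselect (nbr (radius 0) c' x)) => cx.
      rewrite cutT//; apply: eq_bigr => j _; rewrite !cutT//; exact: sub.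
    by rewrite cutF// big1// => j _; rewrite cutF// scaler0.
  exact: cz_lincomb.
by apply: filterS => x H; apply/funext => i; rewrite H// mem_index_enum.
Qed.

(** The selection step is made for each cell in its own coordinates, on the function [invmx (B c) f]
    cut to the dilate. By linearity its image is [invmx (B c)] applied to [local_image], and [S v]
    equals [(S B) (invmx B v)], which separates the matrix from the scalar estimate. *)
Lemma sparse_domination q0 (S : X -> 'M[R]_n) : exists Sel : cellix -> set cellix,
  [/\ forall c c', Sel c c' -> (c.1 < c'.1)%N /\ cell c' `<=` cell c,
      forall c, trivIset (Sel c) cell,
      forall c, (mu (\bigcup_(c' in Sel c) cell c') <= 2^-1%:E * mu (cell c))%E &
  \forall x \ae mu, cell q0 x -> exists s : seq cellix, [/\ uniq s,
    forall c, c \in s -> descendant Sel q0 c /\ cell c x &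
    l2norm (mxact (S x) (local_image q0 x)) <=
      \sum_(c <- s) Num.sqrt (frob2 (S x *m B c)) * (n%:R * lerner_const n * coef c)]].
Proof.
have /choice[Sel SelP] c : exists Sel : set cellix,
  [/\ forall c', Sel c' -> cell c' `<=` cell c /\ (c.1 < c'.1)%N,
      trivIset Sel cell,
      (mu (\bigcup_(c' in Sel) cell c') <= 2^-1%:E * mu (cell c))%E,
      \forall x \ae mu, cell c x -> ~ (\bigcup_(c' in Sel) cell c') x ->
        forall i, `|T (u c ^~ i) x| <= lerner_const n * coef c &
      forall c', Sel c' -> \forall x \ae mu, cell c' x -> forall i,
        `|T (u c ^~ i) x - T (cut (nbr (radius 0) c') (u c ^~ i)) x| <= lerner_const n * coef c].
  have [uc c0] := coef_int c; apply: (lerner_step_ge0 c0 (gstep_u c)).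
  by rewrite uc.
have bound c x (v : 'I_n -> E) : (forall i, `|mxact (invmx (B c)) v i| <= lerner_const n * coef c) ->
    l2norm (mxact (S x) v) <= Num.sqrt (frob2 (S x *m B c)) * (n%:R * lerner_const n * coef c).
  move=> H; have -> : mxact (S x) v = mxact (S x *m B c) (mxact (invmx (B c)) v).
    by rewrite -mxactM -mulmxA mulmxV// mulmx1.
  apply: le_trans (mxact_le _ _) _; rewrite ler_wpM2l ?sqrtr_ge0//.
  apply: le_trans (l2norm_le_sum _) _; rewrite -mulrA.
  apply: (@le_trans _ _ (\sum_(i < n) lerner_const n * coef c)); first exact: ler_sum.
  by rewrite sumr_const card_ord -[leLHS]mulr_natl.
exists Sel; split.
- by move=> c c'; have [H _ _ _ _] := SelP c => /H[].
- by move=> c; have [_ H _ _ _] := SelP c.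
- by move=> c; have [_ _ H _ _] := SelP c.
have H1 c c' : Sel c c' -> (c.1 < c'.1)%N /\ cell c' `<=` cell c.
  by have [H _ _ _ _] := SelP c => /H[].
have H2 c : trivIset (Sel c) cell by have [_ H _ _ _] := SelP c.
have H3 c : (mu (\bigcup_(c' in Sel c) cell c') <= 2^-1%:E * mu (cell c))%E.
  by have [_ _ H _ _] := SelP c.
apply: (@sparse_telescope R d a L L0 Sel q0 H1 H2 H3 _ _ l2norm_seminorm
   (fun c x => mxact (S x) (local_image c x))
   (fun c x => Num.sqrt (frob2 (S x *m B c)) * (n%:R * lerner_const n * coef c))).
- move=> c; have [_ _ _ H _] := SelP c.
  apply: filterS2 H (image_u c) => x H E1 [cx nc]; apply: bound => i.
  by rewrite -E1; exact: H.
- move=> c c' Sc; have [_ _ _ _ /(_ _ Sc) H] := SelP c; have [lt sub] := H1 _ _ Sc.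
  apply: filterS3 H (image_u c) (image_cut_u sub (ltnW lt)) => x H E1 E2 cx.
  rewrite -mxactB; apply: bound => i.
  by rewrite mxactB -E1 -E2; exact: H.
Qed.

End one_function.

End sparse_domination.

(** * Weighted square sums *)

Section weighted_squares.
Context {R : realType} {d n : nat} (a : 'I_d -> R) (L : R) (L0 : 0 < L).
Local Notation X := (d.-tuple R).
Local Notation mu := (lebesgue d).
Local Notation cell := (cell a L).
Local Notation nbr := (nbr a L).
Local Notation side := (side L).
Local Notation cellix := (nat * @gridix d)%type.
Local Notation t := ((2 * d)%N%:R : R).
Local Notation kappa := ((1 + 2 * t) ^+ d).
Implicit Types (c : cellix) (U : X -> 'M[R]_n).

Definition nbr_pt c : X := [tuple corner a L c.1 c.2 i - t * side c.1 | i < d].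

Definition nbr_root U c : 'M[R]_n :=
  sqrtmx (average U (cube (nbr_pt c) ((1 + 2 * t) * side c.1))).

Let nbrE c : nbr t c = hcube (tnth (nbr_pt c)) ((1 + 2 * t) * side c.1).
Proof. by rewrite /nbr; congr (hcube _ _); apply/funext => i; rewrite tnth_mktuple. Qed.

Let t0 : 0 <= t. Proof. by []. Qed.

Let ls0 c : 0 < (1 + 2 * t) * side c.1.
Proof. by rewrite mulr_gt0 ?side_gt0// ltr_pwDl// mulr_ge0. Qed.

Lemma nbr_root_unit U c : regular_weight U -> nbr_root U c \in unitmx.
Proof. by move=> rU; have [_ _] := posdef_sqrt (average_posdef (nbr_pt c) rU (ls0 c)). Qed.

Lemma nbr_root_sym U c : regular_weight U -> (nbr_root U c)^T = nbr_root U c.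
Proof. by move=> rU; have [] := posdef_sqrt (average_posdef (nbr_pt c) rU (ls0 c)). Qed.

(** A scalar weight of mean 1 over the dilate. Summed over [k] it is the squared Frobenius norm of
    the root of [U(x)] times the inverse root of the average. *)
Definition normalized U c k (x : X) : R :=
  mxquad (U x) (invmx (nbr_root U c) *m delta_mx k 0).

Section one_weight.
Variables (U : X -> 'M[R]_n) (AU : R).
Hypothesis rU : regular_weight U.
Hypothesis AU1 : 1 <= AU.
Hypothesis UA : forall e, e != 0 -> (Ainfty_scalar (fun x => mxquad (U x) e) <= AU%:E)%E.

Lemma normalized_ge0 c k x : 0 <= normalized U c k x.
Proof. exact: mxquad_ge0. Qed.

Lemma measurable_normalized c k : measurable_fun setT (normalized U c k).
Proof. by case: rU => mU _ _; exact: measurable_mxquad. Qed.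

Lemma integral_normalized c k :
  (\int[mu]_(x in nbr t c) (normalized U c k x)%:E = (((1 + 2 * t) * side c.1) ^+ d)%:E)%E.
Proof.
rewrite nbrE -integral_cube; [|exact: ltW|exact: normalized_ge0].
by rewrite normalized_average// sqnorm_delta mulr1.
Qed.

Lemma normalized_reverse_hoelder e c k : 0 < e ->
  (@stop_ratio R d 0 `^ e - 1) * (2 * (2 ^+ d.+1 * AU)) <= 1 ->
  (\int[mu]_(x in nbr t c) (normalized U c k x `^ (1 + e))%:E <= (8 * kappa)%:E * mu (cell c))%E.
Proof.
move=> e0 eA.
have e2 : @stop_ratio R d 0 `^ e <= 2.
  have : 1 <= 2 * (2 ^+ d.+1 * AU).
    by rewrite mulr_ege1 ?ler1n// mulr_ege1// exprn_ege1// ler1n.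
  move: eA; move: (2 * _) (_ `^ _) => v u H v1.
  by rewrite leNgt; apply/negP => u2; nra.
have v0 : invmx (nbr_root U c) *m delta_mx k (0 : 'I_1) != 0.
  apply/eqP => /(congr1 (mulmx (nbr_root U c))); rewrite mulKVmx ?nbr_root_unit// mulmx0.
  by move=> /matrixP/(_ k 0); rewrite !mxE !eqxx => /eqP; rewrite oner_eq0.
have AU0 : 0 <= AU := le_trans ler01 AU1.
have := @Ainfty_reverse_hoelder R d (normalized U c k) (tnth (nbr_pt c)) _ AU e 1
  (measurable_normalized c k) (normalized_ge0 c k) (ls0 c) AU0 (UA v0) ltr01 (lexx 1).
rewrite -nbrE integral_normalized mul1r => /(_ erefl (ltW e0) eA e2) H.
apply: le_trans H _; rewrite [X in (_ * X)%E](lebesgue_cell a L0) -EFinM lee_fin exprMn.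
by rewrite mulrA.
Qed.

(** One factor [n] comes from Cauchy-Schwarz over the directions, the other from summing over them;
    the rest is the constant of [sparse_square_sum] with [K = 8 * kappa], where [1 / e] has become
    [rh_const] times the A_infinity bound. *)
Definition square_const : R :=
  n%:R ^+ 2 * ((8 * kappa + 1) ^+ 2 * 128 * kappa ^+ 3 * @rh_const R d).

Lemma square_const_ge0 : 0 <= square_const.
Proof.
by rewrite /square_const !mulr_ge0 ?exprn_ge0 ?addr_ge0 ?mulr_ge0 ?exprn_ge0 ?addr_ge0 ?mulr_ge0// le_max ler01.
Qed.

Lemma weight_square_sum (h : X -> R) (s : seq cellix) (A : cellix -> set X) (y : cellix -> R) :
  measurable_fun setT h -> (forall z, 0 <= h z) -> (\int[mu]_x (h x ^+ 2)%:E < +oo)%E ->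
  uniq s -> (forall c, measurable (A c)) -> (forall c, A c `<=` cell c) ->
  (forall c c' z, c \in s -> c' \in s -> A c z -> A c' z -> c = c') ->
  (forall c, c \in s -> (mu (cell c) <= 2%:E * mu (A c))%E) ->
  (forall c, c \in s -> 0 <= y c /\ ((y c)%:E * mu (cell c) <=
    \int[mu]_(x in nbr t c) (\sum_k Num.sqrt (normalized U c k x) * h x)%:E)%E) ->
  (\sum_(c <- s) (y c ^+ 2)%:E * mu (cell c) <=
   (square_const * AU)%:E * \int[mu]_x (h x ^+ 2)%:E)%E.
Proof.
move=> mh h0 hoo us mA Ac dA hA Hy.
have mn c : measurable (nbr t c) by exact: measurable_nbr.
have sd c : 0 < side c.1 ^+ d by rewrite exprn_gt0// side_gt0.
have ms c k : measurable_fun setT (fun x => Num.sqrt (normalized U c k x) * h x).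
  apply: measurable_funM => //; apply: measurableT_comp (measurable_normalized c k).
  by apply: continuous_measurable_fun; exact: sqrt_continuous.
have s0 c k x : 0 <= Num.sqrt (normalized U c k x) * h x by rewrite mulr_ge0// sqrtr_ge0.
have fin c k : (\int[mu]_(x in nbr t c) (Num.sqrt (normalized U c k x) * h x)%:E)%E \is a fin_num.
  rewrite ge0_fin_numE; last by apply: integral_ge0 => x _; rewrite lee_fin.
  apply: (@le_lt_trans _ _ (\int[mu]_(x in nbr t c) (normalized U c k x)%:E +
      \int[mu]_(x in nbr t c) (h x ^+ 2)%:E)%E).
    rewrite -ge0_integralD//; first last.
    - by apply/measurable_EFinP/measurable_funTS; apply: measurable_funX.
    - by move=> x _; rewrite lee_fin sqr_ge0.
    - by apply/measurable_EFinP/measurable_funTS; exact: measurable_normalized.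
    - by move=> x _; rewrite lee_fin normalized_ge0.
    apply: ae_le_integral => [x _|x _|]; first by rewrite lee_fin.
      by rewrite -EFinD lee_fin addr_ge0 ?normalized_ge0 ?sqr_ge0.
    apply: aeW => x _; rewrite -EFinD lee_fin -{2}(sqr_sqrtr (normalized_ge0 c k x)).
    by have := sqr_ge0 (Num.sqrt (normalized U c k x) - h x);
      have := sqr_ge0 (Num.sqrt (normalized U c k x) + h x); nra.
  rewrite lte_add_pinfty//; first by rewrite integral_normalized ltry.
  by apply: le_lt_trans hoo; apply: le_integral_on => // x; exact: sqr_ge0.
pose z k c := (side c.1 ^+ d)^-1 *
  fine (\int[mu]_(x in nbr t c) (Num.sqrt (normalized U c k x) * h x)%:E)%E.
have z0 k c : 0 <= z k c.
  rewrite mulr_ge0 ?invr_ge0 ?(ltW (sd c))// fine_ge0//.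
  by apply: integral_ge0 => x _; rewrite lee_fin.
have mcE c : mu (cell c) = (side c.1 ^+ d)%:E := lebesgue_cell a L0 c.
have zE k c : ((z k c)%:E * mu (cell c) =
    \int[mu]_(x in nbr t c) (Num.sqrt (normalized U c k x) * h x)%:E)%E.
  by rewrite [X in (_ * X)%E]mcE -EFinM /z mulrAC mulVf ?gt_eqF// mul1r fineK.
have yz c : c \in s -> y c ^+ 2 <= n%:R * \sum_k z k c ^+ 2.
  move=> cs; have [y0 Hyc] := Hy c cs.
  have : y c <= \sum_k z k c.
    have H : ((y c)%:E * mu (cell c) <= (\sum_k z k c)%:E * mu (cell c))%E.
      apply: le_trans Hyc _; under eq_integral do rewrite -sumEFin.
      rewrite ge0_integral_sum//; first last.
      - by move=> k x _; rewrite lee_fin.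
      - by move=> k; apply/measurable_EFinP/measurable_funTS.
      rewrite -sumEFin ge0_sume_distrl; last by move=> k _; rewrite lee_fin.
      by apply: lee_sum => k _; rewrite -zE.
    by move: H; rewrite mcE -!EFinM lee_fin ler_pM2r.
  move=> yle; apply: (@le_trans _ _ ((\sum_k z k c) ^+ 2)).
    by rewrite lerXn2r ?nnegrE// sumr_ge0.
  by have := sqr_sum_le_card (z ^~ c); rewrite card_ord.
(* The single place where the A_infinity bound becomes a factor: the loss [1 / e] of the embedding
   is proportional to [AU]. *)
have [e [e0 e1 eA eE]] := @rh_exponent R d AU AU1.
have K0 : 0 <= 8 * kappa by rewrite mulr_ge0// exprn_ge0// addr_ge0// mulr_ge0.
have Hk k : (\sum_(c <- s) (z k c ^+ 2)%:E * mu (cell c) <=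
   (((8 * kappa + 1) ^+ 2 * 128 * kappa ^+ 3 * @rh_const R d) * AU)%:E * \int[mu]_x (h x ^+ 2)%:E)%E.
  have := @sparse_square_sum R d a L L0 (2 * d)%N h s A (fun c => normalized U c k) (z k) e (8 * kappa)
    e0 e1 K0 mh h0 hoo us mA Ac dA hA (fun c => measurable_normalized c k)
    (fun c => normalized_ge0 c k).
  rewrite eE mulrA; apply.
  - by move=> c _; exact: normalized_reverse_hoelder.
  - by move=> c _; split=> //; rewrite zE.
apply: (@le_trans _ _ (\sum_(c <- s) \sum_k (n%:R * z k c ^+ 2)%:E * mu (cell c))%E).
  rewrite big_seq [leRHS]big_seq; apply: lee_sum => c cs.
  rewrite -ge0_sume_distrl; last by move=> k _; rewrite lee_fin mulr_ge0// sqr_ge0.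
  by rewrite lee_wpmul2r// sumEFin lee_fin -mulr_sumr; exact: yz.
rewrite exchange_big /=.
apply: (@le_trans _ _ (\sum_(k < n) n%:R%:E * ((((8 * kappa + 1) ^+ 2 * 128 * kappa ^+ 3 * @rh_const R d) * AU)%:E *
    \int[mu]_x (h x ^+ 2)%:E))%E).
  apply: lee_sum => k _; apply: le_trans (lee_wpmul2l _ (Hk k)); last by rewrite lee_fin.
  rewrite ge0_sume_distrr; last by move=> c _; rewrite mule_ge0// lee_fin sqr_ge0.
  by apply: lee_sum => c _; rewrite EFinM muleA.
have I0 : (0 <= \int[mu]_x (h x ^+ 2)%:E)%E by apply: integral_ge0 => x _; rewrite lee_fin sqr_ge0.
have Ifin : (\int[mu]_x (h x ^+ 2)%:E)%E \is a fin_num by rewrite ge0_fin_numE.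
rewrite -(fineK Ifin) -!EFinM sumEFin lee_fin sumr_const card_ord -[leLHS]mulr_natl /square_const.
by rewrite le_eqVlt; apply/orP; left; apply/eqP; ring.
Qed.

End one_weight.

End weighted_squares.

(** * Finite sparse sums and their pairing *)

Section pairing.
Context {R : realType} {d n : nat} (a : 'I_d -> R) (L : R) (L0 : 0 < L).
Local Notation X := (d.-tuple R).
Local Notation mu := (lebesgue d).
Local Notation cell := (cell a L).
Local Notation nbr := (nbr a L).
Local Notation side := (side L).
Local Notation cellix := (nat * @gridix d)%type.
Local Notation t := ((2 * d)%N%:R : R).
Variables (W V : X -> 'M[R]_n) (AW AV : R).
Hypotheses (rW : regular_weight W) (rV : regular_weight V).
Hypotheses (AW1 : 1 <= AW) (AV1 : 1 <= AV).
Hypothesis WA : forall e, e != 0 -> (Ainfty_scalar (fun x => mxquad (W x) e) <= AW%:E)%E.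
Hypothesis VA : forall e, e != 0 -> (Ainfty_scalar (fun x => mxquad (V x) e) <= AV%:E)%E.
Variables (Sel : cellix -> set cellix) (q0 : cellix).
Hypothesis Sel_sub : forall c c', Sel c c' -> (c.1 < c'.1)%N /\ cell c' `<=` cell c.
Hypothesis Sel_triv : forall c, trivIset (Sel c) cell.
Hypothesis Sel_half : forall c,
  (mu (\bigcup_(c' in Sel c) cell c') <= 2^-1%:E * mu (cell c))%E.
Variables (h : X -> R) (F : cellix -> R).
Hypothesis mh : measurable_fun setT h.
Hypothesis h0 : forall x, 0 <= h x.
Hypothesis hoo : (\int[mu]_x (h x ^+ 2)%:E < +oo)%E.
Hypothesis F0 : forall c, 0 <= F c.
Hypothesis Fh : forall c, ((F c)%:E * mu (cell c) <=
    \int[mu]_(x in nbr t c) (\sum_k Num.sqrt (normalized a L V c k x) * h x)%:E)%E.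

Definition sparse_weight c (x : X) : R := Num.sqrt (\sum_k normalized a L W c k x).

Definition sparse_sum (s : seq cellix) (x : X) : R :=
  \sum_(c <- s) cut (cell c) (fun x => sparse_weight c x * F c) x.

Let term0 c x : 0 <= cut (cell c) (fun x => sparse_weight c x * F c) x.
Proof. by rewrite /cut; case: ifP => // _; rewrite mulr_ge0// sqrtr_ge0. Qed.

Lemma sparse_sum_ge0 s x : 0 <= sparse_sum s x.
Proof. by apply: sumr_ge0 => c _; exact: term0. Qed.

Let norm_sum_ge0 c x : 0 <= \sum_k normalized a L W c k x.
Proof. by apply: sumr_ge0 => k _; exact: normalized_ge0. Qed.

Lemma measurable_sparse_weight c : measurable_fun setT (sparse_weight c).
Proof.
apply: measurableT_comp; first by apply: continuous_measurable_fun; exact: sqrt_continuous.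
by apply: measurable_sum => k; exact: measurable_normalized.
Qed.

Let mterm c : measurable_fun setT (cut (cell c) (fun x => sparse_weight c x * F c)).
Proof.
apply: measurable_cut; first exact: measurable_cell.
by apply: measurable_funM; [exact: measurable_sparse_weight|exact: measurable_cst].
Qed.

Lemma measurable_sparse_sum s : measurable_fun setT (sparse_sum s).
Proof. by apply: measurable_sum. Qed.

Lemma sparse_weight_le c x : sparse_weight c x <= \sum_k Num.sqrt (normalized a L W c k x).
Proof.
have s0 : 0 <= \sum_k Num.sqrt (normalized a L W c k x) by apply: sumr_ge0 => k _; exact: sqrtr_ge0.
rewrite -(@ler_pXn2r _ 2) ?nnegrE ?sqrtr_ge0// sqr_sqrtr// expr2 mulr_suml.
apply: ler_sum => k _; rewrite -[leLHS](sqr_sqrtr (normalized_ge0 a L rW c k x)) expr2.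
rewrite ler_wpM2l ?sqrtr_ge0// (bigD1 k)//= lerDl.
by apply: sumr_ge0 => j _; exact: sqrtr_ge0.
Qed.

Lemma cell_normalized_lty c :
  (\int[mu]_(x in cell c) (\sum_k normalized a L W c k x)%:E < +oo)%E.
Proof.
have mc := measurable_cell a L c.
under eq_integral do rewrite -sumEFin.
rewrite ge0_integral_sum//; first last.
- by move=> k x _; rewrite lee_fin normalized_ge0.
- by move=> k; apply/measurable_EFinP/measurable_funTS; exact: measurable_normalized.
apply: lte_sum_pinfty => k _.
apply: (@le_lt_trans _ _ (\int[mu]_(x in nbr t c) (normalized a L W c k x)%:E)%E).
  apply: le_integral_on => //; first exact: cell_sub_nbr.
  by move=> x; exact: normalized_ge0.
by rewrite integral_normalized// ltry.
Qed.

(** Finiteness is what permits absorbing the sum later; it holds because finitely many terms occur,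
    each square integrable on its cell. *)
Lemma sparse_sum_lty s : (\int[mu]_x (sparse_sum s x ^+ 2)%:E < +oo)%E.
Proof.
pose g c x := F c ^+ 2 * cut (cell c) (fun x => \sum_k normalized a L W c k x) x.
have cut0 c x : 0 <= cut (cell c) (fun x => \sum_k normalized a L W c k x) x.
  by rewrite /cut; case: ifP.
have g0 c x : 0 <= g c x by rewrite mulr_ge0// sqr_ge0.
have mcut c : measurable_fun setT (cut (cell c) (fun x => \sum_k normalized a L W c k x)).
  apply: measurable_cut; first exact: measurable_cell.
  by apply: measurable_sum => k; exact: measurable_normalized.
have mg c : measurable_fun setT (g c) by apply: measurable_funM => //; exact: measurable_cst.
have sq c x : cut (cell c) (fun x => sparse_weight c x * F c) x ^+ 2 = g c x.
  rewrite /g /cut; case: ifP => _; last by rewrite expr0n mulr0.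
  by rewrite exprMn sqr_sqrtr// mulrC.
have bound x : sparse_sum s x ^+ 2 <= (size s)%:R * \sum_(c <- s) g c x.
  rewrite /sparse_sum !(big_nth q0) !big_mkord.
  apply: le_trans (sqr_sum_le_card _) _; rewrite card_ord ler_wpM2l//.
  by apply: ler_sum => i _; rewrite sq.
apply: (@le_lt_trans _ _ (\int[mu]_x ((size s)%:R * \sum_(c <- s) g c x)%:E)%E).
  by apply: le_integralE => // x; exact: sqr_ge0.
rewrite integralZE//; first last.
- by apply: measurable_sum.
- by move=> x; exact: sumr_ge0.
rewrite lte_mul_pinfty// integral_sumE//.
elim: (s) => [|c s' IH]; first by rewrite big_nil ltry.
rewrite big_cons lte_add_pinfty// integralZE ?sqr_ge0//.
rewrite lte_mul_pinfty ?lee_fin ?sqr_ge0// -(integral_cut (cell c) (fun x => \sum_k normalized a L W c k x)).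
exact: cell_normalized_lty.
Qed.

Local Notation SC := (@square_const R d n).

(* Pairing the sparse sum with itself splits its square integral into two square sums:
   one of averages of h for V, and one of averages of the sparse sum itself for W. *)
Lemma sparse_sum_bound s : uniq s -> (forall c, c \in s -> descendant Sel q0 c) ->
  (\int[mu]_x (sparse_sum s x ^+ 2)%:E <=
   ((SC + 1) ^+ 2 * AW * AV)%:E * \int[mu]_x (h x ^+ 2)%:E)%E.
Proof.
move=> us sF; pose Phi := sparse_sum s.
have Phi0 x : 0 <= Phi x := sparse_sum_ge0 s x.
have mPhi : measurable_fun setT Phi := measurable_sparse_sum s.
have Phoo : (\int[mu]_x (Phi x ^+ 2)%:E < +oo)%E := sparse_sum_lty s.
have sd c : 0 < side c.1 ^+ d by rewrite exprn_gt0// side_gt0.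
have mcE c : mu (cell c) = (side c.1 ^+ d)%:E := lebesgue_cell a L0 c.
have mc c : measurable (cell c) := measurable_cell a L c.
have SC0 : 0 <= SC := square_const_ge0.
have mP c : measurable_fun setT (fun x => sparse_weight c x * Phi x).
  by apply: measurable_funM => //; exact: measurable_sparse_weight.
have P0 c x : 0 <= sparse_weight c x * Phi x by rewrite mulr_ge0// sqrtr_ge0.
have mcut c : measurable_fun setT (cut (cell c) (fun x => sparse_weight c x * Phi x)).
  by apply: measurable_cut => //; exact: measurable_cell.
have cut0 c x : 0 <= cut (cell c) (fun x => sparse_weight c x * Phi x) x.
  by rewrite /cut; case: ifP.
have Phi2 x : Phi x ^+ 2 = \sum_(c <- s) F c * cut (cell c) (fun x => sparse_weight c x * Phi x) x.
  rewrite expr2 {1}/Phi /sparse_sum mulr_suml; apply: eq_bigr => c _.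
  by rewrite /cut; case: ifP => _; rewrite ?mul0r ?mulr0// mulrAC mulrC.
have IPhi : (\int[mu]_x (Phi x ^+ 2)%:E =
    \sum_(c <- s) (F c)%:E * \int[mu]_(x in cell c) (sparse_weight c x * Phi x)%:E)%E.
  under eq_integral do rewrite Phi2.
  rewrite integral_sumE; first last.
  - by move=> c; apply: measurable_funM => //; exact: measurable_cst.
  - by move=> c x; rewrite mulr_ge0.
  apply: eq_bigr => c _; rewrite integralZE//.
  by rewrite (integral_cut (cell c) (fun x => sparse_weight c x * Phi x)).
have Ile c x : cell c x -> sparse_weight c x * Phi x <= \sum_k Num.sqrt (normalized a L W c k x) * Phi x.
  by move=> _; rewrite -mulr_suml ler_wpM2r// sparse_weight_le.
pose G c := (side c.1 ^+ d)^-1 * fine (\int[mu]_(x in cell c) (sparse_weight c x * Phi x)%:E)%E.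
have Ifin c : (\int[mu]_(x in cell c) (sparse_weight c x * Phi x)%:E)%E \is a fin_num.
  rewrite ge0_fin_numE; last by apply: integral_ge0 => x _; rewrite lee_fin.
  have sq0 x : 0 <= sparse_weight c x ^+ 2 by exact: sqr_ge0.
  apply: (@le_lt_trans _ _ (\int[mu]_(x in cell c) (sparse_weight c x ^+ 2)%:E +
      \int[mu]_(x in cell c) (Phi x ^+ 2)%:E)%E).
    rewrite -ge0_integralD//; first last.
    - by apply/measurable_EFinP/measurable_funTS; apply: measurable_funX.
    - by move=> x _; rewrite lee_fin sqr_ge0.
    - by apply/measurable_EFinP/measurable_funTS; apply: measurable_funX; exact: measurable_sparse_weight.
    - by move=> x _; rewrite lee_fin.
    apply: ae_le_integral => [x _|x _|]; first by rewrite lee_fin.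
      by rewrite -EFinD lee_fin addr_ge0 ?sqr_ge0.
    apply: aeW => x _; rewrite -EFinD lee_fin.
    by have := sqr_ge0 (sparse_weight c x - Phi x); have := sqr_ge0 (sparse_weight c x + Phi x); nra.
  rewrite lte_add_pinfty//; last first.
    by apply: le_lt_trans Phoo; apply: le_integral_on => // x; exact: sqr_ge0.
  under eq_integral do rewrite sqr_sqrtr//.
  exact: cell_normalized_lty.
have G0 c : 0 <= G c.
  apply: mulr_ge0; first by rewrite invr_ge0 ltW.
  by apply: fine_ge0; apply: integral_ge0 => x _; rewrite lee_fin.
have GE c : ((G c)%:E * mu (cell c) = \int[mu]_(x in cell c) (sparse_weight c x * Phi x)%:E)%E.
  by rewrite [X in (_ * X)%E]mcE -EFinM /G mulrAC mulVf ?gt_eqF// mul1r fineK.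
clearbody G.
have mA c : measurable (remainder a L Sel c) by exact: measurable_remainder.
have Ac c : remainder a L Sel c `<=` cell c by move=> x [].
have dA c c' z : c \in s -> c' \in s -> remainder a L Sel c z -> remainder a L Sel c' z -> c = c'.
  by move=> cs c's; apply: (remainder_inj Sel_sub Sel_triv (sF c cs) (sF c' c's)).
have hA c : c \in s -> (mu (cell c) <= 2%:E * mu (remainder a L Sel c))%E.
  by move=> _; exact: remainder_half.
have HF := weight_square_sum L0 rV AV1 VA mh h0 hoo us mA Ac dA hA (fun c _ => conj (F0 c) (Fh c)).
have HG := weight_square_sum L0 rW AW1 WA mPhi Phi0 Phoo us mA Ac dA hA (y := G).
have {}HG : (\sum_(c <- s) (G c ^+ 2)%:E * mu (cell c) <= (SC * AW)%:E * \int[mu]_x (Phi x ^+ 2)%:E)%E.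
  apply: HG => c _; split; first exact: G0.
  rewrite GE; apply: (@le_trans _ _ (\int[mu]_(x in cell c) (\sum_k Num.sqrt (normalized a L W c k x) * Phi x)%:E)%E).
    apply: ae_le_integral => [x _|x _|]; first by rewrite lee_fin.
      by rewrite lee_fin; apply: sumr_ge0 => k _; rewrite mulr_ge0// sqrtr_ge0.
    by apply: aeW => x cx; rewrite lee_fin; exact: Ile.
  apply: le_integral_on => //; first exact: cell_sub_nbr.
  by move=> x; apply: sumr_ge0 => k _; rewrite mulr_ge0// sqrtr_ge0.
have [H HE] : exists H, (\int[mu]_x (h x ^+ 2)%:E)%E = H%:E.
  exists (fine (\int[mu]_x (h x ^+ 2)%:E)%E); rewrite fineK// ge0_fin_numE//.
  by apply: integral_ge0 => x _; rewrite lee_fin sqr_ge0.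
have [P PE] : exists P, (\int[mu]_x (Phi x ^+ 2)%:E)%E = P%:E.
  exists (fine (\int[mu]_x (Phi x ^+ 2)%:E)%E); rewrite fineK// ge0_fin_numE//.
  by apply: integral_ge0 => x _; rewrite lee_fin sqr_ge0.
have H0 : 0 <= H by rewrite -lee_fin -HE; apply: integral_ge0 => x _; rewrite lee_fin sqr_ge0.
have sumE (u : cellix -> R) : (\sum_(c <- s) (u c)%:E * mu (cell c) = (\sum_(c <- s) u c * side c.1 ^+ d)%:E)%E.
  by rewrite -sumEFin; apply: eq_bigr => c _; rewrite EFinM -mcE.
rewrite -/Phi PE HE -EFinM lee_fin.
move: HF; rewrite sumE HE -EFinM lee_fin => HF.
move: HG; rewrite sumE PE -EFinM lee_fin => HG.
(* With this weight in the inequality [2FG <= lam F^2 + G^2 / lam], the second term is at most half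
   of [P] and is absorbed; the first yields the product of [AW] and [AV]. *)
pose lam := SC * AW + 1.
have AW0 : 0 <= AW := le_trans ler01 AW1.
have AV0 : 0 <= AV := le_trans ler01 AV1.
have lam0 : 0 < lam by rewrite ltr_wpDl// mulr_ge0.
have Ple : P <= 2^-1 * (lam * (SC * AV * H) + lam^-1 * (SC * AW * P)).
  have PS : P = \sum_(c <- s) F c * G c * side c.1 ^+ d.
    apply: EFin_inj; rewrite -PE IPhi -sumEFin; apply: eq_bigr => c _.
    by rewrite -mulrA (EFinM (F c)) (EFinM (G c)) -mcE GE.
  rewrite {1}PS; apply: (@le_trans _ _ (2^-1 * (lam * (\sum_(c <- s) F c ^+ 2 * side c.1 ^+ d) +
       lam^-1 * (\sum_(c <- s) G c ^+ 2 * side c.1 ^+ d)))).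
    rewrite !mulr_sumr -big_split mulr_sumr; apply: ler_sum => c _ /=.
    have -> : 2^-1 * (lam * (F c ^+ 2 * side c.1 ^+ d) + lam^-1 * (G c ^+ 2 * side c.1 ^+ d)) =
       (lam^-1 * (2^-1 * (lam * F c - G c) ^+ 2) + F c * G c) * side c.1 ^+ d.
      by field; rewrite gt_eqF.
    apply: ler_wpM2r; first exact: ltW.
    rewrite lerDr; apply: mulr_ge0; first by rewrite invr_ge0 ltW.
    by apply: mulr_ge0 => //; exact: sqr_ge0.
  rewrite ler_wpM2l// lerD// ler_wpM2l ?invr_ge0 ?(ltW lam0)//.
have P0' : 0 <= P by rewrite -lee_fin -PE; apply: integral_ge0 => x _; rewrite lee_fin sqr_ge0.
have q1 : lam^-1 * (SC * AW * P) <= P.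
  rewrite mulrA ler_piMl// mulrC ler_pdivrMr// mul1r /lam; lra.
have P2 : P <= lam * (SC * AV * H) by lra.
apply: (le_trans P2); rewrite /lam; move: SC SC0 => S S0.
have -> : (S + 1) ^+ 2 * AW * AV * H =
    (S * AW + 1) * (S * AV * H) + ((2 * S + 1) * AW - S) * (AV * H) by ring.
rewrite lerDl; apply: mulr_ge0; last exact: mulr_ge0.
have SA : S <= S * AW by rewrite ler_peMr.
rewrite subr_ge0; apply: le_trans SA _; rewrite ler_wpM2r//; lra.
Qed.

End pairing.

Lemma ler_sum_uniq_sub {R : numDomainType} {I : eqType} (s s' : seq I) (u : I -> R) :
  uniq s -> uniq s' -> {subset s <= s'} -> (forall i, 0 <= u i) ->
  \sum_(i <- s) u i <= \sum_(i <- s') u i.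
Proof.
move=> us us' ss u0; rewrite (perm_big [seq i <- s' | i \in s]) /=; last first.
  apply: uniq_perm => //; first exact: filter_uniq.
  by move=> i; rewrite mem_filter andb_idr// => /ss.
by rewrite big_filter big_mkcond; apply: ler_sum => i _; case: ifP.
Qed.

(** * The weighted estimate on one large cell *)

Section cell_estimate.
Context {R : realType} {d : nat} {E : completeNormedModType R} (d_gt0 : (0 < d)%N).
Context (a : 'I_d -> R) (L : R) (L0 : 0 < L).
Context {T : (d.-tuple R -> E) -> d.-tuple R -> E}
  {K : d.-tuple R -> d.-tuple R -> {linear E -> E}}
  {omega : R -> R} {CT D : R} (HT : cz_bounds T K omega CT D).
Context {n : nat}.
Local Notation X := (d.-tuple R).
Local Notation mu := (lebesgue d).
Local Notation cell := (cell a L).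
Local Notation nbr := (nbr a L).
Local Notation cellix := (nat * @gridix d)%type.
Local Notation SC := (@square_const R d n).
Local Notation LC := (@lerner_const R d CT D n).
Variables (W V : X -> 'M[R]_n) (A AW AV : R).
Hypotheses (rW : regular_weight W) (rV : regular_weight V).
Hypothesis VE : forall x, V x = invmx (W x).
Hypothesis A0 : 0 <= A.
Hypothesis WVA : forall b l, 0 < l ->
  frob2 (sqrtmx (average W (cube b l)) *m sqrtmx (average V (cube b l))) <= A.
Hypotheses (AW1 : 1 <= AW) (AV1 : 1 <= AV).
Hypothesis WA : forall e, e != 0 -> (Ainfty_scalar (fun x => mxquad (W x) e) <= AW%:E)%E.
Hypothesis VA : forall e, e != 0 -> (Ainfty_scalar (fun x => mxquad (V x) e) <= AV%:E)%E.

Definition cell_const : R := (n%:R * LC) ^+ 2 * (SC + 1) ^+ 2.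

Lemma normalizedE (U : X -> 'M[R]_n) c k x : regular_weight U ->
  normalized a L U c k x = sqnorm (sqrtmx (U x) *m invmx (nbr_root a L U c) *m delta_mx k 0).
Proof. by move=> [_ pU _]; rewrite /normalized mxquad_sqrt// mulmxA. Qed.

Lemma sparse_weight_frob c x :
  sparse_weight a L W c x = Num.sqrt (frob2 (sqrtmx (W x) *m invmx (nbr_root a L W c))).
Proof.
by congr Num.sqrt; rewrite frob2E; apply: eq_bigr => k _; exact: normalizedE.
Qed.

(** The root of the average of [W] and its inverse are inserted between the two factors: one part
    becomes the normalized weight, the other is bounded by the A_2 quantity. *)
Lemma sqrt_frob2_le c x : Num.sqrt (frob2 (sqrtmx (W x) *m nbr_root a L V c)) <=
  Num.sqrt A * sparse_weight a L W c x.
Proof.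
have uA := nbr_root_unit a L0 c rW.
have -> : sqrtmx (W x) *m nbr_root a L V c =
    (sqrtmx (W x) *m invmx (nbr_root a L W c)) *m (nbr_root a L W c *m nbr_root a L V c).
  by rewrite mulmxA mulmxKV.
rewrite sparse_weight_frob -sqrtrM// mulrC ler_wsqrtr//.
apply: le_trans (frob2M_le _ _) _; rewrite ler_wpM2l ?frob2_ge0//.
by apply: WVA; rewrite mulr_gt0 ?side_gt0// ltr_pwDl// mulr_ge0.
Qed.

(** The norm of the [i]-th row of the inverse root of the average of [V], times the inverse root of
    [W(x)], squares to the normalized weight of [V = W^-1] in the direction [i]. *)
Lemma normalized_image_le (f : 'I_n -> E) c i x :
  `|mxact (invmx (nbr_root a L V c)) f i| <=
    Num.sqrt (normalized a L V c i x) * l2norm (mxact (sqrtmx (W x)) f).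
Proof.
have [_ pW _] := rW; have [sS SS uS] := posdef_sqrt (pW x).
set B := nbr_root a L V c.
have sB : (invmx B)^T = invmx B by rewrite invmx_sym// (nbr_root_sym a L0 c rV).
have sV : (invmx (sqrtmx (W x)))^T = invmx (sqrtmx (W x)) by rewrite invmx_sym.
have -> : mxact (invmx B) f = mxact (invmx B *m invmx (sqrtmx (W x))) (mxact (sqrtmx (W x)) f).
  by rewrite -mxactM mulmxKV.
apply: le_trans (mxact_coord_le _ _ _) _; rewrite le_eqVlt; apply/orP; left; apply/eqP.
congr (Num.sqrt _ * _); rewrite /normalized VE (invmx_sqrt (pW x)).
rewrite mxquad_sqr// mulmxA.
have -> : invmx (sqrtmx (W x)) *m invmx B = (invmx B *m invmx (sqrtmx (W x)))^T.
  by rewrite trmx_mul sB sV.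
by rewrite sqnorm_colE; apply: eq_bigr => j _; congr (_ ^+ 2); rewrite [RHS]mxE.
Qed.

(** [h] is a measurable majorant, since the weighted norm of [f] is measurable up to a null set
    only. The pointwise list of cells depends on the point; it is contained in one of countably many
    increasing finite families, to which the uniform bound applies. *)
Lemma cell_estimate N (f : X -> 'I_n -> E) (h : X -> R) q0 :
  (forall i, gstep a L N (f ^~ i)) ->
  measurable_fun setT h -> (forall x, 0 <= h x) -> (\int[mu]_x (h x ^+ 2)%:E < +oo)%E ->
  (\forall x \ae mu, l2norm (mxact (sqrtmx (W x)) (f x)) <= h x) ->
  (\int[mu]_(x in cell q0) (l2norm (mxact (sqrtmx (W x)) (@local_image R d E a L T n f q0 x)) ^+ 2)%:E
   <= (cell_const * (A * AW * AV))%:E * \int[mu]_x (h x ^+ 2)%:E)%E.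
Proof.
move=> fs mh h0 hoo fh; pose B := nbr_root a L V.
have uB c : B c \in unitmx by exact: nbr_root_unit.
pose F := coef a L f B.
have F0 c : 0 <= F c by apply: coef_ge0 => //; exact: fs.
have s0 c k x : 0 <= Num.sqrt (normalized a L V c k x) * h x by rewrite mulr_ge0// sqrtr_ge0.
have Fh c : ((F c)%:E * mu (cell c) <=
    \int[mu]_(x in nbr (2 * d)%N%:R c) (\sum_k Num.sqrt (normalized a L V c k x) * h x)%:E)%E.
  rewrite (coefE L0 fs) radius.unlock mul1n; apply: ae_le_integral => [x _|x _|].
  - by rewrite lee_fin; exact: sumr_ge0.
  - by rewrite lee_fin; exact: sumr_ge0.
  apply: filterS fh => x fx _; rewrite lee_fin; apply: ler_sum => i _.
  apply: le_trans (normalized_image_le _ _ _ x) _.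
  by rewrite ler_wpM2l// sqrtr_ge0.
have [Sel [S1 S2 S3 S4]] := sparse_domination d_gt0 L0 HT fs uB q0 (fun x => sqrtmx (W x)).
(* The descendants whose code is below [k]. *)
pose enum k : seq cellix :=
  [seq c <- pmap choice.pickle_inv (iota 0 k) | `[< descendant Sel q0 c >]].
have enumP k c : c \in enum k -> descendant Sel q0 c.
  by rewrite mem_filter => /andP[/asboolP].
have enum_uniq k : uniq (enum k).
  by apply/filter_uniq/(pmap_uniq choice.pickle_invK); exact: iota_uniq.
have enum_sub k k' : (k <= k')%N -> {subset enum k <= enum k'}.
  move=> kk c; rewrite !mem_filter => /andP[-> /=]; rewrite !mem_pmap => /mapP[i].
  rewrite mem_iota add0n /= => ik ->; apply/map_f; rewrite mem_iota add0n /=.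
  exact: leq_trans ik kk.
have enum_all (s : seq cellix) : (forall c, c \in s -> descendant Sel q0 c) ->
    exists k, {subset s <= enum k}.
  elim: s => [|c s IH] H; first by exists 0%N.
  have [|k Hk] := IH; first by move=> c' c's; apply: H; rewrite inE c's orbT.
  exists (maxn k (choice.pickle c).+1) => c'; rewrite inE => /predU1P[->|/Hk]; last first.
    by apply: enum_sub; exact: leq_maxl.
  rewrite mem_filter; apply/andP; split; first by apply/asboolP/H; rewrite inE eqxx.
  rewrite mem_pmap; apply/mapP; exists (choice.pickle c).
    by rewrite mem_iota add0n leq_max leqnn orbT.
  by rewrite choice.pickleK_inv.
pose Phi k := sparse_sum a L W F (enum k).
have term0 c x : 0 <= cut (cell c) (fun x => sparse_weight a L W c x * F c) x.
  by rewrite /cut; case: ifP => // _; rewrite mulr_ge0// sqrtr_ge0.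
have Phi0 k x : 0 <= Phi k x by exact: sumr_ge0.
have mPhi k : measurable_fun setT (Phi k) by exact: measurable_sparse_sum.
have Phi_mono k k' x : (k <= k')%N -> Phi k x <= Phi k' x.
  by move=> kk; apply: ler_sum_uniq_sub => //; exact: enum_sub.
have LC0 : 0 <= n%:R * LC.
  rewrite mulr_ge0// /lerner_const; have st := le_trans ler01 (stop_const_ge1 d_gt0 HT n).
  have wc := weak_const_ge0 d_gt0 HT; have D0 := cz_D0 HT.
  apply: addr_ge0 => //; apply: mulr_ge0; last first.
    by apply: mulr_ge0 => //; rewrite exprn_ge0// addr_ge0// mulr_ge0.
  apply: addr_ge0 => //; apply: mulr_ge0; last exact: exprn_ge0.
  by apply: mulr_ge0 => //; exact: addr_ge0.
have [c0 c0E] : exists c0, c0 = Num.sqrt A * (n%:R * LC) by eexists.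
have c00 : 0 <= c0 by rewrite c0E; apply: mulr_ge0 => //; exact: sqrtr_ge0.
pose g k (x : X) : \bar R := ((c0 * Phi k x) ^+ 2)%:E.
have g0 k x : (0 <= g k x)%E by rewrite lee_fin sqr_ge0.
have g_mono k k' x : (k <= k')%N -> (g k x <= g k' x)%E.
  move=> kk; rewrite lee_fin lerXn2r ?nnegrE ?mulr_ge0//.
  by rewrite ler_wpM2l// Phi_mono.
have mg k : measurable_fun setT (g k).
  apply/measurable_EFinP; apply: measurable_funX.
  by apply: measurable_funM => //; exact: measurable_cst.
have g_cvg x : cvgn (g ^~ x).
  by apply: ereal_nondecreasing_is_cvgn => k k' kk; exact: g_mono.
apply: (@le_trans _ _ (\int[mu]_x limn (g ^~ x))%E).
  rewrite [leLHS]integral_mkcond; apply: ae_le_integral => [x _|x _|].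
  - by apply: erestrict_ge0 => y _; rewrite lee_fin sqr_ge0.
  - by apply: lime_ge => //; apply: nearW => k.
  apply: filterS S4 => x H _; rewrite patchE; case: ifPn => [/set_mem qx|_]; last first.
    by apply: lime_ge => //; apply: nearW => k.
  have [s [us sF Hs]] := H qx.
  have [k Hk] := enum_all s (fun c cs => proj1 (sF c cs)).
  apply: (@le_trans _ _ (g k x)); last first.
    by apply: lime_ge => //; exists k => // k' /= kk'; exact: g_mono.
  rewrite lee_fin lerXn2r ?nnegrE ?mulr_ge0 ?sqrtr_ge0//.
  apply: le_trans Hs _.
  apply: (@le_trans _ _ (c0 * \sum_(c <- s) cut (cell c) (fun x => sparse_weight a L W c x * F c) x)).
    rewrite mulr_sumr big_seq [leRHS]big_seq; apply: ler_sum => c cs.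
    have [_ cx] := sF c cs; rewrite cutT//.
    have := sqrt_frob2_le c x; rewrite -/B => Hc.
    apply: (@le_trans _ _ (Num.sqrt A * sparse_weight a L W c x * (n%:R * LC * F c))).
      by rewrite ler_wpM2r// mulr_ge0.
    by rewrite le_eqVlt; apply/orP; left; apply/eqP; rewrite c0E; move: (n%:R * LC) => ?; ring.
  by rewrite ler_wpM2l//; apply: ler_sum_uniq_sub.
rewrite (monotone_convergence mu measurableT mg (fun k x _ => g0 k x)); last first.
  by move=> x _ k k' kk; exact: g_mono.
apply: lime_le.
  apply: ereal_nondecreasing_is_cvgn => k k' kk; apply: ae_le_integral => [x _|x _|]; [exact: g0|exact: g0|].
  by apply: aeW => x _; exact: g_mono.
apply: nearW => k; rewrite /g.
under eq_integral do rewrite exprMn.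
rewrite integralZE ?sqr_ge0//; first last.
- exact: measurable_funX.
- by move=> x; exact: sqr_ge0.
have := sparse_sum_bound L0 rW rV AW1 AV1 WA VA S1 S2 S3 mh h0 hoo F0 Fh (enum_uniq k) (@enumP k).
move=> /(lee_wpmul2l (_ : 0 <= (c0 ^+ 2)%:E)%E) H; apply: le_trans (H _) _.
  by rewrite lee_fin sqr_ge0.
rewrite muleA -EFinM; apply: lee_wpmul2r.
  by apply: integral_ge0 => x _; rewrite lee_fin sqr_ge0.
rewrite lee_fin c0E /cell_const exprMn sqr_sqrtr// le_eqVlt; apply/orP; left; apply/eqP.
by move: (n%:R * LC) SC => u v; ring.
Qed.

End cell_estimate.

(** * The bound for step functions *)

Section coordinates.
Context {R : realType} {n : nat} {E : normedModType R}.

Definition coord_of (i : 'I_n) (x : 'I_n -> E) : E := x i.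
Fact coord_of_linear i : linear (coord_of i). Proof. by []. Qed.
HB.instance Definition _ i := GRing.isLinear.Build R ('I_n -> E) E *:%R (coord_of i) (coord_of_linear i).

Definition single (i : 'I_n) (e : E) : 'I_n -> E := fun j => if j == i then e else 0.
Fact single_linear i : linear (single i).
Proof.
move=> r u v; apply/funext => j; rewrite /single /=.
change ((if j == i then r *: u + v else 0) =
  r *: (if j == i then u else 0) + (if j == i then v else 0)).
by case: ifP => // _; rewrite scaler0 addr0.
Qed.
HB.instance Definition _ i := GRing.isLinear.Build R E ('I_n -> E) *:%R (single i) (single_linear i).

Lemma sum_single (x : 'I_n -> E) : \sum_i single i (x i) = x.
Proof.
apply/funext => j; rewrite fct_sumE (bigD1 j)//= /single eqxx big1 ?addr0// => i ij.
by rewrite eq_sym (negbTE ij).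
Qed.

Lemma l2norm_single i (e : E) : l2norm (single i e) = `|e|.
Proof.
rewrite /l2norm (bigD1 i)//= /single eqxx big1 ?addr0 ?sqrtr_sqr ?normr_id// => j ji.
by rewrite (negbTE ji) normr0 expr0n.
Qed.

Context {disp : measure_display} {X : measurableType disp}.
Variable mu : {sigma_finite_measure set X -> \bar R}.
Local Notation normE := (fun x : E => `|x|).

Lemma strongly_measurable_coord (f : X -> 'I_n -> E) i :
  strongly_measurable mu l2norm f -> strongly_measurable mu normE (f ^~ i).
Proof.
move=> mf; have H x : `|coord_of i x| <= 1 * l2norm x by rewrite mul1r; exact: l2norm_ge_coord.
exact: (strongly_measurable_lin l2norm_seminorm seminorm_normr H mf).
Qed.

Lemma strongly_measurable_tuple (f : X -> 'I_n -> E) :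
  (forall i, strongly_measurable mu normE (f ^~ i)) -> strongly_measurable mu l2norm f.
Proof.
move=> mf; have -> : f = \sum_i (fun x => single i (f x i)).
  by apply/funext => x; rewrite fct_sumE sum_single.
apply: strongly_measurable_sum; first exact: l2norm_seminorm.
move=> i _; have H e : l2norm (single i e) <= 1 * `|e| by rewrite mul1r l2norm_single.
exact: (strongly_measurable_lin seminorm_normr l2norm_seminorm H (mf i)).
Qed.

Lemma strongly_measurable_mxact (S : X -> 'M[R]_n) (f : X -> 'I_n -> E) :
  (forall i j, measurable_fun setT (fun x => S x i j)) ->
  strongly_measurable mu l2norm f ->
  strongly_measurable mu l2norm (fun x => mxact (S x) (f x)).
Proof.
move=> mS mf; apply: strongly_measurable_tuple => i.
rewrite (_ : (fun x => _) = \sum_j (fun x => S x i j *: f x j)); last first.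
  by apply/funext => x; rewrite fct_sumE.
apply: strongly_measurable_sum; first exact: seminorm_normr.
move=> j _; apply: strongly_measurable_scale => //; first exact: seminorm_normr.
exact: strongly_measurable_coord.
Qed.

Lemma sqint_coord (f : X -> 'I_n -> E) i : (sqint mu normE (f ^~ i) <= sqint mu l2norm f)%E.
Proof.
apply: ae_le_integral => [x _|x _|]; rewrite ?lee_fin ?sqr_ge0//.
by apply: aeW => x _; rewrite lee_fin lerXn2r ?nnegrE ?sqrtr_ge0//; exact: l2norm_ge_coord.
Qed.

Lemma L2fun_coord (f : X -> 'I_n -> E) i :
  L2fun mu l2norm f -> L2fun mu normE (f ^~ i).
Proof.
move=> [mf foo]; split; first exact: strongly_measurable_coord.
rewrite L2norm_lty; last exact: seminorm_normr.
rewrite L2norm_lty in foo; last exact: l2norm_seminorm.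
by apply: le_lt_trans foo; exact: sqint_coord.
Qed.

Lemma sqint_le_coords (f : X -> 'I_n -> E) : (forall i, strongly_measurable mu normE (f ^~ i)) ->
  (sqint mu l2norm f <= \sum_i sqint mu normE (f ^~ i))%E.
Proof.
move=> mf; have sn := @seminorm_normr R E.
have /choice[g /all_and2[mg /all_and2[g0 gE]]] i : exists g : X -> R,
    measurable_fun setT g /\ (forall x, 0 <= g x) /\ \forall x \ae mu, `|f x i| = g x.
  by have [g ? []] := strongly_measurable_near_norm sn (mf i); exists g.
have E1 i : sqint mu normE (f ^~ i) = (\int[mu]_x (g i x ^+ 2)%:E)%E.
  apply: ae_eq_ge0_integral => [x _|x _|]; rewrite ?lee_fin ?sqr_ge0//.
  by apply: filterS (gE i) => x -> _.
under eq_bigr do rewrite E1.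
rewrite -integral_sumE; first last.
- by move=> i; exact: measurable_funX.
- by move=> i x; exact: sqr_ge0.
have gE' := ae_seq (s := index_enum 'I_n) (fun i _ => gE i).
apply: ae_le_integral => [x _|x _|].
- by rewrite lee_fin sqr_ge0.
- by rewrite lee_fin; apply: sumr_ge0 => i _; exact: sqr_ge0.
apply: filterS gE' => x H _; rewrite lee_fin l2norm_sq; apply: ler_sum => i _.
by rewrite H// mem_index_enum.
Qed.

Lemma L2fun_tuple (f : X -> 'I_n -> E) :
  (forall i, L2fun mu normE (f ^~ i)) -> L2fun mu l2norm f.
Proof.
move=> Lf; have mf i := proj1 (Lf i); split; first exact: strongly_measurable_tuple.
rewrite L2norm_lty; last exact: l2norm_seminorm.
apply: le_lt_trans (sqint_le_coords mf) _; apply: lte_sum_pinfty => i _.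
by have [_] := Lf i; rewrite L2norm_lty//; exact: seminorm_normr.
Qed.

End coordinates.

Section step_estimate.
Context {R : realType} {d : nat} {E : completeNormedModType R} (d_gt0 : (0 < d)%N).
Context {T : (d.-tuple R -> E) -> d.-tuple R -> E}
  {K : d.-tuple R -> d.-tuple R -> {linear E -> E}}
  {omega : R -> R} {CT D : R} (HT : cz_bounds T K omega CT D).
Context {n : nat}.
Local Notation X := (d.-tuple R).
Local Notation mu := (lebesgue d).
Variables (W V : X -> 'M[R]_n) (A AW AV : R).
Hypotheses (rW : regular_weight W) (rV : regular_weight V).
Hypothesis VE : forall x, V x = invmx (W x).
Hypothesis A0 : 0 <= A.
Hypothesis WVA : forall b l, 0 < l ->
  frob2 (sqrtmx (average W (cube b l)) *m sqrtmx (average V (cube b l))) <= A.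
Hypotheses (AW1 : 1 <= AW) (AV1 : 1 <= AV).
Hypothesis WA : forall e, e != 0 -> (Ainfty_scalar (fun x => mxquad (W x) e) <= AW%:E)%E.
Hypothesis VA : forall e, e != 0 -> (Ainfty_scalar (fun x => mxquad (V x) e) <= AV%:E)%E.

(** The [2^d] cells of generation 0 that meet at the origin of the grid; a single one would never
    exhaust more than an orthant as the side grows. *)
Definition orthant_cell (b : {ffun 'I_d -> bool}) : nat * @gridix d :=
  (0%N, [ffun i => if b i then -1 else 0]).

Definition block (a : 'I_d -> R) (L : R) : set X := [set x | forall i, a i - L <= tnth x i < a i + L].

Lemma measurable_block a L : measurable (block a L).
Proof.
rewrite (_ : block _ _ = hcube (fun i => a i - L) (2 * L)); first exact: measurable_hcube.
by apply/seteqP; split=> x H i; have /andP[h1 h2] := H i; apply/andP; split => //=;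
  apply: lt_le_trans h2 _; lra.
Qed.

Lemma block_orthant a L x : block a L x -> exists b, cell a L (orthant_cell b) x.
Proof.
move=> H; exists [ffun i => tnth x i < a i] => i; have /andP[h1 h2] := H i.
rewrite /corner /= !ffunE side.unlock expr0 divr1; apply/andP.
by case: ltP => h; rewrite ?mulrN1 ?mulr0; split; lra.
Qed.

Lemma block_nbr a L b : 0 < L -> block a L `<=` nbr a L (radius d 0) (orthant_cell b).
Proof.
move=> L0 x H i; have /andP[h1 h2] := H i.
have r1 : 1 <= radius d 0 :> R by rewrite radius.unlock mul1n ler1n muln_gt0.
rewrite /corner /= !ffunE side.unlock expr0 divr1; apply/andP.
by case: (b i); rewrite ?mulrN1 ?mulr0; split; nra.
Qed.

(** Enlarging the root side by [2^j] and the generation by [j] leaves the cells unchanged, so a step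
    function stays one on the coarser grid. *)
Lemma side_scale (L : R) j k : side (2 ^+ j * L) (k + j) = side L k.
Proof.
rewrite side.unlock exprD; have : (2 ^+ j : R) != 0 by rewrite expf_neq0.
have : (2 ^+ k : R) != 0 by rewrite expf_neq0.
by move: (2 ^+ j : R) (2 ^+ k : R) => u v u0 v0; field; rewrite u0.
Qed.

Lemma loc_scale a (L : R) j k : @loc R d a (2 ^+ j * L) (k + j) = @loc R d a L k.
Proof. by apply/funext => x; rewrite /loc side_scale. Qed.

Lemma gstep_scale a (L : R) j N (F : zmodType) (f : X -> F) :
  gstep a L N f -> gstep a (2 ^+ j * L) (N + j) f.
Proof. by move=> [B H]; exists B; rewrite /gstepB loc_scale. Qed.

Lemma gstepB_block a (L : R) N B (F : zmodType) (f : X -> F) x j : 0 < L ->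
  gstepB a L N B f -> f x <> 0 -> (B < j)%N -> block a (2 ^+ j * L) x.
Proof.
move=> L0 [_ fB] fx Bj i; have := fB x fx i => Bi.
have := cell_loc a L0 N x i; rewrite /corner /=.
set m := loc a L N x i in Bi *; have s0 := side_gt0 L0 N.
have sL : side L N <= L.
  have := side_anti L0 (leq0n N); have -> : side L 0 = L by rewrite side.unlock expr0 divr1.
  by [].
have mB : `|m%:~R| <= B%:R :> R by rewrite -intr_norm -abszE -pmulrn ler_nat.
have j2 : B%:R + 1 <= 2 ^+ j :> R.
  rewrite natr1 -natrX ler_nat; apply: leq_trans Bj _; exact/ltnW/ltn_expl.
move=> /andP[h1 h2]; move: mB; rewrite ler_norml => /andP[m1 m2].
have P1 : (B%:R + 1) * side L N <= 2 ^+ j * L by apply: ler_pM => //; exact: ltW.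
apply/andP; split; nra.
Qed.

(** For large [j] the support of [f] lies in the dilate of each of the [2^d] large cells, where the
    local image is [T f] itself. Adding these cells gives the factor [2^d], and monotone convergence
    in [j] exhausts the space. *)
Lemma step_estimate a L N (f : X -> 'I_n -> E) (h : X -> R) : 0 < L ->
  (forall i, gstep a L N (f ^~ i)) ->
  measurable_fun setT h -> (forall x, 0 <= h x) -> (\int[mu]_x (h x ^+ 2)%:E < +oo)%E ->
  (\forall x \ae mu, l2norm (mxact (sqrtmx (W x)) (f x)) <= h x) ->
  (sqint mu l2norm (fun x => mxact (sqrtmx (W x)) (componentwise T f x)) <=
   (2 ^+ d * @cell_const R d CT D n * (A * AW * AV))%:E * \int[mu]_x (h x ^+ 2)%:E)%E.
Proof.
move=> L0 fs mh h0 hoo fh.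
have [B fB] : exists B, forall i, gstepB a L N B (f ^~ i).
  have /choice[b Hb] := fs; exists (\max_i b i) => i.
  by apply: gstepB_le (Hb i); exact: leq_bigmax.
set Z := (_%:E * _)%E.
have Lf i : L2fun mu (fun x : E => `|x|) (f ^~ i).
  by apply: gstep_L2fun (fs i) => //; exact: seminorm_normr.
have mTf : strongly_measurable mu l2norm (componentwise T f).
  by apply: strongly_measurable_tuple => i; have [] := cz_L2 HT (Lf i).
have mS : forall i j, measurable_fun setT (fun x => sqrtmx (W x) i j).
  by have [mW pW _] := rW; apply: measurable_sqrtmx => // x; exact: posdef_semi.
have [g mg [g0 gE]] := strongly_measurable_near_norm l2norm_seminorm (strongly_measurable_mxact mS mTf).
have blockE j : (B < j)%N -> (\int[mu]_(x in block a (2 ^+ j * L)) (g x ^+ 2)%:E <= Z)%E.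
  move=> Bj; have Lj : 0 < 2 ^+ j * L by rewrite mulr_gt0// exprn_gt0.
  have mb := measurable_block a (2 ^+ j * L).
  apply: (@le_trans _ _ (\sum_(b : {ffun 'I_d -> bool}) \int[mu]_(x in cell a (2 ^+ j * L) (orthant_cell b)) (g x ^+ 2)%:E)%E).
    apply: integral_fin_cover; first exact: mb.
    - by move=> b; exact: measurable_cell.
    - by apply/measurable_EFinP; exact: measurable_funX.
    - by move=> x; rewrite lee_fin sqr_ge0.
    - exact: block_orthant.
  apply: (@le_trans _ _ (\sum_(b : {ffun 'I_d -> bool}) (@cell_const R d CT D n * (A * AW * AV))%:E * \int[mu]_x (h x ^+ 2)%:E)%E).
    apply: lee_sum => b _.
    apply: le_trans (cell_estimate d_gt0 Lj HT rW rV VE A0 WVA AW1 AV1 WA VA (orthant_cell b)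
      (fun i => gstep_scale j (fs i)) mh h0 hoo fh).
    apply: ae_le_integral => [x _|x _|]; rewrite ?lee_fin ?sqr_ge0//.
    apply: filterS gE => x <- _; rewrite lee_fin le_eqVlt; apply/orP; left; apply/eqP.
    congr (l2norm (mxact _ _) ^+ 2); apply/funext => i; rewrite /componentwise /local_image.
    congr (T _ x); apply/funext => y.
    case: (pselect (nbr a (2 ^+ j * L) (radius d 0) (orthant_cell b) y)) => ny; first by rewrite cutT.
    rewrite cutF//; apply: contrapT => fy; apply: ny; apply: block_nbr => //.
    exact: gstepB_block L0 (fB i) fy Bj.
  have I0 : (0 <= \int[mu]_x (h x ^+ 2)%:E)%E by apply: integral_ge0 => x _; rewrite lee_fin sqr_ge0.
  have Ifin : (\int[mu]_x (h x ^+ 2)%:E)%E \is a fin_num by rewrite ge0_fin_numE.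
  rewrite /Z -(fineK Ifin) -!EFinM sumEFin lee_fin sumr_const card_ffun card_bool card_ord.
  by rewrite -[leLHS]mulr_natl natrX -!mulrA.
have -> : sqint mu l2norm (fun x => mxact (sqrtmx (W x)) (componentwise T f x)) =
    (\int[mu]_x (g x ^+ 2)%:E)%E.
  apply: ae_eq_ge0_integral => [x _|x _|]; rewrite ?lee_fin ?sqr_ge0//.
  by apply: filterS gE => x -> _.
have mblock j := measurable_block a (2 ^+ j * L).
pose G j (x : X) : \bar R := (cut (block a (2 ^+ j * L)) (fun x => g x ^+ 2) x)%:E.
have G0 j x : (0 <= G j x)%E by rewrite lee_fin /cut; case: ifP => // _; exact: sqr_ge0.
have mG j : measurable_fun setT (G j).
  by apply/measurable_EFinP; apply: measurable_cut => //; exact: measurable_funX.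
have block_mono j j' : (j <= j')%N -> block a (2 ^+ j * L) `<=` block a (2 ^+ j' * L).
  move=> jj x H i; have /andP[h1 h2] := H i.
  have : 2 ^+ j * L <= 2 ^+ j' * L by rewrite ler_wpM2r ?(ltW L0)// ler_weXn2l// ler1n.
  by move=> h3; apply/andP; split; lra.
have G_mono x : {homo G ^~ x : j j' / (j <= j')%N >-> (j <= j')%E}.
  move=> j j' jj; rewrite lee_fin /cut; case: ifPn => [/set_mem H|_].
    by rewrite mem_set//; exact: block_mono H.
  by case: ifP => // _; exact: sqr_ge0.
apply: (@le_trans _ _ (\int[mu]_x limn (G ^~ x))%E).
  apply: ae_le_integral => [x _|x _|].
  - by rewrite lee_fin sqr_ge0.
  - by apply: lime_ge; [exact: ereal_nondecreasing_is_cvgn|apply: nearW => k; exact: G0].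
  apply: aeW => x _; apply: lime_ge; first exact: ereal_nondecreasing_is_cvgn.
  have [j Hj] : exists j, block a (2 ^+ j * L) x.
    pose M := \sum_i `|tnth x i - a i|.
    have [j Hj] := side_small (M + 1) L0; exists j => i.
    have iM : `|tnth x i - a i| <= M by rewrite /M (bigD1 i)//= lerDl sumr_ge0.
    move: Hj; rewrite side.unlock ltr_pdivrMr ?exprn_gt0// => Hj.
    by move: iM; rewrite ler_norml => /andP[h1 h2]; apply/andP; split; lra.
  exists j => // j' /= jj; apply: le_trans (G_mono x _ _ jj).
  by rewrite lee_fin cutT.
rewrite (monotone_convergence mu measurableT mG (fun k x _ => G0 k x) (fun x _ => G_mono x)).
apply: lime_le.
  apply: ereal_nondecreasing_is_cvgn => k k' kk; apply: ae_le_integral => [x _|x _|]; [exact: G0|exact: G0|].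
  by apply: aeW => x _; exact: G_mono.
exists B.+1 => // j /= Bj; rewrite /G -(integral_cut (block a (2 ^+ j * L)) (fun x => g x ^+ 2)).
exact: blockE.
Qed.

End step_estimate.

(** * Density of step functions *)

Section step_approximation.
Context {R : realType} {d : nat} (a : 'I_d -> R) (L : R) (L0 : 0 < L).
Local Notation X := (d.-tuple R).
Local Notation mu := (lebesgue d).
Local Notation cell := (cell a L).
Local Notation cellix := (nat * @gridix d)%type.
Context {F : lmodType R} (N : F -> R) (snN : seminorm N).

Lemma step_approx_measure (q0 : cellix) (f : X -> F) (e : R) : 0 < e ->
  strongly_measurable mu N f -> exists M g B, [/\ gstep a L M g, measurable B,
    (mu B <= (e + e)%:E)%E, forall x, ~ cell q0 x -> g x = 0 &
    forall x, cell q0 x -> ~ B x -> N (f x - g x) <= e].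
Proof.
move=> e0 mf; have mq := measurable_cell a L q0.
have qoo : (mu (cell q0) < +oo)%E by rewrite [ltLHS](lebesgue_cell a L0) ltry.
have [_ [B0 [[I [j [v [mj _ ->]]]] mB0 B0e sB]]] := strongly_measurable_approx snN e0 mq qoo mf.
(* The error is shared among the level sets of the simple approximation; the added 1 covers an empty
   index type. *)
pose e' := e / (#|I|%:R + 1).
have I1 : 0 < #|I|%:R + 1 :> R by rewrite ltr_wpDl.
have e'0 : 0 < e' by rewrite divr_gt0.
have /choice[NI /choice[PI HI]] i : exists M P, (q0.1 <= M)%N /\
    (mu (cell q0 `&` sdiff (j @^-1` [set i]) (saturated a L M P)) <= e'%:E)%E.
  by have [_ /(_ _ e'0)[M [P ?]]] := measurable_approximable a L0 q0 (mj i); exists M, P.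
pose M := maxn (\max_i NI i) q0.1.
have /choice[Q HQ] i : exists P', saturated a L (NI i) (PI i) = saturated a L M P'.
  apply: saturated_refine => //; apply: leq_trans (leq_maxl _ _); exact: leq_bigmax.
pose g0 x : F := \sum_i (if x \in saturated a L M (Q i) then v i else 0).
pose bad i := cell q0 `&` sdiff (j @^-1` [set i]) (saturated a L M (Q i)).
have mbad i : measurable (bad i).
  by apply: measurableI => //; apply: measurable_sdiff => //; exact: measurable_saturated.
exists M, (cut (cell q0) g0), (B0 `|` \big[setU/set0]_i bad i); split.
- have [B HB] := gstep_indic a L0 (leq_maxr (\max_i NI i) q0.1 : (q0.1 <= M)%N).
  exists B; split=> [x y xy|x].
    have ind : (\1_(cell q0) x : R^o) = \1_(cell q0) y by have [H _] := HB; exact: H.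
    have qq : (x \in cell q0) = (y \in cell q0).
      by move: ind; rewrite !indicE; case: (x \in _); case: (y \in _) => // /eqP;
        rewrite ?oner_eq0 // eq_sym oner_eq0.
    rewrite /cut qq; case: ifP => // _; apply: eq_bigr => i _.
    have -> // : (x \in saturated a L M (Q i)) = (y \in saturated a L M (Q i)).
    by apply/idP/idP => /set_mem H; apply/mem_set; rewrite /saturated /= ?xy// -xy.
  rewrite /cut; case: ifPn => // /set_mem qx _; have [_ H] := HB; apply: H.
  by rewrite indicE mem_set//; apply/eqP; rewrite oner_eq0.
- by apply: measurableU => //; exact: bigsetU_measurable.
- apply: le_trans (measureU2 _ _ _) _ => //; first exact: bigsetU_measurable.
  rewrite EFinD; apply: leeD => //.
  apply: le_trans (mu_bigsetU_le _ mbad) _.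
  apply: (@le_trans _ _ (\sum_(i : I) e'%:E)%E).
    by apply: lee_sum => i _; rewrite /bad -HQ; have [] := HI i.
  rewrite sumEFin lee_fin sumr_const -[leLHS]mulr_natl /e' mulrA ler_pdivrMr//.
  by rewrite mulrC ler_wpM2l ?(ltW e0)// lerDl.
- by move=> x nx; rewrite cutF.
- move=> x qx nB; rewrite cutT//.
  suff -> : g0 x = (v \o j) x by apply: sB => // Bx; apply: nB; left.
  rewrite /g0 (bigD1 (j x))//= ifT; last first.
    apply/mem_set; apply: contrapT => nS; apply: nB; right.
    by rewrite -bigcup_seq; exists (j x) => /=; [exact: mem_index_enum|split=> //; left; split].
  rewrite big1 ?addr0// => i ij; rewrite ifF//; apply/negP => /set_mem Sx; apply: nB; right.
  rewrite -bigcup_seq; exists i => /=; first exact: mem_index_enum.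
  by split=> //; right; split=> //= E; rewrite E eqxx in ij.
Qed.

(** Borel-Cantelli gives convergence almost everywhere. Values of norm above [M + 1] are replaced by
    0, which does not affect the limit since eventually the error is at most 1; the bound is what
    dominated convergence asks for. *)
Lemma step_approx_bounded (q0 : cellix) (f : X -> F) (M : R) : 0 <= M ->
  strongly_measurable mu N f -> (\forall x \ae mu, N (f x) <= M) ->
  (forall x, ~ cell q0 x -> f x = 0) ->
  exists g : nat -> X -> F, [/\ forall k, exists K, gstep a L K (g k),
    forall k x, N (g k x) <= M + 1, forall k x, ~ cell q0 x -> g k x = 0 &
    \forall x \ae mu, N (f x - g k x) @[k --> \oo] --> 0].
Proof.
move=> M0 mf fM f0.
pose e k : R := 2^-1 ^+ k.+1.
have e0 k : 0 < e k by rewrite exprn_gt0// invr_gt0.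
have /choice[K /choice[g /choice[B H]]] k := step_approx_measure q0 (e0 k) mf.
have mB k : measurable (B k) by have [] := H k.
have B0 : mu (lim_sup_set B) = 0%E.
  apply: lim_sup_set_cvg0 => //.
  apply: (@le_lt_trans _ _ (\sum_(n <oo) (1 * 2^-1 ^+ n)%:E)%E).
    apply: lee_nneseries => // n _; rewrite mul1r; have [_ _ + _ _] := H n.
    by move=> /le_trans; apply; rewrite lee_fin /e exprS; lra.
  by apply: le_lt_trans (nneseries_geometric_half ler01) (ltry _).
have N0 : N 0 = 0 by exact: seminorm0.
exists (fun k x => if N (g k x) <= M + 1 then g k x else 0); split.
- move=> k; exists (K k); have [Hk _ _ _ _] := H k.
  apply: (gstep_comp (Phi := fun v => if N v <= M + 1 then v else 0)) => //.
  by case: ifP.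
- by move=> k x; case: ifP => //; rewrite N0 addr_ge0.
- move=> k x nx; have [_ _ _ /(_ _ nx) -> _] := H k; by case: ifP.
apply: filterS2 fM (_ : \forall x \ae mu, ~ lim_sup_set B x); last first.
  exists (lim_sup_set B); split => //; last by move=> x /= /contrapT.
  apply: bigcap_measurable => // k _; exact: bigcup_measurable.
move=> x fx nx; have [qx|nqx] := pselect (cell q0 x); last first.
  rewrite (_ : (fun k => _) = cst 0); first exact: cvg_cst.
  apply/funext => k; have [_ _ _ /(_ _ nqx) -> _] := H k.
  by rewrite f0//; case: ifP; rewrite subrr N0.
have [n1 h1] : exists n, forall k, (n <= k)%N -> ~ B k x.
  apply: contra_notP nx => nx n _; apply: contra_notP nx => nx; exists n => k nk Bk.
  by apply: nx; exists k.
apply/cvgrPdist_lt => r r0.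
have H2 : \forall k \near \oo, 2^-1 ^+ k < r :> R.
  have /cvgrPdist_lt /(_ _ r0) : 2^-1 ^+ k @[k --> \oo] --> (0 : R).
    by apply: cvg_expr; rewrite gtr0_norm ?invf_lt1 ?ltr1n.
  by apply: filterS => k; rewrite sub0r normrN ger0_norm ?exprn_ge0.
near=> k.
have nBk : ~ B k x by apply: h1; near: k; exists n1.
have [_ _ _ _ /(_ _ qx nBk) fg] := H k.
have ek : e k <= 2^-1 ^+ k.
  by rewrite /e exprS ler_piMl ?exprn_ge0// invf_le1// ler1n.
rewrite ifT; last first.
  rewrite -[g k x](subrK (f x)) addrC.
  apply: le_trans (seminormD snN _ _) _; apply: lerD => //.
  rewrite (seminormB snN); apply: le_trans fg _; apply: le_trans ek _.
  by rewrite exprn_ile1// invf_le1// ler1n.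
rewrite sub0r normrN ger0_norm ?(seminorm_ge0 snN)//.
apply: le_lt_trans fg _; apply: le_lt_trans ek _; by near: k.
Unshelve. all: by end_near. Qed.

End step_approximation.

Lemma sqint_dominated {disp : measure_display} {X : measurableType disp} {R : realType}
    (mu : {measure set X -> \bar R}) {F : lmodType R} (N : F -> R) (snN : seminorm N)
    (u : nat -> X -> F) (b : X -> R) : (forall k, strongly_measurable mu N (u k)) ->
  measurable_fun setT b -> (\int[mu]_x (b x ^+ 2)%:E < +oo)%E ->
  (forall k, \forall x \ae mu, N (u k x) <= b x) ->
  (\forall x \ae mu, N (u k x) @[k --> \oo] --> 0) ->
  sqint mu N (u k) @[k --> \oo] --> 0%E.
Proof.
move=> mu_ mb boo ub u0.
have /choice[g /all_and2[mg /all_and2[g0 gE]]] k : exists g : X -> R,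
    measurable_fun setT g /\ (forall x, 0 <= g x) /\ \forall x \ae mu, N (u k x) = g x.
  by have [g ? []] := strongly_measurable_near_norm snN (mu_ k); exists g.
have E k : sqint mu N (u k) = (\int[mu]_x (g k x ^+ 2)%:E)%E.
  apply: ae_eq_ge0_integral => [x _|x _|]; rewrite ?lee_fin ?sqr_ge0//.
  by apply: filterS (gE k) => x -> _.
have gE' : \forall x \ae mu, forall k, N (u k x) = g k x by exact: ae_foralln.
have ub' : \forall x \ae mu, forall k, N (u k x) <= b x by exact: ae_foralln.
have m0 : measurable_fun setT (cst 0%E : X -> \bar R) by exact: measurable_cst.
have mg2 k : measurable_fun setT (fun x => (g k x ^+ 2)%:E).
  by apply/measurable_EFinP; exact: measurable_funX.
have := dominated_convergence (mu := mu) measurableT mg2 m0 (g := fun x => (b x ^+ 2)%:E).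
case.
- apply: filterS2 gE' u0 => x Ex ux _; apply: cvg_EFin; first by apply: nearW.
  have : (N (u k x) ^+ 2) @[k --> \oo] --> (0 : R).
    by rewrite -[X in _ --> X](mulr0 (0 : R)); under eq_fun do rewrite expr2; exact: cvgM.
  by under eq_fun do rewrite Ex.
- apply/integrableP; split; first by apply/measurable_EFinP; exact: measurable_funX.
  by under eq_integral do rewrite gee0_abs ?lee_fin ?sqr_ge0//.
- apply: filterS2 gE' ub' => x Ex ux k _; rewrite gee0_abs ?lee_fin ?sqr_ge0//.
  rewrite lerXn2r ?nnegrE//; last by rewrite -Ex.
  by apply: le_trans (ux k); rewrite (seminorm_ge0 snN).
move=> _ _; rewrite integral0 [X in _ -> X @ _ --> _](_ : _ = fun k => (\int[mu]_x (g k x ^+ 2)%:E)%E)//.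
by apply/funext => k; exact: E.
Qed.

(** * Almost everywhere limits of rapidly convergent sequences *)

Section fast_sequences.
Context {disp : measure_display} {X : measurableType disp} {R : realType}.
Variable mu : {measure set X -> \bar R}.
Context {F : lmodType R} (N : F -> R) (snN : seminorm N).

Lemma near_norms (u : nat -> X -> F) : (forall k, strongly_measurable mu N (u k)) ->
  exists g : nat -> X -> R, [/\ forall k, measurable_fun setT (g k), forall k x, 0 <= g k x,
    \forall x \ae mu, forall k, N (u k x) = g k x &
    forall k, sqint mu N (u k) = (\int[mu]_x (g k x ^+ 2)%:E)%E].
Proof.
move=> mu_.
have /choice[g /all_and2[mg /all_and2[g0 gE]]] k : exists g : X -> R,
    measurable_fun setT g /\ (forall x, 0 <= g x) /\ \forall x \ae mu, N (u k x) = g x.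
  by have [g ? []] := strongly_measurable_near_norm snN (mu_ k); exists g.
exists g; split=> //; first exact: ae_foralln.
move=> k; apply: ae_eq_ge0_integral => [x _|x _|]; rewrite ?lee_fin ?sqr_ge0//.
by apply: filterS (gE k) => x -> _.
Qed.

(** The rate [8^-k] of the squared norms makes the sum of [4^k] times the squares integrable, hence
    finite almost everywhere; its root bounds every term with the factor [2^-k]. *)
Lemma fast_ae (v : nat -> X -> F) (c : R) : 0 <= c ->
  (forall k, strongly_measurable mu N (v k)) ->
  (forall k, (sqint mu N (v k) <= (c * 8^-1 ^+ k)%:E)%E) ->
  \forall x \ae mu, exists M : R, forall k, N (v k x) <= M * 2^-1 ^+ k.
Proof.
move=> c0 mv vc; have [g [mg g0 gE gI]] := near_norms mv.
pose h k x := (4 ^+ k * g k x ^+ 2)%:E : \bar R.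
have h0 k x : (0 <= h k x)%E by rewrite lee_fin mulr_ge0 ?exprn_ge0 ?sqr_ge0.
have mh k : measurable_fun setT (h k).
  apply/measurable_EFinP; apply: measurable_funM; first exact: measurable_cst.
  exact: measurable_funX.
have int : mu.-integrable setT (fun x => \sum_(0 <= k <oo) h k x)%E.
  apply/integrableP; split; first by apply: ge0_emeasurable_sum => // k x _ _; exact: h0.
  under eq_integral do rewrite gee0_abs ?nneseries_ge0//.
  rewrite integral_nneseries//.
  apply: (@le_lt_trans _ _ (\sum_(0 <= k <oo) (c * 2^-1 ^+ k)%:E)%E).
    apply: lee_nneseries => k _; first by move=> _; apply: integral_ge0.
    rewrite integralZE ?exprn_ge0//; first last.
    - exact: measurable_funX.
    - by move=> x; exact: sqr_ge0.
    rewrite -gI; apply: le_trans (lee_wpmul2l _ (vc k)) _; first by rewrite lee_fin exprn_ge0.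
    rewrite -EFinM lee_fin mulrCA -exprMn le_eqVlt; apply/orP; left; apply/eqP.
    by congr (_ * _ ^+ _); lra.
  by apply: le_lt_trans (nneseries_geometric_half c0) (ltry _).
have := integrable_ae measurableT int.
apply: filterS2 gE => x gE /(_ Logic.I) fin.
pose M := fine (\sum_(0 <= k <oo) h k x)%E.
have hM k : 4 ^+ k * g k x ^+ 2 <= M.
  rewrite -lee_fin /M fineK//; apply: le_trans (nneseries_lim_ge k.+1 (fun i _ _ => h0 i x)).
  by rewrite big_nat_recr//= leeDr// sume_ge0.
have M0 : 0 <= M by apply: fine_ge0; apply: nneseries_ge0.
exists (Num.sqrt M) => k; rewrite gE exprVn ler_pdivlMr ?exprn_gt0//.
rewrite -(@ler_pXn2r _ 2) ?nnegrE ?mulr_ge0 ?sqrtr_ge0 ?exprn_ge0//.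
rewrite sqr_sqrtr// exprMn -exprM mulnC exprM mulrC; apply: le_trans (hM k).
by rewrite (_ : 2 ^+ 2 = 4 :> R)//; lra.
Qed.

Lemma fast_ae_cvg0 (v : nat -> X -> F) (c : R) : 0 <= c ->
  (forall k, strongly_measurable mu N (v k)) ->
  (forall k, (sqint mu N (v k) <= (c * 8^-1 ^+ k)%:E)%E) ->
  \forall x \ae mu, N (v k x) @[k --> \oo] --> 0.
Proof.
move=> c0 mv vc; apply: filterS (fast_ae c0 mv vc) => x [M HM].
have : M * 2^-1 ^+ k @[k --> \oo] --> M * 0.
  by apply: cvgMr; apply: cvg_expr; rewrite gtr0_norm ?invf_lt1 ?ltr1n.
rewrite mulr0; apply: squeeze_cvgr; last exact: cvg_cst.
by apply: nearW => k; rewrite (seminorm_ge0 snN)/=.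
Qed.

Lemma sqint_fatou (u : nat -> X -> F) (v : X -> F) (B : R) :
  (forall k, strongly_measurable mu N (u k)) ->
  (\forall x \ae mu, N (v x - u k x) @[k --> \oo] --> 0) ->
  (\forall k \near \oo, (sqint mu N (u k) <= B%:E)%E) -> (sqint mu N v <= B%:E)%E.
Proof.
move=> mu_ cu [J _ HJ]; have [g [mg g0 gE gI]] := near_norms mu_.
pose h k x := (g (k + J)%N x ^+ 2)%:E : \bar R.
have h0 k x : (0 <= h k x)%E by rewrite lee_fin sqr_ge0.
have mh k : measurable_fun setT (h k) by apply/measurable_EFinP; exact: measurable_funX.
apply: (@le_trans _ _ (\int[mu]_x limn_einf (h ^~ x))%E); last first.
  apply: le_trans (fatou mu measurableT mh (fun k x _ => h0 k x)) _.
  rewrite limn_einf_lim; apply: lime_le; first exact: is_cvg_einfs.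
  apply: nearW => k; apply: (@le_trans _ _ (\int[mu]_x h k x)%E).
    by apply: ereal_inf_lbound; exists k => /=.
  by rewrite -gI; apply: HJ; rewrite /= leq_addl.
apply: ae_le_integral => [x _|x _|].
- by rewrite lee_fin sqr_ge0.
- rewrite limn_einf_lim; apply: lime_ge; first exact: is_cvg_einfs.
  by apply: nearW => k; apply: le_ereal_inf_tmp => _ [j _ <-].
apply: filterS2 gE cu => x Ex ux _.
have c1 : N (u k x) @[k --> \oo] --> N (v x).
  apply/cvgrPdist_le => e e0; have /cvgrPdist_le/(_ _ e0) := ux.
  apply: filterS => k; rewrite sub0r normrN => H; apply: le_trans (seminorm_dist snN _ _) _.
  by apply: le_trans H; exact: ler_norm.
have c2 : h k x @[k --> \oo] --> (N (v x) ^+ 2)%:E.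
  apply: cvg_EFin; first by apply: nearW.
  have : (N (u k x) ^+ 2) @[k --> \oo] --> N (v x) ^+ 2.
    by rewrite expr2; under eq_fun do rewrite expr2; exact: cvgM.
  rewrite -(cvg_shiftn J) /=; apply: cvg_trans; apply: near_eq_cvg; apply: nearW => k.
  by rewrite /= Ex.
by have [-> _] := cvg_limn_einf_sup c2.
Qed.

End fast_sequences.

Lemma cvge0_le {R : realType} (u : nat -> \bar R) (e : R) : 0 < e -> (forall k, (0 <= u k)%E) ->
  u k @[k --> \oo] --> 0%E -> \forall k \near \oo, (u k <= e%:E)%E.
Proof.
move=> e0 u0 /fine_cvgP[fin /cvgrPdist_le/(_ _ e0) H].
apply: filterS2 fin H => k fk; rewrite sub0r normrN => /(le_trans (ler_norm _)).
by rewrite -lee_fin /= fineK.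
Qed.

Section weighted_density.
Context {R : realType} {d n : nat} {E : completeNormedModType R}.
Local Notation X := (d.-tuple R).
Local Notation mu := (lebesgue d).
Local Notation sn := (@l2norm_seminorm R n E).
Variable W : X -> 'M[R]_n.
Hypothesis rW : regular_weight W.

Definition weighted (f : X -> 'I_n -> E) (x : X) : 'I_n -> E := mxact (sqrtmx (W x)) (f x).

Definition wsqint (f : X -> 'I_n -> E) : \bar R := sqint mu l2norm (weighted f).

Lemma weightedB f g : weighted (f - g) = weighted f - weighted g.
Proof. by apply/funext => x; rewrite /weighted mxactB. Qed.

Lemma weightedD f g : weighted (f + g) = weighted f + weighted g.
Proof. by apply/funext => x; rewrite /weighted mxactD. Qed.

Lemma weightedZ r f : weighted (r *: f) = r *: weighted f.
Proof. by apply/funext => x; rewrite /weighted mxactZ. Qed.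

Lemma strongly_measurable_weighted f : strongly_measurable mu l2norm f ->
  strongly_measurable mu l2norm (weighted f).
Proof.
have [mW pW _] := rW; apply: strongly_measurable_mxact.
by apply: measurable_sqrtmx => // x; exact: posdef_semi.
Qed.

Lemma wsqintD f g : strongly_measurable mu l2norm f -> strongly_measurable mu l2norm g ->
  (wsqint (f + g)%R <= 2%:E * wsqint f + 2%:E * wsqint g)%E.
Proof.
move=> mf mg; rewrite /wsqint weightedD.
by apply: (sqintD sn); exact: strongly_measurable_weighted.
Qed.

Lemma wsqintN f : wsqint (- f) = wsqint f.
Proof.
rewrite /wsqint -scaleN1r weightedZ; apply: eq_integral => x _; congr (_ ^+ 2)%:E.
by rewrite -[LHS]/(l2norm (-1 *: weighted f x)) scaleN1r (seminormN sn).
Qed.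

Lemma wsqint_ge0 f : (0 <= wsqint f)%E. Proof. exact: sqint_ge0. Qed.

Definition trace_weight (x : X) : R := frob2 (sqrtmx (W x)).

Lemma trace_weightE x : trace_weight x = \sum_k mxquad (W x) (delta_mx k 0).
Proof.
have [_ pW _] := rW; rewrite /trace_weight frob2E; apply: eq_bigr => k _.
by rewrite mxquad_sqrt.
Qed.

Lemma measurable_trace_weight : measurable_fun setT trace_weight.
Proof.
have [mW _ _] := rW; rewrite (_ : trace_weight = fun x => \sum_k mxquad (W x) (delta_mx k 0)).
  by apply: measurable_sum => k; exact: measurable_mxquad.
by apply/funext => x; exact: trace_weightE.
Qed.

Lemma trace_weight_lty a L : 0 < L ->
  (\int[mu]_(x in hcube a L) (trace_weight x)%:E < +oo)%E.
Proof.
move=> L0; have [mW pW _] := rW; have mc : measurable (hcube a L) by exact: measurable_hcube.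
under eq_integral do rewrite trace_weightE -sumEFin.
rewrite ge0_integral_sum//; first last.
- by move=> k x _; rewrite lee_fin mxquad_ge0.
- by move=> k; apply/measurable_EFinP/measurable_funTS; exact: measurable_mxquad.
apply: lte_sum_pinfty => k _.
have -> : hcube a L = hcube (tnth [tuple a i | i < d]) L.
  by congr (hcube _ _); apply/funext => i; rewrite tnth_mktuple.
rewrite -integral_cube; [|exact: ltW|by move=> x; exact: mxquad_ge0].
by rewrite average_mxquad// ltry.
Qed.

Lemma weighted_le f x : l2norm (weighted f x) <= Num.sqrt (trace_weight x) * l2norm (f x).
Proof. exact: mxact_le. Qed.

Let root : nat * @gridix d := (0%N, [ffun=> 0]).

Lemma cell_root a (L : R) : cell a L root = hcube a L.
Proof.
rewrite /cell /= side.unlock expr0 divr1; congr (hcube _ _); apply/funext => i.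
by rewrite /corner ffunE mulr0 addr0.
Qed.

Lemma cutE (F : lmodType R) (G : set X) (f : X -> F) :
  cut G f = (fun x => (\1_G x : R) *: f x).
Proof.
by apply/funext => x; rewrite /cut indicE; case: ifP; rewrite ?scale1r ?scale0r.
Qed.

Lemma strongly_measurable_cut (G : set X) (f : X -> 'I_n -> E) : measurable G ->
  strongly_measurable mu l2norm f -> strongly_measurable mu l2norm (cut G f).
Proof.
move=> mG mf; rewrite cutE; apply: strongly_measurable_scale => //; exact: sn.
Qed.

(** Cutting to a large cube where [|f| <= m] approximates in both norms by dominated convergence.
    The second conclusion is conditional because the extension is built from functions that need not
    be in L^2. *)
Lemma truncation_approx f (e : R) : 0 < e -> strongly_measurable mu l2norm f ->
  (wsqint f < +oo)%E -> exists (m : nat) (G : set X), [/\ measurable G,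
   G `<=` hcube (fun=> - m.+1%:R) (2 * m.+1%:R),
   \forall x \ae mu, l2norm (cut G f x) <= m%:R,
   (wsqint (f - cut G f)%R <= e%:E)%E &
   (sqint mu l2norm f < +oo)%E -> (sqint mu l2norm (f - cut G f)%R <= e%:E)%E].
Proof.
move=> e0 mf woo; have [h mh [h0 fh]] := strongly_measurable_near_norm sn mf.
have [w mw [w0 fw]] := strongly_measurable_near_norm sn (strongly_measurable_weighted mf).
pose Q (m : nat) : set X := hcube (fun=> - m.+1%:R) (2 * m.+1%:R).
pose G m := Q m `&` [set x | h x <= m%:R].
have mG m : measurable (G m).
  apply: measurableI; first exact: measurable_hcube.
  rewrite -[X in measurable X]setTI; apply: measurable_fun_ler => //; exact: measurable_cst.
have mu_ m : strongly_measurable mu l2norm (f - cut (G m) f).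
  exact: (strongly_measurableB sn mf (strongly_measurable_cut (mG m) mf)).
have eventually x : \forall m \near \oo, G m x.
  pose M := h x + \sum_i `|tnth x i|.
  have s0 : 0 <= \sum_i `|tnth x i| by exact: sumr_ge0.
  have M0 : 0 <= M by exact: addr_ge0.
  exists (Num.bound M) => // m /= Hm.
  have : M < m%:R by apply: lt_le_trans (archi_boundP M0) _; rewrite ler_nat.
  move=> Mm; have m1 : m%:R <= m.+1%:R :> R by rewrite ler_nat.
  split; last by rewrite /= ltW//; apply: le_lt_trans Mm; rewrite /M lerDl.
  move=> i; have : `|tnth x i| <= M.
    by rewrite /M (bigD1 i)//= addrCA lerDl addr_ge0// sumr_ge0.
  by move=> H; have := le_lt_trans H Mm; rewrite ltr_norml => /andP[h1 h2]; apply/andP; split; lra.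
have le1 m x : l2norm ((f - cut (G m) f) x) <= l2norm (f x).
  rewrite -[(f - _) x]/(f x - cut (G m) f x) /cut; case: ifP => _; rewrite ?subr0// subrr.
  by rewrite (seminorm0 sn) sqrtr_ge0.
have wle1 m x : l2norm (weighted (f - cut (G m) f) x) <= l2norm (weighted f x).
  rewrite weightedB -[(_ - _) x]/(weighted f x - weighted (cut (G m) f) x) /weighted /cut.
  case: ifP => _; rewrite -mxactB ?subr0// subrr.
  by rewrite -(scale0r (0 : 'I_n -> E)) mxactZ scale0r (seminorm0 sn) sqrtr_ge0.
have zero x : \forall m \near \oo, (f - cut (G m) f) x = 0.
  by apply: filterS (eventually x) => m Gx; rewrite -[LHS]/(f x - cut (G m) f x) cutT// subrr.
have c0 : \forall x \ae mu, l2norm ((f - cut (G m) f) x) @[m --> \oo] --> 0.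
  apply: aeW => x; apply: cvg_near_cst; apply: filterS (zero x) => m ->; exact: (seminorm0 sn).
have cw0 : \forall x \ae mu, l2norm (weighted (f - cut (G m) f) x) @[m --> \oo] --> 0.
  apply: aeW => x; apply: cvg_near_cst; apply: filterS (zero x) => m H.
  by rewrite /weighted H -(scale0r (0 : 'I_n -> E)) mxactZ scale0r (seminorm0 sn).
have wI : (\int[mu]_x (w x ^+ 2)%:E < +oo)%E.
  apply: le_lt_trans woo; rewrite le_eqVlt; apply/orP; left; apply/eqP.
  by apply: ae_eq_ge0_integral => [x _|x _|]; rewrite ?lee_fin ?sqr_ge0//; apply: filterS fw => x -> _.
have wd m : \forall x \ae mu, l2norm (weighted (f - cut (G m) f) x) <= w x.
  by apply: filterS fw => x <-; exact: wle1.
have W0 := sqint_dominated sn (fun m => strongly_measurable_weighted (mu_ m)) mw wI wd cw0.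
have Wsmall := cvge0_le e0 (fun m => sqint_ge0 mu l2norm (weighted (f - cut (G m) f))) W0.
have key m : \forall x \ae mu, l2norm (cut (G m) f x) <= m%:R.
  apply: filterS fh => x fx; rewrite /cut; case: ifPn => [/set_mem[_ /=]|_]; first by rewrite fx.
  by rewrite (seminorm0 sn).
have GQ m : G m `<=` Q m by move=> x [].
have [foo|fno] := pselect (sqint mu l2norm f < +oo)%E; last first.
  have [m _ Hm] := Wsmall; exists m, (G m); split=> //; exact: (Hm m (leqnn m)).
have hI : (\int[mu]_x (h x ^+ 2)%:E < +oo)%E.
  apply: le_lt_trans foo; rewrite le_eqVlt; apply/orP; left; apply/eqP.
  by apply: ae_eq_ge0_integral => [x _|x _|]; rewrite ?lee_fin ?sqr_ge0//; apply: filterS fh => x -> _.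
have hd m : \forall x \ae mu, l2norm ((f - cut (G m) f) x) <= h x.
  by apply: filterS fh => x <-; exact: le1.
have H0 := sqint_dominated sn mu_ mh hI hd c0.
have Hsmall := cvge0_le e0 (fun m => sqint_ge0 mu l2norm (f - cut (G m) f)) H0.
have [m _ Hm] := filterI Wsmall Hsmall; exists m, (G m).
by have [h1 h2] := Hm m (leqnn m); split.
Qed.

(** After truncation [f] is bounded and boundedly supported; bounded step approximations supported
    in the same cell then converge in both norms, the weighted one being dominated by the root of
    the trace of [W], which is square integrable on cubes. *)
Lemma step_density f (e : R) : 0 < e -> L2fun mu l2norm f -> (wsqint f < +oo)%E ->
  exists a L M g, [/\ 0 < L, forall i, gstep a L M (g ^~ i), L2fun mu l2norm g,
    (sqint mu l2norm (f - g)%R <= e%:E)%E & (wsqint (f - g)%R <= e%:E)%E].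
Proof.
move=> e0 [mf foo] woo; rewrite L2norm_lty in foo; last exact: sn.
have e40 : 0 < e / 4 by rewrite divr_gt0.
have [m [G [mG GQ fm Gw /(_ foo) G2]]] := truncation_approx e40 mf woo.
pose a : 'I_d -> R := fun=> - m.+1%:R; pose L : R := 2 * m.+1%:R.
have L0 : 0 < L by rewrite mulr_gt0.
have mcf := strongly_measurable_cut mG mf.
have cf0 x : ~ cell a L root x -> cut G f x = 0.
  by rewrite cell_root => nx; rewrite cutF// => /GQ.
have [g [gs gM g0 gc]] := step_approx_bounded L0 sn (ler0n R m) mcf fm cf0.
have [K gK] := choice gs.
have gKi k i : gstep a L (K k) (g k ^~ i) by apply: (gstep_comp (Phi := fun v : 'I_n -> E => v i)).
have Lg k : L2fun mu l2norm (g k).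
  by apply: L2fun_tuple => i; apply: gstep_L2fun (gKi k i) => //; exact: seminorm_normr.
have mg k : strongly_measurable mu l2norm (g k) by case: (Lg k).
have mq := measurable_cell a L root.
pose c : R := m%:R + (m%:R + 1).
have c0 : 0 <= c by rewrite !addr_ge0.
pose b := cut (cell a L root) (cst c).
have mb : measurable_fun setT b by apply: measurable_cut => //; exact: measurable_cst.
have bI : (\int[mu]_x (b x ^+ 2)%:E < +oo)%E.
  rewrite (_ : (fun x => (b x ^+ 2)%:E) = (fun x => (cut (cell a L root) (cst (c ^+ 2)) x)%:E)).
    by rewrite integral_cut_cst// [X in (_ * X)%E](lebesgue_cell a L0) -EFinM ltry.
  by apply/funext => x; rewrite /b /cut; case: ifP; rewrite ?expr0n.
have dom k : \forall x \ae mu, l2norm ((cut G f - g k) x) <= b x.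
  apply: filterS fm => x fx; rewrite -[(_ - _) x]/(cut G f x - g k x) /b.
  have [qx|nq] := pselect (cell a L root x).
    rewrite [leRHS]cutT//; apply: le_trans (seminormD sn _ _) _; rewrite (seminormN sn).
    by apply: lerD => //; exact: gM.
  by rewrite [leRHS]cutF// cf0// g0// subrr (seminorm0 sn).
have mS k : strongly_measurable mu l2norm (cut G f - g k).
  exact: (strongly_measurableB sn mcf (mg k)).
have small1 : \forall k \near \oo, (sqint mu l2norm (cut G f - g k)%R <= (e / 4)%:E)%E.
  apply: cvge0_le => //; first by move=> k; exact: sqint_ge0.
  exact: (sqint_dominated sn mS mb bI dom gc).
have small2 : \forall k \near \oo, (wsqint (cut G f - g k)%R <= (e / 4)%:E)%E.
  apply: cvge0_le => //; first by move=> k; exact: wsqint_ge0.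
  pose b' x := Num.sqrt (trace_weight x) * b x.
  have mb' : measurable_fun setT b'.
    apply: measurable_funM => //; apply: measurableT_comp measurable_trace_weight.
    by apply: continuous_measurable_fun; exact: sqrt_continuous.
  have tw0 x : 0 <= trace_weight x by exact: frob2_ge0.
  have b'I : (\int[mu]_x (b' x ^+ 2)%:E < +oo)%E.
    rewrite (_ : (fun x => (b' x ^+ 2)%:E) = (fun x => (c ^+ 2 * cut (cell a L root) trace_weight x)%:E)).
      rewrite integralZE ?sqr_ge0//; first last.
      - by apply: measurable_cut => //; exact: measurable_trace_weight.
      - by move=> x; rewrite /cut; case: ifP.
      rewrite lte_mul_pinfty ?lee_fin ?sqr_ge0// -(integral_cut (cell a L root) trace_weight).
      by rewrite cell_root; exact: trace_weight_lty.
    apply/funext => x; congr EFin; rewrite /b' exprMn sqr_sqrtr// /b /cut; case: ifP => _; first by rewrite mulrC.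
    by rewrite expr0n !mulr0.
  have wdom k : \forall x \ae mu, l2norm (weighted (cut G f - g k) x) <= b' x.
    apply: filterS (dom k) => x H; apply: le_trans (weighted_le _ _) _.
    by rewrite /b' ler_wpM2l// sqrtr_ge0.
  have wc : \forall x \ae mu, l2norm (weighted (cut G f - g k) x) @[k --> \oo] --> 0.
    apply: filterS gc => x H.
    have : Num.sqrt (trace_weight x) * l2norm (cut G f x - g k x) @[k --> \oo] --> Num.sqrt (trace_weight x) * 0.
      exact: cvgMr.
    rewrite mulr0; apply: squeeze_cvgr; last exact: cvg_cst.
    by apply: nearW => k; rewrite sqrtr_ge0/=; exact: weighted_le.
  exact: (sqint_dominated sn (fun k => strongly_measurable_weighted (mS k)) mb' b'I wdom wc).
have [k _ Hk] := filterI small1 small2; have [h1 h2] := Hk k (leqnn k).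
have mfc : strongly_measurable mu l2norm (f - cut G f) := strongly_measurableB sn mf mcf.
have eq : f - g k = (f - cut G f) + (cut G f - g k) by rewrite addrA subrK.
have sum4 : (2%:E * (e / 4)%:E + 2%:E * (e / 4)%:E = e%:E)%E.
  by rewrite -!EFinM -EFinD; congr EFin; lra.
exists a, L, (K k), (g k); split=> //.
- rewrite eq; apply: le_trans (sqintD sn mfc (mS k)) _; rewrite -sum4.
  by apply: leeD; apply: lee_wpmul2l.
- rewrite eq; apply: le_trans (wsqintD mfc (mS k)) _; rewrite -sum4.
  by apply: leeD; apply: lee_wpmul2l.
Qed.

End weighted_density.

(** * Extension *)

Lemma geometric_cvg {R : realType} {E : completeNormedModType R} (y : nat -> E) (M : R) :
  (forall k, `|y k.+1 - y k| <= M * 2^-1 ^+ k) -> cvgn y.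
Proof.
move=> H; have -> : y = (fun k => y 0%N + series (telescope y) k).
  by apply/funext => k; rewrite -eq_sum_telescope.
apply: is_cvgD; first exact: is_cvg_cst.
apply: normed_cvg; apply: (@series_le_cvg _ _ (geometric M 2^-1)).
- by move=> k; exact: normr_ge0.
- by move=> k; apply: le_trans (H k).
- by move=> k; exact: H.
by apply: is_cvg_geometric_series; rewrite gtr0_norm ?invf_lt1 ?ltr1n.
Qed.

Section extension.
Context {R : realType} {d n : nat} {E : completeNormedModType R}.
Local Notation X := (d.-tuple R).
Local Notation mu := (lebesgue d).
Local Notation sn := (@l2norm_seminorm R n E).
Context {T : (d.-tuple R -> E) -> d.-tuple R -> E}
  {K : d.-tuple R -> d.-tuple R -> {linear E -> E}}
  {omega : R -> R} {CT D : R} (HT : cz_bounds T K omega CT D).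
Variable W : X -> 'M[R]_n.
Hypothesis rW : regular_weight W.
Local Notation wsqint := (@wsqint R d n E W).
Local Notation weighted := (@weighted R d n E W).
Local Notation Tn := (@componentwise R d n E T).
Local Notation L2 := (L2fun mu (@l2norm R n E)).
Variable C : R.
Hypothesis C0 : 0 <= C.
Hypothesis step_bound : forall a L M (f : X -> 'I_n -> E), 0 < L ->
  (forall i, gstep a L M (f ^~ i)) -> (wsqint f < +oo)%E -> (wsqint (Tn f) <= C%:E * wsqint f)%E.
Implicit Types f g F G : X -> 'I_n -> E.

Local Notation smeas := (strongly_measurable mu (@l2norm R n E)).

Let mw f : smeas f -> smeas (weighted f).
Proof. exact: strongly_measurable_weighted. Qed.

Let mB f g : smeas f -> smeas g -> smeas (f - g).
Proof. by move=> mf mg; exact: (strongly_measurableB sn mf mg). Qed.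

Let mZ r f : smeas f -> smeas (r *: f).
Proof. by move=> mf; exact: (strongly_measurableZ sn _ mf). Qed.

Let mN f : smeas f -> smeas (- f).
Proof. by rewrite -scaleN1r; exact: mZ. Qed.

Let Lm f : L2 f -> strongly_measurable mu l2norm f. Proof. by case. Qed.

Lemma L2_lin r f g : L2 f -> L2 g -> L2 (r *: f + g).
Proof.
move=> Lf Lg; apply: L2fun_tuple => i.
exact: L2funD (L2funZ _ (L2fun_coord i Lf)) (L2fun_coord i Lg).
Qed.

Lemma L2_sub f g : L2 f -> L2 g -> L2 (f - g).
Proof. by move=> Lf Lg; rewrite addrC -scaleN1r; exact: L2_lin. Qed.

Lemma componentwise_L2 f : L2 f -> L2 (Tn f).
Proof. by move=> Lf; apply: L2fun_tuple => i; apply: (cz_L2 HT); exact: L2fun_coord. Qed.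

Lemma componentwise_lin r f g : L2 f -> L2 g ->
  \forall x \ae mu, Tn (r *: f + g) x = (r *: Tn f + Tn g) x.
Proof.
move=> Lf Lg.
have := ae_seq (s := index_enum 'I_n) (fun i _ => cz_lin HT r (L2fun_coord i Lf) (L2fun_coord i Lg)).
by apply: filterS => x H; apply/funext => i; exact: H (mem_index_enum i).
Qed.

Lemma componentwise_sub f g : L2 f -> L2 g ->
  \forall x \ae mu, Tn (f - g) x = (Tn f - Tn g) x.
Proof.
move=> Lf Lg; have := componentwise_lin (-1) Lg Lf.
by rewrite scaleN1r addrC; apply: filterS => x ->; rewrite scaleN1r addrC.
Qed.

Lemma componentwise_bound f : L2 f ->
  (sqint mu l2norm (Tn f) <= (n%:R * CT ^+ 2)%:E * sqint mu l2norm f)%E.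
Proof.
move=> Lf; apply: le_trans (sqint_le_coords _) _.
  by move=> i; have [] := cz_L2 HT (L2fun_coord i Lf).
apply: (@le_trans _ _ (\sum_(i < n) (CT ^+ 2)%:E * sqint mu l2norm f)%E).
  apply: lee_sum => i _; apply: le_trans (cz_bound HT (L2fun_coord i Lf)) _.
  by apply: lee_wpmul2l; [rewrite lee_fin sqr_ge0|exact: sqint_coord].
have foo : sqint mu l2norm f \is a fin_num.
  by rewrite ge0_fin_numE ?sqint_ge0//; have [_] := Lf; rewrite L2norm_lty//; exact: sn.
rewrite -(fineK foo) -!EFinM sumEFin lee_fin sumr_const card_ord -[leLHS]mulr_natl.
by rewrite mulrA.
Qed.

Lemma wsqint_ae f g : (\forall x \ae mu, f x = g x) -> wsqint f = wsqint g.
Proof. by move=> fg; apply: ae_eq_sqint; apply: filterS fg => x fx; rewrite /weighted fx. Qed.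

Lemma wsqintZ r f : smeas f -> wsqint (r *: f) = ((r ^+ 2)%:E * wsqint f)%E.
Proof. by move=> mf; rewrite /wsqint weightedZ (sqintZ sn _ (mw mf)). Qed.

Lemma wsqint0 : wsqint 0 = 0%E.
Proof.
rewrite -(scale0r (0 : X -> 'I_n -> E)) wsqintZ ?expr0n ?mul0e//.
exact: (strongly_measurable0 mu sn).
Qed.

Lemma wsqintB_le f g (a b : R) : smeas f -> smeas g ->
  (wsqint f <= a%:E)%E -> (wsqint g <= b%:E)%E -> (wsqint (f - g)%R <= (2 * a + 2 * b)%:E)%E.
Proof.
move=> mf mg fa gb; apply: le_trans (wsqintD rW mf (mN mg)) _; rewrite wsqintN.
have -> : (2 * a + 2 * b)%:E = (2%:E * a%:E + 2%:E * b%:E)%E by rewrite -!EFinM -EFinD.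
by apply: leeD; apply: lee_wpmul2l.
Qed.

Let pow8_cvg (c e : R) : 0 < e -> \forall k \near \oo, c * 8^-1 ^+ k <= e.
Proof.
move=> e0; have : c * 8^-1 ^+ k @[k --> \oo] --> c * 0.
  by apply: cvgMr; apply: cvg_expr; rewrite gtr0_norm ?invf_lt1 ?ltr1n.
rewrite mulr0 => /cvgrPdist_le/(_ _ e0); apply: filterS => k.
by rewrite sub0r normrN; exact: le_trans (ler_norm _).
Qed.

Let pow8_ge0 k : 0 <= 8^-1 ^+ k :> R. Proof. by rewrite exprn_ge0 ?invr_ge0. Qed.

(** Step functions approximating [f] in both norms have images converging almost everywhere, by the
    L^2 bound at a fast rate, and Fatou's lemma gives the weighted bound; the 2 comes from
    [sqintD]. *)
Lemma weighted_bound f : L2 f -> (wsqint f < +oo)%E ->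
  (wsqint (Tn f) <= (2 * C)%:E * wsqint f)%E.
Proof.
move=> Lf woo; have mf := Lm Lf.
have e0 k : 0 < 8^-1 ^+ k :> R by rewrite exprn_gt0 ?invr_gt0.
have /choice[g gP] k : exists g, exists a L M, [/\ 0 < L, forall i, gstep a L M (g ^~ i), L2 g,
    (sqint mu l2norm (f - g)%R <= (8^-1 ^+ k)%:E)%E & (wsqint (f - g)%R <= (8^-1 ^+ k)%:E)%E].
  by have [a [L [M [g H]]]] := step_density rW (e0 k) Lf woo; exists g, a, L, M.
have Lg k : L2 (g k) by have [a [L [M []]]] := gP k.
have mg k := Lm (Lg k).
have mT k := Lm (componentwise_L2 (Lg k)).
have mTf := Lm (componentwise_L2 Lf).
have wfin : wsqint f \is a fin_num by rewrite ge0_fin_numE ?wsqint_ge0.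
have [q qE] : exists q, wsqint f = q%:E by exists (fine (wsqint f)); rewrite fineK.
have q0 : 0 <= q by rewrite -lee_fin -qE wsqint_ge0.
have wg k : (wsqint (g k) <= (2 * q + 2 * 8^-1 ^+ k)%:E)%E.
  have -> : g k = f - (f - g k) by rewrite opprB addrCA subrr addr0.
  apply: (wsqintB_le mf (mB mf (mg k))); first by rewrite qE.
  by have [a [L [M []]]] := gP k.
have wTg k : (wsqint (Tn (g k)) <= (C * (2 * q + 2 * 8^-1 ^+ k))%:E)%E.
  have [a [L [M [L0 gs _ _ _]]]] := gP k.
  apply: le_trans (step_bound L0 gs _) _; first exact: le_lt_trans (wg k) (ltry _).
  by rewrite EFinM; apply: lee_wpmul2l; rewrite ?lee_fin.
have mv k : smeas (Tn f - Tn (g k)) := mB mTf (mT k).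
have vle k : (sqint mu l2norm (Tn f - Tn (g k))%R <= (n%:R * CT ^+ 2 * 8^-1 ^+ k)%:E)%E.
  rewrite -(ae_eq_sqint _ (componentwise_sub Lf (Lg k))).
  apply: le_trans (componentwise_bound (L2_sub Lf (Lg k))) _.
  rewrite (EFinM (n%:R * CT ^+ 2)); apply: lee_wpmul2l; first by rewrite lee_fin mulr_ge0 ?sqr_ge0.
  by have [a [L [M []]]] := gP k.
have nC0 : 0 <= n%:R * CT ^+ 2 by rewrite mulr_ge0 ?sqr_ge0.
have cv := fast_ae_cvg0 sn nC0 mv vle.
rewrite qE -EFinM; apply/lee_addgt0Pr => e e0'; rewrite -EFinD.
apply: (sqint_fatou sn (u := fun k => weighted (Tn (g k)))).
- exact: (fun k => mw (mT k)).
- apply: filterS cv => x H.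
  have : Num.sqrt (trace_weight W x) * l2norm (Tn f x - Tn (g k) x) @[k --> \oo] -->
      Num.sqrt (trace_weight W x) * 0 by exact: cvgMr.
  rewrite mulr0; apply: squeeze_cvgr; last exact: cvg_cst.
  by apply: nearW => k; rewrite sqrtr_ge0/= /weighted -mxactB mxact_le.
apply: filterS (pow8_cvg (2 * C) e0') => k Hk; apply: le_trans (wTg k) _.
rewrite lee_fin.
have -> : C * (2 * q + 2 * 8^-1 ^+ k) = 2 * C * q + 2 * C * 8^-1 ^+ k by ring.
by rewrite lerD2l.
Qed.

(** A relation, since limits are determined almost everywhere only. The rate [8^-k] with a free
    constant [c] makes it stable under linear combinations. *)
Definition extends f F := exists (c : R) (g : nat -> X -> 'I_n -> E), [/\ 0 <= c,
  forall k, L2 (g k), forall k, (wsqint (f - g k)%R <= (c * 8^-1 ^+ k)%:E)%E &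
  forall k, (wsqint (F - Tn (g k))%R <= (c * 8^-1 ^+ k)%:E)%E].

Lemma extends_L2 f : L2 f -> extends f (Tn f).
Proof.
move=> Lf; exists 0, (fun=> f); split=> // k; first by rewrite subrr wsqint0 mul0r.
by rewrite subrr wsqint0 mul0r.
Qed.

Lemma extends_lin r f F g G : smeas f -> smeas F ->
  smeas g -> smeas G ->
  extends f F -> extends g G -> extends (r *: f + g) (r *: F + G).
Proof.
move=> mf mF mg mG [c [u [c0 Lu fu Fu]]] [c' [v [c'0 Lv gv Gv]]].
have comb (f1 f2 g1 g2 : X -> 'I_n -> E) k : smeas f1 ->
    smeas f2 -> smeas g1 -> smeas g2 ->
    (wsqint (f1 - g1)%R <= (c * 8^-1 ^+ k)%:E)%E -> (wsqint (f2 - g2)%R <= (c' * 8^-1 ^+ k)%:E)%E ->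
    (wsqint ((r *: f1 + f2) - (r *: g1 + g2))%R <= ((2 * r ^+ 2 * c + 2 * c') * 8^-1 ^+ k)%:E)%E.
  move=> m1 m2 n1 n2 H1 H2.
  have -> : (r *: f1 + f2) - (r *: g1 + g2) = r *: (f1 - g1) + (f2 - g2).
    by rewrite scalerBr opprD addrACA.
  have m12 : smeas (f1 - g1) by exact: mB.
  have m12' : smeas (f2 - g2) by exact: mB.
  apply: le_trans (wsqintD rW _ m12') _; first exact: mZ.
  have -> : ((2 * r ^+ 2 * c + 2 * c') * 8^-1 ^+ k)%:E =
      (2%:E * ((r ^+ 2)%:E * (c * 8^-1 ^+ k)%:E) + 2%:E * (c' * 8^-1 ^+ k)%:E)%E.
    by rewrite -!EFinM -EFinD; congr EFin; ring.
  rewrite (wsqintZ _ m12); apply: leeD; apply: lee_wpmul2l => //.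
  by apply: lee_wpmul2l => //; rewrite lee_fin sqr_ge0.
exists (2 * r ^+ 2 * c + 2 * c'), (fun k => r *: u k + v k); split.
- by apply: addr_ge0; apply: mulr_ge0 => //; apply: mulr_ge0 => //; exact: sqr_ge0.
- by move=> k; exact: L2_lin.
- by move=> k; exact: (comb _ _ _ _ k mf mg (Lm (Lu k)) (Lm (Lv k)) (fu k) (gv k)).
- move=> k; rewrite (_ : wsqint _ = wsqint ((r *: F + G) - (r *: Tn (u k) + Tn (v k)))).
    exact: (comb _ _ _ _ k mF mG (Lm (componentwise_L2 (Lu k))) (Lm (componentwise_L2 (Lv k))) (Fu k) (Gv k)).
  by apply: wsqint_ae; apply: filterS (componentwise_lin r (Lu k) (Lv k)) => x H; congr (_ - _).
Qed.

(** The factor 8 is [2 * 2 * 2]: two uses of the inequality for squares of differences and the 2 of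
    [weighted_bound]. *)
Lemma extends_bound f F : smeas f -> smeas F ->
  (wsqint f < +oo)%E -> extends f F -> (wsqint F <= (8 * C)%:E * wsqint f)%E.
Proof.
move=> mf mF woo [c [g [c0 Lg fg Fg]]].
have wfin : wsqint f \is a fin_num by rewrite ge0_fin_numE ?wsqint_ge0.
have [q qE] : exists q, wsqint f = q%:E by exists (fine (wsqint f)); rewrite fineK.
rewrite qE -EFinM; apply/lee_addgt0Pr => e e0; rewrite -EFinD.
have [k _ /(_ k (leqnn k)) Hk] := pow8_cvg (2 * c + 8 * C * c) e0.
have mg := Lm (Lg k); have mT := Lm (componentwise_L2 (Lg k)).
have wg : (wsqint (g k) <= (2 * q + 2 * (c * 8^-1 ^+ k))%:E)%E.
  have -> : g k = f - (f - g k) by rewrite opprB addrCA subrr addr0.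
  apply: (wsqintB_le mf (mB mf mg)) => //.
  by rewrite qE.
have wT : (wsqint (Tn (g k)) <= (2 * C * (2 * q + 2 * (c * 8^-1 ^+ k)))%:E)%E.
  apply: le_trans (weighted_bound (Lg k) _) _; first exact: le_lt_trans wg (ltry _).
  by rewrite (EFinM (2 * C)); apply: lee_wpmul2l => //; rewrite lee_fin mulr_ge0.
have -> : F = (F - Tn (g k)) - (- Tn (g k)) by rewrite opprK subrK.
apply: le_trans (wsqintB_le _ _ (Fg k) _) _; first exact: mB.
- exact: mN.
- by rewrite wsqintN; exact: wT.
rewrite lee_fin; have -> : 2 * (c * 8^-1 ^+ k) + 2 * (2 * C * (2 * q + 2 * (c * 8^-1 ^+ k))) =
   8 * C * q + (2 * c + 8 * C * c) * 8^-1 ^+ k by ring.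
by rewrite lerD2l.
Qed.

Lemma wsqint_eq0 f : smeas f -> (wsqint f <= 0)%E -> \forall x \ae mu, f x = 0.
Proof.
move=> mf w0; have [h mh [h0 fh]] := strongly_measurable_near_norm sn (mw mf).
have I0 : (\int[mu]_(x in setT) `|(h x ^+ 2)%:E| = 0)%E.
  apply/eqP; rewrite eq_le integral_ge0// andbT; apply: le_trans w0; rewrite le_eqVlt.
  apply/orP; left; apply/eqP; apply: ae_eq_ge0_integral => [x _|x _|]; rewrite ?lee_fin ?sqr_ge0//.
  by apply: filterS fh => x -> _; rewrite gee0_abs ?lee_fin ?sqr_ge0.
have mh2 : measurable_fun setT (fun x => (h x ^+ 2)%:E).
  by apply/measurable_EFinP; exact: measurable_funX.
have [Z [mZ0 Z0 sub]] := (ae_eq_integral_abs mu measurableT mh2).1 I0.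
have H : \forall x \ae mu, h x = 0.
  exists Z; split=> // x nx; apply: sub => /= /(_ Logic.I) [] /eqP.
  by rewrite sqrf_eq0 => /eqP.
apply: filterS2 fh H => x fhx hx.
have [_ pW _] := rW; have [_ _ uS] := posdef_sqrt (pW x).
have E1 : f x = mxact (invmx (sqrtmx (W x))) (weighted f x).
  by rewrite /weighted -mxactM mulVmx// mxact1.
apply/funext => i; apply/eqP; rewrite -normr_eq0 eq_le normr_ge0 andbT.
apply: le_trans (l2norm_ge_coord _ i) _; rewrite E1.
by apply: le_trans (mxact_le _ _) _; rewrite fhx hx mulr0.
Qed.

(** The difference extends the zero function, so its weighted norm vanishes, and [W] is
    invertible. *)
Lemma extends_unique f F G : smeas f -> smeas F -> smeas G -> (wsqint f < +oo)%E ->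
  extends f F -> extends f G -> \forall x \ae mu, F x = G x.
Proof.
move=> mf mF mG woo eF eG; have := extends_lin (-1) mf mG mf mF eG eF.
rewrite !scaleN1r addNr => e0.
have mFG : smeas (- G + F) by rewrite addrC; exact: mB.
have m0 : smeas 0 by exact: (strongly_measurable0 mu sn).
have := extends_bound m0 mFG _ e0; rewrite wsqint0 mule0 => /(_ (ltry 0)) /(wsqint_eq0 mFG).
apply: filterS => x /eqP; rewrite -[(- G + F) x]/(- G x + F x) addrC subr_eq0.
by move/eqP.
Qed.

Lemma bounded_L2 (m : nat) (G : set X) f : measurable G ->
  G `<=` hcube (fun=> - m.+1%:R) (2 * m.+1%:R) -> smeas f ->
  (\forall x \ae mu, l2norm (cut G f x) <= m%:R) -> L2 (cut G f).
Proof.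
move=> mG GQ mf fm; split; first exact: strongly_measurable_cut.
rewrite L2norm_lty; last exact: sn.
apply: (@le_lt_trans _ _ (\int[mu]_x (cut (hcube (fun=> - m.+1%:R) (2 * m.+1%:R)) (cst (m%:R ^+ 2)) x)%:E)%E).
  apply: ae_le_integral => [x _|x _|]; rewrite ?lee_fin ?sqr_ge0//.
    by rewrite /cut; case: ifP => // _; exact: sqr_ge0.
  apply: filterS fm => x H _; rewrite lee_fin.
  have [Gx|nG] := pselect (G x).
    by rewrite [leRHS]cutT ?lerXn2r ?nnegrE ?sqrtr_ge0//; exact: GQ.
  rewrite [in leLHS]cutF// (seminorm0 sn) expr0n /cut; case: ifP => // _; exact: sqr_ge0.
rewrite integral_cut_cst; last exact: measurable_hcube.
by rewrite [X in (_ * X)%E](lebesgue_hcube _ _) ?mulr_ge0// -EFinM ltry.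
Qed.

(** Truncations of [f] lie in L^2, and their images form a fast Cauchy sequence in the weighted
    norm. *)
Lemma extends_exists f : smeas f -> (wsqint f < +oo)%E -> exists F, smeas F /\ extends f F.
Proof.
move=> mf woo.
have e0 k : 0 < 8^-1 ^+ k :> R by rewrite exprn_gt0 ?invr_gt0.
have /choice[g /all_and2[Lg fg]] k : exists g, L2 g /\ (wsqint (f - g)%R <= (8^-1 ^+ k)%:E)%E.
  have [m [G [mG GQ fm Gw _]]] := truncation_approx rW (e0 k) mf woo.
  by exists (cut G f); split; [exact: (bounded_L2 mG GQ mf fm)|exact: Gw].
have mg k := Lm (Lg k).
have gg k l : (k <= l)%N -> (wsqint (g l - g k)%R <= (4 * 8^-1 ^+ k)%:E)%E.
  move=> kl; have -> : g l - g k = (f - g k) - (f - g l) by rewrite opprB [RHS]addrC addrA subrK.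
  apply: le_trans (wsqintB_le (mB mf (mg k)) (mB mf (mg l)) (fg k) (fg l)) _.
  have : 8^-1 ^+ l <= 8^-1 ^+ k :> R.
    by apply: ler_wiXn2l => //; rewrite ?invr_ge0// invf_le1// ler1n.
  by rewrite lee_fin; lra.
pose u k := Tn (g k); have Lu k : L2 (u k) := componentwise_L2 (Lg k); have mu_ k := Lm (Lu k).
have uu k l : (k <= l)%N -> (wsqint (u l - u k)%R <= (8 * C * 8^-1 ^+ k)%:E)%E.
  move=> kl; rewrite -(wsqint_ae (componentwise_sub (Lg l) (Lg k))).
  apply: le_trans (weighted_bound (L2_sub (Lg l) (Lg k)) _) _; first exact: le_lt_trans (gg k l kl) (ltry _).
  apply: (@le_trans _ _ ((2 * C)%:E * (4 * 8^-1 ^+ k)%:E)%E).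
    by apply: lee_wpmul2l; [rewrite lee_fin mulr_ge0|exact: gg].
  by rewrite -EFinM lee_fin le_eqVlt; apply/orP; left; apply/eqP; ring.
have C80 : 0 <= 8 * C by rewrite mulr_ge0.
have fast := fast_ae sn C80 (fun k => mw (mB (mu_ k.+1) (mu_ k))) (fun k => uu k k.+1 (leqnSn k)).
(* The limit is taken of the weighted images, coordinate by coordinate in the complete space [E];
   the inverse root of [W(x)] then recovers a function. *)
pose H (x : X) : 'I_n -> E := fun i => limn (fun k => weighted (u k) x i).
have cH : \forall x \ae mu, l2norm (H x - weighted (u k) x) @[k --> \oo] --> 0.
  apply: filterS fast => x [M HM].
  have ci i : weighted (u k) x i @[k --> \oo] --> H x i.
    apply: (geometric_cvg (M := M)) => k; apply: le_trans (HM k).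
    by rewrite weightedB; exact: (l2norm_ge_coord (weighted (u k.+1) x - weighted (u k) x) i).
  have : \sum_i `|H x i - weighted (u k) x i| @[k --> \oo] --> \sum_(i < n) (0 : R).
    apply: cvg_big => [|i _]; first exact: add_continuous.
    rewrite -(normr0 E) -(subrr (H x i)); apply: cvg_norm; apply: cvgB => //; exact: cvg_cst.
  rewrite big1//; apply: squeeze_cvgr; last exact: cvg_cst.
  by apply: nearW => k; rewrite sqrtr_ge0/=; exact: (l2norm_le_sum (H x - weighted (u k) x)).
pose F x := mxact (invmx (sqrtmx (W x))) (H x).
have [_ pW _] := rW.
have wF x : weighted F x = H x.
  by have [_ _ uS] := posdef_sqrt (pW x); rewrite /weighted /F -mxactM mulmxV// mxact1.
have mF : smeas F.
  apply: (strongly_measurable_lim sn mu_); apply: filterS cH => x Hx.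
  have : Num.sqrt (frob2 (invmx (sqrtmx (W x)))) * l2norm (H x - weighted (u k) x) @[k --> \oo] -->
     Num.sqrt (frob2 (invmx (sqrtmx (W x)))) * 0 by exact: cvgMr.
  rewrite mulr0; apply: squeeze_cvgr; last exact: cvg_cst.
  apply: nearW => k; rewrite sqrtr_ge0/=.
  have -> : F x - u k x = mxact (invmx (sqrtmx (W x))) (H x - weighted (u k) x).
    have [_ _ uS] := posdef_sqrt (pW x).
    by rewrite mxactB /weighted -mxactM mulVmx// mxact1.
  exact: mxact_le.
exists F; split=> //; exists (8 * C + 1), g; split=> //; first exact: addr_ge0.
  move=> k; apply: le_trans (fg k) _; rewrite lee_fin mulrDl mul1r lerDr.
  by apply: mulr_ge0 => //; exact: pow8_ge0.
move=> k; apply: (@le_trans _ _ (8 * C * 8^-1 ^+ k)%:E); last first.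
  by rewrite lee_fin ler_wpM2r ?lerDl//; exact: pow8_ge0.
apply: (sqint_fatou sn (u := fun l => weighted (u l - u k))).
- exact: (fun l => mw (mB (mu_ l) (mu_ k))).
- apply: filterS cH => x Hx.
  rewrite (_ : (fun l => _) = (fun l => l2norm (H x - weighted (u l) x)))//.
  apply/funext => l; congr l2norm; rewrite !weightedB.
  rewrite -[(weighted F - weighted _) x]/(weighted F x - weighted (u k) x).
  rewrite -[(weighted (u l) - weighted _) x]/(weighted (u l) x - weighted (u k) x).
  by rewrite wF opprB addrA subrK.
by exists k => // l /= kl; exact: uu.
Qed.

Lemma bounded_extension_exists : exists S : (X -> 'I_n -> E) -> X -> 'I_n -> E,
  bounded_extension T W S /\
  (operator_norm (weightedL2 W) (weightedL2norm W) S <= (Num.sqrt (8 * C))%:E)%E.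
Proof.
have C80 : 0 <= 8 * C by rewrite mulr_ge0.
have DP f : weightedL2 W f -> smeas f /\ (wsqint f < +oo)%E.
  by move=> [mf [_ foo]]; split=> //; move: foo; rewrite L2norm_lty//; exact: sn.
have PD f : smeas f -> (wsqint f < +oo)%E -> weightedL2 W f.
  move=> mf foo; split; first exact: mf.
  split; first exact: (mw mf).
  by rewrite L2norm_lty//; exact: sn.
(* On L^2 functions the value is [Tn f] itself, so that the extension agrees with the action there;
   other functions of the weighted space get a limit. *)
have /choice[S SP] f : exists F, (weightedL2 W f -> smeas F /\ extends f F) /\
    (L2 f -> F = Tn f).
  have [Lf|nL] := pselect (L2 f).
    exists (Tn f); split=> // _; split; last exact: extends_L2.
    exact: Lm (componentwise_L2 Lf).
  have [/DP[mf woo]|nW] := pselect (weightedL2 W f); last by exists f; split.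
  by have [F FP] := extends_exists mf woo; exists F; split.
have SP1 f : weightedL2 W f -> smeas (S f) /\ extends f (S f) by have [] := SP f.
have Sb f : weightedL2 W f -> (wsqint (S f) <= (8 * C)%:E * wsqint f)%E.
  move=> Df; have [mS eS] := SP1 f Df; have [mf woo] := DP f Df; exact: extends_bound.
have bound : (operator_norm (weightedL2 W) (weightedL2norm W) S <= (Num.sqrt (8 * C))%:E)%E.
  apply: ge_ereal_sup => _ [f [Df f1] <-].
  rewrite /weightedL2norm L2norm_le ?sqrtr_ge0//; last exact: sn.
  rewrite sqr_sqrtr//; apply: le_trans (Sb f Df) _.
  have : (wsqint f <= 1)%E.
    by move: f1; rewrite /weightedL2norm L2norm_le//; [rewrite expr1n|exact: sn].
  by move=> /(lee_wpmul2l (_ : 0 <= (8 * C)%:E)%E); rewrite mule1; apply; rewrite lee_fin.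
exists S; split=> //; split.
  split; last exact: le_lt_trans bound (ltry _).
  - move=> f Df; have [mS _] := SP1 f Df; apply: PD => //.
    by apply: le_lt_trans (Sb f Df) _; rewrite lte_mul_pinfty//; have [] := DP f Df.
  - move=> r f g Df Dg; have [mSf eSf] := SP1 f Df; have [mSg eSg] := SP1 g Dg.
    have [mf foo] := DP f Df; have [mg goo] := DP g Dg.
    have mfg : smeas (r *: f + g).
      by rewrite -[g]opprK; apply: mB; [exact: mZ|exact: mN].
    have mSfg : smeas (r *: S f + S g).
      by rewrite -[S g]opprK; apply: mB; [exact: mZ|exact: mN].
    have fgoo : (wsqint (r *: f + g)%R < +oo)%E.
      apply: le_lt_trans (wsqintD rW (mZ r mf) mg) _.
      by rewrite (wsqintZ r mf) lte_add_pinfty// lte_mul_pinfty// ?lee_fin ?sqr_ge0// lte_mul_pinfty ?lee_fin ?sqr_ge0.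
    have [mS eS] := SP1 _ (PD _ mfg fgoo).
    exact: (extends_unique mfg mS mSfg fgoo eS (extends_lin r mf mSf mg mSg eSf eSg)).
move=> f Lf Df; have [_ /(_ Lf) ->] := SP f; exact: aeW.
Qed.

End extension.

(** * Consequences of A2 *)

Section A2_consequences.
Context {R : realType} {d n : nat}.
Local Notation X := (d.-tuple R).
Local Notation mu := (lebesgue d).

(** Each column is the image of a unit vector, so the passage from operator to Frobenius norm costs
    [n]. *)
Lemma mxopnorm_frob2 (M : 'M[R]_n) (a : R) :
  (mxopnorm M ^+ 2 <= a%:E)%E -> frob2 M <= n%:R * a.
Proof.
move=> Ma; suff H k : sqnorm (M *m delta_mx k 0) <= a.
  rewrite frob2E; apply: (@le_trans _ _ (\sum_(k < n) a)); first by apply: ler_sum => k _.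
  by rewrite sumr_const card_ord -[leLHS]mulr_natl.
pose v : 'I_n -> R^o := fun j => (j == k)%:R.
have v1 : l2norm v = 1.
  rewrite /l2norm (bigD1 k)//= /v eqxx normr1 expr1n big1 ?addr0 ?sqrtr1// => j jk.
  by rewrite (negbTE jk) normr0 expr0n.
have Mv : l2norm (mxact M v) ^+ 2 = sqnorm (M *m delta_mx k 0).
  rewrite l2norm_sq sqnorm_colE; apply: eq_bigr => i _.
  rewrite /mxact (bigD1 k)//= {1}/v eqxx big1 => [|j jk].
    by rewrite addr0 [_ *: _]mulr1 real_normK ?num_real.
  by rewrite /v (negbTE jk) scaler0.
have le : ((l2norm (mxact M v))%:E <= mxopnorm M)%E.
  by apply: ereal_sup_ubound; exists v => //; split=> //=; rewrite v1.
rewrite -Mv -lee_fin; apply: le_trans Ma.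
have l0 : (0 <= (l2norm (mxact M v))%:E)%E by rewrite lee_fin sqrtr_ge0.
by rewrite EFin_expe !expe2 lee_pmul.
Qed.

Lemma frob2_tr (M : 'M[R]_n) : frob2 M^T = frob2 M.
Proof.
rewrite /frob2 exchange_big; apply: eq_bigr => i _; apply: eq_bigr => j _.
by rewrite mxE.
Qed.

Lemma sqnorm_mul_le (M : 'M[R]_n) (v : 'cV[R]_n) : sqnorm (M *m v) <= frob2 M * sqnorm v.
Proof.
rewrite /sqnorm /frob2 mulr_suml; apply: ler_sum => i _; rewrite mxE.
exact: cauchy_schwarz_sum.
Qed.

Definition dot (u v : 'cV[R]_n) : R := (u^T *m v) 0 0.

Lemma dotE u v : dot u v = \sum_i u i 0 * v i 0.
Proof. by rewrite /dot mxE; apply: eq_bigr => i _; rewrite mxE. Qed.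

Lemma dot_le u v (r : R) : 0 < r -> 2 * dot u v <= r * sqnorm u + r^-1 * sqnorm v.
Proof.
move=> r0; rewrite dotE !mulr_sumr -big_split; apply: ler_sum => i _ /=.
have -> : r * u i 0 ^+ 2 + r^-1 * v i 0 ^+ 2 =
   r^-1 * (r * u i 0 - v i 0) ^+ 2 + 2 * (u i 0 * v i 0) by field; rewrite gt_eqF.
by rewrite lerDr mulr_ge0 ?sqr_ge0// invr_ge0 ltW.
Qed.

Lemma dot_sqrt (W : 'M[R]_n) e u (r : R) : posdefmx W -> 0 < r ->
  2 * dot e u <= r * mxquad W e + r^-1 * mxquad (invmx W) u.
Proof.
move=> pW r0; have [sS SS uS] := posdef_sqrt pW.
have -> : dot e u = dot (sqrtmx W *m e) (invmx (sqrtmx W) *m u).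
  by rewrite /dot trmx_mul sS -mulmxA mulKVmx.
rewrite (mxquad_sqrt _ pW) (invmx_sqrt pW) mxquad_sqr ?invmx_sym//; exact: dot_le.
Qed.

Lemma mxquad_dot (A : 'M[R]_n) e : mxquad A e = dot e (A *m e).
Proof. by rewrite /mxquad /dot mulmxA. Qed.

Section one_pair.
Variables (W V : X -> 'M[R]_n) (A : R).
Hypotheses (rW : regular_weight W) (rV : regular_weight V).
Hypothesis VE : forall x, V x = invmx (W x).
Hypothesis A0 : 0 < A.
Hypothesis VWA : forall b l, 0 < l ->
  frob2 (sqrtmx (average V (cube b l)) *m sqrtmx (average W (cube b l))) <= A.

Let hcube_tuple (b : 'I_d -> R) l : hcube b l = hcube (tnth [tuple b i | i < d]) l.
Proof. by congr (hcube _ _); apply/funext => i; rewrite tnth_mktuple. Qed.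

(** The pointwise inequality for [e . u] is integrated over [F]; the [W] term stays on [F], and the
    [V] term is enlarged to the cube and estimated by A_2. *)
Lemma mxquad_A2 e (b : 'I_d -> R) l (F : set X) (f : R) : 0 < l -> measurable F ->
  F `<=` hcube b l -> 0 <= f -> (f%:E <= mu F)%E ->
  ((f ^+ 2)%:E * \int[mu]_(x in hcube b l) (mxquad (W x) e)%:E <=
   (A * (l ^+ d) ^+ 2)%:E * \int[mu]_(x in F) (mxquad (W x) e)%:E)%E.
Proof.
move=> l0 mF FQ f0 fF; set c := [tuple b i | i < d].
have [mW pW _] := rW; have [mV pV _] := rV.
have ld : 0 < l ^+ d by rewrite exprn_gt0.
have w0 := mxquad_ge0 e rW.
set P := average W (cube c l); set P' := average V (cube c l).
have pP : posdefmx P := average_posdef c rW l0.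
have pP' : posdefmx P' := average_posdef c rV l0.
pose m := mxquad P e; have m0 : 0 <= m by have [_ H] := posdef_semi pP; exact: H.
(* With this dual vector the pairing with [e] is the mean of the scalar weight, and the form of the
   average of [V] at [u] is at most [A] times it. *)
pose u := P *m e; have ue : dot e u = m by rewrite /m mxquad_dot.
have WI : (\int[mu]_(x in hcube b l) (mxquad (W x) e)%:E = (l ^+ d * m)%:E)%E.
  by rewrite hcube_tuple -integral_cube ?(ltW l0)// average_mxquad.
have VI : (\int[mu]_(x in hcube b l) (mxquad (V x) u)%:E = (l ^+ d * mxquad P' u)%:E)%E.
  rewrite hcube_tuple -integral_cube ?(ltW l0)//; last exact: mxquad_ge0.
  by rewrite average_mxquad.
have Pu : mxquad P' u <= A * m.
  have [_ SS _] := posdef_sqrt pP.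
  rewrite (mxquad_sqrt _ pP') /u -SS -mulmxA mulmxA; apply: le_trans (sqnorm_mul_le _ _) _.
  rewrite /m (mxquad_sqrt _ pP) ler_wpM2r ?sqnorm_ge0//; exact: VWA.
have IFoo : (\int[mu]_(x in F) (mxquad (W x) e)%:E < +oo)%E.
  apply: le_lt_trans (ltry (l ^+ d * m)); rewrite -WI; exact: le_integral_on.
have IF0 : (0 <= \int[mu]_(x in F) (mxquad (W x) e)%:E)%E by apply: integral_ge0 => x _; rewrite lee_fin.
have [I IE] : exists I, (\int[mu]_(x in F) (mxquad (W x) e)%:E)%E = I%:E.
  exists (fine (\int[mu]_(x in F) (mxquad (W x) e)%:E)%E).
  by rewrite fineK// ge0_fin_numE.
have I0 : 0 <= I by rewrite -lee_fin -IE.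
rewrite WI IE -!EFinM lee_fin.
have [->|f1] := eqVneq f 0; first by rewrite expr0n mul0r !mulr_ge0 ?sqr_ge0// ltW.
have {f1}f1 : 0 < f by rewrite lt_def f1.
(* This weight makes the [V] term equal to [m * f], half of the left side. *)
pose r := l ^+ d * A / f; have r0 : 0 < r by rewrite divr_gt0// mulr_gt0.
have ZF (r' : R) (phi : X -> R) : 0 <= r' -> (forall x, 0 <= phi x) -> measurable_fun setT phi ->
    (\int[mu]_(x in F) (r' * phi x)%:E = r'%:E * \int[mu]_(x in F) (phi x)%:E)%E.
  move=> r'0 phi0 mphi; under eq_integral do rewrite EFinM.
  rewrite ge0_integralZl//; first by apply/measurable_EFinP/measurable_funTS.
  by move=> x _; rewrite lee_fin.
have key : 2 * m * f <= r * I + r^-1 * (l ^+ d * (A * m)).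
  rewrite -lee_fin EFinM; apply: (@le_trans _ _ ((2 * m)%:E * mu F)%E).
    by apply: lee_wpmul2l => //; rewrite lee_fin mulr_ge0.
  rewrite -[leLHS](_ : \int[mu]_(x in F) (2 * m)%:E = _)%E; last by rewrite integral_cst.
  have mw1 : measurable_fun F (fun x => (r * mxquad (W x) e)%:E).
    apply/measurable_EFinP/measurable_funTS; apply: measurable_funM; first exact: measurable_cst.
    exact: measurable_mxquad.
  have mw2 : measurable_fun F (fun x => (r^-1 * mxquad (V x) u)%:E).
    apply/measurable_EFinP/measurable_funTS; apply: measurable_funM; first exact: measurable_cst.
    exact: measurable_mxquad.
  have ri0 : 0 <= r^-1 by rewrite invr_ge0 ltW.
  have v0 := mxquad_ge0 u rV.
  apply: (@le_trans _ _ (\int[mu]_(x in F) ((r * mxquad (W x) e)%:E + (r^-1 * mxquad (V x) u)%:E))%E).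
    apply: ae_le_integral => [x _|x _|]; first by rewrite lee_fin mulr_ge0.
      by rewrite -EFinD lee_fin addr_ge0// mulr_ge0// ltW.
    by apply: aeW => x _; rewrite -EFinD lee_fin -ue VE; exact: dot_sqrt.
  rewrite ge0_integralD//; first last.
  - by move=> x _; rewrite lee_fin mulr_ge0.
  - by move=> x _; rewrite lee_fin mulr_ge0// ltW.
  rewrite EFinD; apply: leeD.
    by rewrite (EFinM r) -IE ZF// ?(ltW r0)//; exact: measurable_mxquad.
  rewrite ZF//; last exact: measurable_mxquad.
  rewrite (EFinM r^-1); apply: lee_wpmul2l; first by rewrite lee_fin.
  apply: (@le_trans _ _ (l ^+ d * mxquad P' u)%:E); first by rewrite -VI; exact: le_integral_on.
  by rewrite lee_fin ler_wpM2l// ltW.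
have key2 : m * f ^+ 2 <= l ^+ d * A * I.
  have E1 : r^-1 * (l ^+ d * (A * m)) = f * m.
    by rewrite /r; field; rewrite !gt_eqF.
  have E2 : r * I = l ^+ d * A * I / f by rewrite /r mulrAC.
  move: key; rewrite E1 E2 => key.
  have : m * f <= l ^+ d * A * I / f by lra.
  by rewrite ler_pdivlMr// expr2 mulrA.
have -> : f ^+ 2 * (l ^+ d * m) = l ^+ d * (m * f ^+ 2) by ring.
have -> : A * l ^+ d ^+ 2 * I = l ^+ d * (l ^+ d * A * I) by ring.
by rewrite ler_wpM2l// ltW.
Qed.

Lemma Ainfty_const_le : (Ainfty_const W <= (@Ainfty_A2_const R d * A)%:E)%E.
Proof.
have [mW pW _] := rW.
apply: ge_ereal_sup => _ [e _ <-]; apply: Ainfty_scalar_le.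
- exact: measurable_mxquad.
- exact: mxquad_ge0.
- exact: ltW.
- move=> b l l0; rewrite hcube_tuple -integral_cube ?(ltW l0)//; last exact: mxquad_ge0.
  by rewrite average_mxquad// ltry.
- by move=> b l F f; exact: mxquad_A2.
Qed.

(** At every point of a cube the maximal function is at least the mean over it. The bound makes the
    finite value of the constant admissible in [rh_exponent]. *)
Lemma Ainfty_const_ge1 : (0 < n)%N -> (1 <= Ainfty_const W)%E.
Proof.
move=> n0; pose e : 'cV[R]_n := delta_mx (Ordinal n0) 0.
have e0 : e != 0.
  by apply/eqP => /matrixP/(_ (Ordinal n0) 0); rewrite !mxE !eqxx => /eqP; rewrite oner_eq0.
pose w x := mxquad (W x) e; have w0 := mxquad_ge0 e rW.
apply: (@le_trans _ _ (Ainfty_scalar w)); last by apply: ereal_sup_ubound; exists e.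
pose b : X := [tuple 0 | i < d]; pose Q : set X := cube b 1.
have mQ : measurable Q by exact: measurable_cube.
pose m := mxquad (average W Q) e.
have QI : (\int[mu]_(x in Q) (w x)%:E = m%:E)%E by rewrite /Q average_mxquad// expr1n mul1r.
have m0 : 0 < m by have [_] := average_posdef b rW ltr01; apply.
apply: (@le_trans _ _ ((\int[mu]_(x in Q) w x)^-1%R%:E *
    \int[mu]_(x in Q) maximal_function (fun y => \1_Q y * w y)%R x)%E); last first.
  by apply: ereal_sup_ubound; exists Q => //; exists b, 1.
have -> : (\int[mu]_(x in Q) w x)%R = m by rewrite /Rintegral QI.
rewrite lee_pdivlMl// mule1.
have -> : m%:E = (\int[mu]_(x in Q) (cst m%:E x))%E.
  by rewrite integral_cst// [X in (_ * X)%E](lebesgue_cube b ler01) expr1n mule1.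
apply: ae_le_integral => [x _|x _|]; first by rewrite lee_fin ltW.
  exact: maximal_function_ge0.
apply: aeW => x Qx; apply: (maximal_function_ge ltr01 Qx).
rewrite expr1n mule1 -QI; apply: ae_le_integral => [y _|y _|]; rewrite ?lee_fin ?w0 ?normr_ge0//.
by apply: aeW => y Qy; rewrite lee_fin indicE mem_set// mul1r ler_norm.
Qed.

End one_pair.

End A2_consequences.

(** * Regularization of weights *)

Section regularization.
Context {R : realType} {d n : nat}.
Local Notation X := (d.-tuple R).
Local Notation mu := (lebesgue d).

Lemma strongly_measurable_real (f : X -> R^o) :
  strongly_measurable mu (fun x : R^o => `|x|) f ->
  exists2 g : X -> R, measurable_fun setT g & \forall x \ae mu, f x = g x.
Proof.
move=> /strongly_measurableP[s [ss [Z [mZ Z0 sf]]]].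
have mC : measurable (~` Z) by exact: measurableC.
exists (cut (~` Z) (f : X -> R)).
  apply: (@measurable_fun_cvg _ _ _ setT (fun k => cut (~` Z) (s k : X -> R))) => [k|x _].
    by apply: measurable_cut => //; exact: (finite_valued_comp_measurable (fun v : R^o => v : R) (ss k)).
  have [Zx|nZ] := pselect (Z x).
    rewrite cutF; last by move/(_ Zx).
    rewrite (_ : (fun k => _) = cst 0); first exact: cvg_cst.
    by apply/funext => k; rewrite cutF//; move/(_ Zx).
  rewrite cutT// (_ : (fun k => cut (~` Z) (s k : X -> R) x) = (fun k => s k x : R)); last first.
    by apply/funext => k; rewrite cutT.
  have H : `|f x - s k x| @[k --> \oo] --> 0 by apply: contrapT => nx; apply: nZ; exact: sf.
  apply/cvgrPdist_le => e e0; have /cvgrPdist_le/(_ _ e0) := H.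
  by apply: filterS => k; rewrite sub0r normrN normr_id.
exists Z; split=> // x nx; apply: contrapT => nZ; apply: nx.
by rewrite /= cutT.
Qed.

Lemma measurable_det {disp} {Y : measurableType disp} (m : nat) (G : Y -> 'M[R]_m) :
  (forall i j, measurable_fun setT (fun x => G x i j)) ->
  measurable_fun setT (fun x => \det (G x)).
Proof.
move=> mG; apply: measurable_sum => s; apply: measurable_funM; first exact: measurable_cst.
by apply: measurable_prod => i _; exact: mG.
Qed.

(** Cramer's rule. As [powR] inverts nonnegative numbers, the inverse of the determinant [D] is
    written [D * (D^2)^-1]. *)
Lemma measurable_invmx {disp} {Y : measurableType disp} (G : Y -> 'M[R]_n) :
  (forall i j, measurable_fun setT (fun x => G x i j)) -> (forall x, G x \in unitmx) ->
  forall i j, measurable_fun setT (fun x => invmx (G x) i j).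
Proof.
move=> mG uG i j.
have mD := measurable_det mG.
have E x : invmx (G x) i j = \det (G x) * (\det (G x) ^+ 2) `^ (-1) * \adj (G x) i j.
  rewrite /invmx uG mxE powR_inv1 ?sqr_ge0//; congr (_ * _).
  have : \det (G x) != 0 by have := uG x; rewrite unitmxE unitfE.
  by move=> D0; field.
under eq_fun do rewrite E mxE /cofactor.
apply: measurable_funM; last first.
  apply: measurable_funM; first exact: measurable_cst.
  by apply: measurable_det => k l; under eq_fun do rewrite !mxE; exact: mG.
apply: measurable_funM => //.
apply: (measurableT_comp (measurable_powR (-1))).
exact: measurable_funX.
Qed.

Lemma ae_eq_integral_signed (D : set X) (f g : X -> \bar R) :
  (\forall x \ae mu, D x -> f x = g x) -> (\int[mu]_(x in D) f x = \int[mu]_(x in D) g x)%E.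
Proof.
move=> fg; rewrite (integralE _ _ f) (integralE _ _ g); congr (_ - _)%E.
  by apply: ae_eq_ge0_integral => [x _|x _|]; rewrite ?funepos_ge0//; apply: filterS fg => x H Dx; rewrite !funeposE H.
by apply: ae_eq_ge0_integral => [x _|x _|]; rewrite ?funeneg_ge0//; apply: filterS fg => x H Dx; rewrite !funenegE H.
Qed.

(** The weight is replaced by the identity matrix on a null set containing all points where it is
    not positive definite or differs from the measurable representatives of its entries. *)
Lemma regularize (W : X -> 'M[R]_n) : matrix_weight W -> exists W' : X -> 'M[R]_n,
  regular_weight W' /\ \forall x \ae mu, W x = W' x.
Proof.
move=> [lW pW].
have /choice[g gP] (p : 'I_n * 'I_n) : exists g : X -> R, measurable_fun setT g /\
    \forall x \ae mu, W x p.1 p.2 = g x.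
  by have [mf _] := lW p.1 p.2; have [g] := strongly_measurable_real mf; exists g.
have aeg : \forall x \ae mu, forall p, W x p.1 p.2 = g p x.
  have := ae_seq (s := index_enum ('I_n * 'I_n)%type) (fun p _ => proj2 (gP p)).
  by apply: filterS => x H p; exact: H (mem_index_enum p).
have [Z [mZ Z0 sub]] : \forall x \ae mu, posdefmx (W x) /\ forall p, W x p.1 p.2 = g p x.
  by apply: filterS2 pW aeg.
pose W' x : 'M[R]_n := if x \in Z then 1%:M else \matrix_(i, j) g (i, j) x.
have WE x : ~ Z x -> W x = W' x /\ posdefmx (W x).
  move=> nZ; have [pWx gx] : posdefmx (W x) /\ forall p, W x p.1 p.2 = g p x.
    by apply: contrapT => nx; apply: nZ; exact: sub.
  split=> //; rewrite /W' memNset//; apply/matrixP => i j; rewrite mxE; exact: (gx (i, j)).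
have aeW' : \forall x \ae mu, W x = W' x.
  by exists Z; split=> // x nx; apply: contrapT => /WE[].
exists W'; split=> //; split.
- move=> i j; rewrite (_ : (fun x => W' x i j) =
    cut Z (cst ((1%:M : 'M[R]_n) i j)) \+ cut (~` Z) (g (i, j))).
    apply: measurable_funD; apply: measurable_cut => //; first exact: measurableC.
    by have [] := gP (i, j).
  apply/funext => x; rewrite /W' /cut /=; case: (boolP (x \in Z)) => /= [xZ|xZ].
    by rewrite in_setC xZ addr0.
  by rewrite in_setC xZ add0r mxE.
- move=> x; have [Zx|nZ] := pselect (Z x); last by have [<-] := WE x nZ.
  rewrite /W' mem_set//; split; first exact: trmx1.
  move=> e e0; rewrite mxquad1 lt_def sqnorm_ge0 andbT; apply: contra_neq e0; exact: sqnorm_eq0.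
move=> b l i j l0; have [_ /(_ (cube b l)) H] := lW i j.
have -> : (\int[mu]_(x in cube b l) `|W' x i j|%:E = \int[mu]_(x in cube b l) `|W x i j|%:E)%E.
  by apply: ae_eq_ge0_integral => [x _|x _|]; rewrite ?lee_fin//; apply: filterS aeW' => x -> _.
by apply: H; exists b, l.
Qed.

Lemma regular_inv (W V : X -> 'M[R]_n) : regular_weight W -> matrix_weight V ->
  (\forall x \ae mu, V x = invmx (W x)) -> regular_weight (inv_weight W).
Proof.
move=> [mW pW iW] [lV _] VE; split.
- by apply: measurable_invmx => // x; exact: posdef_unit.
- by move=> x; exact: posdef_inv.
move=> b l i j l0; have [_ /(_ (cube b l)) H] := lV i j.
have -> : (\int[mu]_(x in cube b l) `|inv_weight W x i j|%:E = \int[mu]_(x in cube b l) `|V x i j|%:E)%E.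
  by apply: ae_eq_ge0_integral => [x _|x _|]; rewrite ?lee_fin//; apply: filterS VE => x -> _.
by apply: H; exists b, l.
Qed.

Lemma ereal_sup_congr {I : Type} (P : set I) (F G : I -> \bar R) :
  (forall i, P i -> F i = G i) -> ereal_sup [set F i | i in P] = ereal_sup [set G i | i in P].
Proof. by move=> FG; congr ereal_sup; exact: eq_imagel. Qed.

Section congruence.
Variables W W' : X -> 'M[R]_n.
Hypothesis WE : \forall x \ae mu, W x = W' x.

Lemma average_ae Q : average W Q = average W' Q.
Proof.
apply/matrixP => i j; rewrite !mxE; congr (_ * fine _).
by apply: ae_eq_integral_signed; apply: filterS WE => x -> _.
Qed.

Lemma Ainfty_const_ae : Ainfty_const W = Ainfty_const W'.
Proof.
have fE e : \forall x \ae mu, mxquad (W x) e = mxquad (W' x) e by apply: filterS WE => x ->.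
have fI e Q : (\int[mu]_(x in Q) mxquad (W x) e)%R = (\int[mu]_(x in Q) mxquad (W' x) e)%R.
  congr fine; apply: ae_eq_integral_signed.
  by apply: filterS (fE e) => x -> _.
have fM e Q x : maximal_function (fun y => \1_Q y * mxquad (W y) e)%R x =
    maximal_function (fun y => \1_Q y * mxquad (W' y) e)%R x.
  rewrite /maximal_function; apply: ereal_sup_congr => P _; apply: (congr1 (mule _)).
  by apply: ae_eq_integral_signed; apply: filterS (fE e) => y -> _.
rewrite /Ainfty_const; apply: ereal_sup_congr => e _.
rewrite /Ainfty_scalar; apply: ereal_sup_congr => Q _; rewrite fI.
by apply: (congr1 (mule _)); apply: eq_integral => x _; exact: fM.
Qed.

Context {E : completeNormedModType R}.

Lemma weightedL2norm_ae : @weightedL2norm R d n E W = weightedL2norm W'.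
Proof.
apply/funext => f; rewrite /weightedL2norm !(L2normE mu (@l2norm_seminorm R n E)); apply: (congr1 (fun z => z `^ _)%E).
by apply: ae_eq_sqint; apply: filterS WE => x ->.
Qed.

Lemma weightedL2_ae : @weightedL2 R d n E W = weightedL2 W'.
Proof.
apply/seteqP; split=> f [mf [mS foo]]; (split; first exact: mf); split.
- by apply: ae_eq_strongly_measurable mS; apply: filterS WE => x ->.
- by move: foo; rewrite -/(weightedL2norm W f) weightedL2norm_ae.
- by apply: ae_eq_strongly_measurable mS; apply: filterS WE => x ->.
- by move: foo; rewrite -/(weightedL2norm W' f) -weightedL2norm_ae.
Qed.

End congruence.

Lemma A2_const_ae (W W' : X -> 'M[R]_n) : (\forall x \ae mu, W x = W' x) ->
  A2_const W = A2_const W'.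
Proof.
move=> WE; rewrite /A2_const /A2_const2; apply: ereal_sup_congr => Q _; rewrite (average_ae WE).
by rewrite (@average_ae (inv_weight W) (inv_weight W'))//; apply: filterS WE => x; rewrite /inv_weight => ->.
Qed.

End regularization.

(** * The norm bound *)

Section main.
Context {R : realType} {d n : nat} (d_gt0 : (0 < d)%N) (n_gt0 : (0 < n)%N)
  {E : completeNormedModType R}.
Local Notation X := (d.-tuple R).
Local Notation mu := (lebesgue d).
Context {T : (d.-tuple R -> E) -> d.-tuple R -> E}
  {K : d.-tuple R -> d.-tuple R -> {linear E -> E}}
  {omega : R -> R} {CT D : R} (HT : cz_bounds T K omega CT D).
Local Notation CC := (2 ^+ d * @cell_const R d CT D n).

Lemma cell_const_ge0 : 0 <= CC.
Proof. by rewrite mulr_ge0 ?exprn_ge0// mulr_ge0 ?sqr_ge0. Qed.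

Lemma Ainfty_A2_const_ge0 : 0 <= @Ainfty_A2_const R d.
Proof. by rewrite !mulr_ge0 ?exprn_ge0. Qed.

Lemma regular_extension (W V : X -> 'M[R]_n) (A AW AV : R) :
  regular_weight W -> regular_weight V -> (forall x, V x = invmx (W x)) -> 0 <= A ->
  (forall b l, 0 < l ->
    frob2 (sqrtmx (average W (cube b l)) *m sqrtmx (average V (cube b l))) <= A) ->
  1 <= AW -> 1 <= AV -> (Ainfty_const W <= AW%:E)%E -> (Ainfty_const V <= AV%:E)%E ->
  exists S : (X -> 'I_n -> E) -> X -> 'I_n -> E, bounded_extension T W S /\
    (operator_norm (weightedL2 W) (weightedL2norm W) S <=
      (Num.sqrt (8 * (CC * (A * AW * AV))))%:E)%E.
Proof.
move=> rW rV VE A0 WVA AW1 AV1 WA VA.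
have AW0 : 0 <= AW := le_trans ler01 AW1; have AV0 : 0 <= AV := le_trans ler01 AV1.
have WAe e : e != 0 -> (Ainfty_scalar (fun x => mxquad (W x) e) <= AW%:E)%E.
  by move=> e0; apply: le_trans WA; apply: ereal_sup_ubound; exists e.
have VAe e : e != 0 -> (Ainfty_scalar (fun x => mxquad (V x) e) <= AV%:E)%E.
  by move=> e0; apply: le_trans VA; apply: ereal_sup_ubound; exists e.
have C0 : 0 <= CC * (A * AW * AV).
  by apply: mulr_ge0; [exact: cell_const_ge0|apply: mulr_ge0 => //; exact: mulr_ge0].
apply: (bounded_extension_exists HT rW C0) => a L M f L0 fs woo.
have Lf : L2fun mu (@l2norm R n E) f.
  by apply: L2fun_tuple => i; apply: gstep_L2fun (fs i) => //; exact: seminorm_normr.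
have mf := strongly_measurable_weighted rW (proj1 Lf).
have [h mh [h0 fh]] := strongly_measurable_near_norm (@l2norm_seminorm R n E) mf.
have hE : wsqint W f = (\int[mu]_x (h x ^+ 2)%:E)%E.
  apply: ae_eq_ge0_integral => [x _|x _|]; rewrite ?lee_fin ?sqr_ge0//.
  by apply: filterS fh => x ->.
rewrite hE; apply: (step_estimate d_gt0 HT rW rV VE A0 WVA AW1 AV1 WAe VAe L0 fs mh h0).
  by rewrite -hE.
by apply: filterS fh => x <-.
Qed.

(** Transposition exchanges the two roots without changing the Frobenius norm. Positivity of [a]
    holds because the product of two invertible roots is not zero, [n] being positive. *)
Lemma A2_pair (W : X -> 'M[R]_n) (a : R) : regular_weight W -> regular_weight (inv_weight W) ->
  (A2_const W <= a%:E)%E ->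
  [/\ 0 < a,
      (forall b l, 0 < l -> frob2 (sqrtmx (average W (cube b l)) *m
        sqrtmx (average (inv_weight W) (cube b l))) <= n%:R * a) &
      (forall b l, 0 < l -> frob2 (sqrtmx (average (inv_weight W) (cube b l)) *m
        sqrtmx (average W (cube b l))) <= n%:R * a)].
Proof.
move=> rW rV Wa; set V := inv_weight W.
have WVA b l : 0 < l ->
    frob2 (sqrtmx (average W (cube b l)) *m sqrtmx (average V (cube b l))) <= n%:R * a.
  move=> l0; apply: mxopnorm_frob2; apply: le_trans Wa; apply: ereal_sup_ubound.
  by exists (cube b l) => //; exists b, l.
split=> //; last first.
  move=> b l l0; have [sW _ _] := posdef_sqrt (average_posdef b rW l0).
  have [sV _ _] := posdef_sqrt (average_posdef b rV l0).
  by rewrite -frob2_tr trmx_mul sW sV; exact: WVA.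
pose b : X := [tuple 0 | i < d].
have [_ _ uW] := posdef_sqrt (average_posdef b rW ltr01).
have [_ _ uV] := posdef_sqrt (average_posdef b rV ltr01).
have := WVA b 1 ltr01; set M := _ *m _ => MA.
have uM : M \in unitmx by rewrite unitmx_mul uW uV.
rewrite -(pmulr_rgt0 _ (_ : 0 < n%:R :> R)) ?ltr0n//; apply: lt_le_trans MA.
rewrite lt_def frob2_ge0 andbT; apply/negP => /eqP M0.
have Mz : M = 0.
  apply/matrixP => i j; rewrite [RHS]mxE; apply/eqP; rewrite -sqrf_eq0.
  have := frob2_ge0 M; move: M0; rewrite /frob2 => /eqP.
  rewrite psumr_eq0 => [/allP/(_ i (mem_index_enum i))/=|k _]; last by apply: sumr_ge0 => l _; exact: sqr_ge0.
  by rewrite psumr_eq0 => [/allP/(_ j (mem_index_enum j))/=|l _]; last exact: sqr_ge0.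
move: uM; rewrite Mz => u0.
have /matrixP/(_ (Ordinal n_gt0) (Ordinal n_gt0)) := mulVmx u0.
by rewrite mulmx0 !mxE eqxx => /eqP; rewrite eq_sym oner_eq0.
Qed.

Lemma Ainfty_finite (W V : X -> 'M[R]_n) (A : R) :
  regular_weight W -> regular_weight V -> (forall x, V x = invmx (W x)) -> 0 < A ->
  (forall b l, 0 < l ->
    frob2 (sqrtmx (average V (cube b l)) *m sqrtmx (average W (cube b l))) <= A) ->
  exists AW, [/\ Ainfty_const W = AW%:E, 1 <= AW & AW <= @Ainfty_A2_const R d * A].
Proof.
move=> rW rV VE A0 VWA.
have le := Ainfty_const_le rW rV VE A0 VWA; have ge1 := Ainfty_const_ge1 rW n_gt0.
have fW : Ainfty_const W \is a fin_num.
  by rewrite ge0_fin_numE ?(le_lt_trans le)// ?ltry//; exact: le_trans ge1.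
exists (fine (Ainfty_const W)); split; first by rewrite fineK.
  by rewrite -lee_fin fineK.
by rewrite -lee_fin fineK.
Qed.

Lemma powR12D (a : R) : 0 < a -> a `^ (3 / 2) = a * Num.sqrt a.
Proof.
move=> a0; have -> : 3 / 2 = 1 + 2^-1 :> R by field.
by rewrite powRD ?gt_eqF// powRr1 ?ltW// powR12_sqrt// ltW.
Qed.

End main.

Theorem theorem6p2 (R : realType) (d n : nat) (d_gt0 : (0 < d)%N)
    (n_gt0 : (0 < n)%N) (E : completeNormedModType R)
    (T : (d.-tuple R -> E) -> d.-tuple R -> E) (T_cz : dini_cz_operator T) :
  exists c1 c2 : R, [/\ 0 < c1, 0 < c2 &
    forall W : d.-tuple R -> 'M[R]_n, A2_weight W ->
    exists S : (d.-tuple R -> 'I_n -> E) -> d.-tuple R -> 'I_n -> E,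
      [/\ bounded_extension T W S,
          (operator_norm (weightedL2 W) (weightedL2norm W) S <=
             c1%:E * (A2_const W * Ainfty_const W *
                      Ainfty_const (inv_weight W)) `^ (2^-1))%E &
          (c1%:E * (A2_const W * Ainfty_const W *
                    Ainfty_const (inv_weight W)) `^ (2^-1) <=
             c2%:E * A2_const W `^ (3 / 2))%E]].
Proof.
have [K [omega [CT [D HT]]]] := dini_cz_operator_bounds T_cz.
have CC0 := @cell_const_ge0 R d n CT D; have KA0 := @Ainfty_A2_const_ge0 R d.
move: CC0 KA0 (@regular_extension R d n d_gt0 E T K omega CT D HT) (@Ainfty_finite R d n n_gt0).
move: (2 ^+ d * @cell_const R d CT D n) (@Ainfty_A2_const R d) => C KA C0 KA0 regext Afin.
(* The 8 is lost in passing from step functions to the extension, [n] in passing from operator to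
   Frobenius norm; the added 1 makes the constant positive. *)
set c1 := Num.sqrt (8 * C * n%:R) + 1.
have c10 : 0 < c1 by rewrite ltr_wpDl ?sqrtr_ge0.
have kn0 : 0 <= KA * n%:R by rewrite mulr_ge0.
exists c1, (c1 * (KA * n%:R) + 1); split=> //.
  by rewrite ltr_wpDl// mulr_ge0// ltW.
move=> W0 [mW mV fA].
(* All quantities in the statement are unchanged when the weight is modified on a null set. *)
have [W [rW WE]] := regularize mW.
have VE : \forall x \ae lebesgue d, inv_weight W0 x = inv_weight W x.
  by apply: filterS WE => x; rewrite /inv_weight => ->.
have rV := regular_inv rW mV VE.
rewrite (A2_const_ae WE) (Ainfty_const_ae WE) (Ainfty_const_ae VE) /bounded_extension.
rewrite (weightedL2_ae WE) (weightedL2norm_ae WE).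
rewrite (A2_const_ae WE) in fA.
have fA2 : A2_const W \is a fin_num.
  rewrite ge0_fin_numE//; pose Q : set (d.-tuple R) := cube [tuple 0 | i < d] 1.
  apply: (@le_trans _ _ (mxopnorm (sqrtmx (average W Q) *m sqrtmx (average (inv_weight W) Q)) ^+ 2)%E).
    exact: sqre_ge0.
  by apply: ereal_sup_ubound; exists Q => //; exists [tuple 0 | i < d], 1.
have [a aE] : exists a, A2_const W = a%:E by exists (fine (A2_const W)); rewrite fineK.
have Wa : (A2_const W <= a%:E)%E by rewrite aE.
have [a0 WVA VWA] := A2_pair n_gt0 rW rV Wa.
have na0 : 0 < n%:R * a by rewrite mulr_gt0// ltr0n.
have [AW [WAE AW1 AWle]] := Afin _ _ _ rW rV (fun=> erefl) na0 VWA.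
have VV x : W x = invmx (inv_weight W x) by rewrite /inv_weight invmxK.
have [AV [VAE AV1 AVle]] := Afin _ _ _ rV rW VV na0 WVA.
rewrite aE WAE VAE.
have [||S [bS nS]] := regext _ _ _ AW AV rW rV (fun=> erefl) (ltW na0) WVA AW1 AV1.
- by rewrite WAE.
- by rewrite VAE.
have AW0 : 0 <= AW := le_trans ler01 AW1; have AV0 : 0 <= AV := le_trans ler01 AV1.
have P0 : 0 <= a * AW * AV by rewrite !mulr_ge0// ltW.
rewrite -!EFinM.
rewrite powR12_sqrt// powR12D//.
exists S; split=> //.
  apply: le_trans nS _; rewrite lee_fin.
  have -> : 8 * (C * (n%:R * a * AW * AV)) = (8 * C * n%:R) * (a * AW * AV) by ring.
  rewrite sqrtrM ?mulr_ge0// ler_wpM2r ?sqrtr_ge0//.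
  by rewrite /c1 lerDl.
rewrite lee_fin.
(* Both A_infinity constants are at most [KA * n * a], the one of the inverse weight by symmetry of
   the A_2 condition; the root of the product is then a multiple of [a^(3/2)]. *)
have le1 : a * AW * AV <= (KA * n%:R * a) ^+ 2 * a.
  have -> : a * AW * AV = AW * AV * a by ring.
  rewrite ler_wpM2r ?(ltW a0)// expr2 -(mulrA KA); exact: ler_pM.
apply: (@le_trans _ _ (c1 * (KA * n%:R * a * Num.sqrt a))).
  rewrite ler_wpM2l ?(ltW c10)//.
  apply: le_trans (ler_wsqrtr le1) _.
  by rewrite sqrtrM ?sqr_ge0// sqrtr_sqr ger0_norm// mulr_ge0// ltW.
have -> : c1 * (KA * n%:R * a * Num.sqrt a) = c1 * (KA * n%:R) * (a * Num.sqrt a) by ring.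
by rewrite ler_wpM2r ?lerDl// mulr_ge0 ?sqrtr_ge0// ltW.
Qed.
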